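(* Let $h_n>0$ and $T=nh_n$. Assume that each of the drifts $B_1,\dots,B_4$ is globally Lipschitz and of class $C^4$ with all partial derivatives of order $0$ to $4$ of polynomial growth, that $\sup_{t}\mathbb{E}[|Y_t|^{\ell}]<\infty$ for all $\ell\ge 0$ and each $Y\in\{\xi_0,\delta_0,\varepsilon_0,\zeta_0\}$, and that each such $Y$ is ergodic with an invariant measure $\pi_Y$: for every $\pi_Y$-integrable $g$, $\frac1T\int_0^Tg(Y_t)dt\to\int g\,d\pi_Y$ in probability as $T\to\infty$. Suppose there is $\theta_0\in\operatorname{Int}\Theta$ with $\mathbf{\Sigma}_0=\mathbf{\Sigma}(\theta_0)$, that $\mathbf{\Sigma}(\theta_1)=\mathbf{\Sigma}(\theta_2)$ implies $\theta_1=\theta_2$ for $\theta_1,\theta_2\in\Theta$, and that $\operatorname{rank}\Delta=q$, where $\Delta=\partial_\theta\operatorname{vech}\mathbf{\Sigma}(\theta)|_{\theta=\theta_0}\in\mathbb{R}^{\bar p\times q}$. Then, as $h_n\to0$ and $nh_n\to\infty$, $\hat\theta_n\to\theta_0$ in probability. If in addition $nh_n^2\to0$, then $$\sqrt n(\hat\theta_n-\theta_0)\to N_q\bigl(0,(\Delta^\top\mathbf{W}(\theta_0)^{-1}\Delta)^{-1}\bigr)\quad\text{in distribution.}$$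
   Context: Notation: for a symmetric $p\times p$ matrix $A$, $\operatorname{vech}A$ is the half-vectorization and $\mathbb{D}_p$ is the $p^2\times\bar p$ duplication matrix, $\operatorname{vec}A=\mathbb{D}_p\operatorname{vech}A$; $A^{+}$ is the Moore-Penrose inverse. $\mathbf{W}(\theta)=2\mathbb{D}_p^{+}(\mathbf{\Sigma}(\theta)\otimes\mathbf{\Sigma}(\theta))\mathbb{D}_p^{+\top}$. True model and data: $p_1,p_2,k_1,k_2,r_1,\dots,r_4\ge 1$ are fixed integers with $k_1\le p_1$, $k_2\le p_2$; $p=p_1+p_2$, $\bar p=p(p+1)/2$. $W_1,\dots,W_4$ are independent standard Wiener processes of dimensions $r_1,\dots,r_4$. The latent processes $\xi_0,\delta_0,\varepsilon_0,\zeta_0$, with values in $\mathbb{R}^{k_1},\mathbb{R}^{p_1},\mathbb{R}^{p_2},\mathbb{R}^{k_2}$, solve for $t\ge0$: $d\xi_{0,t}=B_1(\xi_{0,t})dt+\mathbf{S}_{1,0}dW_{1,t}$, $d\delta_{0,t}=B_2(\delta_{0,t})dt+\mathbf{S}_{2,0}dW_{2,t}$, $d\varepsilon_{0,t}=B_3(\varepsilon_{0,t})dt+\mathbf{S}_{3,0}dW_{3,t}$, $d\zeta_{0,t}=B_4(\zeta_{0,t})dt+\mathbf{S}_{4,0}dW_{4,t}$, with deterministic initial values $c_1,\dots,c_4$ and constant matrices $\mathbf{S}_{i,0}$. Put $\mathbf{\Sigma}_{\xi\xi,0}=\mathbf{S}_{1,0}\mathbf{S}_{1,0}^\top$, $\mathbf{\Sigma}_{\delta\delta,0}=\mathbf{S}_{2,0}\mathbf{S}_{2,0}^\top$,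 $\mathbf{\Sigma}_{\varepsilon\varepsilon,0}=\mathbf{S}_{3,0}\mathbf{S}_{3,0}^\top$, $\mathbf{\Sigma}_{\zeta\zeta,0}=\mathbf{S}_{4,0}\mathbf{S}_{4,0}^\top$; $\mathbf{\Sigma}_{\delta\delta,0}$ and $\mathbf{\Sigma}_{\varepsilon\varepsilon,0}$ are positive definite. Constant matrices: $\mathbf{\Lambda}_{x_1,0}\in\mathbb{R}^{p_1\times k_1}$ of full column rank, $\mathbf{\Lambda}_{x_2,0}\in\mathbb{R}^{p_2\times k_2}$, $\mathbf{\Gamma}_0\in\mathbb{R}^{k_2\times k_1}$, $\mathbf{B}_0\in\mathbb{R}^{k_2\times k_2}$ with zero diagonal, $\mathbf{\Psi}_0=\mathbb{I}_{k_2}-\mathbf{B}_0$ non-singular. The observed process is $\mathbb{X}_t=(\mathbb{X}_{1,t}^\top,\mathbb{X}_{2,t}^\top)^\top$ with $\mathbb{X}_{1,t}=\mathbf{\Lambda}_{x_1,0}\xi_{0,t}+\delta_{0,t}$, $\mathbb{X}_{2,t}=\mathbf{\Lambda}_{x_2,0}\eta_{0,t}+\varepsilon_{0,t}$, $\eta_{0,t}=\mathbf{B}_0\eta_{0,t}+\mathbf{\Gamma}_0\xi_{0,t}+\zeta_{0,t}$. With $t_i^n=ih_n$, $T=nh_n$, $\mathbb{Q}_{\mathbb{XX}}=\frac1T\sum_{i=1}^n(\mathbb{X}_{t_i^n}-\mathbb{X}_{t_{i-1}^n})(\mathbb{X}_{t_i^n}-\mathbb{X}_{t_{i-1}^n})^\top$.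 Parametric model: $\Theta\subset\mathbb{R}^q$ is convex and compact. For $\theta\in\Theta$ there are matrices $\mathbf{\Lambda}_{x_1},\mathbf{\Lambda}_{x_2},\mathbf{\Gamma},\mathbf{\Psi}=\mathbb{I}_{k_2}-\mathbf{B}$ ($\mathbf{B}$ with zero diagonal), $\mathbf{\Sigma}_{\xi\xi},\mathbf{\Sigma}_{\delta\delta},\mathbf{\Sigma}_{\varepsilon\varepsilon},\mathbf{\Sigma}_{\zeta\zeta}$ of respective sizes $p_1\times k_1$, $p_2\times k_2$, $k_2\times k_1$, $k_2\times k_2$, $k_1\times k_1$, $p_1\times p_1$, $p_2\times p_2$, $k_2\times k_2$, each entry being either a known constant or a coordinate of $\theta$ ($\theta$ collects the unknown, non-duplicated entries); $\mathbf{\Lambda}_{x_1}$ has full column rank, $\mathbf{\Psi}$ is non-singular, $\mathbf{\Sigma}_{\xi\xi},\mathbf{\Sigma}_{\zeta\zeta}$ are positive semidefinite, $\mathbf{\Sigma}_{\delta\delta},\mathbf{\Sigma}_{\varepsilon\varepsilon}$ positive definite. $\mathbf{\Sigma}(\theta)$ is the symmetric $p\times p$ matrix with blocks $\mathbf{\Sigma}^{11}=\mathbf{\Lambda}_{x_1}\mathbf{\Sigma}_{\xi\xi}\mathbf{\Lambda}_{x_1}^\top+\mathbf{\Sigma}_{\delta\delta}$, $\mathbf{\Sigma}^{12}=\mathbf{\Lambda}_{x_1}\mathbf{\Sigma}_{\xi\xi}\mathbf{\Gamma}^\top\mathbf{\Psi}^{-1\top}\mathbf{\Lambda}_{x_2}^\top$,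 $\mathbf{\Sigma}^{22}=\mathbf{\Lambda}_{x_2}\mathbf{\Psi}^{-1}(\mathbf{\Gamma}\mathbf{\Sigma}_{\xi\xi}\mathbf{\Gamma}^\top+\mathbf{\Sigma}_{\zeta\zeta})\mathbf{\Psi}^{-1\top}\mathbf{\Lambda}_{x_2}^\top+\mathbf{\Sigma}_{\varepsilon\varepsilon}$; $\mathbf{\Sigma}_0$ is the same expression evaluated at the true matrices (subscript $0$). Contrast and estimator: $\mathrm{F}(Q,\mathbf{\Sigma})=\log\det\mathbf{\Sigma}-\log\det Q+\operatorname{tr}(\mathbf{\Sigma}^{-1}Q)-p$ for $Q,\mathbf{\Sigma}$ positive definite. $\mathbb{F}_n(\theta)=\mathrm{F}(\mathbb{Q}_{\mathbb{XX}},\mathbf{\Sigma}(\theta))$ if $\mathbb{Q}_{\mathbb{XX}}$ is non-singular and $\mathbb{F}_n(\theta)=|\operatorname{vech}\mathbb{Q}_{\mathbb{XX}}-\operatorname{vech}\mathbf{\Sigma}(\theta)|^2$ otherwise. $\hat\theta_n\in\Theta$ is a minimum contrast estimator: $\mathbb{F}_n(\hat\theta_n)=\inf_{\theta\in\Theta}\mathbb{F}_n(\theta)$. *)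

(* Defs.v *)
From HB Require Import structures.
From mathcomp Require Import all_boot all_order all_algebra.
From mathcomp Require Import mxtens.
From mathcomp Require Import all_classical all_reals all_analysis.

Set Implicit Arguments.
Unset Strict Implicit.
Unset Printing Implicit Defensive.

Import Order.TTheory GRing.Theory Num.Theory.
Import numFieldNormedType.Exports.

Local Open Scope classical_set_scope.
Local Open Scope ring_scope.

(** Vectors of R^n are column vectors ['cV[R]_n].  The library norm [`|x|] of a
    matrix is the sup norm; [enorm] is the Euclidean one. *)

Definition enorm (R : realType) (n : nat) (x : 'cV[R]_n) : R :=
  Num.sqrt (\sum_(i < n) x i 0 ^+ 2).

Definition possemidef (R : realType) (n : nat) (A : 'M[R]_n) : Prop :=
  A^T = A /\ forall x : 'cV[R]_n, 0 <= (x^T *m A *m x) 0 0.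

Definition posdef (R : realType) (n : nat) (A : 'M[R]_n) : Prop :=
  A^T = A /\ forall x : 'cV[R]_n, x != 0 -> 0 < (x^T *m A *m x) 0 0.

(** * Moore-Penrose inverse, vectorization, duplication matrix *)

Definition is_mpinv (R : realType) (m n : nat) (A : 'M[R]_(m, n))
    (X : 'M[R]_(n, m)) : Prop :=
  [/\ A *m X *m A = A, X *m A *m X = X,
      (A *m X)^T = A *m X & (X *m A)^T = X *m A].

Lemma is_mpinv_uniq (R : realType) (m n : nat) (A : 'M[R]_(m, n))
    (X Y : 'M[R]_(n, m)) : is_mpinv A X -> is_mpinv A Y -> X = Y.
Proof.
move=> [AXA XAX AXt XAt] [AYA YAY AYt YAt].
have AXY : A *m X = A *m Y.
  by rewrite -AXt -{1}AYA -mulmxA trmx_mul AXt AYt mulmxA AXA.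
have XAY : X *m A = Y *m A.
  by rewrite -XAt -{1}AYA -(mulmxA A) mulmxA trmx_mul YAt XAt -mulmxA (mulmxA A) AXA.
by rewrite -XAX -mulmxA AXY mulmxA XAY YAY.
Qed.

(** [0] is only the default of [xget]: a Moore-Penrose inverse always exists. *)
Definition mpinv (R : realType) (m n : nat) (A : 'M[R]_(m, n)) :
  'M[R]_(n, m) := xget 0 [set X | is_mpinv A X].

(** Positions (i, j) with j <= i (row i, column j), column by column. *)
Definition vech_seq (p : nat) : seq ('I_p * 'I_p) :=
  [seq (i, j) | j : 'I_p <- enum 'I_p,
                i : 'I_p <- [seq i : 'I_p <- enum 'I_p | (j <= i)%N]].

Definition vech_dim (p : nat) : nat := (p * p.+1)./2.

Lemma size_vech_seq (p : nat) : size (vech_seq p) == vech_dim p.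
Proof.
rewrite size_allpairs_dep sumnE big_map big_enum /=.
have szE (j : 'I_p) : size [seq i : 'I_p <- enum 'I_p | (j <= i)%N] = (p - j)%N.
  rewrite size_filter -(count_map val (leq j)) val_enum_ord.
  have jp := ltnW (ltn_ord j).
  have -> : iota 0 p = iota 0 (j + (p - j)) by rewrite subnKC.
  rewrite iotaD count_cat add0n.
  have /eqP -> : count (leq j) (iota 0 j) == 0%N.
    rewrite -leqn0 leqNgt -has_count; apply/hasPn => i.
    by rewrite mem_iota add0n /= -ltnNge.
  rewrite add0n; transitivity (size (iota j (p - j))); last by rewrite size_iota.
  by apply/eqP; rewrite -all_count; apply/allP => i; rewrite mem_iota => /andP[].
rewrite (eq_bigr (fun j : 'I_p => (p - j)%N)) => [|j _]; last exact: szE.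
rewrite (reindex_inj rev_ord_inj) /=.
rewrite (eq_bigr (fun j : 'I_p => j.+1)) => [|j _]; last by rewrite subKn.
rewrite -(big_mkord xpredT (fun j => j.+1)) /vech_dim.
rewrite mulnC -[p in (_ * p)%N]/(p.+1.-1) -bin2 -bin2_sum.
by rewrite big_nat_recl // add0n.
Qed.

Definition vech_tuple (p : nat) : (vech_dim p).-tuple ('I_p * 'I_p) :=
  Tuple (size_vech_seq p).

Definition vech (R : realType) (p : nat) (A : 'M[R]_p) : 'cV[R]_(vech_dim p) :=
  \col_k (let ij := tnth (vech_tuple p) k in A ij.1 ij.2).

(** Columns stacked on top of each other: entry (i, j) has index j * p + i. *)
Definition vec (R : realType) (p : nat) (A : 'M[R]_p) : 'cV[R]_(p * p) :=
  \col_k (let ji := mxtens_unindex k in A ji.2 ji.1).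

Definition dup_mx (R : realType) (p : nat) : 'M[R]_(p * p, vech_dim p) :=
  \matrix_(k, l) (let ji := mxtens_unindex k in
                  let ij := tnth (vech_tuple p) l in
                  ((ij == (ji.2, ji.1)) || (ij == (ji.1, ji.2)))%:R).

Lemma dup_mxE (R : realType) (p : nat) (A : 'M[R]_p) :
  A^T = A -> vec A = dup_mx R p *m vech A.
Proof.
move=> symA; have Asym i j : A i j = A j i by rewrite -[in LHS]symA mxE.
have uniqv : uniq (vech_seq p).
  apply: allpairs_uniq_dep; first exact: enum_uniq.
  - by move=> j _; rewrite filter_uniq ?enum_uniq.
  - by move=> [? ?] [? ?] _ _ /= [-> ->].
have memv (i j : 'I_p) : (j <= i)%N -> (i, j) \in vech_seq p.
  move=> ji; apply/allpairsPdep; exists j, i.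
  split => //; first exact: mem_enum.
  rewrite mem_filter ji /=; exact: mem_enum.
have ordv i j : (i, j) \in vech_seq p -> (j <= i)%N.
  by case/allpairsPdep => j' [i' [_]]; rewrite mem_filter => /andP[? _] [-> ->].
apply/colP => k; rewrite !mxE; under eq_bigr do rewrite !mxE.
case: (mxtens_unindex k) => j i /=.
pose u := if (j <= i)%N then (i, j) else (j, i).
have uv : u \in vech_tuple p.
  by rewrite /u; case: leqP => ?; apply: memv => //; exact: ltnW.
have /tnthP [l ul] := uv.
rewrite (bigD1 l) //= big1 => [|m ml].
  by rewrite -ul /u; case: ifP => _ /=; rewrite !eqxx ?orbT mul1r addr0.
suff -> : (tnth (vech_tuple p) m == (i, j)) || (tnth (vech_tuple p) m == (j, i))
            = false by rewrite mul0r.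
have mu : tnth (vech_tuple p) m != u.
  rewrite ul; apply: contra_neq ml.
  by apply: (@tuple_uniqP _ _ (vech_tuple p) uniqv).
have := mem_tnth m (vech_tuple p); case E : (tnth _ m) mu => [a b] mu /ordv ba.
apply/negP => /orP[] /eqP [ai bj]; move: mu; rewrite /u -?ai -?bj ?ba ?eqxx //.
have [ab|] := leqP a b; rewrite ?eqxx //.
by move: ba => /(conj ab) /andP /anti_leq /val_inj ->; rewrite eqxx.
Qed.

(** * Structural equation model *)

(** The matrices of the model, with entries in an arbitrary type: real numbers,
    or symbolic entries as in [sem_entry] below. *)
Record sem (E : Type) (p1 p2 k1 k2 : nat) : Type := Sem {
  Lambda1 : 'M[E]_(p1, k1);
  Lambda2 : 'M[E]_(p2, k2);
  Gamma : 'M[E]_(k2, k1);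
  Psi : 'M[E]_k2;
  Sigma_xi : 'M[E]_k1;
  Sigma_delta : 'M[E]_p1;
  Sigma_eps : 'M[E]_p2;
  Sigma_zeta : 'M[E]_k2 }.

(** [inl c] is the known constant [c], [inr j] the j-th coordinate of theta. *)
Definition sem_entry (R : realType) (q : nat) : Type := (R + 'I_q)%type.

Definition entry_eval (R : realType) (q : nat) (theta : 'cV[R]_q)
    (e : sem_entry R q) : R :=
  match e with inl c => c | inr j => theta j 0 end.

Definition sem_eval (R : realType) (q p1 p2 k1 k2 : nat)
    (M : sem (sem_entry R q) p1 p2 k1 k2) (theta : 'cV[R]_q) :
    sem R p1 p2 k1 k2 :=
  let ev := entry_eval theta in
  Sem (map_mx ev (Lambda1 M)) (map_mx ev (Lambda2 M)) (map_mx ev (Gamma M))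
      (map_mx ev (Psi M)) (map_mx ev (Sigma_xi M)) (map_mx ev (Sigma_delta M))
      (map_mx ev (Sigma_eps M)) (map_mx ev (Sigma_zeta M)).

(** B = I - Psi has zero diagonal. *)
Definition sem_admissible (R : realType) (p1 p2 k1 k2 : nat)
    (m : sem R p1 p2 k1 k2) : Prop :=
  [/\ \rank (Lambda1 m) = k1,
      forall i, (1%:M - Psi m) i i = 0,
      Psi m \in unitmx,
      possemidef (Sigma_xi m) /\ possemidef (Sigma_zeta m) &
      posdef (Sigma_delta m) /\ posdef (Sigma_eps m)].

Definition sem_cov (R : realType) (p1 p2 k1 k2 : nat)
    (m : sem R p1 p2 k1 k2) : 'M[R]_(p1 + p2) :=
  let L1 := Lambda1 m in let L2 := Lambda2 m in let G := Gamma m in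
  let Pi := invmx (Psi m) in
  let S11 := L1 *m Sigma_xi m *m L1^T + Sigma_delta m in
  let S12 := L1 *m Sigma_xi m *m G^T *m Pi^T *m L2^T in
  let S22 := L2 *m Pi *m (G *m Sigma_xi m *m G^T + Sigma_zeta m) *m Pi^T *m L2^T
             + Sigma_eps m in
  block_mx S11 S12 S12^T S22.

Definition asym_W (R : realType) (p : nat) (S : 'M[R]_p) :
    'M[R]_(vech_dim p) :=
  2%:R *: (mpinv (dup_mx R p) *m (S *t S) *m (mpinv (dup_mx R p))^T).

(** Rows are indexed by the components of [f]: the transpose of the library's
    [jacobian], which acts on row vectors. *)
Definition jacobian_mx (R : realType) (q m : nat) (f : 'cV[R]_q -> 'cV[R]_m)
    (x : 'cV[R]_q) : 'M[R]_(m, q) :=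
  \matrix_(i, j) 'D_(delta_mx j 0) (fun y => f y i 0) x.

(** * Contrast *)

Definition contrastF (R : realType) (p : nat) (Q S : 'M[R]_p) : R :=
  ln (\det S) - ln (\det Q) + \tr (invmx S *m Q) - p%:R.

Definition contrast (R : realType) (p : nat) (Q S : 'M[R]_p) : R :=
  if Q \in unitmx then contrastF Q S else enorm (vech Q - vech S) ^+ 2.

(** * Probability *)

Definition random_vector d (T : measurableType d) (R : realType) (n : nat)
    (X : T -> 'cV[R]_n) : Prop :=
  forall i, measurable_fun [set: T] (fun w => X w i 0).

Definition continuous_paths (T : Type) (R : realType) (V : normedModType R)
    (X : R -> T -> V) : Prop :=
  forall w, {within `[0, +oo[%classic, continuous (fun t => X t w)}.

(** Meant for classes [F i] containing the sure event, as all those below do: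
    the product rule over the whole family then entails the rule over every
    subfamily. *)
Definition mutually_independent d (T : measurableType d) (R : realType)
    (P : probability T R) (I : finType) (F : I -> set (set T)) : Prop :=
  forall A : I -> set T, (forall i, F i (A i)) ->
    P (\bigcap_(i in [set: I]) A i) = (\prod_(i in I) P (A i))%E.

Definition sigma_rv d (T : measurableType d) (R : realType) (X : T -> R) :
  set (set T) := preimage_set_system [set: T] X measurable.

Definition sigma_process d (T : measurableType d) (R : realType)
    (X : R -> T -> R) : set (set T) :=
  <<s \bigcup_(t in [set t | 0 <= t]) sigma_rv (X t) >>.

Definition sigma_vprocess d (T : measurableType d) (R : realType) (n : nat)
    (X : R -> T -> 'cV[R]_n) : set (set T) :=
  <<s \bigcup_(tj in [set tj : R * 'I_n | 0 <= tj.1])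
        sigma_rv (fun w => X tj.1 w tj.2 0) >>.

Definition wiener1 d (T : measurableType d) (R : realType)
    (P : probability T R) (W : R -> T -> R) : Prop :=
  [/\ forall t : R, 0 <= t -> measurable_fun [set: T] (W t),
      {ae P, forall w, W 0 w = 0},
      @continuous_paths T R R W,
      forall (m : nat) (t : nat -> R),
        0 <= t 0%N -> (forall i, t i <= t i.+1) ->
        mutually_independent P
          (fun i : 'I_m => sigma_rv (fun w => W (t i.+1) w - W (t i) w)) &
      forall s t : R, 0 <= s -> s < t -> forall A, measurable A ->
        P ((fun w => W t w - W s w) @^-1` A)
        = normal_prob 0 (Num.sqrt (t - s)) A].

Definition wiener d (T : measurableType d) (R : realType)
    (P : probability T R) (r : nat) (W : R -> T -> 'cV[R]_r) : Prop :=
  (forall j, wiener1 P (fun t w => W t w j 0)) /\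
  mutually_independent P (fun j : 'I_r => sigma_process (fun t w => W t w j 0)).

(** Y solves dY = B(Y) dt + S dW, Y_0 = c.  As S is constant, the stochastic
    integral of S is S W_t and the equation is a pathwise integral equation. *)
Definition sde_solution d (T : measurableType d) (R : realType)
    (P : probability T R) (n r : nat) (B : 'cV[R]_n -> 'cV[R]_n)
    (S : 'M[R]_(n, r)) (c : 'cV[R]_n) (W : R -> T -> 'cV[R]_r)
    (Y : R -> T -> 'cV[R]_n) : Prop :=
  [/\ forall t : R, 0 <= t -> random_vector (Y t),
      continuous_paths Y &
      {ae P, forall w, forall t : R, 0 <= t ->
        Y t w = c
          + \col_i (\int[lebesgue_measure]_(s in `[0, t]) (B (Y s w) i 0))
          + S *m W t w}].

Definition iter_partial (R : realType) (n : nat) (f : 'cV[R]_n -> R)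
    (s : seq 'I_n) : 'cV[R]_n -> R :=
  foldr (fun i g => fun x => 'D_(delta_mx i 0) g x) f s.

(** [B] is of class C^N, i.e. its iterated partial derivatives of order <= N
    exist and are continuous, and they are all of polynomial growth. *)
Definition CN_polygrowth (R : realType) (N n : nat)
    (B : 'cV[R]_n -> 'cV[R]_n) : Prop :=
  forall (k : 'I_n) (s : seq 'I_n), (size s <= N)%N ->
    let g := iter_partial (fun x => B x k 0) s in
    [/\ (size s < N)%N -> forall i x, derivable g x (delta_mx i 0),
        continuous g &
        exists (C : R) (l : nat), forall x, `|g x| <= C * (1 + enorm x) ^+ l].

Definition bounded_moments d (T : measurableType d) (R : realType)
    (P : probability T R) (n : nat) (Y : R -> T -> 'cV[R]_n) : Prop :=
  forall l : R, 0 <= l ->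
    (ereal_sup [set 'E_P[(fun w => (enorm (Y t w) `^ l)%R)] | t in
                 [set t : R | (0 <= t)%R]] < +oo)%E.

Definition cvg_in_prob d (T : measurableType d) (R : realType)
    (P : probability T R) (V : normedModType R) (I : Type) (F : set_system I)
    (X : I -> T -> V) (x : V) : Prop :=
  forall e : R, 0 < e -> P [set w | e < `|X i w - x|] @[i --> F] --> 0%E.

(** R^n with its Borel sigma-algebra. *)
Notation borel R n := (g_sigma_algebraType (@open 'cV[R]_n)).

Definition ergodic d (T : measurableType d) (R : realType)
    (P : probability T R) (n : nat) (Y : R -> T -> 'cV[R]_n) : Prop :=
  exists pi : probability (borel R n) R,
    forall g : borel R n -> R, pi.-integrable [set: borel R n] (EFin \o g) ->
      @cvg_in_prob _ T R P R R (pinfty_nbhs R)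
        (fun U w => U^-1 * \int[lebesgue_measure]_(t in `[0, U]) g (Y t w))
        (\int[pi]_x g x).

(** [normal_prob m 0] is not the Dirac mass at [m] in the library. *)
Definition normal_law (R : realType) (m v : R) (A : set R) : \bar R :=
  if v == 0 then \d_m A else normal_prob m (Num.sqrt v) A.

(** [mu] is N_q(m, V): all its linear forms a^T x have law N(a^T m, a^T V a). *)
Definition is_mvnormal (R : realType) (q : nat) (mu : probability (borel R q) R)
    (m : 'cV[R]_q) (V : 'M[R]_q) : Prop :=
  forall (a : 'cV[R]_q) (A : set R), measurable A ->
    mu [set x : borel R q | A ((a^T *m (x : 'cV[R]_q)) 0 0)]
    = normal_law ((a^T *m m) 0 0) ((a^T *m V *m a) 0 0) A.

Definition cvg_in_law d (T : measurableType d) (R : realType)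
    (P : probability T R) (q : nat) (X : nat -> T -> 'cV[R]_q)
    (mu : probability (borel R q) R) : Prop :=
  forall f : 'cV[R]_q -> R, continuous f -> (exists C : R, forall x, `|f x| <= C) ->
    ('E_P[(fun w => f (X n w))] @[n --> \oo] --> \int[mu]_x (f x)%:E)%E.

(** * Realized covariance *)

Definition realized_cov (T : Type) (R : realType) (p : nat)
    (X : R -> T -> 'cV[R]_p) (n : nat) (h : R) (w : T) : 'M[R]_p :=
  (n%:R * h)^-1 *: \sum_(1 <= i < n.+1)
    (let dX := X (i%:R * h) w - X (i.-1%:R * h) w in dX *m dX^T).

(* Main.v *)
(** Over one sampling step each latent process moves by [S dW] plus a drift
    remainder [u].  The remainder has second moment [O(h^2)], and, up to terms of
    higher order, equals [h] times a function of the past, which is uncorrelated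
    with the increment of the noise.  Hence the realized covariance differs from
    the empirical covariance of i.i.d. Gaussian increments by [O(h + sqrt (h / n))]
    in L1, an error which is [o(1)] when [h -> 0] and [o(1 / sqrt n)] when
    [n h^2 -> 0].

    The rest is deterministic near [Sigma_0].  The contrast separates distinct
    positive definite matrices, so compactness and identifiability force its
    minimizer to be close to [theta0].  A second order expansion of the contrast,
    whose quadratic form is [vech^T W^-1 vech], gives
    [theta - theta0 = (Delta^T W^-1 Delta)^-1 Delta^T W^-1 vech (Q - Sigma_0)
      + o(|Q - Sigma_0|)].
    A central limit theorem for quadratic forms of Gaussian increments, with
    covariance [W] by Isserlis' formula, and Levy's continuity theorem conclude. *)

Require Import Defs.
From HB Require Import structures.
From mathcomp Require Import all_boot all_order all_algebra.
From mathcomp Require Import mxtens ring lra.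
From mathcomp Require Import all_classical all_reals all_analysis measurable_realfun.
Import Order.TTheory GRing.Theory Num.Theory.
Import numFieldNormedType.Exports.
Local Open Scope classical_set_scope.
Local Open Scope ring_scope.

Set Implicit Arguments.
Unset Strict Implicit.
Unset Printing Implicit Defensive.

(** * Expectations *)

(** A solution of the stochastic equation comes with no filtration, so the independence of its past
    from the coming noise has to be derived: the Lipschitz drift makes each path a limit of Euler
    schemes, which are functions of earlier increments. The gain is decisive. By Cauchy-Schwarz
    alone the cross terms of drift and noise would leave an error sqrt h in the realized covariance,
    and sqrt n * sqrt h need not vanish; orthogonality gives h + sqrt (h / n), which multiplied by
    sqrt n is sqrt (n h^2) + sqrt h.

    Convergence in law rests on trigonometric polynomials that approximate continuous functions on
    boxes while keeping their bound everywhere; this replaces Prokhorov's theorem and inversion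
    formulas. The normal characteristic function is not computed from the density: it is the limit
    in the central limit theorem applied to finer and finer subdivisions of a Wiener increment. The
    limit law is carried by the given probability space, as the law of a linear image of increments
    of one noise coordinate. *)

Lemma cvg_ler (R : realType) (u v : nat -> R) (a b : R) :
  u n @[n --> \oo] --> a -> v n @[n --> \oo] --> b ->
  (\forall n \near \oo, u n <= v n) -> a <= b.
Proof.
move=> ua vb uv; rewrite -(cvg_lim _ ua)// -(cvg_lim _ vb)//.
by apply: ler_lim => //; [apply: cvgP ua|apply: cvgP vb].
Qed.

Section expectation.
Context d (T : measurableType d) (R : realType) (P : probability T R).
Implicit Types (f g : T -> R) (c e : R).

Definition L1 f := P.-integrable [set: T] (EFin \o f).
Definition expect f : R := \int[P]_w f w.
Local Notation Ex := expect.

Lemma L1_meas f : L1 f -> measurable_fun [set: T] f.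
Proof. by move=> /integrableP[/measurable_EFinP]. Qed.

Lemma L1_dom f g : measurable_fun [set: T] f -> L1 g ->
  (forall w, `|f w| <= g w) -> L1 f.
Proof.
move=> mf Lg fg; apply: le_integrable Lg => //; first exact/measurable_EFinP.
by move=> x _ /=; rewrite lee_fin (le_trans (fg x))// ler_norm.
Qed.

Lemma L1_cst c : L1 (fun=> c).
Proof. exact: finite_measure_integrable_cst. Qed.

Lemma L1_bnd f (K : R) : measurable_fun [set: T] f -> (forall w, `|f w| <= K) -> L1 f.
Proof. by move=> mf fK; apply: L1_dom mf (L1_cst K) fK. Qed.

Lemma L1D f g : L1 f -> L1 g -> L1 (fun w => f w + g w).
Proof. by move=> Lf Lg; have := integrableD measurableT Lf Lg. Qed.

Lemma L1Z c f : L1 f -> L1 (fun w => c * f w).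
Proof. by move=> Lf; have := integrableZl measurableT c Lf. Qed.

Lemma L1N f : L1 f -> L1 (fun w => - f w).
Proof. by move=> Lf; have := integrableN Lf. Qed.

Lemma L1B f g : L1 f -> L1 g -> L1 (fun w => f w - g w).
Proof. by move=> Lf Lg; apply: L1D => //; apply: L1N. Qed.

Lemma L1_norm f : L1 f -> L1 (fun w => `|f w|).
Proof. by move=> Lf; apply: integrable_norm. Qed.

Lemma L1_sum (I : Type) (s : seq I) (Q : pred I) (F : I -> T -> R) :
  (forall i, Q i -> L1 (F i)) -> L1 (fun w => \sum_(i <- s | Q i) F i w).
Proof.
move=> LF; elim: s => [|i s IH].
  by under eq_fun do rewrite big_nil; exact: L1_cst.
have [Qi|Qi] := boolP (Q i); last by under eq_fun do rewrite big_cons (negbTE Qi).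
under eq_fun do rewrite big_cons Qi.
by apply: L1D => //; apply: LF.
Qed.

Lemma Ex_cst c : Ex (fun=> c) = c.
Proof. rewrite /Ex Rintegral_cst//; have /= -> := probability_setT P.
by rewrite mulr1. Qed.

Lemma ExD f g : L1 f -> L1 g -> Ex (fun w => f w + g w) = Ex f + Ex g.
Proof. by move=> Lf Lg; rewrite /Ex RintegralD. Qed.

Lemma ExZ c f : L1 f -> Ex (fun w => c * f w) = c * Ex f.
Proof. by move=> Lf; rewrite /Ex RintegralZl. Qed.

Lemma ExB f g : L1 f -> L1 g -> Ex (fun w => f w - g w) = Ex f - Ex g.
Proof. by move=> Lf Lg; rewrite /Ex RintegralB. Qed.

Lemma Ex_sum (I : Type) (s : seq I) (Q : pred I) (F : I -> T -> R) :
  (forall i, Q i -> L1 (F i)) ->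
  Ex (fun w => \sum_(i <- s | Q i) F i w) = \sum_(i <- s | Q i) Ex (F i).
Proof.
move=> LF; elim: s => [|i s IH].
  by under eq_fun do rewrite big_nil; rewrite Ex_cst big_nil.
have [Qi|Qi] := boolP (Q i); last first.
  by under eq_fun do rewrite big_cons (negbTE Qi); rewrite big_cons (negbTE Qi).
under eq_fun do rewrite big_cons Qi; rewrite big_cons Qi.
by rewrite ExD ?IH//; [exact: LF|exact: L1_sum].
Qed.

Lemma Ex_le f g : L1 f -> L1 g -> (forall w, f w <= g w) -> Ex f <= Ex g.
Proof. by move=> Lf Lg fg; apply: le_Rintegral. Qed.

Lemma Ex_ge0 f : (forall w, 0 <= f w) -> 0 <= Ex f.
Proof. by move=> f0; apply: Rintegral_ge0. Qed.

Lemma Ex_norm f : L1 f -> `|Ex f| <= Ex (fun w => `|f w|).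
Proof. by move=> Lf; apply: le_normr_Rintegral. Qed.

Lemma EFin_Ex f : L1 f -> (\int[P]_w (f w)%:E)%E = (Ex f)%:E.
Proof.
by move=> Lf; rewrite /expect /Rintegral fineK//; exact: integrable_fin_num.
Qed.

Lemma L1_sq f g : measurable_fun [set: T] f -> measurable_fun [set: T] g ->
  L1 (fun w => f w ^+ 2) -> L1 (fun w => g w ^+ 2) -> L1 (fun w => f w * g w).
Proof.
move=> mf mg Lf Lg; apply: (L1_dom _ (L1D Lf Lg)).
  exact: measurable_funM.
move=> w; rewrite normrM -[f w ^+ 2]real_normK ?num_real//.
rewrite -[g w ^+ 2]real_normK ?num_real//.
have := sqr_ge0 (`|f w| - `|g w|); have := normr_ge0 (f w); have := normr_ge0 (g w).
by nra.
Qed.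

Definition L2 f := measurable_fun [set: T] f /\ L1 (fun w => f w ^+ 2).

Lemma L2M f g : L2 f -> L2 g -> L1 (fun w => f w * g w).
Proof. by move=> [mf Lf] [mg Lg]; exact: L1_sq. Qed.

Lemma L2_cst c : L2 (fun=> c).
Proof. by split => //; exact: L1_cst. Qed.

Lemma L2_L1 f : L2 f -> L1 f.
Proof.
move=> Lf; have := L2M Lf (L2_cst 1).
by under eq_fun do rewrite mulr1.
Qed.

Lemma L2_bnd f (K : R) : measurable_fun [set: T] f -> (forall w, `|f w| <= K) -> L2 f.
Proof.
move=> mf fK; split => //; apply: (@L1_bnd _ (K ^+ 2)).
  exact: measurable_funX.
by move=> w; rewrite normrX lerXn2r// nnegrE// (le_trans _ (fK w)).
Qed.

Lemma L2D f g : L2 f -> L2 g -> L2 (fun w => f w + g w).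
Proof.
move=> Lf Lg; have Lfg := L2M Lf Lg; case: Lf Lg => [mf Lf] [mg Lg]; split.
  exact: measurable_funD.
have := L1D (L1D Lf (L1Z 2 Lfg)) Lg.
by apply: eq_integrable => // w _ /=; congr _%:E; ring.
Qed.

Lemma L2Z c f : L2 f -> L2 (fun w => c * f w).
Proof.
move=> [mf Lf]; split; first exact: measurable_funM.
by under eq_fun do rewrite exprMn; exact: L1Z.
Qed.

Lemma L2N f : L2 f -> L2 (fun w => - f w).
Proof. by move=> /(L2Z (-1)); under eq_fun do rewrite mulN1r. Qed.

Lemma L2B f g : L2 f -> L2 g -> L2 (fun w => f w - g w).
Proof. by move=> Lf Lg; apply: L2D => //; exact: L2N. Qed.

Lemma L2_sum (I : Type) (s : seq I) (Q : pred I) (F : I -> T -> R) :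
  (forall i, Q i -> L2 (F i)) -> L2 (fun w => \sum_(i <- s | Q i) F i w).
Proof.
move=> LF; elim: s => [|i s IH].
  by under eq_fun do rewrite big_nil; exact: L2_cst.
have [Qi|Qi] := boolP (Q i); last by under eq_fun do rewrite big_cons (negbTE Qi).
under eq_fun do rewrite big_cons Qi.
by apply: L2D => //; apply: LF.
Qed.

Lemma L2_dom f g : measurable_fun [set: T] f -> L2 g ->
  (forall w, `|f w| <= `|g w|) -> L2 f.
Proof.
move=> mf [mg Lg] fg; split => //; apply: (L1_dom _ Lg).
  exact: measurable_funX.
by move=> w; rewrite normrX -[leRHS]real_normK ?num_real// lerXn2r// nnegrE.
Qed.

(** A weighted form of Cauchy-Schwarz, from the square of [c * a - b] divided by [c]. The weight is
    chosen at each use to balance the two second moments, so that no square root of an expectation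
    occurs. *)
Lemma Ex_AMGM c f g : 0 < c -> L2 f -> L2 g ->
  Ex (fun w => `|f w * g w|)
  <= c * Ex (fun w => f w ^+ 2) + c^-1 * Ex (fun w => g w ^+ 2).
Proof.
move=> c0 Lf Lg; have Lfg := L2M Lf Lg; case: Lf Lg => [mf Lf] [mg Lg].
rewrite -!ExZ// -ExD; [|exact: L1Z..].
apply: Ex_le; [exact: L1_norm|apply: L1D; exact: L1Z|move=> w].
rewrite normrM -[f w ^+ 2]real_normK ?num_real//.
rewrite -[g w ^+ 2]real_normK ?num_real//.
set a : R := `|f w|; set b : R := `|g w|.
have a0 : 0 <= a by exact: normr_ge0.
have b0 : 0 <= b by exact: normr_ge0.
have : 0 <= c^-1 * (c * a - b) ^+ 2 by rewrite mulr_ge0// ?sqr_ge0// invr_ge0 ltW.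
have -> : c^-1 * (c * a - b) ^+ 2 = c * a ^+ 2 - 2 * a * b + c^-1 * b ^+ 2.
  by field; rewrite gt_eqF.
by nra.
Qed.

Lemma sqr_sum_le (I : Type) (r : seq I) (a : I -> R) :
  (\sum_(k <- r) a k) ^+ 2 <= (size r)%:R * \sum_(k <- r) a k ^+ 2.
Proof.
elim: r => [|i r IH]; first by rewrite !big_nil expr0n/= mulr0.
rewrite !big_cons/=; set s := \sum_(k <- r) a k in IH *.
set t := \sum_(k <- r) _ in IH *; rewrite -natr1; set m := size r in IH *.
have [m0|m0] := eqVneq m 0%N.
  have r0 : r = [::] by apply: size0nil.
  by rewrite /s /t m0 r0 !big_nil !addr0 add0r mul1r.
have {}m0 : (m%:R : R) != 0 by rewrite pnatr_eq0.
(* Expanded, this bounds the cross term 2 s a by s^2 / m + m a^2, which together with s^2 <= m t is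
   what the induction step asks for. The division is why m = 0 was split off. *)
have : 0 <= m%:R^-1 * (s - m%:R * a i) ^+ 2.
  by rewrite mulr_ge0 ?sqr_ge0.
have -> : m%:R^-1 * (s - m%:R * a i) ^+ 2
  = m%:R^-1 * s ^+ 2 - 2 * s * a i + m%:R * a i ^+ 2 by field.
have : m%:R^-1 * s ^+ 2 <= t.
  by rewrite mulrC ler_pdivrMr ?lt_neqAle 1?eq_sym ?m0 ?ler0n//= mulrC.
nra.
Qed.

Lemma markov1 f e : L1 f -> 0 < e ->
  (P [set w | (e < `|f w|)%R] <= (e^-1 * Ex (fun w => `|f w|))%:E)%E.
Proof.
move=> Lf e0; have mf := L1_meas Lf.
have mA : measurable [set w | e < `|f w|].
  rewrite [X in measurable X](_ : _ = (fun w => `|f w|) @^-1` `]e, +oo[%classic).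
    by rewrite -[X in measurable X]setTI; apply: measurableT_comp.
  by apply/seteqP; split=> w /=; rewrite in_itv/= andbT.
rewrite EFinM lee_pdivlMl// -(EFin_Ex (L1_norm Lf)).
have -> : (e%:E * P [set w | (e < `|f w|)%R])%E
   = (\int[P]_(w in [set w | (e < `|f w|)%R]) e%:E)%E by rewrite integral_cst.
apply: (@le_trans _ _ (\int[P]_(w in [set w | (e < `|f w|)%R]) (`|f w|)%:E)%E).
  apply: ge0_le_integral => //=.
  - by move=> *; rewrite lee_fin ltW.
  - by apply/measurable_EFinP; apply: measurableT_comp => //; exact: measurable_funTS.
  - by move=> w ew; rewrite lee_fin ltW.
apply: ge0_subset_integral => //.
by apply/measurable_EFinP; exact: measurableT_comp.
Qed.

Lemma ae_cvg_Ex (f_ : nat -> T -> R) f g :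
  (forall m, measurable_fun [set: T] (f_ m)) -> measurable_fun [set: T] f ->
  {ae P, forall w, f_ m w @[m --> \oo] --> f w} ->
  L1 g -> (forall m w, `|f_ m w| <= g w) -> Ex (f_ m) @[m --> \oo] --> Ex f.
Proof.
move=> mf_ mf ff Lg fg.
have [||||| Lf _] := @dominated_convergence _ T R P _ measurableT
   (fun m => EFin \o f_ m) (EFin \o f) (EFin \o g).
- by move=> m; apply/measurable_EFinP.
- exact/measurable_EFinP.
- by apply: filterS ff => w fw _; apply: cvg_EFin => //; exact: nearW.
- exact: Lg.
- by apply: aeW => w m _; rewrite /= lee_fin.
have Lf_ m : L1 (f_ m) by apply: L1_dom Lg _.
by rewrite (EFin_Ex Lf) => /fine_cvgP[].
Qed.

(** Fatou's lemma for second moments: the limiting square is capped at a level [K], dominated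
    convergence passes the bound to the capped square, and monotone convergence removes the cap.
    Square integrability of the limit is part of the conclusion. *)
Lemma ae_cvg_fatou (f_ : nat -> T -> R) f (c_ : nat -> R) c :
  (forall m, measurable_fun [set: T] (f_ m)) -> measurable_fun [set: T] f ->
  (forall m, L1 (fun w => f_ m w ^+ 2)) ->
  {ae P, forall w, f_ m w @[m --> \oo] --> f w} ->
  (forall m, Ex (fun w => f_ m w ^+ 2) <= c_ m) -> c_ m @[m --> \oo] --> c ->
  L2 f /\ Ex (fun w => f w ^+ 2) <= c.
Proof.
move=> mf_ mf Lf_ ff Ec cc.
have mf2 : measurable_fun [set: T] (fun w => f w ^+ 2) by exact: measurable_funX.
have mf_2 m : measurable_fun [set: T] (fun w => f_ m w ^+ 2).
  exact: measurable_funX.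
pose g (K : nat) w := Num.min (f w ^+ 2) K%:R.
have mg K : measurable_fun [set: T] (g K) by exact: measurable_minr.
have g0 K w : 0 <= g K w by rewrite le_min sqr_ge0 ler0n.
have Lg K : L1 (g K).
  by apply: (@L1_bnd _ K%:R) => // w; rewrite ger0_norm// ge_min lexx orbT.
have gc K : Ex (g K) <= c.
  have H : Ex (fun w => Num.min (f_ m w ^+ 2) K%:R) @[m --> \oo] --> Ex (g K).
    apply: (@ae_cvg_Ex _ _ (fun=> K%:R)) => //.
    - by move=> m; apply: measurable_minr.
    - apply: filterS ff => w fw.
      apply: (cvg_comp _ (fun x : R => Num.min (x ^+ 2) K%:R) fw).
      apply: (@continuous_min R R (fun x : R => x ^+ 2) (fun=> K%:R)); last exact: cvg_cst.
      exact: exprn_continuous.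
    - exact: L1_cst.
    - move=> m w; rewrite ger0_norm; first by rewrite ge_min lexx orbT.
      by rewrite le_min sqr_ge0 ler0n.
  apply: (cvg_ler H cc); apply: nearW => m.
  apply: le_trans (Ec m); apply: Ex_le => //.
    apply: (@L1_bnd _ K%:R); first exact: measurable_minr.
    move=> w; rewrite ger0_norm; first by rewrite ge_min lexx orbT.
    by rewrite le_min sqr_ge0 ler0n.
  by move=> w; rewrite ge_min lexx.
have H : (\int[P]_w (f w ^+ 2)%:E <= c%:E)%E.
  have := @cvg_monotone_convergence _ T R P _ measurableT
    (fun K => EFin \o g K).
  have -> : (fun w => limn (fun K => (EFin \o g K) w)) = EFin \o (fun w => f w ^+ 2).
    apply/funext => w /=; apply/cvg_lim => //; apply: cvg_EFin; first exact: nearW.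
    apply: cvg_near_cst; near=> K; rewrite /= /g; apply/min_idPl.
    near: K; exact: nbhs_infty_ger.
  move=> C; apply: (cvge_le _ (C _ _ _)).
  - by apply: nearW => K; rewrite EFin_Ex// lee_fin.
  - by move=> K; apply/measurable_EFinP.
  - by move=> K w _; rewrite lee_fin.
  - move=> w _ m n mn; rewrite lee_fin le_min ge_min lexx/= ge_min ler_nat mn.
    by rewrite orbT.
have Lf2 : L1 (fun w => f w ^+ 2).
  apply/integrableP; split; first exact/measurable_EFinP.
  apply: le_lt_trans (ltry c).
  by under eq_integral do rewrite /= ger0_norm ?sqr_ge0//.
by split; [split|rewrite -lee_fin -EFin_Ex].
Unshelve. all: by end_near.
Qed.

End expectation.

(** * Independence *)

Section independence.
Context d (T : measurableType d) (R : realType) (P : probability T R).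

Definition indep2 (f g : T -> R) := forall A B : set R,
  measurable A -> measurable B ->
  P (f @^-1` A `&` g @^-1` B) = (P (f @^-1` A) * P (g @^-1` B))%E.

(** The law of the pair and the product of the two laws agree on rectangles, hence everywhere.
    Tonelli's theorem then gives the integrability of the product, and Fubini's its mean. *)
Lemma indep2_Ex f g : L1 P f -> L1 P g -> indep2 f g ->
  L1 P (fun w => f w * g w) /\ expect P (fun w => f w * g w) = expect P f * expect P g.
Proof.
move=> Lf Lg fg; have mf := L1_meas Lf; have mg := L1_meas Lg.
pose X : {RV P >-> R} := MeasurableFun.Pack (MeasurableFun.Class (isMeasurableFun.Build _ _ _ _ _ mf)).
pose Y : {RV P >-> R} := MeasurableFun.Pack (MeasurableFun.Class (isMeasurableFun.Build _ _ _ _ _ mg)).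
pose h w := (f w, g w).
have mh : measurable_fun [set: T] h by exact: measurable_fun_pair.
pose Z : {RV P >-> (R * R)%type} := MeasurableFun.Pack (MeasurableFun.Class (isMeasurableFun.Build _ _ _ _ _ mh)).
have E : forall A, measurable A -> (distribution P X \x distribution P Y)%E A = distribution P Z A.
  by apply: product_measure_unique => A B mA mB; exact: fg.
pose k (z : R * R) := (z.1 * z.2)%:E.
have mk : measurable_fun [set: R * R] k.
  by apply/measurable_EFinP; apply: measurable_funM.
have mn : measurable_fun [set: R] (fun y : R => (`|y|)%:E).
  by apply/measurable_EFinP; exact: normr_measurable.
have Ik : (distribution P X \x distribution P Y)%E.-integrable [set: R * R] k.
  apply/integrable12ltyP => //.
  have -> : (\int[distribution P X]_x \int[distribution P Y]_y `|k (x, y)|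
     = \int[distribution P X]_x (`|x|%:E * (expect P (fun w => `|g w|))%:E))%E.
    apply: eq_integral => x _.
    under eq_integral do rewrite /k /= normrM EFinM.
    rewrite ge0_integralZl// ge0_integral_distribution//=.
    by rewrite EFin_Ex//; exact: L1_norm.
  rewrite ge0_integralZr//; last by rewrite lee_fin Ex_ge0.
  rewrite ge0_integral_distribution//=.
  by rewrite EFin_Ex; [rewrite -EFinM ltry|exact: L1_norm].
have Lfg : L1 P (fun w => f w * g w).
  apply/integrableP; split; first by apply/measurable_EFinP; exact: measurable_funM.
  have /integrableP[_] := Ik; rewrite (eq_measure_integral (distribution P Z)); last first.
    by move=> A mA _; exact: E.
  by rewrite ge0_integral_distribution//; apply: measurableT_comp.
split => //; apply: EFin_inj; rewrite -EFin_Ex//.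
have -> : (\int[P]_w (f w * g w)%:E = \int[distribution P Z]_z k z)%E.
  by rewrite integral_distribution.
rewrite -(eq_measure_integral (distribution P Z) (fun A mA _ => E A mA)).
rewrite -integral12_prod_meas1// /fubini_F.
have -> : (\int[distribution P X]_x \int[distribution P Y]_y k (x, y)
     = \int[distribution P X]_x (x%:E * (expect P g)%:E))%E.
  apply: eq_integral => x _.
  have Ly : (distribution P Y).-integrable [set: R] (EFin \o id).
    by apply: integrable_pushforward => //; exact/measurable_EFinP.
  have -> : (\int[distribution P Y]_y k (x, y) = \int[distribution P Y]_y (x%:E * (EFin \o id) y))%E.
    by apply: eq_integral => y _.
  rewrite integralZl//= integral_distribution//=.
  by rewrite EFin_Ex.
have Lx : (distribution P X).-integrable [set: R] (EFin \o id).
  by apply: integrable_pushforward => //; exact/measurable_EFinP.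
have -> : (\int[distribution P X]_x (x%:E * (expect P g)%:E)
    = \int[distribution P X]_x ((EFin \o id) x * (expect P g)%:E))%E.
  by apply: eq_integral => x _.
by rewrite integralZr//= integral_distribution//= EFin_Ex.
Qed.

(** Dynkin's argument: for fixed [B], the events obeying the product rule form a lambda-system, so
    it is enough to have the rule on a generating pi-system. *)
Lemma indep_gen (G : set (set T)) (B : set T) :
  setI_closed G -> G `<=` measurable -> measurable B ->
  (forall A, G A -> P (A `&` B) = (P A * P B)%E) ->
  forall A, <<s G >> A -> P (A `&` B) = (P A * P B)%E.
Proof.
move=> GI Gm mB GB A GA.
suff: <<s G >> `<=` [set A | measurable A /\ P (A `&` B) = (P A * P B)%E].
  by move=> /(_ _ GA)[].
apply: lambda_system_subset => //; last by move=> C GC; split; [exact: Gm|exact: GB].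
have fB : P B \is a fin_num by rewrite fin_num_measure.
apply/dynkin_lambda_system; split.
- by split; [exact: measurableT|rewrite setTI probability_setT mul1e].
- move=> C [mC PC]; split; first exact: measurableC.
  have -> : ~` C `&` B = B `\` (C `&` B).
    apply/seteqP; split => x /=; first by move=> [nC Bx]; split => // -[].
    by move=> [Bx nCB]; split => // Cx; apply: nCB.
  rewrite measureD//; last 2 first.
  - exact: measurableI.
  - by rewrite ltey_eq fB.
  rewrite setICA setIid; transitivity (P B - P (C `&` B))%E; first by [].
  rewrite PC probability_setC//.
  by rewrite muleBl ?mul1e.
- move=> F tF HF; split; first by apply: bigcupT_measurable => k; case: (HF k).
  rewrite setI_bigcupl.
  have mF k : measurable (F k) by case: (HF k).
  have -> : P (\bigcup_i (F i `&` B)) = (\sum_(i <oo) P (F i `&` B))%E.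
    apply/esym/cvg_lim => //; apply: measure_semi_sigma_additive.
    - by move=> i; apply: measurableI.
    - by apply: trivIset_setIr.
    - by apply: bigcupT_measurable => i; apply: measurableI.
  have -> : P (\bigcup_i F i) = (\sum_(i <oo) P (F i))%E.
    apply/esym/cvg_lim => //; apply: measure_semi_sigma_additive => //.
    exact: bigcupT_measurable.
  rewrite muleC -(fineK fB) -nneseriesZl//.
  by apply: eq_eseriesr => i _; rewrite fineK// muleC; case: (HF i).
Qed.

Context (I : finType) (F : I -> set (set T)).
Hypothesis Fm : forall i, F i `<=` measurable.
Hypothesis FT : forall i, F i [set: T].
Hypothesis FI : forall i, setI_closed (F i).
Hypothesis FP : mutually_independent P F.

(** Only a generating family: the information carried by the sources selected by [A] is
    [<<s block A >>]. *)
Definition block (A : pred I) : set (set T) := \bigcup_(i in [set i | A i]) F i.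

(** Cylinders form a pi-system generating the same sigma-algebra as the block. They are
    intersections over all of [I], trivial outside [A], so that [mutually_independent] applies to
    them directly. *)
Let cyl (A : pred I) : set (set T) := [set X | exists E : I -> set T,
  [/\ forall i, F i (E i), forall i, ~~ A i -> E i = setT &
      X = \bigcap_(i in [set: I]) E i]].

Let cyl_setI A : setI_closed (cyl A).
Proof.
move=> _ _ [E [FE ET ->]] [E' [FE' ET' ->]].
exists (fun i => E i `&` E' i); split.
- by move=> i; apply: FI.
- by move=> i Ai; rewrite ET// ET'// setTI.
- by rewrite bigcapI.
Qed.

Let cyl_meas A : cyl A `<=` measurable.
Proof.
move=> _ [E [FE _ ->]]; apply: fin_bigcap_measurable => // i _.
exact/Fm.
Qed.

Let block_cyl A : <<s block A >> `<=` <<s cyl A >>.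
Proof.
apply: smallest_sub; first exact: smallest_sigma_algebra.
move=> X [i Ai FX]; apply: sub_gen_smallest.
exists (fun j => if j == i then X else setT); split.
- by move=> j; case: eqP => [->|].
- by move=> j; case: eqP => // -> /negP.
- apply/seteqP; split => x /=.
    by move=> Xx j _; case: ifP.
  by move=> /(_ i Logic.I); rewrite eqxx.
Qed.

Lemma block_meas A : <<s block A >> `<=` measurable.
Proof.
apply: smallest_sub; first exact: sigma_algebra_measurable.
by move=> X [i _ /Fm].
Qed.

(** Dynkin's argument is applied to each block in turn, which leaves two cylinders. Their product
    rule holds factor by factor, since at every index one of the two sides is the whole space. *)
Lemma block_indep (A B : pred I) X Y : (forall i, A i -> ~~ B i) ->
  <<s block A >> X -> <<s block B >> Y -> P (X `&` Y) = (P X * P Y)%E.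
Proof.
move=> AB AX BY; have mY := block_meas BY.
apply: (indep_gen (@cyl_setI A) (@cyl_meas A) mY) (block_cyl AX) => {AX}X AX.
have mX := cyl_meas AX.
rewrite setIC muleC.
apply: (indep_gen (@cyl_setI B) (@cyl_meas B) mX) (block_cyl BY) => {mY}Y {}BY.
case: AX BY => [E [FE ET ->]] [E' [FE' ET' ->]].
rewrite -bigcapI FP; last by move=> i; apply: FI.
rewrite FP// FP// -big_split/=; apply: eq_bigr => i _.
have [Ai|nAi] := boolP (A i).
  by rewrite ET' ?AB// setTI probability_setT mul1e.
by rewrite (ET _ nAi) setIT probability_setT mule1.
Qed.

Lemma block_indep2 (A B : pred I) (f g : T -> R) :
  (forall i, A i -> ~~ B i) ->
  measurable_fun [set: g_sigma_algebraType (block A)] f ->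
  measurable_fun [set: g_sigma_algebraType (block B)] g ->
  indep2 f g.
Proof.
move=> AB mf mg X Y mX mY; apply: (block_indep AB).
  by have := mf measurableT X mX; rewrite setTI.
by have := mg measurableT Y mY; rewrite setTI.
Qed.

Lemma block_measurable_fun (A : pred I) (f : T -> R) :
  measurable_fun [set: g_sigma_algebraType (block A)] f ->
  measurable_fun [set: T] f.
Proof.
by move=> mf _ X mX; have /block_meas := mf measurableT X mX.
Qed.

Lemma block_sub (A B : pred I) (f : T -> R) : (forall i, A i -> B i) ->
  measurable_fun [set: g_sigma_algebraType (block A)] f ->
  measurable_fun [set: g_sigma_algebraType (block B)] f.
Proof.
move=> AB mf _ X mX; have := mf measurableT X mX.
apply: smallest_sub; first exact: smallest_sigma_algebra.
by move=> Y [i Ai FY]; apply: sub_gen_smallest; exists i => //; exact: AB.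
Qed.

End independence.

(** * Gaussian moments *)

Section gaussian_moments.
Context (R : realType) (s : R) (s0 : 0 < s).
Local Notation mu := (@lebesgue_measure R).
Local Notation N := (@normal_prob R 0 s).
Local Notation g := (@normal_pdf R 0 s).

(** Change of variables is known for the Radon-Nikodym derivative; the explicit density is almost
    everywhere equal to it because both have the same integral over every measurable set. *)
Lemma ge0_integral_normal (f : R -> \bar R) : measurable_fun [set: R] f ->
  (forall x, 0 <= f x)%E ->
  (\int[N]_x f x = \int[mu]_x (f x * (g x)%:E))%E.
Proof.
move=> mf f0; have dom := @normal_prob_dominates R 0 s.
have mg : measurable_fun [set: R] (EFin \o g).
  by apply/measurable_EFinP; exact: measurable_normal_pdf.
rewrite -(Radon_Nikodym_SigmaFinite.change_of_variables dom)//.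
apply: ae_eq_integral => //.
- apply: emeasurable_funM => //.
  exact: measurable_int (Radon_Nikodym_SigmaFinite.f_integrable dom).
- exact: emeasurable_funM.
- apply: ae_eqe_mul2l; apply: integral_ae_eq => //.
  + exact: Radon_Nikodym_SigmaFinite.f_integrable.
  + by move=> A AT mA; rewrite -Radon_Nikodym_SigmaFinite.f_integral.
Qed.

Lemma normal_pdf_pos x : g x = normal_peak s * expR (- x ^+ 2 / (s ^+ 2 *+ 2)).
Proof. by rewrite normal_pdfE ?gt_eqF// /normal_fun subr0. Qed.

(** The constant in |x|^j <= C j * exp (x^2 / (4 s^2)). Half of the Gaussian exponent pays for the
    power; the other half is the exponent of a normal density with standard deviation [s'] = sqrt 2
    * s, which is integrable. *)
Let C (j : nat) : R := 1 + (4 * s ^+ 2) ^+ j * j`!%:R.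

Let C_gt0 j : 0 < C j.
Proof. by rewrite ltr_pwDl// mulr_ge0// exprn_ge0// mulr_ge0// sqr_ge0. Qed.

Let norm_exp_le (j : nat) (x : R) : `|x| ^+ j <= C j * expR (x ^+ 2 / (4 * s ^+ 2)).
Proof.
have s2 : 0 < 4 * s ^+ 2 by rewrite mulr_gt0// exprn_gt0.
set y := x ^+ 2 / _; have y0 : 0 <= y by rewrite divr_ge0 ?sqr_ge0// ltW.
have e1 : 1 <= expR y by rewrite -[leLHS]expR0 ler_expR.
have xj : `|x| ^+ j <= 1 + (x ^+ 2) ^+ j.
  rewrite -[x ^+ 2]real_normK ?num_real// -exprM mulnC exprM.
  set t := `|x| ^+ j; have t0 : 0 <= t by rewrite exprn_ge0.
  by have := sqr_ge0 (t - 1); nra.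
have yj : y ^+ j <= j`!%:R * expR y.
  case: j {xj} => [|j]; first by rewrite expr0 fact0 mul1r.
  have jf : 0 < (j.+1`!%:R : R) by rewrite ltr0n fact_gt0.
  by rewrite mulrC -ler_pdivrMr// (le_trans _ (expR_ge1Dxn j y0))// lerDr.
apply: (le_trans xj); rewrite mulrDl mul1r lerD//.
have -> : x ^+ 2 = (4 * s ^+ 2) * y by rewrite /y mulrC divfK// gt_eqF.
by rewrite exprMn -mulrA ler_wpM2l// exprn_ge0// ltW.
Qed.

Let s' := Num.sqrt 2 * s.
Let s'0 : s' != 0.
Proof. by rewrite mulf_neq0// gt_eqF// sqrtr_gt0. Qed.

Let D : R := normal_peak s / normal_peak s'.

Let gE x : g x * expR (x ^+ 2 / (4 * s ^+ 2)) = D * normal_pdf 0 s' x.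
Proof.
rewrite normal_pdf_pos normal_pdfE// /normal_fun subr0 /D.
rewrite -[LHS]mulrA -expRD [RHS]mulrA divfK; last by rewrite gt_eqF// normal_peak_gt0.
congr (_ * expR _); rewrite /s' exprMn sqr_sqrtr// -[_ *+ 2]mulr_natr.
by rewrite -[(_ * s ^+ 2) *+ 2]mulr_natr; field; rewrite gt_eqF.
Qed.

Let g_le (j : nat) x : `|x| ^+ j * g x <= C j * D * normal_pdf 0 s' x.
Proof.
rewrite -mulrA -gE mulrCA [leLHS]mulrC ler_wpM2l ?normal_pdf_ge0//.
Qed.

Let D_ge0 : 0 <= D.
Proof. by rewrite divr_ge0// normal_peak_ge0. Qed.

Lemma mu_integrable_pow (j : nat) : mu.-integrable [set: R] (fun x => (x ^+ j * g x)%:E).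
Proof.
have I := integrableZl measurableT (C j * D) (@integrable_normal_pdf R 0 s').
apply: le_integrable I => //.
  apply/measurable_EFinP; apply: measurable_funM; first exact: measurable_funX.
  exact: measurable_normal_pdf.
move=> x _; rewrite /= lee_fin normrM normrX [`|g x|]ger0_norm ?normal_pdf_ge0//.
by rewrite (le_trans (g_le j x))// ler_norm.
Qed.

Lemma N_integrable_pow (j : nat) : N.-integrable [set: R] (fun x => (x ^+ j)%:E).
Proof.
apply/integrableP; split; first by apply/measurable_EFinP; exact: measurable_funX.
rewrite ge0_integral_normal//; last first.
  by apply: measurableT_comp => //; apply/measurable_EFinP; exact: measurable_funX.
have /integrableP[_] := mu_integrable_pow j; apply: le_lt_trans.
apply: ge0_le_integral => //.
- by move=> x _; rewrite mule_ge0// lee_fin normal_pdf_ge0.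
- apply: emeasurable_funM.
    by apply: measurableT_comp => //; apply/measurable_EFinP; exact: measurable_funX.
  by apply/measurable_EFinP; exact: measurable_normal_pdf.
- by apply: measurableT_comp => //; exact: measurable_int (mu_integrable_pow j).
- by move=> x _; rewrite /= -EFinM lee_fin normrM [`|g x|]ger0_norm ?normal_pdf_ge0.
Qed.

Let J (j : nat) : R := \int[mu]_x (x ^+ j * g x).

Lemma normal_moment_density j : \int[N]_x (x ^+ j) = J j.
Proof.
rewrite /J /Rintegral; congr fine.
have dom := @normal_prob_dominates R 0 s.
rewrite -(Radon_Nikodym_change_of_variables dom)//; last exact: N_integrable_pow.
apply: ae_eq_integral => //.
- apply: emeasurable_funM => //; first by apply/measurable_EFinP; exact: measurable_funX.
- exact: measurable_int (mu_integrable_pow j).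
- have -> : (fun x => (x ^+ j * g x)%:E) = (fun x => (x ^+ j)%:E * (g x)%:E)%E by [].
  apply: ae_eqe_mul2l; apply: integral_ae_eq => //.
  + exact: Radon_Nikodym_integrable.
  + by apply/measurable_EFinP; exact: measurable_normal_pdf.
  + by move=> A AT mA; rewrite -Radon_Nikodym_integral.
Qed.

Let derive_g (x : R) : is_derive x 1 g (- (x / s ^+ 2) * g x).
Proof.
have -> : g = (fun x => normal_peak s * expR (- x ^+ 2 / (s ^+ 2 *+ 2))).
  by apply/funext => y; rewrite normal_pdf_pos.
apply: is_derive_eq.
rewrite /GRing.scale/= -[(s ^+ 2) *+ 2]mulr_natr; field.
by rewrite gt_eqF.
Qed.

(** [f k] is the derivative of [F k], and [F k] vanishes at both ends of the line. That the integral
    of [f k] is 0 is integration by parts, and links the moments of order k - 1 and k + 1. *)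
Let F (k : nat) (x : R) := x ^+ k * g x.
Let f (k : nat) (x : R) : R := k%:R * (x ^+ k.-1 * g x) - s ^- 2 * (x ^+ k.+1 * g x).

Let derive_F k (x : R) : is_derive x 1 (F k) (f k x).
Proof.
have dg := derive_g x.
have H := is_deriveM (is_deriveX k (is_derive_id x (1 : R))) dg.
have -> : F k = id ^+ k * g by apply/funext => y; rewrite mulrfctE exprfctE.
apply: (is_derive_eq H); rewrite /f exprfctE /GRing.scale/= mulr1 (exprS x k); field.
by rewrite gt_eqF.
Qed.

Let cont_f k : continuous (f k).
Proof.
have cX j : continuous (fun x : R => x ^+ j * g x).
  move=> x; apply: cvgM; first exact: exprn_continuous.
  by apply: continuous_normal_pdf; rewrite gt_eqF.
by move=> x; apply: cvgB; (apply: cvgM; [exact: cvg_cst|exact: cX]).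
Qed.

Let int_f k : mu.-integrable [set: R] (EFin \o f k).
Proof.
have := integrableB measurableT (integrableZl measurableT k%:R (mu_integrable_pow k.-1))
  (integrableZl measurableT (s ^- 2) (mu_integrable_pow k.+1)).
by apply: eq_integrable => // x _.
Qed.

(** The Gaussian factor bounds one power of |x| more than [F k] contains, which leaves a decay 1 /
    (n + 1) at the end points. *)
Let F_cvg k : F k n.+1%:R - F k (- n.+1%:R) @[n --> \oo] --> (0 : R).
Proof.
pose K := 2 * (C k.+1 * normal_peak s).
have B (x : R) : `|x| ^+ k.+1 * g x <= C k.+1 * normal_peak s.
  rewrite normal_pdf_pos mulrCA [leRHS]mulrC ler_wpM2l ?normal_peak_ge0//.
  apply: (@le_trans _ _ (C k.+1 * (expR (x ^+ 2 / (4 * s ^+ 2)) * expR (- x ^+ 2 / (s ^+ 2 *+ 2))))).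
    by rewrite mulrA ler_wpM2r ?expR_ge0// norm_exp_le.
  rewrite ler_piMr ?(ltW (C_gt0 _))// -expRD -[leRHS]expR0 ler_expR.
  rewrite [X in X <= _](_ : _ = - (x ^+ 2 / (4 * s ^+ 2))).
    by rewrite oppr_le0 divr_ge0 ?sqr_ge0// mulr_ge0// sqr_ge0.
  by rewrite -[(s ^+ 2) *+ 2]mulr_natr; field; rewrite gt_eqF.
have BF (x : R) n : `|x| = n.+1%:R -> `|F k x| <= C k.+1 * normal_peak s * n.+1%:R^-1.
  move=> xn; rewrite ler_pdivlMr ?ltr0n// /F normrM normrX [`|g x|]ger0_norm ?normal_pdf_ge0//.
  by have := B x; rewrite exprSr xn mulrAC.
apply/norm_cvg0P; apply: (@squeeze_cvgr _ _ _ _ (fun=> 0) (fun n => K * n.+1%:R^-1)).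
- apply: nearW => n; rewrite normr_ge0/= (le_trans (ler_normB _ _))//.
  rewrite /K mulr_natl mulrnAl mulr2n lerD//; apply: BF; rewrite ?normrN ger0_norm//.
- exact: cvg_cst.
- rewrite -[X in _ --> X](mulr0 K); apply: cvgM; first exact: cvg_cst.
  exact: cvg_harmonic.
Qed.

Let int_f0 k : \int[mu]_x f k x = 0.
Proof.
pose A n := `[(- n.+1%:R : R), n.+1%:R]%classic.
have FTC n : (\int[mu]_(x in A n) (f k x)%:E = (F k n.+1%:R - F k (- n.+1%:R))%:E)%E.
  rewrite EFinB; apply: continuous_FTC2.
  - by rewrite gtrN.
  - exact/continuous_subspaceT/cont_f.
  - have dF x : derivable (F k) x 1 by apply: ex_derive; exact: derive_F.
    have cF x : F k @ x --> F k x.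
      by apply/differentiable_continuous/derivable1_diffP.
    split; first by move=> x _.
      exact: cvg_at_right_filter.
    exact: cvg_at_left_filter.
  - by move=> x _; have ? := derive_F k x; rewrite derive1E derive_val.
have [||||| _ _] := @dominated_convergence _ (measurableTypeR R) R mu _ measurableT
   (fun n => (EFin \o f k) \_ (A n)) (EFin \o f k) (abse \o (EFin \o f k)).
- move=> n; apply/(measurable_restrictT _ _).1 => //; first exact: measurable_itv.
  by apply: measurable_funTS; exact: measurable_int (int_f k).
- exact: measurable_int (int_f k).
- apply: aeW => x _; apply: cvg_near_cst; near=> n.
  rewrite patchE ifT// inE /A/= in_itv/= -ler_norml.
  have /ltW/le_trans -> // : `|x| < n%:R by near: n; exact: nbhs_infty_gtr.
  by rewrite ler_nat.
- exact: integrable_abse.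
- by apply: aeW => x n _; rewrite /= patchE; case: ifP => //; rewrite abse0.
- have -> : (fun n => \int[mu]_x ((EFin \o f k) \_ (A n)) x)%E
      = EFin \o (fun n => F k n.+1%:R - F k (- n.+1%:R)).
    by apply/funext => n /=; rewrite -integral_mkcond FTC.
  rewrite -(@fineK _ (\int[mu]_x (EFin \o f k) x)%E); last first.
    exact: integrable_fin_num.
  by move=> /fine_cvgP[_ H]; apply: cvg_unique (F_cvg k).
Unshelve. all: by end_near.
Qed.

Lemma normal_moment0 : J 0 = 1.
Proof.
rewrite -normal_moment_density /Rintegral.
under eq_integral do rewrite expr0.
by rewrite integral_cst//= mul1e probability_setT.
Qed.

Lemma normal_moment1 : J 1 = 0.
Proof.
have := int_f0 0; rewrite /f; under eq_Rintegral do rewrite mul0r sub0r -mulNr.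
by rewrite RintegralZl//; [move=> /eqP; rewrite mulf_eq0 oppr_eq0 invr_eq0 sqrf_eq0 gt_eqF//= => /eqP|exact: mu_integrable_pow].
Qed.

Lemma normal_momentSS k : J k.+2 = k.+1%:R * s ^+ 2 * J k.
Proof.
have := int_f0 k.+1; rewrite /f RintegralB//; last 2 first.
- exact: (integrableZl measurableT k.+1%:R (mu_integrable_pow k)).
- exact: (integrableZl measurableT (s ^- 2) (mu_integrable_pow k.+2)).
rewrite !RintegralZl//; try exact: mu_integrable_pow.
rewrite -/(J k.+2) -/(J k) => /eqP; rewrite subr_eq0 => /eqP H.
by rewrite mulrAC H mulrAC mulVf ?mul1r// gt_eqF// exprn_gt0.
Qed.

End gaussian_moments.

(** * Increments of the driving noise *)

Section noise.
Context d (T : measurableType d) (R : realType) (P : probability T R).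
Local Notation Ex := (expect P).
Local Notation L1 := (L1 P).
Local Notation L2 := (L2 P).
Implicit Types s t : R.

Lemma sigma_rv_meas (X : T -> R) : measurable_fun [set: T] X ->
  sigma_rv X `<=` measurable.
Proof. by move=> mX _ [B mB <-]; exact: mX. Qed.

Lemma sigma_rvT (X : T -> R) : sigma_rv X [set: T].
Proof. by exists setT; rewrite ?preimage_setT ?setTI. Qed.

Lemma sigma_rvI (X : T -> R) : setI_closed (sigma_rv X).
Proof.
move=> _ _ [A mA <-] [B mB <-]; exists (A `&` B); first exact: measurableI.
by rewrite !setTI preimage_setI.
Qed.

Context (J : finType) (W : J -> R -> T -> R).

(** The coordinates of all driving noises are treated as one finite family of scalar processes; the
    vector structure reappears only in the loadings. *)
Definition noise_family := (forall j, wiener1 P (W j)) /\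
  mutually_independent P (fun j => sigma_process (W j)).

Hypothesis hW : noise_family.

Definition inc (j : J) (s t : R) (w : T) : R := W j t w - W j s w.

Lemma W_meas j t : 0 <= t -> measurable_fun [set: T] (W j t).
Proof. by case: hW => /(_ j)[+ _ _ _ _] _; exact. Qed.

Lemma inc_meas j s t : 0 <= s -> 0 <= t -> measurable_fun [set: T] (inc j s t).
Proof. by move=> s0 t0; apply: measurable_funB; exact: W_meas. Qed.

Lemma inc_distr j s t : 0 <= s -> s < t -> forall A, measurable A ->
  P (inc j s t @^-1` A) = normal_prob 0 (Num.sqrt (t - s)) A.
Proof. by case: hW => /(_ j)[_ _ _ _ +] _; exact. Qed.

Lemma inc_integral j s t (f : R -> R) : 0 <= s -> s < t ->
  (normal_prob 0 (Num.sqrt (t - s))).-integrable [set: R] (EFin \o f) ->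
  L1 (f \o inc j s t) /\
  Ex (f \o inc j s t) = \int[normal_prob 0 (Num.sqrt (t - s))]_x f x.
Proof.
move=> s0 st If; have mi : @measurable_fun _ _ T (measurableTypeR R) setT (inc j s t) := inc_meas j s0 (ltW (le_lt_trans s0 st)).
pose X : {RV P >-> measurableTypeR R} :=
  MeasurableFun.Pack (MeasurableFun.Class (isMeasurableFun.Build _ _ _ _ _ mi)).
have E (A : set (measurableTypeR R)) : measurable A -> A `<=` setT ->
    distribution P X A = normal_prob 0 (Num.sqrt (t - s)) A.
  by move=> mA _; exact: inc_distr.
have mf : measurable_fun [set: R] f by move/integrableP: If => [/measurable_EFinP].
have LX : L1 (f \o inc j s t).
  apply/integrableP; split.
    by apply/measurable_EFinP; exact: measurableT_comp.
  have /integrableP[_] := If; rewrite -(eq_measure_integral (normal_prob 0 (Num.sqrt (t - s))) E).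
  by rewrite ge0_integral_distribution//; apply/measurable_EFinP; exact: measurableT_comp.
split => //; rewrite /expect /Rintegral -(eq_measure_integral (normal_prob 0 (Num.sqrt (t - s))) E).
by rewrite integral_distribution//; exact/measurable_EFinP.
Qed.

Lemma L1_incX j s t k : 0 <= s -> s < t -> L1 (fun w => inc j s t w ^+ k).
Proof.
move=> s0 st; have st0 : 0 < Num.sqrt (t - s) by rewrite sqrtr_gt0 subr_gt0.
by have [] := @inc_integral j s t (fun x => x ^+ k) s0 st (N_integrable_pow st0 k).
Qed.

Lemma L2_incX j s t k : 0 <= s -> s < t -> L2 (fun w => inc j s t w ^+ k).
Proof.
move=> s0 st; split.
  by apply: measurable_funX; apply: inc_meas => //; rewrite ltW// (le_lt_trans s0).
by under eq_fun do rewrite -exprM; exact: L1_incX.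
Qed.

Lemma L2_inc j s t : 0 <= s -> s < t -> L2 (inc j s t).
Proof. by move=> s0 st; have := @L2_incX j s t 1 s0 st. Qed.

(** The eighth moment serves the fourth moments of quadratic terms that the central limit theorem
    asks for. *)
Lemma Ex_inc j s t : 0 <= s -> s < t ->
  [/\ Ex (inc j s t) = 0, Ex (fun w => inc j s t w ^+ 2) = t - s,
      Ex (fun w => inc j s t w ^+ 3) = 0, Ex (fun w => inc j s t w ^+ 4) = 3 * (t - s) ^+ 2 &
      Ex (fun w => inc j s t w ^+ 8) = 105 * (t - s) ^+ 4].
Proof.
move=> s0 st; have ts : 0 < t - s by rewrite subr_gt0.
have st0 : 0 < Num.sqrt (t - s) by rewrite sqrtr_gt0.
have M k : Ex (fun w => inc j s t w ^+ k)
   = \int[lebesgue_measure]_x (x ^+ k * normal_pdf 0 (Num.sqrt (t - s)) x).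
  rewrite -(normal_moment_density st0).
  by have [_ <-] := @inc_integral j s t (fun x => x ^+ k) s0 st (N_integrable_pow st0 k).
have M1 := normal_moment1 st0; have M0 := normal_moment0 st0.
have sq : Num.sqrt (t - s) ^+ 2 = t - s by rewrite sqr_sqrtr// ltW.
split; first by have := M 1; rewrite M1.
- by rewrite M (normal_momentSS st0) M0 sq; ring.
- by rewrite M (normal_momentSS st0) M1 mulr0.
- by rewrite M !(normal_momentSS st0) M0 sq; ring.
- by rewrite M !(normal_momentSS st0) M0 sq; ring.
Qed.

Section grid.
Context (m : nat) (tt : nat -> R).
Hypothesis tt0 : 0 <= tt 0%N.
Hypothesis ttS : forall i, tt i <= tt i.+1.

Lemma grid_ge0 i : 0 <= tt i.
Proof. by elim: i => // i IH; rewrite (le_trans IH). Qed.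

Definition grid_sys (ij : 'I_m * J) : set (set T) :=
  sigma_rv (inc ij.2 (tt ij.1) (tt ij.1.+1)).

Lemma grid_sysm ij : grid_sys ij `<=` measurable.
Proof. by apply: sigma_rv_meas; apply: inc_meas; exact: grid_ge0. Qed.

Lemma grid_sys_process ij : grid_sys ij `<=` sigma_process (W ij.2).
Proof.
move=> _ [B mB <-].
pose G := \bigcup_(t in [set t : R | 0 <= t]) sigma_rv (W ij.2 t).
have mW t : 0 <= t -> measurable_fun [set: g_sigma_algebraType G] (W ij.2 t).
  by move=> t0 _ C mC; apply: sub_sigma_algebra; exists t => //; exists C.
have := measurable_funB (mW _ (grid_ge0 ij.1.+1)) (mW _ (grid_ge0 ij.1)).
by move=> /(_ measurableT B mB).
Qed.

(** Two layers: independence of the scalar processes splits the intersection over coordinates, and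
    independence of the increments of one Wiener process splits each piece over time steps. *)
Lemma grid_indep : mutually_independent P grid_sys.
Proof.
move=> A FA; case: hW => hw hJ.
have -> : \bigcap_(ij in [set: 'I_m * J]) A ij =
    \bigcap_(j in [set: J]) \bigcap_(i in [set: 'I_m]) A (i, j).
  apply/seteqP; split => x /= Ax; first by move=> j _ i _; exact: Ax.
  by case=> i j _; exact: Ax.
rewrite hJ; last first.
  move=> j.
  pose G := \bigcup_(t in [set t : R | 0 <= t]) sigma_rv (W j t).
  apply: (@fin_bigcap_measurable _ (g_sigma_algebraType G)) => // i _.
  exact: grid_sys_process (FA (i, j)).
transitivity (\prod_(ij : 'I_m * J) P (A (ij.1, ij.2)))%E; last first.
  by apply: eq_big => // -[].
rewrite -(pair_bigA _ (fun i j => P (A (i, j))))/= exchange_big/=.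
apply: eq_bigr => j _; have [_ _ _ hind _] := hw j.
by rewrite (hind m tt)// => i; exact: FA (i, j).
Qed.

Definition grid_block (A : pred ('I_m * J)) := block grid_sys A.

Lemma grid_indep2 (A B : pred ('I_m * J)) (f g : T -> R) :
  (forall i, A i -> ~~ B i) ->
  measurable_fun [set: g_sigma_algebraType (grid_block A)] f ->
  measurable_fun [set: g_sigma_algebraType (grid_block B)] g ->
  indep2 P f g.
Proof.
apply: block_indep2; [exact: grid_sysm| | |exact: grid_indep].
- by move=> i; exact: sigma_rvT.
- by move=> i; exact: sigma_rvI.
Qed.

Lemma grid_block_meas (A : pred ('I_m * J)) (f : T -> R) :
  measurable_fun [set: g_sigma_algebraType (grid_block A)] f ->
  measurable_fun [set: T] f.
Proof. by apply: block_measurable_fun; exact: grid_sysm. Qed.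

Lemma inc_block (A : pred ('I_m * J)) (i : 'I_m) (j : J) : A (i, j) ->
  measurable_fun [set: g_sigma_algebraType (grid_block A)] (inc j (tt i) (tt i.+1)).
Proof.
move=> Aij _ B mB; apply: sub_sigma_algebra; exists (i, j) => //.
by exists B.
Qed.

End grid.

(** The product is regrouped as a product of powers [z a ^+ e a], where [e a] counts the indices
    equal to [a]. Independence factors its mean: an odd multiplicity kills it, two distinct pairs
    give (t - s)^2, and a fourfold index gives 3 (t - s)^2, where all three pairings count. *)
Lemma isserlis s t (i j k l : J) : 0 <= s -> s < t ->
  let z a := inc a s t in
  L1 (fun w => z i w * z j w * z k w * z l w) /\
  Ex (fun w => z i w * z j w * z k w * z l w) = (t - s) ^+ 2 *
   ((i == j)%:R * (k == l)%:R + (i == k)%:R * (j == l)%:R + (i == l)%:R * (j == k)%:R).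
Proof.
move=> s0 st z.
(* A grid with a single step from s to t: the blocks then select coordinates only. *)
pose tt (n : nat) := if n is 0%N then s else t.
have ttS n : tt n <= tt n.+1 by case: n => //=; exact: ltW.
have mz (A : pred J) a : A a -> measurable_fun [set: g_sigma_algebraType
    (grid_block tt (fun ia : 'I_1 * J => A ia.2))] (z a).
  move=> Aa; exact: (@inc_block 1 tt (fun ia => A ia.2) ord0 a).
have ind (A : pred J) (f g : T -> R) :
    measurable_fun [set: g_sigma_algebraType (grid_block tt (fun ia : 'I_1 * J => A ia.2))] f ->
    measurable_fun [set: g_sigma_algebraType (grid_block tt (fun ia : 'I_1 * J => ~~ A ia.2))] g ->
    indep2 P f g.
  by apply: (@grid_indep2 1 tt s0 ttS) => ia; rewrite negbK.
pose e (a : J) : nat := ((i == a) + (j == a) + (k == a) + (l == a))%N.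
have prodE w : z i w * z j w * z k w * z l w = \prod_a z a w ^+ e a.
  have q a : \prod_b z b w ^+ (a == b) = z a w.
    rewrite (bigD1 a)//= eqxx expr1 big1 ?mulr1// => b.
    by rewrite eq_sym => /negbTE ->.
  under eq_bigr do rewrite /e !exprD.
  by rewrite !big_split/= !q.
have H (r : seq J) : uniq r -> L1 (fun w => \prod_(a <- r) z a w ^+ e a) /\
    Ex (fun w => \prod_(a <- r) z a w ^+ e a) = \prod_(a <- r) Ex (fun w => z a w ^+ e a).
  elim: r => [_|a r IH /= /andP[ar ur]].
    under eq_fun do rewrite big_nil; rewrite big_nil.
    by split; [exact: L1_cst|exact: Ex_cst].
  have [L E] := IH ur.
  under eq_fun do rewrite big_cons; rewrite big_cons -E.
  apply: indep2_Ex => //; first exact: L1_incX.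
  apply: (ind (pred1 a)).
    by apply: measurable_funX; apply: mz; rewrite /= eqxx.
  have : {subset r <= predC1 a}.
    by move=> b br; rewrite inE; apply: contraNneq ar => <-.
  elim: r {IH ar ur L E} => [_|b r IH rs].
    have -> : (fun w => \prod_(b <- [::]) z b w ^+ e b) = (fun=> 1).
      by apply/funext => w; rewrite big_nil.
    exact: measurable_cst.
  have -> : (fun w => \prod_(c <- b :: r) z c w ^+ e c)
      = (fun w => z b w ^+ e b * \prod_(c <- r) z c w ^+ e c).
    by apply/funext => w; rewrite big_cons.
  apply: measurable_funM.
    apply: measurable_funX; apply: (mz (fun c => ~~ pred1 a c)).
    by apply: rs; rewrite inE eqxx.
  by apply: IH => c cr; apply: rs; rewrite inE cr orbT.
under eq_fun do rewrite prodE.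
have [L E] := H _ (index_enum_uniq J); split => //; rewrite E {H L E}.
pose h := t - s; pose mu (n : nat) : R := nth 0 [:: 1; 0; h; 0; 3 * h ^+ 2] n.
have e4 a : (e a <= 4)%N.
  by rewrite /e; do 4 case: (_ == a).
have M a : Ex (fun w => z a w ^+ e a) = mu (e a).
  have [E1 E2 E3 E4 _] := Ex_inc a s0 st.
  have := e4 a; case: (e a) => [|[|[|[|[|//]]]]] _ /=.
  - by under eq_fun do rewrite expr0; exact: Ex_cst.
  - by under eq_fun do rewrite expr1; exact: E1.
  - exact: E2.
  - exact: E3.
  - exact: E4.
under eq_bigr do rewrite M.
have Z a : odd (e a) -> \prod_b mu (e b) = 0.
  by rewrite (bigD1 a)//=; have := e4 a; case: (e a) => [|[|[|[|[|//]]]]] _ //= _; rewrite mul0r.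
have two a b : a != b -> e a = 2 -> e b = 2 -> (forall c, c != a -> c != b -> e c = 0%N) ->
    \prod_b mu (e b) = h ^+ 2.
  move=> ab ea eb ec; rewrite (bigD1 a)//= (bigD1 b) 1?eq_sym//= ea eb big1 ?mulr1//.
  by move=> c /andP[ca cb]; rewrite ec.
have nE (a b : J) : a != b -> ((a == b) = false) * ((b == a) = false).
  by move=> ab; rewrite (eq_sym b) (negbTE ab).
have [ij|/nE ij] := eqVneq i j.
  have [kl|/nE kl] := eqVneq k l; last first.
    rewrite (Z k).
      by rewrite -ij; case: (eqVneq i k) => [E|_]; rewrite ?E ?kl ?mulr0 ?mul0r ?addr0 ?mulr0.
    by rewrite /e -ij eqxx kl; case: (i == k).
  rewrite -ij -kl; have [ik|ik] := eqVneq i k.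
    rewrite (bigD1 i)//= big1 => [|b bi]; last first.
      by rewrite /e -ij -kl -ik eq_sym (negbTE bi).
    by rewrite /e -ij -kl -ik eqxx /mu /= /h /=; ring.
  rewrite (two _ _ ik); first by rewrite /h /=; ring.
  - by rewrite /e -ij -kl !eqxx !(nE _ _ ik).
  - by rewrite /e -ij -kl !eqxx !(nE _ _ ik).
  - by move=> c /nE ci /nE ck; rewrite /e -ij -kl ci ck.
have [kl|/nE kl] := eqVneq k l.
  rewrite (Z i).
    by rewrite -kl; case: (eqVneq i k) => [E|_]; rewrite -?E ?ij ?mulr0 ?mul0r ?addr0 ?mulr0.
  by rewrite /e -kl eqxx ij; case: (k == i).
have [ik|/nE ik] := eqVneq i k.
  have [jl|/nE jl] := eqVneq j l; last first.
    rewrite (Z j); first by rewrite -ik ij /=; ring.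
    by rewrite /e -ik eqxx ij jl.
  rewrite (two i j); first by rewrite -ik -jl !ij /h /=; ring.
  - by rewrite eq_sym ij.
  - by rewrite /e -ik -jl eqxx ij.
  - by rewrite /e -ik -jl eqxx ij.
  - by move=> c /nE ci /nE ck; rewrite /e -ik -jl ci ck.
have [il|/nE il] := eqVneq i l.
  have [jk|/nE jk] := eqVneq j k; last first.
    rewrite (Z j); first by rewrite /=; ring.
    by rewrite /e -il eqxx ij jk.
  rewrite (two i j); first by rewrite /h /=; ring.
  - by rewrite eq_sym ij.
  - by rewrite /e -il -jk eqxx ij.
  - by rewrite /e -il -jk eqxx ij.
  - by move=> c /nE ci /nE ck; rewrite /e -il -jk ci ck.
rewrite (Z i); first by rewrite /=; ring.
by rewrite /e eqxx ij ik il.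
Qed.

End noise.

(** * The four noises as one family of scalar Wiener processes *)

Section stacked_noise.
Context d (T : measurableType d) (R : realType) (P : probability T R).
Context (r1 r2 r3 r4 : nat).
Context (W1 : R -> T -> 'cV[R]_r1) (W2 : R -> T -> 'cV[R]_r2)
        (W3 : R -> T -> 'cV[R]_r3) (W4 : R -> T -> 'cV[R]_r4).

Definition stacked_index : finType := (('I_r1 + 'I_r2) + ('I_r3 + 'I_r4))%type.

Definition stacked_noise (j : stacked_index) (t : R) (w : T) : R :=
  match j with
  | inl (inl i) => W1 t w i 0 | inl (inr i) => W2 t w i 0
  | inr (inl i) => W3 t w i 0 | inr (inr i) => W4 t w i 0
  end.

Lemma sigma_process_vprocess (r : nat) (W : R -> T -> 'cV[R]_r) (A : 'I_r -> set T) :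
  (forall i, sigma_process (fun t w => W t w i 0) (A i)) ->
  sigma_vprocess W (\bigcap_(i in [set: 'I_r]) A i).
Proof.
move=> HA; pose G := \bigcup_(tj in [set tj : R * 'I_r | 0 <= tj.1])
        sigma_rv (fun w => W tj.1 w tj.2 0).
apply: (@fin_bigcap_measurable _ (g_sigma_algebraType G)) => // i _.
have := HA i; apply: smallest_sub; first exact: smallest_sigma_algebra.
by move=> X [t t0 tX]; apply: sub_sigma_algebra; exists (t, i).
Qed.

Lemma stacked_noise_family : wiener P W1 -> wiener P W2 -> wiener P W3 -> wiener P W4 ->
  mutually_independent P (fun i : 'I_4 =>
          nth set0 [:: sigma_vprocess W1; sigma_vprocess W2;
                       sigma_vprocess W3; sigma_vprocess W4] i) ->
  noise_family P stacked_noise.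
Proof.
move=> [w1 i1] [w2 i2] [w3 i3] [w4 i4] hW; split.
  by case=> [[j|j]|[j|j]]; [exact: w1|exact: w2|exact: w3|exact: w4].
move=> A FA.
pose B (k : nat) : set T := nth set0
  [:: \bigcap_(i in [set: 'I_r1]) A (inl (inl i)); \bigcap_(i in [set: 'I_r2]) A (inl (inr i));
      \bigcap_(i in [set: 'I_r3]) A (inr (inl i)); \bigcap_(i in [set: 'I_r4]) A (inr (inr i))] k.
have -> : \bigcap_(j in [set: stacked_index]) A j = \bigcap_(k in [set: 'I_4]) B k.
  apply/seteqP; split => x /= Ax.
    by case=> [[|[|[|[|//]]]]] ? _ i _; exact: Ax.
  case=> [[i|i]|[i|i]] _.
  - exact: (Ax (@Ordinal 4 0 isT) Logic.I i).
  - exact: (Ax (@Ordinal 4 1 isT) Logic.I i).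
  - exact: (Ax (@Ordinal 4 2 isT) Logic.I i).
  - exact: (Ax (@Ordinal 4 3 isT) Logic.I i).
rewrite (hW (fun k : 'I_4 => B k)); last first.
  case=> [[|[|[|[|//]]]]] ?; apply: sigma_process_vprocess => i.
  - exact: FA (inl (inl i)).
  - exact: FA (inl (inr i)).
  - exact: FA (inr (inl i)).
  - exact: FA (inr (inr i)).
rewrite !big_ord_recl big_ord0 mule1 /B /=.
transitivity (\prod_(j : stacked_index) P (A j))%E; last by [].
rewrite big_sumType/= !big_sumType/= i1; last by move=> i; exact: FA (inl (inl i)).
rewrite i2; last by move=> i; exact: FA (inl (inr i)).
rewrite i3; last by move=> i; exact: FA (inr (inl i)).
rewrite i4; last by move=> i; exact: FA (inr (inr i)).
by rewrite !muleA.
Qed.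

End stacked_noise.

(** * A central limit theorem through characteristic functions *)

Section trigonometric_bounds.
Context (R : realType).
Implicit Types x y : R.

(** The intermediate point is kept because [1 - cos c] is quadratic in x, which is where the cubic
    bound on [sin x - x] comes from. None of the constants below is meant to be sharp. *)
Lemma sin_cos_MVT x : exists2 c, `|c| <= `|x| & sin x = x * cos c.
Proof.
have dsin a b : forall y, y \in `]a, b[ -> is_derive y 1 (@sin R) (cos y).
  by move=> y _; exact: is_derive_sin.
have csin a b : {within `[a, b], continuous (@sin R)}.
  exact/continuous_subspaceT/continuous_sin.
have [x0|x0|->] := ltgtP x 0; last by exists 0; rewrite // sin0 mul0r.
- have [c /[!in_itv]/= /andP[xc c0] E] := MVT x0 (dsin x 0) (csin x 0).
  exists c; first by rewrite !ltr0_norm// lerNl opprK ltW.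
  by move: E; rewrite sin0 !sub0r mulrN mulrC => /oppr_inj.
- have [c /[!in_itv]/= /andP[xc c0] E] := MVT x0 (dsin 0 x) (csin 0 x).
  exists c; first by rewrite !gtr0_norm// ltW.
  by move: E; rewrite sin0 !subr0 mulrC.
Qed.

Lemma norm_sin_le x : `|sin x| <= `|x|.
Proof.
have [c _ ->] := sin_cos_MVT x; rewrite normrM ler_piMr//.
by rewrite ler_norml cos_geN1 cos_le1.
Qed.

Lemma one_sub_cosE x : 1 - cos x = 2 * sin (x / 2) ^+ 2.
Proof.
have -> : cos x = cos (x / 2 + x / 2) by congr cos; field.
by have := cos2Dsin2 (x / 2); rewrite cosD; lra.
Qed.

Lemma one_sub_cos_le x : 0 <= 1 - cos x <= x ^+ 2 / 2.
Proof.
rewrite subr_ge0 cos_le1/= one_sub_cosE.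
have : sin (x / 2) ^+ 2 <= (x / 2) ^+ 2.
  rewrite -[leLHS]real_normK ?num_real// -[leRHS]real_normK ?num_real//.
  by rewrite lerXn2r ?nnegrE ?norm_sin_le.
by move: (sin _ ^+ 2) => s; rewrite expr_div_n; lra.
Qed.

Lemma norm_sin_sub_le x : `|sin x - x| <= `|x| ^+ 3 / 2.
Proof.
have [c cx ->] := sin_cos_MVT x; rewrite -{2}(mulr1 x) -mulrBr normrM exprS -mulrA.
rewrite ler_wpM2l// distrC; have /andP[c0 c1] := one_sub_cos_le c.
rewrite ger0_norm// (le_trans c1)// ler_pM2r ?invr_gt0//.
by rewrite -[leLHS]real_normK ?num_real// lerXn2r ?nnegrE.
Qed.

Lemma norm_cos_sub_le x : `|cos x - (1 - x ^+ 2 / 2)| <= x ^+ 4.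
Proof.
have -> : cos x - (1 - x ^+ 2 / 2) = 2 * ((x / 2 - sin (x / 2)) * (x / 2 + sin (x / 2))).
  have -> : cos x = 1 - (1 - cos x) by ring.
  by rewrite one_sub_cosE; field.
have A := norm_sin_sub_le (x / 2); have B := norm_sin_le (x / 2).
rewrite !normrM [`|2|]ger0_norm//.
have C : `|x / 2 + sin (x / 2)| <= 2 * `|x / 2|.
  by rewrite (le_trans (ler_normD _ _))// mulr_natl mulr2n lerD2l.
have -> : x ^+ 4 = `|x| ^+ 4 by rewrite -normrX ger0_norm// exprn_even_ge0.
have D : `|x / 2| = `|x| / 2 by rewrite normrM [`|2^-1|]ger0_norm.
rewrite D in A B C.
rewrite distrC in A.
have N : 0 <= `|x| by [].
have := ler_pM (normr_ge0 _) (normr_ge0 _) A C.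
set p := _ * `|_ + _|; move: N; move: `|x| => t t0 H.
have : 0 <= t ^+ 4 by rewrite exprn_ge0.
nra.
Qed.

(** The exponential lies between 1 - x and 1 / (1 + x). *)
Lemma expRN_bound x : 0 <= x -> `|expR (- x) - (1 - x)| <= x ^+ 2.
Proof.
move=> x0; have A := expR_ge1Dx (- x); have B := expR_ge1Dx x.
rewrite ger0_norm ?subr_ge0//.
have C : expR (- x) <= (1 + x)^-1.
  rewrite expRN lef_pV2 ?posrE ?expR_gt0//; lra.
have x1 : 0 < 1 + x by lra.
have D : (1 + x)^-1 - (1 - x) <= x ^+ 2.
  have -> : (1 + x)^-1 - (1 - x) = x ^+ 2 * (1 + x)^-1 by field; rewrite gt_eqF.
  by rewrite ler_piMr ?sqr_ge0// invf_le1//; lra.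
lra.
Qed.

Lemma norm_cosB_le x y : `|cos x - cos y| <= `|x - y|.
Proof.
have -> : cos x - cos y = - (2 * sin ((x + y) / 2) * sin ((x - y) / 2)).
  have -> : cos x = cos ((x + y) / 2 + (x - y) / 2) by congr cos; field.
  have -> : cos y = cos ((x + y) / 2 - (x - y) / 2) by congr cos; field.
  by rewrite cosB cosD; ring.
rewrite normrN !normrM [`|2|]ger0_norm//.
have := norm_sin_le ((x - y) / 2); rewrite normrM [`|2^-1|]ger0_norm//.
have : `|sin ((x + y) / 2)| <= 1 by rewrite ler_norml sin_geN1 sin_le1.
have := normr_ge0 (sin ((x + y) / 2)); have := normr_ge0 (sin ((x - y) / 2)).
nra.
Qed.

End trigonometric_bounds.

(** * Characteristic functions of sums of independent variables *)

Section clt.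
Context d (T : measurableType d) (R : realType) (P : probability T R).
Local Notation Ex := (expect P).
Local Notation L1 := (L1 P).
Local Notation L2 := (L2 P).

Lemma indep2_comp (f g : T -> R) (u v : R -> R) : indep2 P f g ->
  measurable_fun [set: R] u -> measurable_fun [set: R] v -> indep2 P (u \o f) (v \o g).
Proof.
move=> fg mu mv A B mA mB; apply: (fg (u @^-1` A) (v @^-1` B)).
  by rewrite -[X in measurable X]setTI; exact: mu.
by rewrite -[X in measurable X]setTI; exact: mv.
Qed.

Let mcos : measurable_fun [set: R] (@cos R).
Proof. apply: continuous_measurable_fun => x; exact: continuous_cos. Qed.
Let msin : measurable_fun [set: R] (@sin R).
Proof. apply: continuous_measurable_fun => x; exact: continuous_sin. Qed.

Lemma L1_cos (f : T -> R) : measurable_fun [set: T] f -> L1 (fun w => cos (f w)).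
Proof.
move=> mf; apply: (@L1_bnd _ _ _ _ _ 1); first exact: (measurableT_comp mcos).
by move=> w; rewrite ler_norml cos_geN1 cos_le1.
Qed.

Lemma L1_sin (f : T -> R) : measurable_fun [set: T] f -> L1 (fun w => sin (f w)).
Proof.
move=> mf; apply: (@L1_bnd _ _ _ _ _ 1); first exact: (measurableT_comp msin).
by move=> w; rewrite ler_norml sin_geN1 sin_le1.
Qed.

Lemma norm_Ex_le1 (f : T -> R) : L1 f -> (forall w, `|f w| <= 1) -> `|Ex f| <= 1.
Proof.
move=> Lf f1; rewrite (le_trans (Ex_norm Lf))// -[leRHS](Ex_cst P 1).
by apply: Ex_le => //; [exact: L1_norm|exact: L1_cst].
Qed.

(* Real and imaginary parts of characteristic functions are carried separately,
   since the library integral is real-valued. *)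
Lemma cf_sum (x : nat -> T -> R) (c : nat -> R) (e : R) (n : nat) :
  (forall i, (i < n)%N -> measurable_fun [set: T] (x i)) ->
  (forall k, (k < n)%N -> indep2 P (fun w => \sum_(0 <= i < k) x i w) (x k)) ->
  (forall i, (i < n)%N -> 0 <= c i <= 1) ->
  (forall i, (i < n)%N -> `|Ex (fun w => cos (x i w)) - c i| <= e) ->
  (forall i, (i < n)%N -> `|Ex (fun w => sin (x i w))| <= e) ->
  `|Ex (fun w => cos (\sum_(0 <= i < n) x i w)) - \prod_(0 <= i < n) c i| <= 2 * n%:R * e /\
  `|Ex (fun w => sin (\sum_(0 <= i < n) x i w))| <= 2 * n%:R * e.
Proof.
elim: n => [|n IH] mx ind c01 hc hs.
  under eq_fun do rewrite big_geq// cos0; under [in X in _ /\ X]eq_fun do rewrite big_geq// sin0.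
  by rewrite !Ex_cst big_geq// subrr normr0 mulr0 mul0r.
have ltS i : (i < n)%N -> (i < n.+1)%N by move=> /ltnW.
have [A B] := IH (fun i h => mx i (ltS i h)) (fun i h => ind i (ltS i h))
  (fun i h => c01 i (ltS i h)) (fun i h => hc i (ltS i h)) (fun i h => hs i (ltS i h)).
pose S w := \sum_(0 <= i < n) x i w.
have mS : measurable_fun [set: T] S.
  have -> : S = (fun w => \sum_(i < n) x i w) by apply/funext => w; rewrite /S big_mkord.
  by apply: measurable_sum => i; apply: mx; exact: ltS.
have mxn := mx n (ltnSn n).
have prod (u v : R -> R) : measurable_fun setT u -> measurable_fun setT v ->
    (forall y, `|u y| <= 1) -> (forall y, `|v y| <= 1) ->
    L1 (fun w => u (S w) * v (x n w)) /\
    Ex (fun w => u (S w) * v (x n w)) = Ex (fun w => u (S w)) * Ex (fun w => v (x n w)).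
  move=> mu mv u1 v1; apply: indep2_Ex.
  - by apply: (@L1_bnd _ _ _ _ _ 1) => //; exact: measurableT_comp.
  - by apply: (@L1_bnd _ _ _ _ _ 1) => //; exact: measurableT_comp.
  - exact: (indep2_comp (ind n (ltnSn n)) mu mv).
have c1 y : `|cos y| <= (1 : R) by rewrite ler_norml cos_geN1 cos_le1.
have s1 y : `|sin y| <= (1 : R) by rewrite ler_norml sin_geN1 sin_le1.
have [Lcc Ecc] := prod _ _ mcos mcos c1 c1.
have [Lss Ess] := prod _ _ msin msin s1 s1.
have [Lcs Ecs] := prod _ _ mcos msin c1 s1.
have [Lsc Esc] := prod _ _ msin mcos s1 c1.
have -> : (fun w => cos (\sum_(0 <= i < n.+1) x i w))
   = (fun w => cos (S w) * cos (x n w) - sin (S w) * sin (x n w)).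
  by apply/funext => w; rewrite big_nat_recr//= cosD.
have -> : (fun w => sin (\sum_(0 <= i < n.+1) x i w))
   = (fun w => sin (S w) * cos (x n w) + cos (S w) * sin (x n w)).
  by apply/funext => w; rewrite big_nat_recr//= sinD.
rewrite ExB// ExD// Ecc Ess Ecs Esc big_nat_recr//=.
have a1 := norm_Ex_le1 (L1_cos mS) (fun w => c1 (S w)).
have b1 := norm_Ex_le1 (L1_sin mS) (fun w => s1 (S w)).
have d1 := norm_Ex_le1 (L1_cos mxn) (fun w => c1 (x n w)).
have := hc n (ltnSn n); have := hs n (ltnSn n); have := c01 n (ltnSn n).
move: (\prod_(0 <= i < n) c i) A B a1 b1 d1 => p.
have -> : n.+1%:R = n%:R + 1 :> R by rewrite natr1.
set a := Ex (fun w => cos (S w)); set b := Ex (fun w => sin (S w)).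
set g := Ex (fun w => cos (x n w)); set h := Ex (fun w => sin (x n w)).
move: (c n) => q; have [r rE] : exists r, 2 * n%:R * e = r by eexists.
rewrite rE => A B a1 b1 d1 /andP[q0 q1] hh hg.
have -> : 2 * (n%:R + 1) * e = r + 2 * e by rewrite -rE; ring.
have e0 : 0 <= e by rewrite (le_trans _ hh).
have M1 (x' y' z : R) : `|x'| <= 1 -> `|y'| <= z -> `|x' * y'| <= z.
  by move=> hx hy; rewrite normrM (le_trans _ hy)// ler_piMl.
have qn : `|q| <= 1 by rewrite ger0_norm.
split.
  (* All other factors being bounded by 1, a new summand costs [e] for its real part and [e] for its
     imaginary part, whence the factor 2 in the bound. *)
  have -> : a * g - b * h - p * q = a * (g - q) + q * (a - p) - b * h by ring.
  have := ler_normB (a * (g - q) + q * (a - p)) (b * h).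
  have := ler_normD (a * (g - q)) (q * (a - p)).
  have := M1 _ _ _ a1 hg; have := M1 _ _ _ qn A; have := M1 _ _ _ b1 hh; lra.
have := ler_normD (b * g) (a * h); rewrite [b * g]mulrC.
have := M1 _ _ _ d1 B; have := M1 _ _ _ a1 hh; lra.
Qed.

Lemma cvg_invsqrtn : (Num.sqrt n%:R)^-1 @[n --> \oo] --> (0 : R).
Proof.
have H : (Num.sqrt (n%:R^-1 : R)) @[n --> \oo] --> Num.sqrt (0 : R).
  apply: (cvg_comp _ (@Num.sqrt R) _ (@sqrt_continuous R 0)).
  by rewrite -(cvg_shiftS (fun n : nat => (n%:R^-1 : R))); exact: cvg_harmonic.
rewrite sqrtr0 in H.
suff -> : (fun n : nat => (Num.sqrt n%:R : R)^-1) = (fun n => Num.sqrt (n%:R^-1)) by [].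
by apply/funext => n; rewrite sqrtrV.
Qed.

(** Lyapunov's theorem for a triangular array, since the sampling step changes with n. At frequency
    a = u / sqrt n each summand has characteristic function exp (- a^2 v / 2) up to O(|a|^3), and n
    such errors are O(1 / sqrt n). *)
Lemma clt (y : nat -> nat -> T -> R) (v C : R) :
  (forall n i, (i < n)%N -> measurable_fun [set: T] (y n i)) ->
  (forall n i, (i < n)%N -> L1 (fun w => y n i w ^+ 4)) ->
  (forall n i, (i < n)%N -> Ex (y n i) = 0) ->
  (forall n i, (i < n)%N -> Ex (fun w => y n i w ^+ 2) = v) ->
  (forall n i, (i < n)%N -> Ex (fun w => y n i w ^+ 4) <= C) ->
  (forall n k, (k < n)%N -> indep2 P (fun w => \sum_(0 <= i < k) y n i w) (y n k)) ->
  forall u : R,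
  Ex (fun w => cos (u * ((Num.sqrt n%:R)^-1 * \sum_(0 <= i < n) y n i w))) @[n --> \oo]
    --> expR (- (u ^+ 2 * v / 2)) /\
  Ex (fun w => sin (u * ((Num.sqrt n%:R)^-1 * \sum_(0 <= i < n) y n i w))) @[n --> \oo]
    --> (0 : R).
Proof.
move=> my L4 E1 E2 E4 ind u.
pose a (n : nat) : R := u * (Num.sqrt n%:R)^-1.
(* The error of one summand: the fourth power comes from the cosine and the exponential, the third
   from the sine. *)
pose e (n : nat) : R := a n ^+ 4 * (C + v ^+ 2) + `|a n| ^+ 3 * (v + C).
have key (n : nat) : (0 < n)%N ->
    `|Ex (fun w => cos (\sum_(0 <= i < n) a n * y n i w)) - expR (- (u ^+ 2 * v / 2))| <= 2 * n%:R * e n /\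
    `|Ex (fun w => sin (\sum_(0 <= i < n) a n * y n i w))| <= 2 * n%:R * e n.
  move=> n0; pose c := expR (- (a n ^+ 2 * v / 2)).
  have v0 : 0 <= v by rewrite -(E2 n 0%N n0) Ex_ge0// => w; exact: sqr_ge0.
  have C0 : 0 <= C.
    by rewrite (le_trans _ (E4 n 0%N n0))// Ex_ge0// => w; exact: exprn_even_ge0.
  have nr : (n%:R : R) != 0 by rewrite pnatr_eq0 -lt0n.
  have an2 : a n ^+ 2 = u ^+ 2 / n%:R by rewrite /a exprMn exprVn sqr_sqrtr.
  have -> : expR (- (u ^+ 2 * v / 2)) = \prod_(0 <= i < n) c.
    rewrite prodr_const_nat subn0 /c -expRM_natl an2; congr expR.
    by rewrite -mulr_natl; field.
  have av0 : 0 <= a n ^+ 2 * v / 2 by rewrite divr_ge0// mulr_ge0// sqr_ge0.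
  apply: cf_sum => [i li|k lk|i li|i li|i li].
  - by apply: measurable_funM => //; exact: my.
  - have -> : (fun w => \sum_(0 <= i < k) a n * y n i w)
        = (fun r => a n * r) \o (fun w => \sum_(0 <= i < k) y n i w).
      by apply/funext => w /=; rewrite mulr_sumr.
    by apply: (indep2_comp (u := fun r => a n * r) (v := fun r => a n * r) (ind n k lk)); exact: measurable_funM.
  - by rewrite expR_ge0 /c -[leRHS]expR0 ler_expR oppr_le0.
  - have m := my n i li.
    have L2y : L1 (fun w => y n i w ^+ 2).
      apply: (@L1_dom _ _ _ _ _ (fun w => 1 + y n i w ^+ 4)).
      + exact: measurable_funX.
      + by apply: L1D; [exact: L1_cst|exact: L4].
      + move=> w; rewrite ger0_norm ?sqr_ge0//.
        have -> : y n i w ^+ 4 = (y n i w ^+ 2) ^+ 2 by rewrite -exprM.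
        by have := sqr_ge0 (y n i w ^+ 2 - 1); have := sqr_ge0 (y n i w); nra.
    have mx : measurable_fun [set: T] (fun w => a n * y n i w) by apply: measurable_funM.
    have L := L1_cos mx.
    pose q w := 1 - a n ^+ 2 / 2 * y n i w ^+ 2.
    have Lq : L1 q by apply: L1B; [exact: L1_cst|exact: L1Z].
    have -> : Ex (fun w => cos (a n * y n i w)) - c
        = Ex (fun w => cos (a n * y n i w) - q w) - (c - (1 - a n ^+ 2 * v / 2)).
      rewrite ExB// /q ExB ?ExZ ?Ex_cst ?E2//; [ring|exact: L1_cst|exact: L1Z].
    have B1 : `|Ex (fun w => cos (a n * y n i w) - q w)| <= a n ^+ 4 * C.
      rewrite (le_trans (Ex_norm (L1B L Lq)))//.
      apply: le_trans (_ : Ex (fun w => a n ^+ 4 * y n i w ^+ 4) <= _).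
        apply: Ex_le; [exact/L1_norm/L1B|apply: L1Z; exact: L4|move=> w].
        have := norm_cos_sub_le (a n * y n i w); rewrite /q [(a n * _) ^+ 2]exprMn [(a n * _) ^+ 4]exprMn.
        by have -> : a n ^+ 2 * y n i w ^+ 2 / 2 = a n ^+ 2 / 2 * y n i w ^+ 2 by ring.
      by rewrite ExZ; [rewrite ler_wpM2l ?exprn_even_ge0 ?E4|exact: L4].
    have B2 := expRN_bound av0; rewrite (le_trans (ler_normB _ _))//.
    rewrite (le_trans (lerD B1 B2))// /e.
    have : 0 <= `|a n| ^+ 3 * (v + C) by rewrite mulr_ge0 ?exprn_ge0// addr_ge0.
    have : 0 <= a n ^+ 4 * v ^+ 2 by rewrite mulr_ge0 ?sqr_ge0// exprn_even_ge0.
    have -> : (a n ^+ 2 * v / 2) ^+ 2 = a n ^+ 4 * v ^+ 2 / 4 by field.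
    by lra.
  - have m := my n i li.
    have L2y : L1 (fun w => y n i w ^+ 2).
      apply: (@L1_dom _ _ _ _ _ (fun w => 1 + y n i w ^+ 4)).
      + exact: measurable_funX.
      + by apply: L1D; [exact: L1_cst|exact: L4].
      + move=> w; rewrite ger0_norm ?sqr_ge0//.
        have -> : y n i w ^+ 4 = (y n i w ^+ 2) ^+ 2 by rewrite -exprM.
        by have := sqr_ge0 (y n i w ^+ 2 - 1); have := sqr_ge0 (y n i w); nra.
    have mx : measurable_fun [set: T] (fun w => a n * y n i w) by apply: measurable_funM.
    have L := L1_sin mx.
    have Ly : L1 (y n i) by apply: L2_L1; split.
    have -> : Ex (fun w => sin (a n * y n i w))
        = Ex (fun w => sin (a n * y n i w) - a n * y n i w).
      by rewrite ExB// ?ExZ ?E1// ?mulr0 ?subr0//; exact: L1Z.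
    have Lq : L1 (fun w => a n * y n i w) by exact: L1Z.
    rewrite (le_trans (Ex_norm (L1B L Lq)))//.
    (* The third absolute moment is avoided through 2 |y|^3 <= y^2 + y^4. *)
    apply: (@le_trans _ _ (Ex (fun w => `|a n| ^+ 3 / 4 * (y n i w ^+ 2 + y n i w ^+ 4)))).
      apply: Ex_le; [exact/L1_norm/L1B|apply: L1Z; apply: L1D => //; exact: L4|move=> w].
      have := norm_sin_sub_le (a n * y n i w); rewrite normrM exprMn.
      have -> : y n i w ^+ 4 = `|y n i w| ^+ 4 by rewrite -normrX ger0_norm// exprn_even_ge0.
      have -> : y n i w ^+ 2 = `|y n i w| ^+ 2 by rewrite -normrX ger0_norm// sqr_ge0.
      move: (sin _ - _) (`|y n i w|) (normr_ge0 (y n i w)) => z r r0 H.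
      apply: (le_trans H); have := mulr_ge0 (exprn_ge0 3 (normr_ge0 (a n))) (mulr_ge0 (sqr_ge0 r) (sqr_ge0 (r - 1))).
      by move: (`|a n| ^+ 3) => b; lra.
    rewrite ExZ ?ExD ?E2//; [|exact: L4|apply: L1D => //; exact: L4].
    rewrite /e; have := E4 n i li; move: (Ex _) => z zC.
    have A3 : 0 <= `|a n| ^+ 3 by exact: exprn_ge0.
    have : 0 <= a n ^+ 4 * (C + v ^+ 2) by rewrite mulr_ge0 ?exprn_even_ge0// addr_ge0 ?sqr_ge0.
    by nra.
have e0 : 2 * n%:R * e n @[n --> \oo] --> (0 : R).
  have S := cvg_invsqrtn.
  have E : \forall n \near \oo, 2 * u ^+ 4 * (C + v ^+ 2) * ((Num.sqrt n%:R)^-1 * (Num.sqrt n%:R)^-1)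
      + 2 * `|u| ^+ 3 * (v + C) * (Num.sqrt n%:R)^-1 = 2 * n%:R * e n.
    near=> n; have n0 : (0 < n)%N by near: n; exact: nbhs_infty_gt.
    have s0 : Num.sqrt (n%:R : R) != 0 by rewrite gt_eqF// sqrtr_gt0 ltr0n.
    rewrite /e /a normrM [`|(_)^-1|]ger0_norm// !exprMn.
    have -> : 2 * n%:R = 2 * Num.sqrt (n%:R : R) ^+ 2 by rewrite sqr_sqrtr.
    by move: (Num.sqrt _) s0 => s s0; field.
  apply: cvg_trans (near_eq_cvg E) _.
  have Z : 0 = 2 * u ^+ 4 * (C + v ^+ 2) * (0 * 0) + 2 * `|u| ^+ 3 * (v + C) * 0 :> R.
    by rewrite !mulr0 addr0.
  rewrite Z; apply: cvgD; apply: cvgM => //; try exact: cvg_cst.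
  exact: cvgM.
have aE n w : u * ((Num.sqrt n%:R)^-1 * \sum_(0 <= i < n) y n i w)
    = \sum_(0 <= i < n) a n * y n i w by rewrite mulrA mulr_sumr.
split.
- apply/cvgrPdist_le => eps eps0; near=> n.
  under eq_fun do rewrite aE.
  rewrite distrC (le_trans (key n _).1)//; first by near: n; exact: nbhs_infty_gt.
  rewrite (le_trans (ler_norm _))//; near: n.
  by have /cvgrPdist_le/(_ _ eps0) := e0; under eq_near do rewrite sub0r normrN.
- apply/cvgrPdist_le => eps eps0; near=> n.
  under eq_fun do rewrite aE.
  rewrite sub0r normrN (le_trans (key n _).2)//; first by near: n; exact: nbhs_infty_gt.
  rewrite (le_trans (ler_norm _))//; near: n.
  by have /cvgrPdist_le/(_ _ eps0) := e0; under eq_near do rewrite sub0r normrN.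
Unshelve. all: by end_near.
Qed.

(** The increment is cut into n equal pieces, each multiplied by sqrt n. Their normalized sum is the
    increment itself for every n > 0, so its characteristic function is a constant sequence and
    equals the limit in [clt]. *)
Lemma cf_inc (J : finType) (W : J -> R -> T -> R) (hW : noise_family P W) (j : J)
    (s t u : R) : 0 <= s -> s < t ->
  Ex (fun w => cos (u * inc W j s t w)) = expR (- (u ^+ 2 * (t - s) / 2)) /\
  Ex (fun w => sin (u * inc W j s t w)) = 0.
Proof.
move=> s0 st; have ts : 0 < t - s by rewrite subr_gt0.
pose tt (n i : nat) : R := s + i%:R * ((t - s) / n%:R).
pose y (n i : nat) w := Num.sqrt n%:R * inc W j (tt n i) (tt n i.+1) w.
have dt n : (0 < n)%N -> 0 < (t - s) / n%:R by move=> n0; rewrite divr_gt0// ltr0n.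
have ttS n i : tt n i.+1 - tt n i = (t - s) / n%:R by rewrite /tt -natr1; ring.
have tt0 n i : 0 <= tt n i by rewrite addr_ge0// mulr_ge0// divr_ge0// ltW.
have ttlt n i : (i < n)%N -> tt n i < tt n i.+1.
  by move=> li; rewrite -subr_gt0 ttS dt// (leq_ltn_trans _ li).
have sq n : Num.sqrt (n%:R : R) ^+ 2 = n%:R by rewrite sqr_sqrtr.
have sq4 n : Num.sqrt (n%:R : R) ^+ 4 = n%:R ^+ 2 by rewrite -[in RHS](sq n) -exprM.
have [||||||H1 H2] := @clt y (t - s) (3 * (t - s) ^+ 2) _ _ _ _ _ _ u.
- by move=> n i li; apply: measurable_funM => //; apply: (inc_meas hW).
- move=> n i li; under eq_fun do rewrite exprMn.
  by apply: L1Z; apply: (L1_incX hW) => //; exact: ttlt.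
- move=> n i li; have [E _ _ _ _] := Ex_inc hW j (tt0 n i) (ttlt n i li).
  by rewrite ExZ ?E ?mulr0//; apply: L2_L1; apply: (L2_inc hW) => //; exact: ttlt.
- move=> n i li; have [_ E _ _ _] := Ex_inc hW j (tt0 n i) (ttlt n i li).
  under eq_fun do rewrite exprMn sq.
  rewrite ExZ ?E ?ttS; last by apply: (L1_incX hW) => //; exact: ttlt.
  by field; rewrite pnatr_eq0 -lt0n (leq_ltn_trans _ li).
- move=> n i li; have [_ _ _ E _] := Ex_inc hW j (tt0 n i) (ttlt n i li).
  under eq_fun do rewrite exprMn sq4.
  rewrite ExZ ?E ?ttS; last by apply: (L1_incX hW) => //; exact: ttlt.
  rewrite le_eqVlt; apply/orP; left; apply/eqP.
  by field; rewrite pnatr_eq0 -lt0n (leq_ltn_trans _ li).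
- move=> n k lk; have tm i : tt n i <= tt n i.+1.
    by rewrite -subr_ge0 ttS ltW// dt// (leq_ltn_trans _ lk).
  pose A (ij : 'I_n * J) := (ij.1 < k)%N.
  pose B (ij : 'I_n * J) := (ij.1 == k :> nat).
  apply: (grid_indep2 hW (tt0 n 0%N) tm (A := A) (B := B)).
  + by move=> ij; rewrite /A /B => /ltn_eqF ->.
  + have -> : (fun w => \sum_(0 <= i < k) y n i w) = (fun w => \sum_(i < k) y n i w).
      by apply/funext => w; rewrite big_mkord.
    apply: measurable_sum => i; apply: measurable_funM => //.
    by apply: (@inc_block _ _ _ _ _ n (tt n) A (Ordinal (ltn_trans (ltn_ord i) lk)) j); rewrite /A /=; exact: ltn_ord.
  + apply: measurable_funM => //.
    by apply: (@inc_block _ _ _ _ _ n (tt n) B (Ordinal lk) j); rewrite /B /=.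
have tel n w : (0 < n)%N -> u * ((Num.sqrt n%:R)^-1 * \sum_(0 <= i < n) y n i w)
    = u * inc W j s t w.
  move=> n0; congr (_ * _).
  rewrite -mulr_sumr mulKf; last by rewrite gt_eqF// sqrtr_gt0 ltr0n.
  rewrite /inc (@telescope_sumr_eq _ _ _ (fun i => W j (tt n i) w))//.
  by rewrite /tt mul0r addr0 mulrC divfK ?subrKC// pnatr_eq0 -lt0n.
split.
- apply: (cvg_unique _ _ H1) => //; apply: cvg_near_cst.
  by exists 1%N => // n /= n0; congr expect; apply/funext => w; rewrite tel.
- apply: (cvg_unique _ _ H2) => //; apply: cvg_near_cst.
  by exists 1%N => // n /= n0; congr expect; apply/funext => w; rewrite tel.
Qed.

End clt.

(** * Random vectors *)

Section matrix_norm.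
Context (R : realType).

Lemma mx_norm_coord m n (A : 'M[R]_(m, n)) i j : `|A i j| <= `|A|.
Proof. by rewrite [leRHS]/Num.Def.normr /= mx_normrE; apply: (le_bigmax _ (fun ij => `|A ij.1 ij.2|) (i, j)). Qed.

Lemma mx_norm_le m n (A : 'M[R]_(m, n)) (c : R) : 0 <= c ->
  (forall i j, `|A i j| <= c) -> `|A| <= c.
Proof.
by move=> c0 Ac; rewrite [leLHS]/Num.Def.normr /= mx_normrE; apply: bigmax_le => // -[i j] _.
Qed.

Lemma mx_norm_lt m n (A : 'M[R]_(m, n)) (c : R) : 0 < c ->
  (forall i j, `|A i j| < c) -> `|A| < c.
Proof.
by move=> c0 Ac; rewrite [ltLHS]/Num.Def.normr /= mx_normrE; apply/bigmax_ltP; split => // -[i j] _.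
Qed.

Lemma mx_norm_mul m n p (A : 'M[R]_(m, n)) (B : 'M[R]_(n, p)) :
  `|A *m B| <= n%:R * `|A| * `|B|.
Proof.
apply: mx_norm_le => [|i j]; first by rewrite !mulr_ge0.
rewrite mxE (le_trans (ler_norm_sum _ _ _))// -mulrA mulr_natl -[X in _ *+ X]card_ord -sumr_const.
by apply: ler_sum => k _; rewrite normrM ler_pM// mx_norm_coord.
Qed.

Lemma trmx_continuous m n : continuous (@trmx R m n).
Proof.
move=> A; apply/(@cvgrPdist_lt _ _ _ _ (nbhs_filter A)) => e e0.
apply/nbhs_ballP; exists e => //= B.
rewrite -ball_normE/= => AB; rewrite -linearB /=; apply: mx_norm_lt => // i j.
by rewrite mxE; apply: le_lt_trans (mx_norm_coord _ _ _) AB.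
Qed.

Lemma compact_box n (K : R) : compact [set x : 'cV[R]_n | `|x| <= K].
Proof.
have [K0|K0] := ltP K 0.
  rewrite [X in compact X](_ : _ = set0); first exact: compact0.
  by apply/seteqP; split => x //= /(le_trans (normr_ge0 x)); rewrite leNgt K0.
have C : compact [set v : 'rV[R]_n | forall i, `[(- K), K]%classic (v ord0 i)].
  by apply: (@rV_compact _ _ (fun=> `[(- K), K]%classic)) => i; exact: segment_compact.
have := continuous_compact (continuous_subspaceT (@trmx_continuous 1 n)) C.
congr compact; apply/seteqP; split => [_ [v vK <-]|x xK] /=.
  apply: mx_norm_le => // i j; rewrite mxE ord1.
  by have := vK i; rewrite /= in_itv/= ler_norml.
exists x^T; last by rewrite trmxK.
by move=> i /=; rewrite mxE in_itv/= -ler_norml (le_trans (mx_norm_coord _ _ _)).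
Qed.

(** Heine's theorem with only one of the two points confined to [K]: in [path_unif] the other time
    may lie beyond the end of the interval. *)
Lemma compact_unif_continuous (U V : normedModType R) (f : U -> V) (K : set U) :
  compact K -> continuous f -> forall e, 0 < e ->
  exists2 d, 0 < d & forall x y, K x -> `|x - y| < d -> `|f x - f y| < e.
Proof.
move=> /compact_near_coveringP cK cf e e0.
have := cK _ (0 : R)^'+ (fun d x => forall y, `|x - y| < d -> `|f x - f y| < e) _.
case.
  move=> x Kx; have e20 : 0 < e / 2 by rewrite divr_gt0.
  have /cvgrPdist_lt/(_ _ e20)/nbhs_ballP [r /= r0 rf] := cf x.
  have r20 : 0 < r / 2 by rewrite divr_gt0.
  near=> z d => y yzd.
  have zx : `|x - z| < r / 2 by near: z; apply/nbhs_ballP; exists (r / 2) => //= z; rewrite -ball_normE.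
  have dr : d < r / 2 by near: d; exact: nbhs_right_lt.
  have A : `|f x - f z| < e / 2.
    by apply: rf; rewrite -ball_normE/= (lt_le_trans zx)// ler_pdivrMr// ler_peMr ?ler1n// ltW.
  have B : `|f x - f y| < e / 2.
    apply: rf; rewrite -ball_normE/= (_ : x - y = (x - z) + (z - y)); last by rewrite addrA subrK.
    by rewrite (le_lt_trans (ler_normD _ _))// [ltRHS](splitr r) ltrD// (lt_trans yzd).
  rewrite (_ : f z - f y = - (f x - f z) + (f x - f y)); last by rewrite opprB addrA subrK.
  by rewrite (le_lt_trans (ler_normD _ _))// normrN [ltRHS](splitr e) ltrD.
move=> r /= r0 H; exists (r / 2); first by rewrite divr_gt0.
move=> x y Kx xy; apply: (H (r / 2)) => //=; last by rewrite divr_gt0.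
rewrite sub0r normrN gtr0_norm ?divr_gt0//.
by rewrite ltr_pdivrMr// ltr_pMr// ltr1n.
Unshelve. all: by end_near. Qed.

End matrix_norm.

(** * Borel measurability of random vectors *)

Section borel_vectors.
Context d (T : measurableType d) (R : realType).

(** Every open set is the countable union of the rational boxes that it contains, and the preimage
    of a box is a finite intersection of coordinate events. Boxes not contained in [U] contribute
    the empty set, so that the union runs over a fixed countable type. *)
Lemma random_vector_open n (X : T -> 'cV[R]_n) : random_vector X ->
  forall U : set 'cV[R]_n, open U -> measurable (X @^-1` U).
Proof.
move=> mX U oU.
pose box (c : 'cV[rat]_n * nat) : set 'cV[R]_n :=
  [set x | forall i, `|x i 0 - ratr (c.1 i 0)| < c.2.+1%:R^-1].
pose F (c : 'cV[rat]_n * nat) : set T := if `[< box c `<=` U >] then X @^-1` box c else set0.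
have -> : X @^-1` U = \bigcup_c F c.
  apply/seteqP; split => w /=; last first.
    by move=> [c _]; rewrite /F; case: asboolP => // cU /cU.
  move=> UX; have /nbhs_ballP[r /= r0 rU] : nbhs (X w) U by exact: open_nbhs_nbhs.
  have [N N0] : exists N : nat, N.+1%:R^-1 < r / 2.
    have r2 : 0 < r / 2 by rewrite divr_gt0.
    near \oo => N; exists N; near: N.
    have := @cvg_harmonic R; move=> /cvgrPdist_lt/(_ _ r2); apply: filterS => N.
    by rewrite /harmonic/= sub0r normrN ger0_norm.
  have N10 : 0 < N.+1%:R^-1 :> R by rewrite invr_gt0.
  have /choice[c Hc] : forall i : 'I_n, exists q : rat, `|X w i 0 - ratr q| < N.+1%:R^-1.
    set dd : R := N.+1%:R^-1 in N0 N10 *.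
    move=> i; have : X w i 0 - dd < X w i 0 + dd by lra.
    move=> /rat_in_itvoo[q]; rewrite in_itv/= => /andP[q1 q2]; exists q.
    by rewrite ltr_norml; apply/andP; split; lra.
  exists (\col_i c i, N) => //; rewrite /F; case: asboolP => [_|].
    by move=> i; rewrite /= mxE.
  case=> x /= Hx; apply: rU; rewrite -ball_normE /=.
  apply: (@le_lt_trans _ _ (N.+1%:R^-1 + N.+1%:R^-1)); last by move: N0; set dd : R := N.+1%:R^-1; lra.
  apply: mx_norm_le => [|i j]; first by rewrite addr_ge0.
  rewrite !mxE ord1; have := Hx i; have := Hc i; rewrite mxE => H1 H2.
  rewrite (_ : X w i 0 - x i 0 = (X w i 0 - ratr (c i)) - (x i 0 - ratr (c i))); last by ring.
  by rewrite (le_trans (ler_normB _ _))// lerD// ltW.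
apply: countable_bigcupT_measurable; first exact: countableP.
move=> c; rewrite /F; case: asboolP => // _.
have -> : X @^-1` box c = \bigcap_(i in [set: 'I_n])
    (fun w => X w i 0) @^-1` [set r | `|r - ratr (c.1 i 0)| < c.2.+1%:R^-1].
  by apply/seteqP; split => w /= H i; [move=> _; exact: H|exact: (H i Logic.I)].
apply: fin_bigcap_measurable => // i _.
rewrite -[X in measurable X]setTI; apply: mX => //.
have -> : [set r : R | `|r - ratr (c.1 i 0)| < c.2.+1%:R^-1]
    = `](ratr (c.1 i 0) - c.2.+1%:R^-1), (ratr (c.1 i 0) + c.2.+1%:R^-1)[%classic.
  by apply/seteqP; split => r /=; rewrite in_itv/= ltr_distl.
exact: measurable_itv.
Unshelve. all: by end_near. Qed.

Lemma open_measurable_fun (f : T -> R) :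
  (forall U : set R, open U -> measurable (f @^-1` U)) -> measurable_fun [set: T] f.
Proof.
move=> fU; apply: (measurability _ (RGenOpens.measurableE R)) => _ [_ [x [y ->]] <-].
by rewrite setTI; apply: fU; exact: interval_open.
Qed.

Lemma continuous_random_vector n (X : T -> 'cV[R]_n) (f : 'cV[R]_n -> R) :
  random_vector X -> continuous f -> measurable_fun [set: T] (f \o X).
Proof.
move=> mX cf; apply: open_measurable_fun => U oU.
rewrite comp_preimage; apply: random_vector_open => //.
by apply: open_comp oU => x _; exact: cf.
Qed.

Lemma random_vector_borel n (X : T -> 'cV[R]_n) : random_vector X ->
  @measurable_fun _ _ T (borel R n) setT X.
Proof.
move=> mX; apply: (@measurability _ _ _ (borel R n) _ _ (@open 'cV[R]_n)) => // _ [U oU <-].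
by rewrite setTI; exact: random_vector_open.
Qed.

Lemma random_vector_norm n (X : T -> 'cV[R]_n) : random_vector X ->
  measurable_fun [set: T] (fun w => `|X w|).
Proof. by move=> mX; apply: (continuous_random_vector mX); exact: norm_continuous. Qed.

End borel_vectors.

(** * Convergence in law from characteristic functions *)

Section bernstein.
Context (R : realType).

Definition bern (N : nat) (u : R) (j : nat) : R :=
  'C(N, j)%:R * u ^+ j * (1 - u) ^+ (N - j).

Lemma bern_ge0 N u j : 0 <= u <= 1 -> 0 <= bern N u j.
Proof.
by move=> /andP[u0 u1]; rewrite !mulr_ge0 ?exprn_ge0 ?subr_ge0.
Qed.

(** Pascal's rule in probabilistic form: a binomial variable of size N + 1 is one of size N plus a
    Bernoulli variable. With [g] arbitrary, mass and variance both follow by induction. *)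
Lemma sum_bernS N u (g : nat -> R) :
  \sum_(0 <= j < N.+2) bern N.+1 u j * g j =
  u * (\sum_(0 <= j < N.+1) bern N u j * g j.+1)
  + (1 - u) * (\sum_(0 <= j < N.+1) bern N u j * g j).
Proof.
rewrite big_nat_recl// [X in _ = _ + _ * X]big_nat_recl//.
have -> : \sum_(0 <= j < N) bern N u j.+1 * g j.+1
    = \sum_(0 <= j < N.+1) bern N u j.+1 * g j.+1.
  by rewrite big_nat_recr//= /bern bin_small// !mul0r addr0.
rewrite mulrDr !mulr_sumr addrCA -big_split/=; congr (_ + _).
  by rewrite /bern !bin0 !subn0 exprS; ring.
apply: eq_big_nat => j /andP[_ jN]; rewrite /bern binS natrD subSS.
have [jN'|jN'] := eqVneq j N.
  by rewrite jN' bin_small// subnn exprS; ring.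
have lt : (j < N)%N by rewrite ltn_neqAle jN' -ltnS.
have -> : (N - j = (N - j.+1).+1)%N by rewrite subnS prednK// subn_gt0.
by rewrite !exprS; ring.
Qed.

Lemma sum_bern N u : \sum_(0 <= j < N.+1) bern N u j = 1.
Proof.
elim: N => [|N IH]; first by rewrite big_nat1 /bern bin0 !expr0 !mulr1.
under eq_bigr do rewrite -[bern _ _ _]mulr1.
rewrite (sum_bernS N u (fun=> 1)); under eq_bigr do rewrite mulr1.
by rewrite IH; ring.
Qed.

(** The centre [a] is free because the induction shifts it to [a - 1]. *)
Lemma sum_bern_var N u (a : R) :
  \sum_(0 <= j < N.+1) bern N u j * (j%:R - a) ^+ 2
  = N%:R * u * (1 - u) + (N%:R * u - a) ^+ 2.
Proof.
elim: N a => [|N IH] a.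
  by rewrite big_nat1 /bern bin0 !expr0; ring.
rewrite (sum_bernS N u (fun j => (j%:R - a) ^+ 2)) IH.
have -> : \sum_(0 <= j < N.+1) bern N u j * (j.+1%:R - a) ^+ 2
    = \sum_(0 <= j < N.+1) bern N u j * (j%:R - (a - 1)) ^+ 2.
  by apply: eq_bigr => j _; rewrite -natr1; congr (_ * _ ^+ 2); ring.
by rewrite IH -[N.+1%:R]natr1; ring.
Qed.

Context (q N : nat).

Definition bern_mult (u : 'I_q -> R) (k : {ffun 'I_q -> 'I_N.+1}) : R :=
  \prod_i bern N (u i) (k i).

Lemma bern_mult_ge0 u k : (forall i, 0 <= u i <= 1) -> 0 <= bern_mult u k.
Proof. by move=> u01; apply: prodr_ge0 => i _; exact: bern_ge0. Qed.

Lemma sum_bern_mult u : \sum_k bern_mult u k = 1.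
Proof.
rewrite -(bigA_distr_bigA (fun i (j : 'I_N.+1) => bern N (u i) j)).
rewrite big1// => i _; rewrite -(sum_bern N (u i)).
by rewrite big_mkord.
Qed.

Lemma sum_bern_mult_var u i : (0 < N)%N ->
  \sum_k bern_mult u k * ((k i)%:R / N%:R - u i) ^+ 2 = u i * (1 - u i) / N%:R.
Proof.
move=> N0; have N0' : (N%:R : R) != 0 by rewrite pnatr_eq0 -lt0n.
pose F l (j : 'I_N.+1) := bern N (u l) j * (if l == i then (j%:R / N%:R - u i) ^+ 2 else 1).
rewrite (eq_bigr (fun k : {ffun 'I_q -> 'I_N.+1} => \prod_l F l (k l))); last first.
  move=> k _; rewrite /F big_split/=; congr (_ * _).
  by rewrite (bigD1 i)//= eqxx big1 ?mulr1// => l /negbTE ->.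
rewrite -(bigA_distr_bigA F) (bigD1 i)//= [X in _ * X]big1 ?mulr1; last first.
  move=> l /negbTE li; rewrite /F li -[RHS](sum_bern N (u l)) big_mkord.
  by apply: eq_bigr => j _; rewrite mulr1.
rewrite /F eqxx.
have := sum_bern_var N (u i) (N%:R * u i); rewrite subrr expr0n/= addr0 big_mkord => H.
rewrite (eq_bigr (fun j : 'I_N.+1 => N%:R ^- 2 * (bern N (u i) j * (j%:R - N%:R * u i) ^+ 2))).
  by rewrite -mulr_sumr H; field.
by move=> j _; field.
Qed.

End bernstein.

(** * Trigonometric polynomials and uniform approximation on boxes *)

Section trigonometric_polynomials.
Context (R : realType) (q : nat).

Definition dot (a x : 'cV[R]_q) : R := (a^T *m x) 0 0.

Lemma dotE a x : dot a x = \sum_i a i 0 * x i 0.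
Proof. by rewrite /dot mxE; apply: eq_bigr => i _; rewrite mxE. Qed.

Lemma dotDl a b x : dot (a + b) x = dot a x + dot b x.
Proof. by rewrite /dot linearD mulmxDl mxE. Qed.

Lemma dotBl a b x : dot (a - b) x = dot a x - dot b x.
Proof. by rewrite /dot linearB mulmxBl !mxE. Qed.

(** The phase [b] brings in sines and constants, and the product-to-sum formula then closes the
    class under products. The mean of a member is determined by the characteristic function of the
    vector. *)
Inductive trig : ('cV[R]_q -> R) -> Prop :=
| trig_cos a b : trig (fun x => cos (dot a x + b))
| trigD f g : trig f -> trig g -> trig (fun x => f x + g x)
| trigZ c f : trig f -> trig (fun x => c * f x).

Lemma trig_cst c : trig (fun=> c).
Proof.
have := trigZ c (trig_cos 0 0); congr trig; apply/funext => x.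
by rewrite /dot linear0 mul0mx mxE addr0 cos0 mulr1.
Qed.

Lemma trigM f g : trig f -> trig g -> trig (fun x => f x * g x).
Proof.
move=> tf tg; elim: tf => [a b|f1 f2 _ IH1 _ IH2|c f1 _ IH].
- elim: tg => [a' b'|g1 g2 _ IH1 _ IH2|c g1 _ IH].
  + have := trigZ 2^-1 (trigD (trig_cos (a + a') (b + b')) (trig_cos (a - a') (b - b'))).
    congr trig; apply/funext => x; rewrite dotDl dotBl.
    have -> : dot a x + dot a' x + (b + b') = (dot a x + b) + (dot a' x + b') by ring.
    have -> : dot a x - dot a' x + (b - b') = (dot a x + b) - (dot a' x + b') by ring.
    by rewrite cosB cosD; field.
  + by have := trigD IH1 IH2; congr trig; apply/funext => x; rewrite mulrDr.
  + by have := trigZ c IH; congr trig; apply/funext => x; rewrite mulrCA.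
- by have := trigD IH1 IH2; congr trig; apply/funext => x; rewrite mulrDl.
- by have := trigZ c IH; congr trig; apply/funext => x; rewrite mulrA.
Qed.

Lemma trigX f n : trig f -> trig (fun x => f x ^+ n).
Proof.
move=> tf; elim: n => [|n IH]; first exact: trig_cst.
by have := trigM tf IH; congr trig; apply/funext => x; rewrite exprS.
Qed.

Lemma trig_sum (I : Type) (r : seq I) (F : I -> 'cV[R]_q -> R) :
  (forall i, trig (F i)) -> trig (fun x => \sum_(i <- r) F i x).
Proof.
move=> tF; elim: r => [|i r IH].
  by have := trig_cst 0; congr trig; apply/funext => x; rewrite big_nil.
by have := trigD (tF i) IH; congr trig; apply/funext => x; rewrite big_cons.
Qed.

Lemma trig_prod (I : Type) (r : seq I) (F : I -> 'cV[R]_q -> R) :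
  (forall i, trig (F i)) -> trig (fun x => \prod_(i <- r) F i x).
Proof.
move=> tF; elim: r => [|i r IH].
  by have := trig_cst 1; congr trig; apply/funext => x; rewrite big_nil.
by have := trigM (tF i) IH; congr trig; apply/funext => x; rewrite big_cons.
Qed.

(** The left side is 2 sin^2 ((a - b) / 2), the right side 2 sin ((a - b) / 2) cos ((a + b) / 2). On
    this range |(a + b) / 2| <= pi / 2 - (a - b) / 2, so the cosine dominates the remaining sine. *)
Let sin_sub_ge (a b : R) : - (pi / 2) <= b -> b <= a -> a <= pi / 2 ->
  1 - cos (a - b) <= sin a - sin b.
Proof.
move=> b1 ba a1.
have -> : sin a - sin b = 2 * sin ((a - b) / 2) * cos ((a + b) / 2).
  have -> : sin a = sin ((a + b) / 2 + (a - b) / 2) by congr sin; field.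
  have -> : sin b = sin ((a + b) / 2 - (a - b) / 2) by congr sin; field.
  by rewrite sinB sinD; ring.
rewrite one_sub_cosE expr2 mulrA ler_wpM2l//.
  rewrite mulr_ge0// sin_ge0_pi// divr_ge0 ?subr_ge0//=.
  rewrite ler_pdivrMr//; have := @pi_ge0 R; lra.
have -> : sin ((a - b) / 2) = cos (pi / 2 - (a - b) / 2).
  by rewrite cosB cos_pihalf sin_pihalf mul0r add0r mul1r.
have pp := @pi_ge0 R.
have [s0|s0] := leP 0 (a + b).
  rewrite leNgt; apply/negP => H.
  have : pi / 2 - (a - b) / 2 < (a + b) / 2.
    by rewrite -ltr_cos// in_itv/=; apply/andP; split; lra.
  by apply/negP; rewrite -leNgt; lra.
have -> : cos ((a + b) / 2) = cos (- ((a + b) / 2)) by rewrite cosN.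
rewrite leNgt; apply/negP => H.
have : pi / 2 - (a - b) / 2 < - ((a + b) / 2).
  by rewrite -ltr_cos// in_itv/=; apply/andP; split; lra.
by apply/negP; rewrite -leNgt; lra.
Qed.

(** A modulus of continuity for the arcsine; by [sin_sub_ge], 1 - cos e serves. *)
Let sin_near (e : R) : 0 < e -> e <= pi -> exists2 h, 0 < h & forall a b : R,
  - (pi / 2) <= a <= pi / 2 -> - (pi / 2) <= b <= pi / 2 ->
  `|sin a - sin b| < h -> `|a - b| < e.
Proof.
move=> e0 epi; exists (1 - cos e).
  rewrite subr_gt0 -[ltRHS]cos0 ltr_cos// in_itv/= ?lexx ?pi_ge0//.
  by rewrite ltW.
have H a b : - (pi / 2) <= b -> b <= a -> a <= pi / 2 ->
    `|sin a - sin b| < 1 - cos e -> `|a - b| < e.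
  move=> b1 ba a1 ab; rewrite ger0_norm ?subr_ge0// ltNge; apply/negP => eab.
  have := sin_sub_ge b1 ba a1; rewrite leNgt => /negP; apply.
  apply: (le_lt_trans (ler_norm _)); apply: (lt_le_trans ab).
  rewrite lerD2l lerN2 leNgt; apply/negP => C.
  have : a - b < e.
    rewrite -ltr_cos// in_itv/= ?(ltW e0)//.
    by rewrite subr_ge0 ba/=; lra.
  by rewrite ltNge eab.
move=> a b /andP[a0 a1] /andP[b0 b1]; have [ab|ab] := leP b a; first exact: H.
by rewrite distrC [X in _ -> X < _]distrC; apply: H => //; exact: ltW.
Qed.

(* Multivariate Bernstein polynomials in the variables [(1 + sin (c * x_i)) / 2],
   which separate the points of the box of radius [K]. *)
Lemma trig_approx (f : 'cV[R]_q -> R) (C K e : R) : continuous f ->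
  (forall x, `|f x| <= C) -> 0 < K -> 0 < e ->
  exists2 h, trig h & (forall x, `|h x| <= C) /\
     forall x, `|x| <= K -> `|h x - f x| <= e.
Proof.
move=> cf fC K0 e0.
have C0 : 0 <= C := le_trans (normr_ge0 _) (fC 0).
have e20 : 0 < e / 2 by rewrite divr_gt0.
have pi0 := @pi_gt0 R.
(* Scales the box to |c x_i| <= pi / 2, where the sine is injective. *)
pose c : R := pi / (2 * K); have c0 : 0 < c by rewrite divr_gt0// mulr_gt0.
have [r r0 rf] := compact_unif_continuous (@compact_box R q K) cf e20.
have [h h0 hs] : exists2 h, 0 < h & forall a b : R,
  - (pi / 2) <= a <= pi / 2 -> - (pi / 2) <= b <= pi / 2 ->
  `|sin a - sin b| < h -> `|a - b| < Num.min (c * r) pi.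
  apply: sin_near; first by rewrite lt_min mulr_gt0.
  by rewrite ge_min lexx orbT.
(* Chebyshev's weight: at a node with some coordinate off by at least h / 2, [D] times the squared
   distance exceeds the trivial bound 2 C on the difference. *)
pose D : R := 2 * C * (h / 2) ^- 2.
have D0 : 0 <= D by rewrite mulr_ge0 ?mulr_ge0// invr_ge0 sqr_ge0.
pose N := (Num.truncn (D * q%:R / (e / 2))).+1.
have NE : D * q%:R / N%:R <= e / 2.
  rewrite ler_pdivrMr ?ltr0n// [leRHS]mulrC -ler_pdivrMr//.
  by rewrite ltW// truncnS_gt.
pose u (x : 'cV[R]_q) i := (1 + sin (c * x i 0)) / 2.
have u01 x i : 0 <= u x i <= 1.
  have := sin_geN1 (c * x i 0); have := sin_le1 (c * x i 0).
  by rewrite /u => H1 H2; apply/andP; split; lra.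
(* The point of the box at which the transformed coordinates take the values k_i / N. *)
pose node (k : {ffun 'I_q -> 'I_N.+1}) : 'cV[R]_q :=
  \col_i (asin (2 * ((k i)%:R / N%:R) - 1) / c).
pose H x := \sum_k f (node k) * bern_mult (u x) k.
have trig_u i : trig (fun x => u x i).
  have := trigZ 2^-1 (trigD (trig_cst 1) (trig_cos (c *: delta_mx i 0) (- (pi / 2)))).
  congr trig; apply/funext => x; rewrite /u mulrC; congr (_ / _); congr (_ + _).
  rewrite cosB cos_pihalf sin_pihalf mulr0 add0r mulr1; congr sin.
  rewrite dotE (bigD1 i)//= !mxE !eqxx mulr1 big1 ?addr0// => j ji.
  by rewrite !mxE (negbTE ji) mulr0 mul0r.
have trig_v i : trig (fun x => 1 - u x i).
  have := trigD (trig_cst 1) (trigZ (-1) (trig_u i)).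
  by congr trig; apply/funext => x; rewrite mulN1r.
exists H.
  apply: trig_sum => k; apply: trigZ; apply: trig_prod => i; rewrite /bern.
  by apply: trigM; [apply: trigM; [exact: trig_cst|exact: trigX]|exact: trigX].
split=> [x|x xK].
  rewrite (le_trans (ler_norm_sum _ _ _))// -[leRHS]mulr1 -(sum_bern_mult N (u x)).
  rewrite mulr_sumr; apply: ler_sum => k _; rewrite normrM.
  by rewrite [`|bern_mult _ _|]ger0_norm ?bern_mult_ge0// ler_wpM2r ?bern_mult_ge0.
have -> : H x - f x = \sum_k (f (node k) - f x) * bern_mult (u x) k.
  under [RHS]eq_bigr do rewrite mulrBl.
  by rewrite sumrB -mulr_sumr sum_bern_mult mulr1.
rewrite (le_trans (ler_norm_sum _ _ _))//.
(* The first term covers the nodes close to x, by uniform continuity, and the second the others.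
   Summed against the Bernstein weights, the second is a variance of order [D * q / N]. *)
apply: (@le_trans _ _ (\sum_k (e / 2 * bern_mult (u x) k +
    D * \sum_i bern_mult (u x) k * ((k i)%:R / N%:R - u x i) ^+ 2))); last first.
  rewrite big_split/= -mulr_sumr sum_bern_mult mulr1 -mulr_sumr exchange_big/=.
  have -> : e = e / 2 + e / 2 by field.
  rewrite lerD// ?divff//; first by lra.
  apply: le_trans (_ : D * (\sum_(i < q) N%:R^-1) <= _).
    apply: ler_wpM2l => //; apply: ler_sum => i _; rewrite [leLHS](_ : _ = u x i * (1 - u x i) / N%:R).
      2: exact: (@sum_bern_mult_var R q N (u x) i isT).
    rewrite ler_piMl//; have /andP[] := u01 x i; move: (u x i) => t; nra.
  by rewrite sumr_const card_ord -[_ *+ q]mulr_natl mulrA.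
apply: ler_sum => k _.
have b0 := bern_mult_ge0 k (u01 x).
rewrite -mulr_sumr mulrCA [e / 2 * _]mulrC -mulrDr normrM.
rewrite [`|bern_mult _ _|]ger0_norm// mulrC ler_wpM2l//.
have S0 : 0 <= \sum_i ((k i)%:R / N%:R - u x i) ^+ 2.
  by apply: sumr_ge0 => i _; exact: sqr_ge0.
have [good|] := pselect (forall i, `|(k i)%:R / N%:R - u x i| < h / 2).
  apply: (@le_trans _ _ (e / 2)); last by rewrite lerDl mulr_ge0.
  rewrite ltW// distrC rf//; apply: mx_norm_lt => // i j; rewrite !mxE ord1.
  set t := (k i)%:R / N%:R.
  have t01 : 0 <= t <= 1.
    rewrite divr_ge0//= ler_pdivrMr ?ltr0n// mul1r ler_nat.
    by rewrite -ltnS.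
  have tt : -1 <= 2 * t - 1 <= 1 by move/andP: t01 => [? ?]; apply/andP; split; lra.
  have [as1 asE] := asin_def tt.
  have xb : - (pi / 2) <= c * x i 0 <= pi / 2.
    have : `|x i 0| <= K := le_trans (mx_norm_coord x i 0) xK.
    rewrite ler_norml => /andP[x1 x2].
    have cK : c * K = pi / 2 by rewrite /c; field; rewrite gt_eqF.
    by rewrite -cK -mulrN !ler_pM2l// x1 x2.
  have := hs _ _ xb as1; rewrite asE lt_min => /(_ _)/andP[|A _].
    have := good i; rewrite -/t /u => G.
    have -> : sin (c * x i 0) - (2 * t - 1) = - (2 * (t - (1 + sin (c * x i 0)) / 2)) by field.
    by rewrite normrN normrM [`|2|]ger0_norm// mulrC -ltr_pdivlMr.
  have -> : x i 0 - asin (2 * t - 1) / c = c^-1 * (c * x i 0 - asin (2 * t - 1)).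
    by field; rewrite gt_eqF.
  by rewrite normrM gtr0_norm ?invr_gt0// mulrC ltr_pdivrMr// [r * _]mulrC.
move=> /existsNP[i /negP]; rewrite -leNgt => bad.
apply: (@le_trans _ _ (2 * C)).
  by rewrite (le_trans (ler_normB _ _))// mulr_natl mulr2n lerD.
apply: (@le_trans _ _ (D * \sum_i ((k i)%:R / N%:R - u x i) ^+ 2)); last first.
  by rewrite lerDr ltW.
rewrite /D -mulrA ler_peMr ?mulr_ge0// mulrC ler_pdivlMr ?mul1r; last first.
  by rewrite exprn_gt0// divr_gt0.
rewrite (bigD1 i)//= -[leLHS]addr0 lerD//; last first.
  by apply: sumr_ge0 => l _; exact: sqr_ge0.
rewrite -[leRHS]real_normK ?num_real// lerXn2r// ?nnegrE// ltW// divr_gt0//.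
Qed.

End trigonometric_polynomials.

Lemma cvg_eq_near (R : realType) (u v : nat -> R) (l : R) :
  (\forall n \near \oo, u n = v n) -> u n @[n --> \oo] --> l -> v n @[n --> \oo] --> l.
Proof. by move=> uv; apply: cvg_trans; exact: near_eq_cvg. Qed.

(** * Levy's continuity theorem under tightness *)

Section levy.
Context d (T : measurableType d) (R : realType) (P : probability T R) (q : nat).
Local Notation Ex := (expect P).
Local Notation L1 := (L1 P).

Lemma dot_meas (a : 'cV[R]_q) (X : T -> 'cV[R]_q) : random_vector X ->
  measurable_fun [set: T] (fun w => dot a (X w)).
Proof.
move=> mX; under eq_fun do rewrite dotE.
by apply: measurable_sum => i; exact: measurable_funM.
Qed.

Lemma trig_L1 h (X : T -> 'cV[R]_q) : random_vector X -> trig h ->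
  L1 (fun w => h (X w)).
Proof.
move=> mX; elim=> [a b|f g _ Lf _ Lg|c f _ Lf]; [|exact: L1D|exact: L1Z].
by apply: L1_cos; apply: measurable_funD => //; exact: dot_meas.
Qed.

Context (X : nat -> T -> 'cV[R]_q) (Y : T -> 'cV[R]_q).
Hypothesis mX : forall n, (0 < n)%N -> random_vector (X n).
Hypothesis mY : random_vector Y.
Hypothesis cfc : forall a, Ex (fun w => cos (dot a (X n w))) @[n --> \oo]
  --> Ex (fun w => cos (dot a (Y w))).
Hypothesis cfs : forall a, Ex (fun w => sin (dot a (X n w))) @[n --> \oo]
  --> Ex (fun w => sin (dot a (Y w))).

Lemma trig_cvg h : trig h ->
  Ex (fun w => h (X n w)) @[n --> \oo] --> Ex (fun w => h (Y w)).
Proof.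
have near0 : \forall n \near \oo, (0 < n)%N by exact: nbhs_infty_gt.
elim=> [a b|f g tf cf tg cg|c f tf cf].
- have E (Z : T -> 'cV[R]_q) : random_vector Z -> Ex (fun w => cos (dot a (Z w) + b)) =
      cos b * Ex (fun w => cos (dot a (Z w))) - sin b * Ex (fun w => sin (dot a (Z w))).
    move=> mZ; have mz := dot_meas a mZ.
    rewrite -!ExZ ?L1_cos ?L1_sin// -ExB; [|exact/L1Z/L1_cos|exact/L1Z/L1_sin].
    by congr expect; apply/funext => w; rewrite cosD; ring.
  have C : cos b * Ex (fun w => cos (dot a (X n w))) - sin b * Ex (fun w => sin (dot a (X n w)))
      @[n --> \oo] --> Ex (fun w => cos (dot a (Y w) + b)).
    by rewrite E//; apply: cvgB; apply: cvgM => //; exact: cvg_cst.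
  apply: (cvg_eq_near _ C).
  by apply: filterS near0 => n n0; rewrite E//; exact: mX.
- rewrite ExD ?trig_L1//; apply: cvg_eq_near (cvgD cf cg).
  by apply: filterS near0 => n n0; rewrite ExD//; apply: trig_L1 => //; exact: mX.
- rewrite ExZ ?trig_L1//; apply: cvg_eq_near (cvgM (cvg_cst c) cf).
  by apply: filterS near0 => n n0; rewrite ExZ//; apply: trig_L1 => //; exact: mX.
Qed.

Hypothesis tightX : forall e : R, 0 < e -> exists2 K : R, 0 < K &
  \forall n \near \oo, (P [set w | (K < `|X n w|)%R] <= e%:E)%E.
Hypothesis tightY : forall e : R, 0 < e -> exists2 K : R, 0 < K & (P [set w | (K < `|Y w|)%R] <= e%:E)%E.

Let tail_meas (K : R) (Z : T -> 'cV[R]_q) : random_vector Z -> measurable [set w | K < `|Z w|].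
Proof.
move=> mZ; have := random_vector_norm mZ.
have -> : [set w | K < `|Z w|] = (fun w => `|Z w|) @^-1` `]K, +oo[%classic.
  by apply/seteqP; split=> w /=; rewrite in_itv/= andbT.
by move=> H; rewrite -[X in measurable X]setTI; apply: H.
Qed.

(** Inside the box the difference is at most [e]; outside, it is at most 2 C on an event of
    probability at most [t]. *)
Let Ex_approx (Z : T -> 'cV[R]_q) (f h : 'cV[R]_q -> R) (C K e t : R) : random_vector Z ->
  continuous f -> (forall x, `|f x| <= C) -> L1 (fun w => h (Z w)) ->
  (forall x, `|h x| <= C) ->
  (forall x, `|x| <= K -> `|h x - f x| <= e) -> 0 <= e ->
  (P [set w | (K < `|Z w|)%R] <= t%:E)%E ->
  `|Ex (fun w => h (Z w)) - Ex (fun w => f (Z w))| <= e + 2 * C * t.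
Proof.
move=> mZ cf fC Lh hC hf e0 Pt.
have C0 : 0 <= C := le_trans (normr_ge0 _) (fC 0).
have Lf : L1 (fun w => f (Z w)).
  by apply: (@L1_bnd _ _ _ _ _ C) => //; exact: continuous_random_vector.
have mA := tail_meas K mZ; set A := [set w | _] in mA Pt.
have LA : L1 (\1_A : T -> R).
  apply: (@L1_bnd _ _ _ _ _ 1); first exact: measurable_indic.
  by move=> w; rewrite indicE; case: (_ \in _); rewrite ?normr1 ?normr0.
have EA : Ex (\1_A : T -> R) <= t.
  by rewrite -lee_fin -EFin_Ex// integral_indic// setIT.
rewrite -ExB// (le_trans (Ex_norm (L1B Lh Lf)))//.
apply: (@le_trans _ _ (Ex (fun w => e + 2 * C * (\1_A w : R)))).
  apply: Ex_le; [exact/L1_norm/L1B|apply: L1D; [exact: L1_cst|exact: L1Z]|move=> w].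
  rewrite indicE; have [wA|] := boolP (w \in A).
    rewrite (le_trans (ler_normB _ _))// mulr1 (le_trans (lerD (hC _) (fC _)))//.
    by rewrite mulr_natl mulr2n lerDr.
  rewrite notin_setE /A /= => /negP; rewrite -leNgt => ZK.
  by rewrite mulr0 addr0 hf.
rewrite ExD ?ExZ ?Ex_cst//; [|exact: L1_cst|exact: L1Z].
by rewrite lerD2l ler_wpM2l// mulr_ge0.
Qed.

Lemma levy f : continuous f -> (exists C, forall x, `|f x| <= C) ->
  Ex (fun w => f (X n w)) @[n --> \oo] --> Ex (fun w => f (Y w)).
Proof.
move=> cf [C0 fC0]; pose C := Num.max 1 C0.
have fC x : `|f x| <= C by rewrite le_max fC0 orbT.
have C1 : 0 < C by rewrite lt_max ltr01.
apply/cvgrPdist_le => e e0.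
(* With this tail level the replacement of [f] by [h] costs e / 8 + 2 C t = 3 e / 8 on each side,
   and the convergence of the means of [h] another e / 8. *)
pose t := e / (8 * C); have t0 : 0 < t by rewrite divr_gt0// mulr_gt0.
have [K1 K10 tX] := tightX t0; have [K2 K20 tY] := tightY t0.
pose K := Num.max K1 K2; have K0 : 0 < K by rewrite lt_max K10.
have mono (Z : T -> 'cV[R]_q) K' : random_vector Z -> K' <= K ->
    (P [set w | (K' < `|Z w|)%R] <= t%:E)%E -> (P [set w | (K < `|Z w|)%R] <= t%:E)%E.
  move=> mZ KK; apply: le_trans; apply: le_measure; rewrite ?inE; try exact: tail_meas.
  by move=> w /=; exact: le_lt_trans.
have e8 : 0 < e / 8 by rewrite divr_gt0.
have [h th [hC hf]] := trig_approx cf fC K0 e8.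
have Ct : 2 * C * t = e / 4 by rewrite /t; field; rewrite gt_eqF.
have HY := Ex_approx mY cf fC (trig_L1 mY th) hC hf (ltW e8)
  (mono _ _ mY (_ : K2 <= K) tY).
have {}HY := HY _; rewrite Ct in HY.
have HT := trig_cvg th; move/cvgrPdist_le: HT => /(_ _ e8) HT.
near=> n.
have mXn : random_vector (X n) by apply: mX; near: n; exact: nbhs_infty_gt.
have tXn : (P [set w | (K1 < `|X n w|)%R] <= t%:E)%E by near: n.
have K1K : K1 <= K by rewrite le_max lexx.
have K2K : K2 <= K by rewrite le_max lexx orbT.
have := Ex_approx mXn cf fC (trig_L1 mXn th) hC hf (ltW e8) (mono _ _ mXn K1K tXn).
have := HY K2K; rewrite Ct.
have : `|Ex (fun w => h (Y w)) - Ex (fun w => h (X n w))| <= e / 8 by near: n.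
set hy := Ex (fun w => h (Y w)); set hx := Ex (fun w => h (X n w)).
set fy := Ex (fun w => f (Y w)); set fx := Ex (fun w => f (X n w)) => H1 H2 H3.
rewrite (_ : fy - fx = - (hy - fy) + (hy - hx) + (hx - fx)); last by ring.
have := ler_normD (- (hy - fy) + (hy - hx)) (hx - fx).
have := ler_normD (- (hy - fy)) (hy - hx); rewrite normrN; lra.
Unshelve. all: by end_near.
Qed.

End levy.

(** * Normal vectors *)

Section laws.
Context d (T : measurableType d) (R : realType) (P : probability T R).
Local Notation Ex := (expect P).
Local Notation L1 := (L1 P).
Local Notation L2 := (L2 P).

(** Markov's inequality for the squared Euclidean norm, which dominates the square of the sup
    norm. *)
Lemma tail_bound q (Z : T -> 'cV[R]_q) (C K : R) : 0 < K ->
  (forall i, L2 (fun w => Z w i 0)) -> (forall i, Ex (fun w => Z w i 0 ^+ 2) <= C) ->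
  (P [set w | (K < `|Z w|)%R] <= (K ^- 2 * (q%:R * C))%:E)%E.
Proof.
move=> K0 LZ EZ; have mZ : random_vector Z by move=> i; case: (LZ i).
pose S w := \sum_i Z w i 0 ^+ 2.
have LS : L1 S by apply: L1_sum => i _; case: (LZ i).
have S0 w : 0 <= S w by apply: sumr_ge0 => i _; exact: sqr_ge0.
have K2 : 0 < K ^+ 2 / 4 by rewrite divr_gt0// exprn_gt0.
have K2' : 0 < K ^+ 2 by rewrite exprn_gt0.
have sub : [set w | K < `|Z w|] `<=` [set w | K ^+ 2 < `|S w|].
  move=> w /= KZ; rewrite ger0_norm// ltNge; apply/negP => SK.
  move: KZ; rewrite ltNge => /negP; apply; apply: mx_norm_le => [|i j]; first exact: ltW.
  rewrite ord1 -ler_sqr ?nnegrE// ?(ltW K0)// real_normK ?num_real//.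
  apply: le_trans SK; rewrite /S (bigD1 i)//= lerDl.
  by apply: sumr_ge0 => k _; exact: sqr_ge0.
have mN f (e : R) : measurable_fun [set: T] f -> measurable [set w | e < (f w : R)].
  move=> mf; have -> : [set w | e < f w] = f @^-1` `]e, +oo[%classic.
    by apply/seteqP; split=> w /=; rewrite in_itv/= andbT.
  by rewrite -[X in measurable X]setTI; apply: mf.
apply: (@le_trans _ _ (P [set w | (K ^+ 2 < `|S w|)%R])).
  apply: le_measure => //; rewrite inE; apply: mN.
    exact: random_vector_norm.
  by apply: measurableT_comp => //; exact: L1_meas LS.
apply: (le_trans (markov1 LS K2')); rewrite lee_fin ler_wpM2l ?invr_ge0 ?(ltW K2')//.
have -> : (fun w => `|S w|) = S by apply/funext => w; rewrite ger0_norm.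
rewrite /S Ex_sum; last by move=> i _; case: (LZ i).
by rewrite mulr_natl -[X in _ *+ X]card_ord -sumr_const; apply: ler_sum => i _.
Qed.

(** Open intervals form a generating pi-system, and their indicators are pointwise limits of bounded
    continuous functions. *)
Lemma law_eq (Z Z' : T -> R) : measurable_fun [set: T] Z -> measurable_fun [set: T] Z' ->
  (forall f : R -> R, continuous f -> (exists C, forall x, `|f x| <= C) ->
     Ex (f \o Z) = Ex (f \o Z')) ->
  forall A, measurable A -> P (Z @^-1` A) = P (Z' @^-1` A).
Proof.
move=> mZ mZ' H.
pose X : {RV P >-> R} := MeasurableFun.Pack (MeasurableFun.Class (isMeasurableFun.Build _ _ _ _ _ mZ)).
pose X' : {RV P >-> R} := MeasurableFun.Pack (MeasurableFun.Class (isMeasurableFun.Build _ _ _ _ _ mZ')).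
suff E A : measurable A -> distribution P X A = distribution P X' A by exact: E.
apply: (measure_unique (@RGenOpens.G R) (fun n => `](- n%:R), n%:R[%classic)).
- exact: RGenOpens.measurableE.
- move=> _ _ [a [b ->]] [a' [b' ->]]; exists (Num.max a a'), (Num.min b b').
  apply/seteqP; split => x /=; rewrite !in_itv/= gt_max lt_min.
    by move=> [/andP[-> ->] /andP[-> ->]].
  by move=> /andP[/andP[-> ->] /andP[-> ->]].
- by move=> n; exists (- n%:R), n%:R.
- apply/seteqP; split => // x _; near \oo => n; exists n => //=.
  by rewrite in_itv/= -ltr_norml; near: n; exact: nbhs_infty_gtr.
- move=> _ [a [b ->]].
  (* n times the distance to the complement of the interval, capped at 1. *)
  pose f (n : nat) (x : R) := Num.min 1 (n%:R * Num.max 0 (Num.min (x - a) (b - x))).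
  have cf n : continuous (f n).
    have cm : continuous (fun x : R => Num.min (x - a) (b - x)).
      move=> x; apply: (@continuous_min R R (fun x => x - a) (fun x => b - x)).
        by apply: cvgB; [exact: cvg_id|exact: cvg_cst].
      by apply: cvgB; [exact: cvg_cst|exact: cvg_id].
    move=> x; rewrite /f.
    apply: (@continuous_min R R (fun=> 1) (fun x => n%:R * Num.max 0 (Num.min (x - a) (b - x)))).
      exact: cvg_cst.
    apply: cvgM; first exact: cvg_cst.
    apply: (@continuous_max R R (fun=> 0) (fun x => Num.min (x - a) (b - x))); last exact: cm.
    exact: cvg_cst.
  have f01 n x : 0 <= f n x <= 1.
    by rewrite ge_min lexx le_min ler01/= mulr_ge0// le_max lexx.
  have fb n x : `|f n x| <= 1 by have /andP[? ?] := f01 n x; rewrite ger0_norm.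
  have fc x : f n x @[n --> \oo] --> (\1_(`]a, b[%classic) x : R).
    apply: cvg_near_cst; rewrite indicE.
    have [|] := boolP (x \in `]a, b[%classic); rewrite ?(inE, notin_setE) /= in_itv/=.
      move=> /andP[ax xb]; pose m := Num.min (x - a) (b - x).
      have m0 : 0 < m by rewrite lt_min !subr_gt0 ax.
      near=> n; apply/min_idPl; rewrite -/m (max_idPr (ltW m0)) -ler_pdivrMr//.
      by near: n; exact: nbhs_infty_ger.
    move=> xab; near=> n; rewrite /f (max_idPl _) ?mulr0; first by apply/min_idPr.
    rewrite leNgt; apply/negP; rewrite lt_min !subr_gt0 => /andP[ax xb].
    by apply: xab; rewrite ax.
  have lim (U : T -> R) : measurable_fun [set: T] U ->
      Ex (f n \o U) @[n --> \oo] --> Ex (fun w => \1_(`]a, b[%classic) (U w)).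
    move=> mU; apply: (@ae_cvg_Ex _ _ _ _ _ _ (fun=> 1)).
    - by move=> n; apply: measurableT_comp => //; exact: continuous_measurable_fun.
    - by apply: measurableT_comp => //; exact: measurable_indic.
    - by apply: aeW => w; exact: fc.
    - exact: L1_cst.
    - by move=> n w; exact: fb.
  have PE (U : T -> R) : measurable_fun [set: T] U ->
      P (U @^-1` `]a, b[%classic) = (Ex (fun w => \1_(`]a, b[%classic) (U w)))%:E.
    move=> mU; have mA : measurable (U @^-1` `]a, b[%classic).
      by rewrite -[X in measurable X]setTI; exact: mU.
    rewrite -EFin_Ex; last first.
      apply: (@L1_bnd _ _ _ _ _ 1) => [|w]; last by rewrite indicE; case: (_ \in _); rewrite ?normr1 ?normr0.
      by apply: measurableT_comp => //; exact: measurable_indic.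
    have := integral_indic P measurableT mA; rewrite setIT => <-.
    by apply: eq_integral.
  rewrite -[LHS]/(P (Z @^-1` _)) -[RHS]/(P (Z' @^-1` _)) (PE _ mZ) (PE _ mZ'); congr EFin.
  apply: (cvg_unique _ (lim _ mZ)) => //.
  suff -> : (fun n => Ex (f n \o Z)) = (fun n => Ex (f n \o Z')) by exact: lim.
  by apply/funext => n; apply: H => //; exists 1.
- by move=> n; apply: le_lt_trans (probability_le1 _ _) _ => //; rewrite ltry.
Unshelve. all: by end_near.
Qed.

(** Uniqueness is the continuity theorem [levy] for a constant sequence of one-dimensional vectors;
    the second moments supply tightness. *)
Lemma cf_law_eq (Z Z' : T -> R) : measurable_fun [set: T] Z -> measurable_fun [set: T] Z' ->
  L2 Z -> L2 Z' ->
  (forall u, Ex (fun w => cos (u * Z w)) = Ex (fun w => cos (u * Z' w))) ->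
  (forall u, Ex (fun w => sin (u * Z w)) = Ex (fun w => sin (u * Z' w))) ->
  forall A, measurable A -> P (Z @^-1` A) = P (Z' @^-1` A).
Proof.
move=> mZ mZ' LZ LZ' Hc Hs; apply: law_eq => // f cf [C fC].
pose v (U : T -> R) w : 'cV[R]_1 := const_mx (U w).
have mv U : measurable_fun [set: T] U -> random_vector (v U).
  by move=> mU i; rewrite /v; under eq_fun do rewrite mxE.
have dv (a : 'cV[R]_1) U w : dot a (v U w) = a 0 0 * U w.
  by rewrite dotE big_ord1 mxE.
have tight U : L2 U -> forall e : R, 0 < e -> exists2 K : R, 0 < K &
    (P [set w | (K < `|v U w|)%R] <= e%:E)%E.
  move=> LU e e0; pose S := Ex (fun w => U w ^+ 2).
  have S0 : 0 <= S by apply: Ex_ge0 => w; exact: sqr_ge0.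
  exists (Num.sqrt ((S + 1) / e)); first by rewrite sqrtr_gt0 divr_gt0// ltr_wpDl.
  apply: (le_trans (@tail_bound 1 (v U) S _ _ _ _)).
  - by rewrite sqrtr_gt0 divr_gt0// ltr_wpDl.
  - by move=> i; rewrite /v; under eq_fun do rewrite mxE.
  - by move=> i; rewrite /v; under eq_fun do rewrite mxE.
  rewrite lee_fin sqr_sqrtr ?divr_ge0 ?addr_ge0// ?(ltW e0)// mul1r invf_div.
  by rewrite mulrAC ler_pdivrMr ?ler_wpM2l ?ler_wpDr// ?(ltW e0)// ltr_wpDl.
have cosE a U : (fun w => cos (dot a (v U w))) = (fun w => cos (a 0 0 * U w)).
  by apply/funext => w; rewrite dv.
have sinE a U : (fun w => sin (dot a (v U w))) = (fun w => sin (a 0 0 * U w)).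
  by apply/funext => w; rewrite dv.
have fE U : (fun w => f (v U w 0 0)) = f \o U by apply/funext => w; rewrite mxE.
have := @levy _ T R P 1 (fun=> v Z) (v Z') (fun _ _ => mv _ mZ) (mv _ mZ').
move=> /(_ _ _ _ (tight _ LZ') (fun x => f (x 0 0))) H.
rewrite -!fE; apply: (cvg_unique _ _ (H _ _ _ _ _)) => //.
- exact: cvg_cst.
- by move=> a; rewrite !cosE Hc; exact: cvg_cst.
- by move=> a; rewrite !sinE Hs; exact: cvg_cst.
- by move=> e /(tight _ LZ)[K K0 HK]; exists K => //; exact: nearW.
- move=> x; apply: (cvg_comp (fun y : 'cV[R]_1 => y 0 0) f); last exact: cf.
  exact: coord_continuous.
- by exists C => x; exact: fC.
Qed.

Context (J : finType) (W : J -> R -> T -> R) (hW : noise_family P W) (j : J).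
Context (q : nat) (L : 'M[R]_q).

(* Realized on the given probability space, so that the Gaussian law is the
   distribution of a random vector built from the noise. *)
Definition gauss_vector (w : T) : 'cV[R]_q := L *m \col_k inc W j k%:R k.+1%:R w.

(** Extended by 0 beyond q, so that the sums run over integers, as in [cf_sum]. *)
Let coef (a : 'cV[R]_q) (k : nat) : R := if insub k is Some i then (L^T *m a) i 0 else 0.

Let dot_gauss a w : dot a (gauss_vector w)
  = \sum_(0 <= k < q) coef a k * inc W j k%:R k.+1%:R w.
Proof.
rewrite /dot /gauss_vector mulmxA -[a^T *m L]trmxK trmx_mul trmxK mxE big_mkord.
by apply: eq_bigr => k _; rewrite !mxE /coef valK mxE.
Qed.

Let var (a : 'cV[R]_q) : R := (a^T *m (L *m L^T) *m a) 0 0.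

Let varE a : var a = \sum_(0 <= k < q) coef a k ^+ 2.
Proof.
rewrite /var mulmxA -mulmxA -[a^T *m L]trmxK trmx_mul trmxK mxE big_mkord.
by apply: eq_bigr => k _; rewrite [in LHS]mxE /coef valK expr2.
Qed.

Let L2g (k : nat) : L2 (inc W j k%:R k.+1%:R).
Proof. by apply: (L2_inc hW) => //; rewrite ltr_nat. Qed.

Lemma gauss_vector_L2 i : L2 (fun w => gauss_vector w i 0).
Proof.
have -> : (fun w => gauss_vector w i 0)
   = (fun w => \sum_(k < q) L i k * inc W j k%:R k.+1%:R w).
  by apply/funext => w; rewrite mxE; apply: eq_bigr => k _; rewrite mxE.
by apply: L2_sum => k _; apply: L2Z.
Qed.

Lemma gauss_vector_rv : random_vector gauss_vector.
Proof. by move=> i; case: (gauss_vector_L2 i). Qed.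

Lemma cf_gauss a : Ex (fun w => cos (dot a (gauss_vector w))) = expR (- (var a / 2)) /\
  Ex (fun w => sin (dot a (gauss_vector w))) = 0.
Proof.
under eq_fun do rewrite dot_gauss; under [in X in _ /\ X]eq_fun do rewrite dot_gauss.
pose x (k : nat) w := coef a k * inc W j k%:R k.+1%:R w.
pose c (k : nat) := expR (- (coef a k ^+ 2 / 2)).
have lt1 k : (k%:R : R) < k.+1%:R by rewrite ltr_nat.
have cfk k := cf_inc hW j (coef a k) (ler0n R k) (lt1 k).
have sub1 k : (k.+1%:R - k%:R : R) = 1 by rewrite -natr1 addrC addKr.
(* With error 0, [cf_sum] says that characteristic functions of independent summands multiply
   exactly. *)
have [|||||A B] := @cf_sum _ T R P x c 0 q.
- by move=> i _; case: (L2Z (coef a i) (L2g i)).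
- move=> k lk.
  pose A (ij : 'I_q * J) := (ij.1 < k)%N.
  pose B (ij : 'I_q * J) := (ij.1 == k :> nat).
  have tm i : (i%:R : R) <= i.+1%:R by rewrite ler_nat.
  apply: (grid_indep2 hW (lexx (0%:R : R)) tm (A := A) (B := B)).
  + by move=> ij; rewrite /A /B => /ltn_eqF ->.
  + have -> : (fun w => \sum_(0 <= i < k) x i w) = (fun w => \sum_(i < k) x i w).
      by apply/funext => w; rewrite big_mkord.
    apply: measurable_sum => i; apply: measurable_funM => //.
    by apply: (@inc_block _ _ _ _ _ q (fun i => i%:R) A (Ordinal (ltn_trans (ltn_ord i) lk)) j); rewrite /A /=; exact: ltn_ord.
  + apply: measurable_funM => //.
    by apply: (@inc_block _ _ _ _ _ q (fun i => i%:R) B (Ordinal lk) j); rewrite /B /=.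
- move=> i _; rewrite expR_ge0 -[leRHS]expR0 ler_expR oppr_le0.
  by rewrite divr_ge0// sqr_ge0.
- by move=> i _; have [-> _] := cfk i; rewrite sub1 mulr1 subrr normr0.
- by move=> i _; have [_ ->] := cfk i; rewrite normr0.
rewrite mulr0 in A B; split; last by apply/eqP; rewrite -normr_le0.
move: A; rewrite normr_le0 subr_eq0 => /eqP ->.
rewrite /c -expR_sum varE mulr_suml -sumrN //.
Qed.

Lemma gauss_borel : measurable_fun [set: T] (gauss_vector : T -> borel R q).
Proof. exact: random_vector_borel gauss_vector_rv. Qed.

Definition gauss_rv : {mfun T >-> borel R q} :=
  MeasurableFun.Pack (MeasurableFun.Class (isMeasurableFun.Build _ _ _ _ _ gauss_borel)).

Definition gauss_law : probability (borel R q) R := distribution P gauss_rv.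

Lemma gauss_lawE (f : 'cV[R]_q -> R) : continuous f -> (exists C : R, forall x, `|f x| <= C) ->
  (\int[gauss_law]_x (f x)%:E)%E = (Ex (f \o gauss_vector))%:E.
Proof.
move=> cf [C fC].
have mf : measurable_fun [set: borel R q] f.
  apply: open_measurable_fun => U oU; apply: sub_sigma_algebra.
  by apply: open_comp => // x _; exact: cf.
have Lf : L1 (f \o gauss_vector).
  by apply: L1_bnd (continuous_random_vector gauss_vector_rv cf) (fun w => fC _).
rewrite -(EFin_Ex Lf) /gauss_law integral_distribution //; exact/measurable_EFinP.
Qed.

(** A linear form of positive variance has the characteristic function of the Wiener increment over
    [0, [var a]], whose law is normal by definition. If the variance is 0, all coefficients vanish
    and the form is identically 0. *)
Lemma gauss_law_mvnormal : is_mvnormal gauss_law 0 (L *m L^T).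
Proof.
move=> a A mA; rewrite mulmx0 mxE.
rewrite [LHS](_ : _ = P ((fun w => dot a (gauss_vector w)) @^-1` A)) //.
rewrite -/(var a) /normal_law; have md := dot_meas a gauss_vector_rv.
case: ifPn => [/eqP v0|v0].
  have c0 k : (k < q)%N -> coef a k = 0.
    move=> kq; move/eqP: v0; rewrite varE big_mkord psumr_eq0 => [/allP|i _]; last exact: sqr_ge0.
    by move/(_ (Ordinal kq)); rewrite mem_index_enum sqrf_eq0 => /(_ isT)/eqP.
  have -> : (fun w => dot a (gauss_vector w)) = cst 0.
    by apply/funext => w; rewrite dot_gauss big_mkord big1// => k _; rewrite c0 ?mul0r.
  rewrite preimage_cst diracE; case: ifP => // _; rewrite ?probability_setT ?measure0//.
have dotZ u w : dot (u *: a) (gauss_vector w) = u * dot a (gauss_vector w).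
  by rewrite /dot linearZ/= -scalemxAl mxE.
have varZ u : var (u *: a) = u ^+ 2 * var a.
  by rewrite /var [(u *: a)^T]linearZ/= -scalemxAr -!scalemxAl !mxE mulrA expr2.
have {}v0 : 0 < var a.
  rewrite lt_def v0 varE; apply: sumr_ge0 => k _; exact: sqr_ge0.
have mI : measurable_fun [set: T] (inc W j 0 (var a)) by case: (L2_inc hW j (lexx 0) v0).
rewrite (@cf_law_eq _ (inc W j 0 (var a))) //.
- have := inc_distr hW j (lexx 0) v0. by rewrite subr0 => ->.
- rewrite (_ : (fun w => _) = (fun w => \sum_i a i 0 * gauss_vector w i 0)).
    by apply: L2_sum => i _; apply/L2Z/gauss_vector_L2.
  by apply/funext => w; rewrite dotE.
- exact: L2_inc.
- move=> u; have [-> _] := cf_inc hW j u (lexx 0) v0; rewrite subr0.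
  rewrite (_ : (fun w => _) = (fun w => cos (dot (u *: a) (gauss_vector w)))).
    by have [-> _] := cf_gauss (u *: a); rewrite varZ.
  by apply/funext => w; rewrite dotZ.
- move=> u; have [_ ->] := cf_inc hW j u (lexx 0) v0.
  rewrite (_ : (fun w => _) = (fun w => sin (dot (u *: a) (gauss_vector w)))).
    by have [_ ->] := cf_gauss (u *: a).
  by apply/funext => w; rewrite dotZ.
Qed.

End laws.

(** * Drift remainders of the latent processes *)

Lemma lipschitzE (R : realType) (U V : normedModType R) (f : U -> V) : lipschitz f ->
  exists2 L, 0 <= L & forall x y, `|f x - f y| <= L * `|x - y|.
Proof.
move=> [M [_ MP]]; exists (Num.max 0 M + 1); first by rewrite addr_ge0// le_max lexx.
move=> x y; have := MP (Num.max 0 M + 1) _ (x, y) _; apply => //.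
by rewrite ltr_pwDr// le_max lexx orbT.
Qed.

Lemma lipschitz_bound_continuous (R : realType) (U V : normedModType R) (f : U -> V) (L : R) :
  0 <= L -> (forall x y, `|f x - f y| <= L * `|x - y|) -> continuous f.
Proof.
move=> L0 fL x; apply/cvgrPdist_lt => /= e e0.
have L1 : 0 < L + 1 by rewrite ltr_wpDl.
near=> y.
rewrite (le_lt_trans (fL x y))//.
apply: (@le_lt_trans _ _ ((L + 1) * `|x - y|)); first by rewrite ler_wpM2r// lerDl.
rewrite -ltr_pdivlMl// mulrC; near: y.
have D0 : 0 < e / (L + 1) by rewrite divr_gt0.
by have /cvgrPdist_lt := @cvg_id _ (nbhs x) => /(_ _ D0).
Unshelve. all: by end_near.
Qed.

Lemma cvg_sum_nat (R : realType) (T : Type) (F : set_system T) {FF : Filter F} (N : nat)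
    (f : nat -> T -> R) (a : nat -> R) :
  (forall i, (i < N)%N -> f i x @[x --> F] --> a i) ->
  (\sum_(0 <= i < N) f i x) @[x --> F] --> \sum_(0 <= i < N) a i.
Proof.
move=> fa; rewrite big_nat.
have -> : (fun x => \sum_(0 <= i < N) f i x) = (fun x => \sum_(0 <= i < N | (0 <= i < N)%N) f i x).
  by apply/funext => x; rewrite big_nat.
by apply: cvg_big => [|i /andP[_ iN]]; [exact: add_continuous|exact: fa].
Qed.

Lemma integral_osc (R : realType) (g : R -> R) (s t v e : R) : continuous g -> 0 <= s -> s <= t ->
  (forall r, s <= r <= t -> `|g r - v| <= e) ->
  `|(\int[lebesgue_measure]_(r in `[0, t]) g r)
    - (\int[lebesgue_measure]_(r in `[0, s]) g r) - (t - s) * v| <= (t - s) * e.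
Proof.
move=> cg s0 st gv; set mu := lebesgue_measure.
have It a b : mu.-integrable `[a, b]%classic (EFin \o g).
  apply: continuous_compact_integrable; first exact: segment_compact.
  by apply: continuous_subspaceT => x; exact: cg.
have sub : `]s, t]%classic `<=` `[s, t]%classic.
  by move=> r /=; rewrite !in_itv/= => /andP[/ltW-> ->].
have Ist : mu.-integrable `]s, t]%classic (EFin \o g).
  by apply: (@integrableS _ _ _ mu _ _ _ _ _ sub) => //; exact: It.
have muE : fine (mu `]s, t]%classic) = t - s.
  rewrite /mu lebesgue_measure_itv/= lte_fin; by case: ltgtP st => // ->; rewrite subrr.
have Ic c : mu.-integrable `]s, t]%classic (EFin \o cst c).
  apply: (@integrableS _ _ _ mu _ _ _ _ _ sub) => //; apply: continuous_compact_integrable.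
    exact: segment_compact.
  by apply: continuous_subspaceT => x; exact: cvg_cst.
rewrite (@Rintegral_itvB R g (BLeft 0) (BRight t) s)//.
rewrite [_ * v]mulrC -muE -(@Rintegral_cst _ _ _ mu) // -RintegralB//.
apply: (le_trans (le_normr_Rintegral _ _)) => //.
  exact: (integrableB _ Ist (Ic v)).
rewrite [leRHS]mulrC -Rintegral_cst//; apply: le_Rintegral => //.
- exact: (integrable_norm (integrableB _ Ist (Ic v))).
- exact: (Ic e).
- by move=> r; rewrite /= in_itv/= => /andP[/ltW sr rt]; rewrite gv ?sr.
exact: (Ic v).
Qed.

(** * Second moment of a sum of orthogonal terms *)

Section orthogonal_sum.
Context d (T : measurableType d) (R : realType) (P : probability T R).
Local Notation Ex := (expect P).
Local Notation L1 := (L1 P).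
Local Notation L2 := (L2 P).

Lemma L2_mul_bnd (K : R) (a x : T -> R) : measurable_fun [set: T] a ->
  (forall w, `|a w| <= K) -> L2 x -> L2 (fun w => a w * x w).
Proof.
move=> ma aK Lx; apply: (L2_dom _ (L2Z K Lx)) => [|w].
  by apply: measurable_funM => //; case: Lx.
have K0 : 0 <= K := le_trans (normr_ge0 _) (aK w).
by rewrite !normrM [`|K|]ger0_norm// ler_wpM2r.
Qed.

(** The isometry of a discrete stochastic integral: in the square of the partial sum the cross term
    with the new summand is the mean of [x i], which is 0, times that of an independent variable.
    The bound [K] makes the products square integrable. *)
Lemma orthogonal_sum (N : nat) (a x : nat -> T -> R) (K v : R) :
  (forall i, (i < N)%N -> [/\ measurable_fun [set: T] (a i), forall w, `|a i w| <= K,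
     L2 (x i), Ex (x i) = 0 & Ex (fun w => x i w ^+ 2) = v]) ->
  (forall i, (i < N)%N -> indep2 P (fun w => a i w ^+ 2) (fun w => x i w ^+ 2)) ->
  (forall i, (i < N)%N -> indep2 P (fun w => (\sum_(0 <= k < i) a k w * x k w) * a i w) (x i)) ->
  L2 (fun w => \sum_(0 <= i < N) a i w * x i w) /\
  Ex (fun w => (\sum_(0 <= i < N) a i w * x i w) ^+ 2)
    = v * \sum_(0 <= i < N) Ex (fun w => a i w ^+ 2).
Proof.
move=> H I1 I2; suff: forall k, (k <= N)%N ->
    L2 (fun w => \sum_(0 <= i < k) a i w * x i w) /\
    Ex (fun w => (\sum_(0 <= i < k) a i w * x i w) ^+ 2)
      = v * \sum_(0 <= i < k) Ex (fun w => a i w ^+ 2) by apply.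
elim=> [_|k IH kN].
  have -> : (fun w => \sum_(0 <= i < 0) a i w * x i w) = (fun=> 0).
    by apply/funext => w; rewrite big_geq.
  have -> : (fun w => (\sum_(0 <= i < 0) a i w * x i w) ^+ 2) = (fun=> 0).
    by apply/funext => w; rewrite big_geq// expr0n.
  by split; [exact: L2_cst|rewrite Ex_cst big_geq// mulr0].
have [LS ES] := IH (ltnW kN); have [ma aK Lx x0 xv] := H k kN.
set S := (fun w => \sum_(0 <= i < k) a i w * x i w) in LS.
have Lax := L2_mul_bnd ma aK Lx.
have E : (fun w => \sum_(0 <= i < k.+1) a i w * x i w) = (fun w => S w + a k w * x k w).
  by apply/funext => w; rewrite big_nat_recr.
have La : L2 (a k) := L2_bnd P ma aK.
have La2 : L1 (fun w => a k w ^+ 2) by case: La.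
have Lx2 : L1 (fun w => x k w ^+ 2) by case: Lx.
have [L1a E1] := indep2_Ex La2 Lx2 (I1 k kN).
have [L1b E2] := indep2_Ex (L2M LS La) (L2_L1 Lx) (I2 k kN).
rewrite E; split; first exact: L2D.
have -> : (fun w => (\sum_(0 <= i < k.+1) a i w * x i w) ^+ 2)
   = (fun w => S w ^+ 2 + (2 * (S w * a k w * x k w) + a k w ^+ 2 * x k w ^+ 2)).
  by apply/funext => w; rewrite big_nat_recr//= -/(S w); ring.
have LS2 : L1 (fun w => S w ^+ 2) by case: LS.
rewrite (ExD LS2 (L1D (L1Z 2 L1b) L1a)) (ExD (L1Z 2 L1b) L1a) (ExZ 2 L1b) E2 E1.
by rewrite x0 !mulr0 add0r ES xv big_nat_recr//= mulrDr [v * Ex _]mulrC.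
Qed.
End orthogonal_sum.

(** * Moments of the drift remainder of one latent process *)

Section drift.
Context d (T : measurableType d) (R : realType) (P : probability T R).
Local Notation Ex := (expect P).
Local Notation L1 := (L1 P).
Local Notation L2 := (L2 P).
Context (J : finType) (W : J -> R -> T -> R) (hW : noise_family P W).
Context (n r : nat) (B : 'cV[R]_n -> 'cV[R]_n) (S : 'M[R]_(n, r)) (c : 'cV[R]_n).
Context (iota : 'I_r -> J) (Y : R -> T -> 'cV[R]_n).
Hypothesis hY : sde_solution P B S c (fun t w => \col_k W (iota k) t w) Y.
Hypothesis B_lip : lipschitz B.
Hypothesis Y_mom : bounded_moments P Y.

Let L : R := s2val (cid2 (lipschitzE B_lip)).
Let L0 : 0 <= L. Proof. by rewrite /L; case: cid2. Qed.
Let BL x y : `|B x - B y| <= L * `|x - y|. Proof. by rewrite /L; case: cid2. Qed.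
Let B_cont : continuous B. Proof. exact: lipschitz_bound_continuous L0 BL. Qed.

(** Almost surely the integral of the l-th drift coordinate over [s, t]. As a difference it is
    plainly measurable, and the decomposition of the increments holds for every outcome. *)
Definition resid (l : 'I_n) (s t : R) (w : T) : R :=
  Y t w l 0 - Y s w l 0 - \sum_k S l k * inc W (iota k) s t w.

(** The path frozen at its initial value for negative times, hence continuous on the whole line. *)
Let y (w : T) (t : R) := Y (Num.max 0 t) w.

Let y_cont w : continuous (y w).
Proof.
have [_ cY _] := hY => t.
have mc : Num.max 0 t \in `[0, +oo[%classic by rewrite inE /= in_itv/= le_max lexx.
have := cY w; rewrite continuous_subspace_in => /(_ _ mc) cy.
apply/cvgrPdist_lt => e e0.
have mc' : `[0, +oo[%classic (Num.max 0 t) by rewrite -inE.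
have H : within `[0, +oo[%classic (nbhs (Num.max 0 t)) [set z | `|Y (Num.max 0 t) w - Y z w| < e].
  rewrite (nbhs_subspace_in mc').
  by move/cvgrPdist_lt: cy => /(_ e e0).
have mm : Num.max 0 z @[z --> t] --> Num.max 0 t.
  by apply: (@continuous_max R R (fun=> 0) id); [exact: cvg_cst|exact: cvg_id].
have := mm _ H; rewrite /= !near_simpl => {}H; near=> z.
by have := near H z; apply=> //; rewrite /= in_itv/= le_max lexx.
Unshelve. all: by end_near.
Qed.

Lemma path_unif w (a e : R) : 0 < e ->
  exists2 dl, 0 < dl & forall s t, 0 <= s <= a -> 0 <= t -> `|s - t| < dl -> `|Y s w - Y t w| < e.
Proof.
move=> e0; have := compact_unif_continuous (@segment_compact _ 0 a) (@y_cont w) e0.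
move=> [dl d0 H]; exists dl => // s t /andP[s0 sa] t0 st.
have := H s t _ st; rewrite /y !(max_idPr _)//; apply.
by rewrite /= in_itv/= s0.
Qed.

(** The quantifiers stand inside the almost sure statement: one exceptional set serves all times and
    all comparison values [v], which later depend on the outcome. *)
Lemma resid_osc : {ae P, forall w, forall (l : 'I_n) (s t v e : R), 0 <= s -> s <= t ->
  (forall r, s <= r <= t -> `|B (Y r w) l 0 - v| <= e) ->
  `|resid l s t w - (t - s) * v| <= (t - s) * e}.
Proof.
have [_ _ hae] := hY; apply: filterS hae => w hw l s t v e s0 st H.
have t0 := le_trans s0 st.
have E (a : R) : 0 <= a -> \int[lebesgue_measure]_(z in `[0, a]) B (Y z w) l 0
    = \int[lebesgue_measure]_(z in `[0, a]) B (y w z) l 0.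
  move=> a0; apply: eq_Rintegral => z; rewrite inE/= in_itv/= => /andP[z0 _].
  by rewrite /y (max_idPr z0).
have -> : resid l s t w = \int[lebesgue_measure]_(r in `[0, t]) B (y w r) l 0
    - \int[lebesgue_measure]_(r in `[0, s]) B (y w r) l 0.
  rewrite /resid (hw _ s0) (hw _ t0) !mxE.
  have -> : \sum_k S l k * inc W (iota k) s t w = \sum_k S l k * W (iota k) t w
     - \sum_k S l k * W (iota k) s w.
    by rewrite -sumrB; apply: eq_bigr => k _; rewrite mulrBr.
  under [in LHS]eq_bigr do rewrite mxE.
  under [X in _ - (_ + X) - _]eq_bigr do rewrite mxE.
  rewrite -(E t t0) -(E s s0); ring.
apply: integral_osc => // [x|z /andP[sz zt]].
  apply: (cvg_comp (fun z => B (y w z)) (fun v : 'cV_n => v l 0)); last exact: coord_continuous.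
  apply: (cvg_comp (y w) B); [exact: y_cont|exact: B_cont].
by rewrite /y (max_idPr (le_trans s0 sz)) H// sz.
Qed.

Let Y_rv t : 0 <= t -> random_vector (Y t). Proof. by case: hY => + _ _; exact. Qed.

Let normE2 (v : 'cV[R]_n) : `|v| ^+ 2 <= \sum_i v i 0 ^+ 2.
Proof.
have S0 : 0 <= \sum_i v i 0 ^+ 2 by apply: sumr_ge0 => i _; exact: sqr_ge0.
rewrite -[leRHS]sqr_sqrtr// ler_sqr ?nnegrE ?sqrtr_ge0//.
apply: mx_norm_le => [|i j]; first exact: sqrtr_ge0.
rewrite ord1 -ler_sqr ?nnegrE ?sqrtr_ge0// sqr_sqrtr// real_normK ?num_real//.
by rewrite (bigD1 i)//= lerDl; apply: sumr_ge0 => k _; exact: sqr_ge0.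
Qed.

Lemma state_L2 : exists2 C, 0 <= C & forall (t : R) i, 0 <= t ->
  L2 (fun w => Y t w i 0) /\ Ex (fun w => Y t w i 0 ^+ 2) <= C.
Proof.
have := Y_mom (ler0n R 2); set A := [set _ | _ in _] => sA.
have qE (t : R) w : enorm (Y t w) `^ 2 = \sum_i Y t w i 0 ^+ 2.
  rewrite powR_mulrn ?sqrtr_ge0// sqr_sqrtr//.
  by apply: sumr_ge0 => i _; exact: sqr_ge0.
have q0 (t : R) w : 0 <= \sum_i Y t w i 0 ^+ 2 by apply: sumr_ge0 => i _; exact: sqr_ge0.
have le (t : R) : 0 <= t -> (\int[P]_w (\sum_i Y t w i 0 ^+ 2)%:E <= ereal_sup A)%E.
  move=> t0; apply: ereal_sup_ubound; exists t => //.
  by rewrite unlock; apply: eq_integral => w _; rewrite qE.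
have s0 : (0 <= ereal_sup A)%E.
  apply: le_trans (le 0 (lexx 0)).
  by apply: integral_ge0 => w _; rewrite lee_fin.
exists (fine (ereal_sup A)); first exact: fine_ge0.
move=> t i t0; have mY := Y_rv t0.
have mq : measurable_fun [set: T] (fun w => \sum_i Y t w i 0 ^+ 2).
  by apply: measurable_sum => k; apply: measurable_funX; exact: mY.
have Lq : L1 (fun w => \sum_i Y t w i 0 ^+ 2).
  apply/integrableP; split; first exact/measurable_EFinP.
  rewrite (eq_integral (fun w => (\sum_i Y t w i 0 ^+ 2)%:E)); last first.
    by move=> w _ /=; rewrite ger0_norm.
  exact: le_lt_trans (le t t0) sA.
have iq w : Y t w i 0 ^+ 2 <= \sum_i Y t w i 0 ^+ 2.
  by rewrite (bigD1 i)//= lerDl; apply: sumr_ge0 => k _; exact: sqr_ge0.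
have LY : L2 (fun w => Y t w i 0).
  split; first exact: mY.
  by apply: (L1_dom _ Lq) => [|w]; [apply: measurable_funX|rewrite ger0_norm ?sqr_ge0].
split=> //; have [_ LY2] := LY.
apply: (le_trans (Ex_le LY2 Lq iq)).
by rewrite -lee_fin -EFin_Ex// fineK ?le// ge0_fin_numE.
Qed.

Let b l t w := B (Y t w) l 0.

Let b_meas l t : 0 <= t -> measurable_fun [set: T] (b l t).
Proof.
move=> t0; apply: (continuous_random_vector (Y_rv t0) (f := fun v => B v l 0)) => x.
apply: (cvg_comp B (fun v : 'cV_n => v l 0)); [exact: B_cont|exact: coord_continuous].
Qed.

Let sq2 (x z : R) : (x + z) ^+ 2 <= 2 * x ^+ 2 + 2 * z ^+ 2.
Proof. by have := sqr_ge0 (x - z); nra. Qed.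

Lemma drift_L2 : exists2 C, 0 <= C & forall (t : R) l, 0 <= t ->
  L2 (b l t) /\ Ex (fun w => b l t w ^+ 2) <= C.
Proof.
have [C C0 HC] := state_L2.
exists (2 * `|B 0| ^+ 2 + 2 * L ^+ 2 * (n%:R * C)).
  by rewrite addr_ge0// ?mulr_ge0 ?sqr_ge0.
move=> t l t0; pose g w := 2 * `|B 0| ^+ 2 + 2 * L ^+ 2 * \sum_i Y t w i 0 ^+ 2.
have Lq : L1 (fun w => \sum_i Y t w i 0 ^+ 2).
  by apply: L1_sum => i _; have [[]] := HC t i t0.
have Lg : L1 g by apply: L1D; [exact: L1_cst|exact: L1Z].
have bg w : b l t w ^+ 2 <= g w.
  apply: (@le_trans _ _ ((`|B 0| + L * `|Y t w|) ^+ 2)).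
    rewrite -[leLHS]real_normK ?num_real// ler_sqr ?nnegrE ?addr_ge0 ?mulr_ge0//.
    apply: (le_trans (mx_norm_coord (B (Y t w)) l 0)).
    rewrite -[B (Y t w)](subrK (B 0)) addrC (le_trans (ler_normD _ _))// lerD2l.
    by have := BL (Y t w) 0; rewrite subr0.
  rewrite (le_trans (sq2 _ _))// lerD2l exprMn -mulrA !ler_wpM2l ?sqr_ge0//.
have Lb : L2 (b l t).
  split; first exact: b_meas.
  apply: (L1_dom _ Lg) => [|w]; last by rewrite ger0_norm ?sqr_ge0.
  exact/measurable_funX/b_meas.
split=> //; have [_ Lb2] := Lb; apply: (le_trans (Ex_le Lb2 Lg bg)).
rewrite (ExD (L1_cst P _) (L1Z _ Lq)) (ExZ _ Lq) Ex_cst.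
rewrite lerD2l ler_wpM2l ?mulr_ge0 ?sqr_ge0// Ex_sum; last first.
  by move=> i _; have [[]] := HC t i t0.
rewrite mulr_natl -[X in _ *+ X]card_ord -sumr_const; apply: ler_sum => i _.
by have [] := HC t i t0.
Qed.

Let resid_meas l s t : 0 <= s -> 0 <= t -> measurable_fun [set: T] (resid l s t).
Proof.
move=> s0 t0; apply: measurable_funB.
  by apply: measurable_funB; exact: Y_rv.
apply: measurable_sum => k; apply: measurable_funM => //.
exact: (inc_meas hW).
Qed.

(** Second moments of Riemann sums are controlled term by term, and Fatou's lemma carries the bound
    to the time integral; joint measurability in time and outcome is never invoked. *)
Let riemann l (s h : R) (v : T -> R) : 0 <= s -> 0 < h ->
  {ae P, forall w, \sum_(0 <= k < m.+1) (h / m.+1%:R * (b l (s + k%:R * (h / m.+1%:R)) w - v w))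
     @[m --> \oo] --> resid l s (s + h) w - h * v w}.
Proof.
move=> s0 h0; apply: filterS resid_osc => w osc.
apply/cvgrPdist_le => e e0.
have L1' : 0 < L + 1 by rewrite ltr_wpDl.
(* If the path moves by less than this over one mesh, the drift moves by at most [e / h], and the
   errors of all meshes add up to at most [e]. *)
have e1 : 0 < e / h / (L + 1) by rewrite !divr_gt0.
have [dl dl0 Hd] := path_unif w (s + h) e1.
near=> m; set a := h / m.+1%:R.
have a0 : 0 < a by rewrite divr_gt0.
have adl : a < dl by rewrite ltr_pdivrMr// mulrC -ltr_pdivrMr//; apply: (@lt_trans _ _ m%:R); [near: m; exact: nbhs_infty_gtr|by rewrite ltr_nat].
have am : m.+1%:R * a = h by rewrite mulrC divfK.
pose tk (k : nat) := s + k%:R * a.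
have rE k : (k <= m.+1)%N -> resid l s (tk k) w = \sum_(0 <= i < k) resid l (tk i) (tk i.+1) w.
  elim: k => [|k IH] km; first by rewrite big_geq// /tk mul0r addr0 /resid /inc; rewrite subrr big1 ?subrr// => i _; rewrite subrr mulr0.
  rewrite big_nat_recr//= -IH ?(ltnW km)// /resid /inc.
  rewrite [X in _ - X](_ : _ = \sum_k0 S l k0 * (W (iota k0) (tk k) w - W (iota k0) s w)
     + \sum_k0 S l k0 * (W (iota k0) (tk k.+1) w - W (iota k0) (tk k) w)).
    ring.
  by rewrite -big_split; apply: eq_bigr => i _ /=; ring.
have -> : s + h = tk m.+1 by rewrite /tk am.
rewrite rE//.
have -> : h * v w = \sum_(0 <= i < m.+1) a * v w.
  by rewrite sumr_const_nat subn0 -[RHS]mulr_natl mulrA am.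
rewrite -!sumrB (le_trans (ler_norm_sum _ _ _))//.
have -> : e = \sum_(0 <= i < m.+1) a * (e / h).
  rewrite sumr_const_nat subn0 -mulr_natl mulrA am mulrC divfK//; exact: lt0r_neq0.
rewrite !big_nat; apply: ler_sum => k /andP[_ km].
have tk0 i : 0 <= tk i by rewrite addr_ge0// mulr_ge0// ltW.
have tkS : tk k.+1 - tk k = a by rewrite /tk -natr1; ring.
have tkm : tk k <= s + h by rewrite lerD2l -am ler_wpM2r ?(ltW a0)// ler_nat ltnW.
have := osc l (tk k) (tk k.+1) (b l (tk k) w) (e / h) (tk0 _).
have ttk : tk k <= tk k.+1 by rewrite -subr_ge0 tkS ltW.
rewrite tkS => /(_ ttk).
set Y1 := resid _ _ _ _; set Y2 := b _ _ _ => H.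
rewrite (_ : _ - _ = Y1 - a * Y2); last by ring.
apply: H => z /andP[z1 z2].
have : `|B (Y z w) - B (Y (tk k) w)| <= e / h.
  rewrite (le_trans (BL _ _))//.
  have YY : `|Y z w - Y (tk k) w| <= e / h / (L + 1).
    rewrite distrC ltW// Hd ?tk0 ?tkm//; first exact: le_trans (tk0 _) z1.
    rewrite distrC ger0_norm ?subr_ge0// (le_lt_trans _ adl)// -tkS.
    by rewrite lerD2r.
  rewrite (le_trans (ler_wpM2l L0 YY))// mulrCA ger_pMr ?divr_gt0//.
  by rewrite ler_pdivrMr// mul1r lerDl.
apply: le_trans; rewrite -[B (Y z w) l 0 - _]/(_ - _) /Y2 /b.
by have := mx_norm_coord (B (Y z w) - B (Y (tk k) w)) l 0; rewrite !mxE.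
Unshelve. all: by end_near.
Qed.

(** Used twice: [v = 0] bounds the remainder itself, [v = b l s] its deviation from the drift frozen
    at the left end. *)
Let resid_sq l (s h : R) (v : T -> R) D : 0 <= s -> 0 < h -> measurable_fun [set: T] v ->
  (forall z, s <= z <= s + h -> L2 (fun w => b l z w - v w) /\
     Ex (fun w => (b l z w - v w) ^+ 2) <= D) ->
  L2 (fun w => resid l s (s + h) w - h * v w) /\
  Ex (fun w => (resid l s (s + h) w - h * v w) ^+ 2) <= h ^+ 2 * D.
Proof.
move=> s0 h0 mv HD.
pose a m : R := h / m.+1%:R.
have a0 m : 0 < a m by rewrite divr_gt0.
have am m : m.+1%:R * a m = h by rewrite mulrC divfK.
have rng m k : (k < m.+1)%N -> s <= s + k%:R * a m <= s + h.
  move=> km; rewrite lerDl mulr_ge0 ?(ltW (a0 _))//= lerD2l -(am m).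
  by rewrite ler_wpM2r ?(ltW (a0 _))// ler_nat ltnW.
pose F m k w := a m * (b l (s + k%:R * a m) w - v w).
have LF m k : (k < m.+1)%N -> L2 (F m k) by move=> /rng/HD[? _]; exact: L2Z.
have Ls m : L2 (fun w => \sum_(0 <= k < m.+1) F m k w).
  have -> : (fun w => \sum_(0 <= k < m.+1) F m k w) = (fun w => \sum_(k < m.+1) F m k w).
    by apply/funext => w; rewrite big_mkord.
  by apply: L2_sum => k _; exact: LF.
apply: (@ae_cvg_fatou _ _ _ P _ _ (fun=> h ^+ 2 * D) _ (fun m => proj1 (Ls m)) _ (fun m => proj2 (Ls m))).
- apply: measurable_funB; last exact: measurable_funM.
  by apply: resid_meas => //; rewrite addr_ge0// ltW.
- exact: riemann.
- move=> m; pose G w := \sum_(k < m.+1) m.+1%:R * F m k w ^+ 2.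
  have LG (k : 'I_m.+1) : L1 (fun w => m.+1%:R * F m k w ^+ 2).
    by apply: L1Z; have [] := LF m k (ltn_ord k).
  have LG' : L1 G by apply: L1_sum => k _; exact: LG.
  apply: (@le_trans _ _ (Ex G)).
    apply: Ex_le => //; first by have [] := Ls m.
    move=> w; have := sqr_sum_le (index_iota 0 m.+1) (fun k => F m k w).
    by rewrite size_iota subn0 mulr_sumr [X in _ <= X -> _]big_mkord.
  rewrite Ex_sum//; have -> : h ^+ 2 * D = \sum_(k < m.+1) m.+1%:R * (a m ^+ 2 * D).
    by rewrite sumr_const card_ord -(am m) -mulr_natl; ring.
  apply: ler_sum => k _; have [Lk Ek] := HD _ (rng m k (ltn_ord k)).
  have [_ Lk2] := Lk; have [_ LF2] := LF m k (ltn_ord k).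
  rewrite ExZ// ler_wpM2l// /F.
  have -> : (fun w => (a m * (b l (s + k%:R * a m) w - v w)) ^+ 2)
    = (fun w => a m ^+ 2 * (b l (s + k%:R * a m) w - v w) ^+ 2).
    by apply/funext => w; rewrite exprMn.
  by rewrite ExZ// ler_wpM2l// sqr_ge0.
- exact: cvg_cst.
Qed.

Lemma resid_L2 : exists2 C, 0 <= C & forall l (s h : R), 0 <= s -> 0 < h ->
  L2 (resid l s (s + h)) /\ Ex (fun w => resid l s (s + h) w ^+ 2) <= C * h ^+ 2.
Proof.
have [C C0 HC] := drift_L2; exists C => // l s h s0 h0.
have := @resid_sq l s h (fun=> 0) C s0 h0 (measurable_cst _).
have -> : (fun w => resid l s (s + h) w - h * 0) = resid l s (s + h).
  by apply/funext => w; rewrite mulr0 subr0.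
have -> : (fun w => (resid l s (s + h) w - h * 0) ^+ 2) = (fun w => resid l s (s + h) w ^+ 2).
  by apply/funext => w; rewrite mulr0 subr0.
rewrite mulrC; apply=> z /andP[sz _]; have z0 := le_trans s0 sz.
have -> : (fun w => b l z w - 0) = b l z by apply/funext => w; rewrite subr0.
have -> : (fun w => (b l z w - 0) ^+ 2) = (fun w => b l z w ^+ 2).
  by apply/funext => w; rewrite subr0.
exact: HC.
Qed.

Let sqr_sum_ord (m : nat) (a : 'I_m -> R) : (\sum_k a k) ^+ 2 <= m%:R * \sum_k a k ^+ 2.
Proof. by have := sqr_sum_le (enum 'I_m) a; rewrite size_enum_ord !big_enum. Qed.

(** The noise contributes order t - s and the drift (t - s)^2, which the restriction to a unit of
    time absorbs. *)
Lemma state_increment : exists2 C, 0 <= C & forall i (s t : R), 0 <= s -> s <= t <= s + 1 ->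
  L2 (fun w => Y t w i 0 - Y s w i 0) /\
  Ex (fun w => (Y t w i 0 - Y s w i 0) ^+ 2) <= C * (t - s).
Proof.
have [C C0 HC] := resid_L2.
pose D i := r%:R * \sum_k S i k ^+ 2.
have D0 i : 0 <= D i by rewrite mulr_ge0// sumr_ge0// => k _; exact: sqr_ge0.
exists (2 * C + 2 * \sum_i D i).
  by rewrite addr_ge0// mulr_ge0// sumr_ge0.
move=> i s t s0 /andP[st t1].
have [->|ts] := eqVneq t s.
  rewrite subrr mulr0; have -> : (fun w => Y s w i 0 - Y s w i 0) = (fun=> 0).
    by apply/funext => w; rewrite subrr.
  split; first exact: L2_cst.
  by have -> : (fun w => (Y s w i 0 - Y s w i 0) ^+ 2) = (fun=> 0);
    [apply/funext => w; rewrite subrr expr0n|rewrite Ex_cst].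
have {ts}st' : s < t by rewrite lt_neqAle eq_sym ts.
have h0 : 0 < t - s by rewrite subr_gt0.
have [Lr Er] := HC i s (t - s) s0 h0; rewrite subrKC in Lr Er.
pose N w := \sum_k S i k * inc W (iota k) s t w.
have LN : L2 N by apply: L2_sum => k _; apply/L2Z/L2_inc.
have E : (fun w => Y t w i 0 - Y s w i 0) = (fun w => resid i s t w + N w).
  by apply/funext => w; rewrite /resid /N subrK.
have LY : L2 (fun w => Y t w i 0 - Y s w i 0) by rewrite E; exact: L2D.
split=> //.
pose G w := 2 * resid i s t w ^+ 2 + 2 * \sum_k r%:R * (S i k ^+ 2 * inc W (iota k) s t w ^+ 2).
have LN1 k : L1 (fun w => S i k ^+ 2 * inc W (iota k) s t w ^+ 2).
  by apply: L1Z; have [] := L2_inc hW (iota k) s0 st'.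
have LN2 : L1 (fun w => \sum_k r%:R * (S i k ^+ 2 * inc W (iota k) s t w ^+ 2)).
  by apply: L1_sum => k _; exact: L1Z.
have Lr2 : L1 (fun w => resid i s t w ^+ 2) by case: Lr.
have LG : L1 G by apply: L1D; exact: L1Z.
apply: (@le_trans _ _ (Ex G)).
  apply: Ex_le => //; first by case: LY.
  move=> w; rewrite -[Y t w i 0 - _]/((fun w => Y t w i 0 - Y s w i 0) w) E.
  rewrite (le_trans (sq2 _ _))// lerD2l ler_wpM2l// /N.
  apply: (le_trans (sqr_sum_ord _)); rewrite mulr_sumr.
  by apply: ler_sum => k _; rewrite exprMn.
rewrite (ExD (L1Z _ Lr2) (L1Z _ LN2)) (ExZ _ Lr2) (ExZ _ LN2) [leRHS]mulrDl lerD//.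
  rewrite -mulrA ler_wpM2l// (le_trans Er)// ler_wpM2l// expr2 ger_pMl//.
  by rewrite lerBlDl.
rewrite -mulrA ler_wpM2l// Ex_sum; last by move=> k _; exact: L1Z.
apply: (@le_trans _ _ (D i * (t - s))); last first.
  by rewrite ler_wpM2r ?(ltW h0)// (bigD1 i)//= lerDl sumr_ge0.
rewrite /D -mulrA mulr_suml mulr_sumr; apply: ler_sum => k _.
have [_ E2 _ _ _] := Ex_inc hW (iota k) s0 st'.
rewrite ExZ// ExZ ?E2//; by have [] := L2_inc hW (iota k) s0 st'.
Qed.

(** Freezing the drift at the left end gains a factor h: by the Lipschitz property its mean square
    variation is of the order of that of the state. *)
Lemma resid_drift : exists2 C, 0 <= C & forall l (s h : R), 0 <= s -> 0 < h <= 1 ->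
  L2 (fun w => resid l s (s + h) w - h * b l s w) /\
  Ex (fun w => (resid l s (s + h) w - h * b l s w) ^+ 2) <= C * h ^+ 3.
Proof.
have [C C0 HC] := state_increment; have [C' C'0 HC'] := drift_L2.
exists (L ^+ 2 * (n%:R * C)); first by rewrite mulr_ge0 ?sqr_ge0 ?mulr_ge0.
move=> l s h s0 /andP[h0 h1].
have -> : L ^+ 2 * (n%:R * C) * h ^+ 3 = h ^+ 2 * (L ^+ 2 * (n%:R * (C * h))) by ring.
apply: resid_sq => //; first by have [[]] := HC' s l s0.
move=> z /andP[sz zh]; have z0 := le_trans s0 sz.
have LD : L2 (fun w => b l z w - b l s w).
  by apply: L2B; [have [] := HC' z l z0|have [] := HC' s l s0].
have z1 : s <= z <= s + 1 by rewrite sz/= (le_trans zh)// lerD2l.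
have Li i : L1 (fun w => (Y z w i 0 - Y s w i 0) ^+ 2) by have [[]] := HC i s z s0 z1.
have LS : L1 (fun w => \sum_i (Y z w i 0 - Y s w i 0) ^+ 2) by apply: L1_sum.
split=> //; apply: (@le_trans _ _ (Ex (fun w => L ^+ 2 * \sum_i (Y z w i 0 - Y s w i 0) ^+ 2))).
  apply: Ex_le => [||w]; [by case: LD|exact: L1Z|].
  apply: (@le_trans _ _ ((L * `|Y z w - Y s w|) ^+ 2)).
    rewrite -[leLHS]real_normK ?num_real// ler_sqr ?nnegrE ?mulr_ge0//.
    apply: le_trans (BL _ _); rewrite /b.
    by have := mx_norm_coord (B (Y z w) - B (Y s w)) l 0; rewrite !mxE.
  rewrite exprMn ler_wpM2l ?sqr_ge0// (le_trans (normE2 _))//.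
  by apply: ler_sum => i _; rewrite !mxE.
rewrite ExZ// ler_wpM2l ?sqr_ge0// Ex_sum//.
rewrite [leRHS]mulr_natl -[X in _ *+ X]card_ord -sumr_const; apply: ler_sum => i _.
have [_ Ei] := HC i s z s0 z1; rewrite (le_trans Ei)// ler_wpM2l//.
by rewrite lerBlDl.
Qed.

(* The Euler scheme is a function of the past increments of the noise, hence
   independent of the coming one. With a truncated drift the sums of drift
   times increment are therefore orthogonal; Fatou's lemma removes first the
   discretization, then the truncation. *)
Fixpoint euler (a : R) (k : nat) (w : T) : 'cV[R]_n :=
  if k is k'.+1 then
    euler a k' w + a *: B (euler a k' w)
    + S *m \col_i inc W (iota i) (k'%:R * a) (k'.+1%:R * a) w
  else c.

(** Discrete Gronwall inequality: if the path oscillates by at most [m] within a step, the errors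
    satisfy e' <= e + L a (m + e), so that e + m grows by at most the factor 1 + L a. *)
Let euler_err : {ae P, forall w, forall (a m : R) (K : nat), 0 < a -> 0 <= m ->
  (forall k z, (k < K)%N -> k%:R * a <= z <= k.+1%:R * a -> `|Y z w - Y (k%:R * a) w| <= m) ->
  forall k, (k <= K)%N -> `|Y (k%:R * a) w - euler a k w| <= m * ((1 + L * a) ^+ k - 1)}.
Proof.
have [_ _ hae] := hY.
have W0 : {ae P, forall w, forall j, W j 0 w = 0}.
  have hW0 j : {ae P, forall w, W j 0 w = 0} by case: hW => /(_ j) [].
  exact: filter_forall.
apply: filterS3 resid_osc hae W0 => w osc hw w0 a m K a0 m0 Hm.
elim=> [_|k IH kK].
  rewrite expr0 subrr mulr0 mul0r /= hw// (_ : \col_i _ = 0); last first.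
    by apply/colP => i; rewrite !mxE set_itv1 Rintegral_set1.
  rewrite (_ : \col_k _ = 0) ?mulmx0 ?addr0 ?subrr ?normr0//.
  by apply/colP => i; rewrite !mxE w0.
have {}IH := IH (ltnW kK); set ek := `|Y (k%:R * a) w - euler a k w| in IH.
have G0 : 0 <= m * ((1 + L * a) ^+ k.+1 - 1).
  rewrite mulr_ge0// subr_ge0 exprn_ege1// lerDl mulr_ge0// ltW//.
apply: mx_norm_le => // i j; rewrite ord1 /=.
have kS : k.+1%:R * a - k%:R * a = a by rewrite -natr1; ring.
have ka0 : 0 <= k%:R * a by rewrite mulr_ge0// ltW.
have kle : k%:R * a <= k.+1%:R * a by rewrite -subr_ge0 kS ltW.
have := osc i (k%:R * a) (k.+1%:R * a) (B (euler a k w) i 0) (L * (m + ek)) ka0 kle.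
rewrite kS => /(_ _)/= H.
rewrite !mxE; set A := \sum_(_ <- _ | _) _.
have -> : Y (k.+1%:R * a) w i 0 - (euler a k w i 0 + a * B (euler a k w) i 0 + A)
   = (Y (k%:R * a) w - euler a k w) i 0
     + (resid i (k%:R * a) (k.+1%:R * a) w - a * B (euler a k w) i 0).
  rewrite !mxE /resid /A; under eq_bigr do rewrite mxE; ring.
rewrite (le_trans (ler_normD _ _))//.
apply: (@le_trans _ _ (ek + a * (L * (m + ek)))).
  apply: lerD; first exact: mx_norm_coord.
  apply: H => z zk.
  have := mx_norm_coord (B (Y z w) - B (euler a k w)) i 0; rewrite !mxE => /le_trans; apply.
  rewrite (le_trans (BL _ _))// ler_wpM2l//.
  rewrite -(subrKA (Y (k%:R * a) w)) (le_trans (ler_normD _ _))// lerD2r.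
  exact: Hm.
have La : 0 <= L * a by rewrite mulr_ge0// ltW.
rewrite exprS.
set X := (1 + L * a) ^+ k in IH *; nra.
Qed.

(** With mesh t / (m + 1), the time i t is a grid point of every scheme, of index i (m + 1). *)
Let euler_cvg (t : R) (N : nat) : 0 < t -> {ae P, forall w, forall i, (i <= N)%N ->
  euler (t / m.+1%:R) (i * m.+1) w @[m --> \oo] --> Y (i%:R * t) w}.
Proof.
move=> t0; apply: filterS euler_err => w err i iN.
apply/cvgrPdist_le => /= e e0.
(* Dominates every Gronwall factor (1 + L a)^k up to time N t, whatever the mesh. *)
pose g := expR (L * (N%:R * t)).
have eg : 0 < e / g by rewrite divr_gt0 ?expR_gt0.
have [dl dl0 Hd] := path_unif w (N%:R * t) eg.
near=> m; set a := t / m.+1%:R.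
have a0 : 0 < a by rewrite divr_gt0.
have adl : a < dl.
  rewrite ltr_pdivrMr// mulrC -ltr_pdivrMr//.
  by apply: (@lt_trans _ _ m%:R); [near: m; exact: nbhs_infty_gtr|rewrite ltr_nat].
have am : m.+1%:R * a = t by rewrite mulrC divfK.
have Ka : (i * m.+1)%:R * a = i%:R * t by rewrite natrM -mulrA am.
have -> : i%:R * t = (i * m.+1)%:R * a by [].
have := @err a (e / g) (i * m.+1)%N a0 (ltW eg) _ (i * m.+1)%N (leqnn _).
rewrite Ka => H; apply: (le_trans (H _)).
  move=> k z kK /andP[z1 z2]; apply: ltW; rewrite distrC.
  have ka0 : 0 <= k%:R * a by rewrite mulr_ge0// ltW.
  apply: Hd; last 1 first.
  - rewrite distrC ger0_norm ?subr_ge0// (le_lt_trans _ adl)//.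
    by rewrite lerBlDl -[X in _ + X]mul1r -mulrDl natr1.
  - rewrite ka0/= (@le_trans _ _ ((i * m.+1)%:R * a))// ?Ka ?ler_wpM2r ?(ltW t0) ?ler_nat//.
    by rewrite -Ka ler_wpM2r ?(ltW a0)// ler_nat ltnW.
  - exact: le_trans z1.
have La : 0 <= L * a by rewrite mulr_ge0// ltW.
apply: (@le_trans _ _ (e / g * g)); last by rewrite divfK// gt_eqF// expR_gt0.
rewrite ler_wpM2l ?(ltW eg)//; apply: (@le_trans _ _ ((1 + L * a) ^+ (i * m.+1))).
  by rewrite gerBl.
apply: (@le_trans _ _ (expR (L * a) ^+ (i * m.+1))).
  by apply: lerXn2r; rewrite ?nnegrE ?expR_ge0 ?addr_ge0// expR_ge1Dx.
rewrite -expRM_natl ler_expR mulrCA Ka ler_wpM2l// ler_wpM2r ?(ltW t0)//.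
by rewrite ler_nat.
Unshelve. all: by end_near.
Qed.

Let grid_le (a : R) : 0 < a -> forall k, k%:R * a <= k.+1%:R * a.
Proof. by move=> a0 k; rewrite ler_wpM2r ?(ltW a0)// ler_nat. Qed.

Let euler_past (a : R) (N : nat) (k : nat) : 0 < a -> (k <= N)%N ->
  @random_vector _ (g_sigma_algebraType (@grid_block d T R J W N (fun k => k%:R * a)
    (fun ij => ij.1 < k)%N)) R n (euler a k).
Proof.
move=> a0; elim: k => [|k IH] kN i /=; first exact: measurable_cst.
have {}IH := IH (ltnW kN).
have sub (f : T -> R) := @block_sub _ _ R _ (@grid_sys d T R J W N (fun k => k%:R * a)) (fun ij => ij.1 < k)%N (fun ij => ij.1 < k.+1)%N f (fun ij => @ltnW _ _).
have mS : measurable_fun [set: g_sigma_algebraType (@grid_block d T R J W N (fun k => k%:R * a)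
    (fun ij => ij.1 < k.+1)%N)] (fun w => \sum_j S i j * inc W (iota j) (k%:R * a) (k.+1%:R * a) w).
  apply: measurable_sum => j; apply: measurable_funM => //.
  by apply: (@inc_block _ _ _ _ _ N (fun k => k%:R * a) _ (Ordinal kN) (iota j)).
have -> : (fun w => (euler a k w + a *: B (euler a k w)
    + S *m \col_j inc W (iota j) (k%:R * a) (k.+1%:R * a) w) i 0)
  = (fun w => euler a k w i 0 + a * B (euler a k w) i 0
     + \sum_j S i j * inc W (iota j) (k%:R * a) (k.+1%:R * a) w).
  by apply/funext => w; rewrite !mxE; congr (_ + _); apply: eq_bigr => j _; rewrite mxE.
apply: measurable_funD; last exact: mS.
apply: measurable_funD; first by apply: sub; exact: (IH i).
apply: measurable_funM => //; apply: sub.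
apply: (continuous_random_vector IH (f := fun v => B v i 0)) => x.
apply: (cvg_comp B (fun v : 'cV_n => v i 0)); [exact: B_cont|exact: coord_continuous].
Qed.

Let inc_past (a : R) (N : nat) (A : pred ('I_N * J)) (lo hi : nat) (j : J) : (lo <= hi <= N)%N ->
  (forall k : 'I_N, (lo <= k < hi)%N -> A (k, j)) ->
  measurable_fun [set: g_sigma_algebraType (@grid_block d T R J W N (fun k => k%:R * a) A)]
    (inc W j (lo%:R * a) (hi%:R * a)).
Proof.
elim: hi => [|hi IH] /andP[lh hN] HA.
  move: lh; rewrite leqn0 => /eqP ->.
  by rewrite (_ : inc _ _ _ _ = cst 0)//; apply/funext => w; rewrite /inc subrr.
move: lh; rewrite leq_eqVlt => /predU1P[->|lh].
  by rewrite (_ : inc _ _ _ _ = cst 0)//; apply/funext => w; rewrite /inc subrr.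
have -> : inc W j (lo%:R * a) (hi.+1%:R * a) =
    (fun w => inc W j (lo%:R * a) (hi%:R * a) w + inc W j (hi%:R * a) (hi.+1%:R * a) w).
  by apply/funext => w; rewrite /inc; ring.
apply: measurable_funD.
  apply: IH => [|k /andP[lk kh]]; first by rewrite -ltnS lh ltnW.
  by apply: HA; rewrite lk ltnW.
apply: (@inc_block _ _ _ _ _ N (fun k => k%:R * a) A (Ordinal hN) j).
by apply: HA; rewrite /= -ltnS lh /=.
Qed.

Let trunc (K x : R) : R := Num.max (- K) (Num.min K x).

Let trunc_cont K : continuous (trunc K).
Proof.
move=> x; apply: (@continuous_max R R (fun=> - K) (fun x => Num.min K x)); first exact: cvg_cst.
by apply: (@continuous_min R R (fun=> K) id); [exact: cvg_cst|exact: cvg_id].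
Qed.

Let trunc_bnd K x : 0 <= K -> `|trunc K x| <= K.
Proof.
move=> K0; rewrite ler_norml /trunc le_max lexx/= ge_max ge_min lexx orTb andbT.
by rewrite ge0_cp.
Qed.

Let trunc_le K x : 0 <= K -> `|trunc K x| <= `|x|.
Proof.
move=> K0; rewrite /trunc; have [xK|Kx] := leP K x.
  rewrite max_r ?ge0_cp// !ger0_norm//; exact: le_trans xK.
have [xK|Kx'] := leP x (- K) => //.
rewrite normrN ger0_norm// ler0_norm; first by rewrite lerNr.
by rewrite (le_trans xK)// oppr_le0.
Qed.

Let trunc_cvg x : trunc m%:R x @[m --> \oo] --> x.
Proof.
apply: cvg_near_cst; near=> m.
have : `|x| <= m%:R by near: m; exact: nbhs_infty_ger.
by rewrite ler_norml /trunc => /andP[xm mx]; rewrite min_r// max_r.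
Unshelve. all: by end_near.
Qed.

Section bound.
Context (l : 'I_n) (j : J) (h : R) (N : nat).
Hypothesis h0 : 0 < h.

Let dw (i : nat) w := inc W j (i%:R * h) (i.+1%:R * h) w.

Let dwE (m i : nat) : dw i = inc W j ((i * m.+1)%:R * (h / m.+1%:R)) ((i.+1 * m.+1)%:R * (h / m.+1%:R)).
Proof.
have E k : (k * m.+1)%:R * (h / m.+1%:R) = k%:R * h.
  by rewrite natrM -mulrA [m.+1%:R * _]mulrC divfK.
by rewrite /dw !E.
Qed.

Let dw_moments i : [/\ L2 (dw i), Ex (dw i) = 0 & Ex (fun w => dw i w ^+ 2) = h].
Proof.
have i0 : 0 <= i%:R * h by rewrite mulr_ge0// ltW.
have ii : i%:R * h < i.+1%:R * h by rewrite ltr_pM2r// ltr_nat.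
have [E1 E2 _ _ _] := Ex_inc hW j i0 ii.
split=> //; first exact: (L2_inc hW).
by rewrite [LHS]E2 -natr1; ring.
Qed.

Let euler_noise (K : R) (m : nat) : 0 <= K ->
  let a i w := trunc K (B (euler (h / m.+1%:R) (i * m.+1) w) l 0) in
  L2 (fun w => \sum_(0 <= i < N) a i w * dw i w) /\
  Ex (fun w => (\sum_(0 <= i < N) a i w * dw i w) ^+ 2)
    = h * \sum_(0 <= i < N) Ex (fun w => a i w ^+ 2).
Proof.
move=> K0 a.
have a0 : 0 < h / m.+1%:R by rewrite divr_gt0.
pose tt k : R := k%:R * (h / m.+1%:R).
have tt0 : 0 <= tt 0%N by rewrite /tt mul0r.
pose M := (N * m.+1)%N.
have lt1 i k : (i < k)%N -> (i.+1 * m.+1 <= k * m.+1)%N by move=> ik; rewrite leq_mul2r ik orbT.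
have ma k i : (k <= i)%N -> (i < N)%N -> measurable_fun
    [set: g_sigma_algebraType (@grid_block d T R J W M tt (fun ij => ij.1 < i * m.+1)%N)] (a k).
  move=> ki iN; apply: (@block_sub _ _ R _ (@grid_sys d T R J W M tt) (fun ij => ij.1 < k * m.+1)%N).
    by move=> ij /= /leq_trans; apply; rewrite leq_mul2r ki orbT.
  have kM : (k * m.+1 <= M)%N by rewrite leq_mul2r (leq_trans ki (ltnW iN)) orbT.
  apply: (continuous_random_vector (euler_past a0 kM) (f := fun v => trunc K (B v l 0))) => x.
  apply: (cvg_comp (fun v => B v l 0) (trunc K)); last exact: trunc_cont.
  apply: (cvg_comp B (fun v : 'cV_n => v l 0)); [exact: B_cont|exact: coord_continuous].
have mdw k i : (k < i)%N -> (i < N)%N -> measurable_fun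
    [set: g_sigma_algebraType (@grid_block d T R J W M tt (fun ij => ij.1 < i * m.+1)%N)] (dw k).
  move=> ki iN; rewrite (dwE m); apply: inc_past.
    by rewrite leq_mul2r leqnSn orbT leq_mul2r (leq_trans ki (ltnW iN)) orbT.
  by move=> x /= /andP[_ /leq_trans]; apply; exact: lt1.
have fdw i : (i < N)%N -> measurable_fun
    [set: g_sigma_algebraType (@grid_block d T R J W M tt (fun ij => i * m.+1 <= ij.1)%N)] (dw i).
  move=> iN; rewrite (dwE m); apply: inc_past.
    by rewrite leq_mul2r leqnSn orbT leq_mul2r iN orbT.
  by move=> x /= /andP[].
(* Index [i * m.+1] of the fine grid is the time i h: the steps before it are the past, those from
   it on the future. *)
have gi (i : nat) := @grid_indep2 _ _ _ P _ _ hW M tt tt0 (grid_le a0)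
  (fun ij => ij.1 < i * m.+1)%N (fun ij => i * m.+1 <= ij.1)%N.
have dis (i : nat) (ij : 'I_M * J) : (ij.1 < i * m.+1)%N -> ~~ (i * m.+1 <= ij.1)%N by rewrite ltnNge.
apply: (@orthogonal_sum _ T R P N a dw K h).
- move=> i iN; have [Ld E0 E2] := dw_moments i; split=> //.
    exact: (grid_block_meas hW tt0 (grid_le a0) (ma i i (leqnn _) iN)).
  by move=> w; exact: trunc_bnd.
- move=> i iN; apply: (gi i); first exact: dis.
    by apply: measurable_funX; exact: (ma i i (leqnn i)).
  by apply: measurable_funX; exact: fdw.
- move=> i iN; apply: (gi i); [exact: dis| |exact: fdw].
  apply: measurable_funM; last exact: (ma i i (leqnn i)).
  have -> : (fun w => \sum_(0 <= k < i) a k w * dw k w) = (fun w => \sum_(k < i) a k w * dw k w).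
    by apply/funext => w; rewrite big_mkord.
  apply: measurable_sum => k; apply: measurable_funM; first exact: (ma k i (ltnW (ltn_ord k)) iN).
  exact: (mdw k i (ltn_ord k) iN).
Qed.

Let drift_cvg : {ae P, forall w, forall K i, (i <= N)%N ->
  trunc K (B (euler (h / m.+1%:R) (i * m.+1) w) l 0) @[m --> \oo] --> trunc K (b l (i%:R * h) w)}.
Proof.
apply: filterS (euler_cvg N h0) => w H K i iN.
apply: (cvg_comp (fun m => euler (h / m.+1%:R) (i * m.+1) w) (fun v => trunc K (B v l 0)) (H i iN)).
apply: (cvg_comp (fun v => B v l 0) (trunc K)); last exact: trunc_cont.
apply: (cvg_comp B (fun v : 'cV_n => v l 0)); [exact: B_cont|exact: coord_continuous].
Qed.

Let ih0 i : 0 <= i%:R * h. Proof. by rewrite mulr_ge0// ltW. Qed.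

Let mtrunc K i : measurable_fun [set: T] (fun w => trunc K (b l (i%:R * h) w)).
Proof.
apply: (continuous_random_vector (Y_rv (ih0 i)) (f := fun v => trunc K (B v l 0))) => x.
apply: (cvg_comp (fun v => B v l 0) (trunc K)); last exact: trunc_cont.
apply: (cvg_comp B (fun v : 'cV_n => v l 0)); [exact: B_cont|exact: coord_continuous].
Qed.

Let msum (a : nat -> T -> R) : (forall i, measurable_fun [set: T] (a i)) ->
  measurable_fun [set: T] (fun w => \sum_(0 <= i < N) a i w * dw i w).
Proof.
move=> ma; have -> : (fun w => \sum_(0 <= i < N) a i w * dw i w) = (fun w => \sum_(i < N) a i w * dw i w).
  by apply/funext => w; rewrite big_mkord.
by apply: measurable_sum => i; apply: measurable_funM => //; have [[]] := dw_moments i.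
Qed.

Let trunc_noise (K : R) : 0 <= K ->
  L2 (fun w => \sum_(0 <= i < N) trunc K (b l (i%:R * h) w) * dw i w) /\
  Ex (fun w => (\sum_(0 <= i < N) trunc K (b l (i%:R * h) w) * dw i w) ^+ 2)
    <= h * \sum_(0 <= i < N) Ex (fun w => trunc K (b l (i%:R * h) w) ^+ 2).
Proof.
move=> K0; pose a m i w := trunc K (B (euler (h / m.+1%:R) (i * m.+1) w) l 0).
apply: (@ae_cvg_fatou _ _ _ P (fun m w => \sum_(0 <= i < N) a m i w * dw i w) _
  (fun m => h * \sum_(0 <= i < N) Ex (fun w => a m i w ^+ 2))).
- by move=> m; have [[]] := euler_noise m K0.
- by apply: msum => i; exact: mtrunc.
- by move=> m; have [[]] := euler_noise m K0.
- apply: filterS drift_cvg => w H.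
  apply: cvg_sum_nat => i iN; apply: cvgMr_tmp.
  exact: H (ltnW iN).
- by move=> m; have [_ <-] := euler_noise m K0.
- apply: cvgMr; apply: cvg_sum_nat => i iN.
  apply: (@ae_cvg_Ex _ _ _ P _ _ (fun=> K ^+ 2)).
  + move=> m; apply: measurable_funX.
    have a0 : 0 < h / m.+1%:R by rewrite divr_gt0.
    have tt0 : 0 <= 0%:R * (h / m.+1%:R) by rewrite mul0r.
    apply: (grid_block_meas hW tt0 (grid_le a0)).
    apply: (continuous_random_vector (euler_past a0 (leqnn (i * m.+1))) (f := fun v => trunc K (B v l 0))) => x.
    apply: (cvg_comp (fun v => B v l 0) (trunc K)); last exact: trunc_cont.
    apply: (cvg_comp B (fun v : 'cV_n => v l 0)); [exact: B_cont|exact: coord_continuous].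
  + exact/measurable_funX/mtrunc.
  + apply: filterS drift_cvg => w H; rewrite expr2.
    rewrite (_ : (fun m => _) = (fun m => a m i w * a m i w)); last by apply/funext => m; rewrite expr2.
    by apply: cvgM; exact: H (ltnW iN).
  + exact: L1_cst.
  + by move=> m w; rewrite normrX lerXn2r ?nnegrE// trunc_bnd.
Qed.

(** Orthogonality makes this second moment of order N h, where the triangle inequality would give
    N^2 h. *)
Lemma drift_noise (C : R) : (forall (t : R), 0 <= t ->
    L2 (b l t) /\ Ex (fun w => b l t w ^+ 2) <= C) ->
  L2 (fun w => \sum_(0 <= i < N) b l (i%:R * h) w * dw i w) /\
  Ex (fun w => (\sum_(0 <= i < N) b l (i%:R * h) w * dw i w) ^+ 2) <= C * (N%:R * h).
Proof.
move=> HC.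
apply: (@ae_cvg_fatou _ _ _ P (fun m w => \sum_(0 <= i < N) trunc m%:R (b l (i%:R * h) w) * dw i w) _
  (fun=> C * (N%:R * h))).
- by move=> m; have [[]] := trunc_noise (ler0n R m).
- by apply: msum => i; exact: b_meas.
- by move=> m; have [[]] := trunc_noise (ler0n R m).
- apply: aeW => w; apply: cvg_sum_nat => i _; apply: cvgMr_tmp.
  exact: trunc_cvg.
- move=> m; have [_ /le_trans] := trunc_noise (ler0n R m); apply.
  have -> : C * (N%:R * h) = h * \sum_(0 <= i < N) C.
    by rewrite sumr_const_nat subn0 -mulr_natl; ring.
  rewrite ler_wpM2l ?(ltW h0)//; apply: ler_sum => i _.
  have [[_ Lb] Eb] := HC _ (ih0 i); apply: le_trans Eb; apply: Ex_le => //.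
    by apply: (L1_dom _ Lb) => [|w]; [exact/measurable_funX/mtrunc|
      rewrite normrX -[leRHS]real_normK ?num_real// lerXn2r ?nnegrE// trunc_le].
  by move=> w; rewrite -[leLHS]real_normK ?num_real// -[leRHS]real_normK ?num_real// lerXn2r ?nnegrE// trunc_le.
- exact: cvg_cst.
Qed.
End bound.

End drift.

(** * The class of negligible remainders and its linear structure *)

Section small_residuals.
Context d (T : measurableType d) (R : realType) (P : probability T R).
Local Notation Ex := (expect P).
Local Notation L1 := (L1 P).
Local Notation L2 := (L2 P).
Context (J : finType) (W : J -> R -> T -> R).

Definition step (u : R -> R -> T -> R) (h : R) (i : nat) := u (i%:R * h) (i.+1%:R * h).

(* Cauchy-Schwarz and the first bound would only give [N * h * sqrt h] in the
   second one; the gain comes from [drift_noise]. *)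
Definition small_resid (u : R -> R -> T -> R) := exists2 C, 0 <= C & forall h, 0 < h <= 1 ->
  (forall i, L2 (step u h i) /\ Ex (fun w => step u h i w ^+ 2) <= C * h ^+ 2) /\
  (forall j N, L1 (fun w => \sum_(0 <= i < N) step u h i w * step (inc W j) h i w) /\
     Ex (fun w => `|\sum_(0 <= i < N) step u h i w * step (inc W j) h i w|)
     <= C * (Num.sqrt N%:R * h * (Num.sqrt N%:R * h + Num.sqrt h))).

Let Z0 N (h : R) : 0 < h -> 0 <= Num.sqrt (N%:R : R) * h * (Num.sqrt N%:R * h + Num.sqrt h).
Proof. by move=> h0; rewrite !mulr_ge0 ?addr_ge0 ?mulr_ge0 ?sqrtr_ge0 ?(ltW h0). Qed.

Lemma small_residZ a u : small_resid u -> small_resid (fun s t w => a * u s t w).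
Proof.
move=> [C C0 H]; exists (a ^+ 2 * C + `|a| * C).
  by apply: addr_ge0; apply: mulr_ge0 => //; exact: sqr_ge0.
move=> h h01; have /andP[h0 h1] := h01; have [H1 H2] := H h h01; split=> [i|j N].
  have [Lu Eu] := H1 i; split; first exact: L2Z.
  rewrite (_ : (fun w => _) = (fun w => a ^+ 2 * step u h i w ^+ 2)); last first.
    by apply/funext => w; rewrite /step exprMn.
  rewrite ExZ; last by case: Lu.
  rewrite mulrDl ler_wpDr ?mulr_ge0 ?sqr_ge0 ?(ltW h0)//.
  by rewrite -[leRHS]mulrA ler_wpM2l ?sqr_ge0.
have [Lu Eu] := H2 j N.
have E w : \sum_(0 <= i < N) step (fun s t w => a * u s t w) h i w * step (inc W j) h i w
  = a * \sum_(0 <= i < N) step u h i w * step (inc W j) h i w.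
  by rewrite mulr_sumr; apply: eq_bigr => i _; rewrite /step mulrA.
rewrite (_ : (fun w => \sum_(0 <= i < N) _) = (fun w => a * \sum_(0 <= i < N) step u h i w * step (inc W j) h i w)); last exact/funext.
rewrite (_ : (fun w => `|_|) = (fun w => `|a| * `|\sum_(0 <= i < N) step u h i w * step (inc W j) h i w|)); last first.
  by apply/funext => w; rewrite E normrM.
split; first exact: L1Z.
rewrite ExZ; last exact: L1_norm.
have p0 : 0 <= a ^+ 2 * C by apply: mulr_ge0 => //; exact: sqr_ge0.
rewrite mulrDl; apply: ler_wpDl; first by apply: mulr_ge0 => //; exact: Z0.
by rewrite -[leRHS]mulrA ler_wpM2l.
Qed.

Lemma small_residD u v : small_resid u -> small_resid v ->
  small_resid (fun s t w => u s t w + v s t w).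
Proof.
move=> [C C0 H] [D D0 G]; exists (2 * C + 2 * D); first by rewrite addr_ge0// mulr_ge0.
move=> h h01; have /andP[h0 h1] := h01.
have [H1 H2] := H h h01; have [G1 G2] := G h h01; split=> [i|j N].
  have [Lu Eu] := H1 i; have [Lv Ev] := G1 i; split; first exact: L2D.
  have Lu2 : L1 (fun w => step u h i w ^+ 2) by case: Lu.
  have Lv2 : L1 (fun w => step v h i w ^+ 2) by case: Lv.
  have [_ L] := L2D Lu Lv.
  apply: (@le_trans _ _ (Ex (fun w => 2 * step u h i w ^+ 2 + 2 * step v h i w ^+ 2))).
    apply: Ex_le => [||w]; [exact: L|by apply: L1D; exact: L1Z|].
    rewrite -[step _ _ _ _]/(step u h i w + step v h i w).
    by have := sqr_ge0 (step u h i w - step v h i w); nra.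
  rewrite (ExD (L1Z 2 Lu2) (L1Z 2 Lv2)) !ExZ// [leRHS]mulrDl.
  by rewrite -!mulrA lerD// ler_wpM2l.
have [Lu Eu] := H2 j N; have [Lv Ev] := G2 j N.
set Su := (fun w => \sum_(0 <= i < N) step u h i w * _) in Lu Eu.
set Sv := (fun w => \sum_(0 <= i < N) step v h i w * _) in Lv Ev.
have E w : \sum_(0 <= i < N) step (fun s t w => u s t w + v s t w) h i w * step (inc W j) h i w
  = Su w + Sv w.
  by rewrite -big_split; apply: eq_bigr => i _; rewrite /step mulrDl.
rewrite (_ : (fun w => \sum_(0 <= i < N) _) = (fun w => Su w + Sv w)); last exact/funext.
rewrite (_ : (fun w => `|_|) = (fun w => `|Su w + Sv w|)); last first.
  by apply/funext => w; rewrite E.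
split; first exact: L1D.
apply: (@le_trans _ _ (Ex (fun w => `|Su w| + `|Sv w|))).
  by apply: Ex_le => [||w]; [exact/L1_norm/L1D|apply: L1D; exact: L1_norm|exact: ler_normD].
rewrite (ExD (L1_norm Lu) (L1_norm Lv)) mulrDl.
apply: lerD; [apply: (le_trans Eu)|apply: (le_trans Ev)];
  by rewrite ler_wpM2r ?Z0// ler_peMl// ler1n.
Qed.

Lemma small_resid0 : small_resid (fun _ _ _ => 0).
Proof.
exists 0 => // h h01; split=> [i|j N].
  split; first exact: L2_cst.
  by rewrite (_ : (fun w => _) = (fun=> 0)) ?Ex_cst ?mul0r//; apply/funext => w; rewrite /step expr0n.
rewrite (_ : (fun w => \sum_(0 <= i < N) _) = (fun=> 0)); last first.
  by apply/funext => w; rewrite big1// => i _; rewrite /step mul0r.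
rewrite (_ : (fun w => `|_|) = (fun=> 0)); last first.
  by apply/funext => w; rewrite big1 ?normr0// => i _; rewrite /step mul0r.
by split; [exact: L1_cst|rewrite Ex_cst mul0r].
Qed.

Lemma small_resid_sum (I : Type) (s : seq I) (u : I -> R -> R -> T -> R) :
  (forall i, small_resid (u i)) -> small_resid (fun r t w => \sum_(i <- s) u i r t w).
Proof.
move=> H; elim: s => [|i s IH].
  rewrite (_ : (fun r t w => _) = (fun _ _ _ => 0)); first exact: small_resid0.
  by apply/funext => r; apply/funext => t; apply/funext => w; rewrite big_nil.
rewrite (_ : (fun r t w => _) = (fun r t w => u i r t w + \sum_(i <- s) u i r t w)).
  exact: small_residD.
by apply/funext => r; apply/funext => t; apply/funext => w; rewrite big_cons.
Qed.

End small_residuals.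

Section small_drift.
Context d (T : measurableType d) (R : realType) (P : probability T R).
Local Notation Ex := (expect P).
Local Notation L1 := (L1 P).
Local Notation L2 := (L2 P).
Context (J : finType) (W : J -> R -> T -> R) (hW : noise_family P W).
Context (n r : nat) (B : 'cV[R]_n -> 'cV[R]_n) (S : 'M[R]_(n, r)) (c : 'cV[R]_n).
Context (iota : 'I_r -> J) (Y : R -> T -> 'cV[R]_n).
Hypothesis hY : sde_solution P B S c (fun t w => \col_k W (iota k) t w) Y.
Hypothesis B_lip : lipschitz B.
Hypothesis Y_mom : bounded_moments P Y.

Lemma resid_small l : small_resid P W (resid W S iota Y l).
Proof.
have [C C0 HC] := resid_L2 hW hY B_lip Y_mom.
have [D D0 HD] := resid_drift hW hY B_lip Y_mom.
have [E E0 HE] := drift_L2 hY B_lip Y_mom.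
exists (C + D + E + 1); first by rewrite !addr_ge0.
move=> h h01; have /andP[h0 h1] := h01.
have ih0 i : 0 <= i%:R * h by rewrite mulr_ge0// ltW.
have iS i : i.+1%:R * h = i%:R * h + h by rewrite -natr1; ring.
split=> [i|j N].
  have [Lu Eu] := HC l _ _ (ih0 i) h0; rewrite /step iS; split=> //.
  by rewrite (le_trans Eu)// ler_wpM2r ?sqr_ge0// -!addrA lerDl !addr_ge0.
have [->|N1] := posnP N.
  rewrite (_ : (fun w => \sum_(0 <= i < 0) _) = (fun=> 0)); last first.
    by apply/funext => w; rewrite big_geq.
  rewrite (_ : (fun w => `|_|) = (fun=> 0)); last first.
    by apply/funext => w; rewrite big_geq// normr0.
  by split; [exact: L1_cst|rewrite Ex_cst sqrtr0 !mul0r mulr0].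
pose b i w := B (Y (i%:R * h) w) l 0; pose x i := step (inc W j) h i.
pose rho i w := step (resid W S iota Y l) h i w - h * b i w.
have Lrho i : L2 (rho i) /\ Ex (fun w => rho i w ^+ 2) <= D * h ^+ 3.
  by rewrite /rho /step iS; exact: HD.
have Lx i : L2 (x i) /\ Ex (fun w => x i w ^+ 2) = h.
  have lt : i%:R * h < i.+1%:R * h by rewrite iS ltrDl.
  split; first exact: (L2_inc hW).
  by have [_ E2 _ _ _] := Ex_inc hW j (ih0 i) lt; rewrite [LHS]E2 iS; ring.
have [LM EM] := drift_noise hW hY B_lip (l := l) j N h0 (fun t t0 => HE t l t0).
set M := (fun w => \sum_(0 <= i < N) _) in LM EM.
pose rx (i : 'I_N) w := rho i w * x i w.
have Lrx i : L1 (rx i) by apply: L2M; [case: (Lrho i)|case: (Lx i)].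
have Lsrx : L1 (fun w => \sum_i rx i w) by apply: L1_sum.
have LhM : L1 (fun w => h * M w) by apply: L1Z; exact: L2_L1.
have E1 w : \sum_(0 <= i < N) step (resid W S iota Y l) h i w * x i w
  = \sum_i rx i w + h * M w.
  rewrite big_mkord /M big_mkord mulr_sumr -big_split; apply: eq_bigr => i _.
  by rewrite /rx /rho /= -/(b i w) -[inc W j _ _ w]/(x i w); ring.
rewrite (_ : (fun w => \sum_(0 <= i < N) _) = (fun w => \sum_i rx i w + h * M w)); last exact/funext.
rewrite (_ : (fun w => `|_|) = (fun w => `|\sum_i rx i w + h * M w|)); last first.
  by apply/funext => w; rewrite E1.
split; first exact: L1D.
apply: (@le_trans _ _ (Ex (fun w => \sum_i `|rx i w| + `|h * M w|))).
  apply: Ex_le => [||w]; [exact/L1_norm/L1D| |].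
    by apply: L1D; [apply: L1_sum => i _; exact: L1_norm|exact: L1_norm].
  by rewrite (le_trans (ler_normD _ _))// lerD2r ler_norm_sum.
rewrite ExD; [|by apply: L1_sum => i _; exact: L1_norm|exact: L1_norm].
rewrite Ex_sum; last by move=> i _; exact: L1_norm.
have N0 : 0 <= N%:R :> R by [].
have s2 : Num.sqrt (N%:R : R) ^+ 2 = N%:R by rewrite sqr_sqrtr.
have t2 : Num.sqrt h ^+ 2 = h by rewrite sqr_sqrtr// ltW.
have B1 : \sum_i Ex (fun w => `|rx i w|) <= (D + 1) * (N%:R * h ^+ 2).
  rewrite mulrCA mulr_natl -[X in _ *+ X]card_ord -sumr_const; apply: ler_sum => i _.
  (* The weight 1 / h balances the moments D h^3 and h, giving (D + 1) h^2 per step. *)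
  have hi : 0 < h^-1 by rewrite invr_gt0.
  have [Lr Er] := Lrho i; have [Lxi Ei] := Lx i.
  apply: (le_trans (Ex_AMGM hi Lr Lxi)); rewrite invrK Ei.
  rewrite mulrDl mul1r -expr2 lerD2r ler_pdivrMl// (le_trans Er)//.
  by rewrite (_ : h * _ = D * h ^+ 3)//; ring.
set s := Num.sqrt _ in s2 *; set t := Num.sqrt h in t2 *.
have t0 : 0 < t by rewrite sqrtr_gt0.
have s0 : 0 < s by rewrite sqrtr_gt0 ltr0n.
(* The inverse of sqrt (N h): it balances the second moment E N h of [M] against the constant 1. *)
have st0 : 0 < (s * t)^-1 by rewrite invr_gt0 mulr_gt0.
have B2 : Ex (fun w => `|h * M w|) <= (E + 1) * (h * (s * t)).
  rewrite (_ : (fun w => _) = (fun w => h * `|M w * 1|)); last first.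
    by apply/funext => w; rewrite mulr1 normrM gtr0_norm.
  rewrite ExZ; last by apply/L1_norm/L2M => //; exact: L2_cst.
  rewrite mulrCA ler_wpM2l ?(ltW h0)//.
  apply: (le_trans (Ex_AMGM st0 LM (L2_cst P 1))).
  rewrite invrK expr1n Ex_cst mulr1 mulrDl mul1r lerD2r.
  rewrite ler_pdivrMl ?mulr_gt0// (le_trans EM)// -s2 -t2.
  by rewrite (_ : _ * (_ * _) = s * t * (E * (s * t)))//; ring.
apply: (le_trans (lerD B1 B2)); rewrite -s2 -{1 2}t2.
have p1 : 0 <= s ^+ 2 * t ^+ 4 by rewrite mulr_ge0 ?exprn_ge0 ?(ltW s0) ?(ltW t0).
have p2 : 0 <= s * t ^+ 3 by rewrite mulr_ge0 ?exprn_ge0 ?(ltW s0) ?(ltW t0).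
rewrite -t2; nra.
Qed.
End small_drift.

(** * Quadratic forms of the noise and the realized covariance *)

Section quadratic.
Context d (T : measurableType d) (R : realType) (P : probability T R).
Local Notation Ex := (expect P).
Local Notation L1 := (L1 P).
Local Notation L2 := (L2 P).
Context (J : finType) (W : J -> R -> T -> R) (hW : noise_family P W).
Context (p : nat) (A : 'I_p -> J -> R).

Definition noise_part (x : 'I_p) (h : R) (i : nat) (w : T) : R :=
  \sum_j A x j * step (inc W j) h i w.

Definition noise_cov (x y : 'I_p) : R := \sum_j A x j * A y j.

Local Notation N := noise_part.
Local Notation Sg := noise_cov.

Let grid0 (h : R) i : 0 < h -> 0 <= i%:R * h.
Proof. by move=> h0; rewrite mulr_ge0// ltW. Qed.

Let gridS (h : R) i : 0 < h -> i%:R * h < i.+1%:R * h.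
Proof. by move=> h0; rewrite ltr_pM2r// ltr_nat. Qed.

Let gridB (h : R) (i : nat) : i.+1%:R * h - i%:R * h = h.
Proof. by rewrite -natr1; ring. Qed.

Lemma pow4_sum_le (I : Type) (r : seq I) (a : I -> R) :
  (\sum_(k <- r) a k) ^+ 4 <= (size r)%:R ^+ 3 * \sum_(k <- r) a k ^+ 4.
Proof.
have S0 (b : I -> R) : 0 <= \sum_(k <- r) b k ^+ 2 by apply: sumr_ge0 => k _; exact: sqr_ge0.
have H := sqr_sum_le r a; have H2 := sqr_sum_le r (fun k => a k ^+ 2).
have -> : (\sum_(k <- r) a k) ^+ 4 = ((\sum_(k <- r) a k) ^+ 2) ^+ 2 by rewrite -exprM.
apply: (@le_trans _ _ (((size r)%:R * \sum_(k <- r) a k ^+ 2) ^+ 2)).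
  by apply: lerXn2r => //; rewrite nnegrE ?sqr_ge0 ?mulr_ge0.
rewrite exprMn [_ ^+ 3]exprSr -mulrA ler_wpM2l ?sqr_ge0// (le_trans H2)//.
by under eq_bigr do rewrite -exprM.
Qed.

Lemma noise_pow8 : exists2 K, 0 <= K & forall x (h : R) i, 0 < h ->
  L1 (fun w => N x h i w ^+ 8) /\ Ex (fun w => N x h i w ^+ 8) <= K * h ^+ 4.
Proof.
pose m : R := (size (index_enum J))%:R.
(* Power means produce m^7, the eighth moment of a standard normal variable the factor 105. *)
pose c x := m ^+ 6 * (m * \sum_j A x j ^+ 8) * 105.
have c0 x : 0 <= c x.
  rewrite !mulr_ge0 ?exprn_ge0// ?sumr_ge0// => j _.
  by rewrite (exprM _ 2 4) exprn_ge0// sqr_ge0.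
exists (\sum_x c x) => [|x h i h0]; first by apply: sumr_ge0.
pose G w := m ^+ 6 * (m * \sum_j A x j ^+ 8 * step (inc W j) h i w ^+ 8).
have Ld j : L1 (fun w => A x j ^+ 8 * step (inc W j) h i w ^+ 8).
  by apply/L1Z/(L1_incX hW) => //; [exact: grid0|exact: gridS].
have LS : L1 (fun w => \sum_j A x j ^+ 8 * step (inc W j) h i w ^+ 8) by apply: L1_sum.
have LG : L1 G by apply/L1Z/L1Z.
have NG w : N x h i w ^+ 8 <= G w.
  rewrite (exprM _ 2 4) /N.
  have := sqr_sum_le (index_enum J) (fun j => A x j * step (inc W j) h i w).
  rewrite -/m => H1.
  apply: (@le_trans _ _ ((m * \sum_j (A x j * step (inc W j) h i w) ^+ 2) ^+ 4)).
    apply: lerXn2r => //; rewrite nnegrE ?sqr_ge0 ?mulr_ge0// sumr_ge0// => j _.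
    exact: sqr_ge0.
  rewrite exprMn /G (exprD m 4 2) -mulrA ler_wpM2l ?exprn_ge0//.
  have := pow4_sum_le (index_enum J) (fun j => (A x j * step (inc W j) h i w) ^+ 2).
  rewrite -/m [m ^+ 3]exprSr -mulrA => /le_trans; apply.
  rewrite ler_wpM2l ?exprn_ge0// ler_wpM2l//; apply: ler_sum => j _.
  by rewrite -exprM exprMn.
have mN : measurable_fun [set: T] (N x h i).
  apply: measurable_sum => j; apply: measurable_funM => //.
  by apply: (inc_meas hW) => //; exact: grid0.
have N8 w : 0 <= N x h i w ^+ 8 by rewrite (exprM _ 2 4) exprn_ge0// sqr_ge0.
have LN : L1 (fun w => N x h i w ^+ 8).
  apply: (L1_dom _ LG) => [|w]; first exact: measurable_funX.
  by rewrite ger0_norm.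
split=> //; apply: (le_trans (Ex_le LN LG NG)).
rewrite /G !ExZ//; last exact: L1Z.
rewrite Ex_sum//; apply: (@le_trans _ _ (c x * h ^+ 4)); last first.
  by rewrite ler_wpM2r ?exprn_ge0 ?(ltW h0)// (bigD1 x)//= lerDl sumr_ge0.
have -> : c x * h ^+ 4 = m ^+ 6 * (m * \sum_j A x j ^+ 8 * (105 * h ^+ 4)).
  by rewrite -mulr_suml /c; ring.
rewrite ler_wpM2l ?exprn_ge0// ler_wpM2l//.
apply: ler_sum => j _; have [_ _ _ _ E8] := Ex_inc hW j (grid0 i h0) (gridS i h0).
rewrite ExZ; last by apply: (L1_incX hW) => //; [exact: grid0|exact: gridS].
by rewrite E8 gridB.
Qed.

Let mN x h i : 0 < h -> measurable_fun [set: T] (N x h i).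
Proof.
move=> h0; apply: measurable_sum => j; apply: measurable_funM => //.
by apply: (inc_meas hW) => //; exact: grid0.
Qed.

Let x (h : R) (i : nat) (j : J) := step (inc W j) h i.

Let Lx h i j : 0 < h -> L2 (x h i j).
Proof. by move=> h0; apply: (L2_inc hW); [exact: grid0|exact: gridS]. Qed.

Let sum_delta (f : J -> R) j : \sum_k f k * (j == k)%:R = f j.
Proof.
rewrite (bigD1 j)//= eqxx mulr1 big1 ?addr0// => k kj.
by rewrite eq_sym (negbTE kj) mulr0.
Qed.

Let cross h i j k : 0 < h -> Ex (fun w => x h i j w * x h i k w) = h * (j == k)%:R.
Proof.
move=> h0; have [E1 E2 _ _ _] := Ex_inc hW j (grid0 i h0) (gridS i h0).
have [<-|jk] := eqVneq j k.
  by rewrite mulr1 -[RHS](gridB h i) -E2.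
pose tt (n : nat) := if n is 0%N then i%:R * h else i.+1%:R * h.
have ttS n : tt n <= tt n.+1 by case: n => //=; rewrite ltW// gridS.
have := @grid_indep2 _ _ _ P _ _ hW 1 tt (grid0 i h0) ttS (fun ij => ij.2 == j) (fun ij => ij.2 == k) (x h i j) (x h i k).
case/(_ _ _ _)/(indep2_Ex (L2_L1 (Lx i j h0)) (L2_L1 (Lx i k h0))).
- by move=> ij /eqP ->.
- exact: (@inc_block _ _ _ _ _ 1 tt (fun ij => ij.2 == j) ord0 j).
- exact: (@inc_block _ _ _ _ _ 1 tt (fun ij => ij.2 == k) ord0 k).
by move=> _ ->; rewrite [Ex (x h i j)]E1 mul0r mulr0.
Qed.

(** Expands one factor in the increments. Applied once per factor, it lifts moments of increments to
    moments of [noise_part]. *)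
Let lin (V : T -> R) (h : R) i e (f : J -> R) :
  (forall m, L1 (fun w => V w * x h i m w) /\ Ex (fun w => V w * x h i m w) = f m) ->
  L1 (fun w => V w * N e h i w) /\ Ex (fun w => V w * N e h i w) = \sum_m A e m * f m.
Proof.
move=> H; rewrite (_ : (fun w => V w * N e h i w) = (fun w => \sum_m A e m * (V w * x h i m w))); last first.
  by apply/funext => w; rewrite /N mulr_sumr; apply: eq_bigr => m _; rewrite mulrCA.
have LZ m : L1 (fun w => A e m * (V w * x h i m w)) by apply: L1Z; case: (H m).
split; first exact: L1_sum.
by rewrite Ex_sum//; apply: eq_bigr => m _; have [? <-] := H m; rewrite ExZ.
Qed.

Lemma noise_L2 z (h : R) i : 0 < h -> L2 (N z h i).
Proof. by move=> h0; apply: L2_sum => j _; apply: L2Z; exact: Lx. Qed.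

Lemma noise_moment2 a b (h : R) i : 0 < h ->
  Ex (fun w => N a h i w * N b h i w) = h * Sg a b.
Proof.
move=> h0.
have H1 j : L1 (fun w => x h i j w * N b h i w) /\ Ex (fun w => x h i j w * N b h i w) = h * A b j.
  have [|? ->] := @lin (x h i j) h i b (fun k => h * (j == k)%:R).
    by move=> k; split; [apply: L2M; exact: Lx|exact: cross].
  split=> //; under eq_bigr do rewrite mulrCA.
  by rewrite -mulr_sumr sum_delta.
have [|_ E2] := @lin (N b h i) h i a (fun j => h * A b j).
  move=> j; have [L E] := H1 j.
  by rewrite (_ : (fun w => _) = (fun w => x h i j w * N b h i w)) //; apply/funext => w; rewrite mulrC.
rewrite (_ : (fun w => _) = (fun w => N b h i w * N a h i w)); last by apply/funext => w; rewrite mulrC.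
by rewrite E2 /Sg mulr_sumr; apply: eq_bigr => j _; rewrite mulrCA.
Qed.

(** The Kronecker deltas of [isserlis] are contracted against the loadings one factor at a time,
    starting from the last. *)
Lemma noise_moment4 a b c e (h : R) i : 0 < h ->
  L1 (fun w => (N a h i w * N b h i w) * (N c h i w * N e h i w)) /\
  Ex (fun w => (N a h i w * N b h i w) * (N c h i w * N e h i w))
    = h ^+ 2 * (Sg a b * Sg c e + Sg a c * Sg b e + Sg a e * Sg b c).
Proof.
move=> h0; pose X := x h i.
have I j k l m : L1 (fun w => X j w * X k w * X l w * X m w) /\ _ :=
  @isserlis _ _ _ _ _ _ hW _ _ j k l m (grid0 i h0) (gridS i h0).
have H1 j k l : L1 (fun w => X j w * X k w * X l w * N e h i w) /\
    Ex (fun w => X j w * X k w * X l w * N e h i w)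
    = h ^+ 2 * ((j == k)%:R * A e l + (j == l)%:R * A e k + (k == l)%:R * A e j).
  have [? ->] := @lin (fun w => X j w * X k w * X l w) h i e _ (fun m => I j k l m).
  split=> //; rewrite gridB.
  rewrite -(sum_delta (A e) l) -(sum_delta (A e) k) -(sum_delta (A e) j).
  rewrite !mulr_sumr -!big_split mulr_sumr; apply: eq_bigr => m _ /=; ring.
have H2 j k : L1 (fun w => X j w * X k w * (N c h i w * N e h i w)) /\
    Ex (fun w => X j w * X k w * (N c h i w * N e h i w))
    = h ^+ 2 * ((j == k)%:R * Sg c e + A c j * A e k + A c k * A e j).
  have [|L E] := @lin (fun w => X j w * X k w * N e h i w) h i c
    (fun l => h ^+ 2 * ((j == k)%:R * A e l + (j == l)%:R * A e k + (k == l)%:R * A e j)).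
    move=> l; rewrite (_ : (fun w => _) = (fun w => X j w * X k w * X l w * N e h i w)) //.
    by apply/funext => w; rewrite mulrAC.
  rewrite (_ : (fun w => _) = (fun w => X j w * X k w * N e h i w * N c h i w)); last first.
    by apply/funext => w; rewrite -[RHS]mulrA [X in _ * X]mulrC.
  split=> //; rewrite E -(sum_delta (A c) j) -(sum_delta (A c) k) /Sg.
  rewrite !mulr_suml !mulr_sumr -!big_split mulr_sumr; apply: eq_bigr => m _ /=; ring.
have H3 j : L1 (fun w => X j w * (N b h i w * (N c h i w * N e h i w))) /\
    Ex (fun w => X j w * (N b h i w * (N c h i w * N e h i w)))
    = h ^+ 2 * (A b j * Sg c e + A c j * Sg b e + A e j * Sg b c).
  have [|L E] := @lin (fun w => X j w * (N c h i w * N e h i w)) h i b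
    (fun k => h ^+ 2 * ((j == k)%:R * Sg c e + A c j * A e k + A c k * A e j)).
    move=> k; rewrite (_ : (fun w => _) = (fun w => X j w * X k w * (N c h i w * N e h i w))) //.
    by apply/funext => w; rewrite mulrAC.
  rewrite (_ : (fun w => _) = (fun w => X j w * (N c h i w * N e h i w) * N b h i w)); last first.
    by apply/funext => w; rewrite -[RHS]mulrA [X in _ * X]mulrC.
  split=> //; rewrite E -(sum_delta (A b) j) /Sg.
  rewrite !mulr_suml !mulr_sumr -!big_split mulr_sumr; apply: eq_bigr => m _ /=; ring.
have [|L E] := @lin (fun w => N b h i w * (N c h i w * N e h i w)) h i a
    (fun j => h ^+ 2 * (A b j * Sg c e + A c j * Sg b e + A e j * Sg b c)).
  move=> j; rewrite (_ : (fun w => _) = (fun w => X j w * (N b h i w * (N c h i w * N e h i w)))) //.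
  by apply/funext => w; rewrite mulrC.
rewrite (_ : (fun w => _) = (fun w => N b h i w * (N c h i w * N e h i w) * N a h i w)); last first.
  by apply/funext => w; ring.
split=> //; rewrite E /Sg !mulr_suml -!big_split mulr_sumr; apply: eq_bigr => m _ /=; ring.
Qed.

Context (I : finType) (pr : I -> 'I_p * 'I_p).

(** The pairing [pr] is left free: with [I = unit] it picks a single entry of the covariance, and
    with the positions of [vech] the whole half-vectorization. *)
Definition qterm (k : I) (h : R) (i : nat) (w : T) : R :=
  h^-1 * (N (pr k).1 h i w * N (pr k).2 h i w) - Sg (pr k).1 (pr k).2.

(** Isserlis' covariance of two products; for the positions of [vech] it is an entry of [asym_W], by
    [asym_WE]. *)
Definition qcov (k l : I) : R :=
  Sg (pr k).1 (pr l).1 * Sg (pr k).2 (pr l).2 + Sg (pr k).1 (pr l).2 * Sg (pr k).2 (pr l).1.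

Lemma qterm_moments k l (h : R) i : 0 < h ->
  [/\ L2 (qterm k h i), Ex (qterm k h i) = 0 &
      Ex (fun w => qterm k h i w * qterm l h i w) = qcov k l].
Proof.
move=> h0; have hN : h != 0 by rewrite gt_eqF.
have M2 a b : L1 (fun w => N a h i w * N b h i w) by apply: L2M; exact: noise_L2.
have LN k' : L2 (fun w => N (pr k').1 h i w * N (pr k').2 h i w).
  split; first by apply: measurable_funM; exact: mN.
  have [L _] := noise_moment4 (pr k').1 (pr k').2 (pr k').1 (pr k').2 i h0.
  by rewrite (_ : (fun w => _) = (fun w => N (pr k').1 h i w * N (pr k').2 h i w * (N (pr k').1 h i w * N (pr k').2 h i w)))//; apply/funext => w; rewrite expr2.
have Lq k' : L2 (qterm k' h i) by apply: L2B; [exact: L2Z|exact: L2_cst].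
have Eq k' : Ex (qterm k' h i) = 0.
  rewrite ExB; [|by apply: L1Z|exact: L1_cst].
  by rewrite ExZ// noise_moment2// Ex_cst mulKf// subrr.
split=> //.
have [L4 E4] := noise_moment4 (pr k).1 (pr k).2 (pr l).1 (pr l).2 i h0.
rewrite (_ : (fun w => _) = (fun w => h ^- 2 * (N (pr k).1 h i w * N (pr k).2 h i w * (N (pr l).1 h i w * N (pr l).2 h i w))
   - (Sg (pr k).1 (pr k).2 * qterm l h i w + Sg (pr l).1 (pr l).2 * (h^-1 * (N (pr k).1 h i w * N (pr k).2 h i w))))); last first.
  by apply/funext => w; rewrite /qterm; field.
have La : L1 (fun w => h^-1 * (N (pr k).1 h i w * N (pr k).2 h i w)) by exact: L1Z.
have Lb := L2_L1 (Lq l).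
rewrite ExB; [|exact: L1Z|by apply: L1D; apply: L1Z].
rewrite ExD; [|exact: L1Z|exact: L1Z].
rewrite !ExZ// Eq E4 noise_moment2// /qcov; field.
by [].
Qed.

Let pow4D (a b : R) : (a - b) ^+ 4 <= 8 * a ^+ 4 + 8 * b ^+ 4.
Proof.
have H1 : (a - b) ^+ 2 <= 2 * a ^+ 2 + 2 * b ^+ 2 by have := sqr_ge0 (a + b); nra.
have H2 : (2 * a ^+ 2 + 2 * b ^+ 2) ^+ 2 <= 8 * a ^+ 4 + 8 * b ^+ 4.
  rewrite -subr_ge0 (_ : _ - _ = 4 * (a ^+ 2 - b ^+ 2) ^+ 2); last by ring.
  by rewrite mulr_ge0// sqr_ge0.
have -> : (a - b) ^+ 4 = ((a - b) ^+ 2) ^+ 2 by rewrite -exprM.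
apply: le_trans H2; apply: lerXn2r => //; rewrite nnegrE ?sqr_ge0//.
by rewrite addr_ge0// mulr_ge0// sqr_ge0.
Qed.

Lemma qterm_pow4 : exists2 K, 0 <= K & forall k (h : R) i, 0 < h ->
  L1 (fun w => qterm k h i w ^+ 4) /\ Ex (fun w => qterm k h i w ^+ 4) <= K.
Proof.
have [K K0 HK] := noise_pow8.
pose c k := 8 * (Sg (pr k).1 (pr k).2) ^+ 4.
have c0 k : 0 <= c k by rewrite mulr_ge0// (exprM _ 2 2) exprn_ge0// sqr_ge0.
exists (16 * K + \sum_k c k) => [|k h i h0]; first by rewrite addr_ge0 ?mulr_ge0 ?sumr_ge0.
have [La Ea] := HK (pr k).1 h i h0; have [Lb Eb] := HK (pr k).2 h i h0.
pose G w := 8 * h ^- 4 * (N (pr k).1 h i w ^+ 8 + N (pr k).2 h i w ^+ 8) + c k.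
have h4 : 0 < h ^- 4 by rewrite invr_gt0 exprn_gt0.
have LG : L1 G by apply: L1D; [apply/L1Z/L1D|exact: L1_cst].
have qG w : qterm k h i w ^+ 4 <= G w.
  rewrite (le_trans (pow4D _ _))// lerD2r -mulrA ler_wpM2l// exprMn exprVn ler_wpM2l ?(ltW h4)//.
  set a := N _ _ _ _; set b := N _ _ _ _; rewrite exprMn.
  have -> : a ^+ 8 = (a ^+ 4) ^+ 2 by rewrite -exprM.
  have -> : b ^+ 8 = (b ^+ 4) ^+ 2 by rewrite -exprM.
  set u := a ^+ 4; set v := b ^+ 4; have := sqr_ge0 (u - v); have := sqr_ge0 u; have := sqr_ge0 v; nra.
have q0 w : 0 <= qterm k h i w ^+ 4 by rewrite (exprM _ 2 2) exprn_ge0// sqr_ge0.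
have mq : measurable_fun [set: T] (qterm k h i) by have [[]] := qterm_moments k k i h0.
have Lq : L1 (fun w => qterm k h i w ^+ 4).
  by apply: (L1_dom _ LG) => [|w]; [exact: measurable_funX|rewrite ger0_norm].
split=> //; apply: (le_trans (Ex_le Lq LG qG)).
rewrite /G ExD; [|by apply/L1Z/L1D|exact: L1_cst].
rewrite ExZ; last exact: L1D.
rewrite ExD// Ex_cst; apply: lerD; last by rewrite (bigD1 k)//= lerDl sumr_ge0.
have -> : 16 * K = 8 * h ^- 4 * (K * h ^+ 4 + K * h ^+ 4) by field; rewrite gt_eqF.
by rewrite ler_wpM2l ?mulr_ge0 ?(ltW h4)// lerD.
Qed.

Context (cf : I -> R).

Definition qform (h : R) (i : nat) (w : T) : R := \sum_k cf k * qterm k h i w.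

Definition qvar : R := \sum_k \sum_l cf k * cf l * qcov k l.

Lemma qform_moments (h : R) i : 0 < h ->
  [/\ L2 (qform h i), Ex (qform h i) = 0 & Ex (fun w => qform h i w ^+ 2) = qvar].
Proof.
move=> h0; have Lq k : L2 (qterm k h i) by have [] := qterm_moments k k i h0.
split; first by apply: L2_sum => k _; exact: L2Z.
  rewrite Ex_sum => [|k _]; last exact/L1Z/L2_L1.
  rewrite big1// => k _; rewrite ExZ; last exact: L2_L1.
  by have [_ -> _] := qterm_moments k k i h0; rewrite mulr0.
have L k l : L1 (fun w => cf k * cf l * (qterm k h i w * qterm l h i w)) by apply/L1Z/L2M.
rewrite (_ : (fun w => _) = (fun w => \sum_k \sum_l cf k * cf l * (qterm k h i w * qterm l h i w))); last first.
  apply/funext => w; rewrite expr2 /qform mulr_suml; apply: eq_bigr => k _.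
  by rewrite mulr_sumr; apply: eq_bigr => l _; ring.
rewrite Ex_sum => [|k _]; last by apply: L1_sum.
apply: eq_bigr => k _; rewrite Ex_sum//; apply: eq_bigr => l _.
by rewrite ExZ; [have [_ _ ->] := qterm_moments k l i h0|exact: L2M].
Qed.

Lemma qform_pow4 : exists2 K, 0 <= K & forall (h : R) i, 0 < h ->
  L1 (fun w => qform h i w ^+ 4) /\ Ex (fun w => qform h i w ^+ 4) <= K.
Proof.
have [K K0 HK] := qterm_pow4; pose m : R := (size (index_enum I))%:R.
exists (m ^+ 3 * \sum_k cf k ^+ 4 * K) => [|h i h0].
  rewrite mulr_ge0 ?exprn_ge0// sumr_ge0// => k _.
  by rewrite mulr_ge0// (exprM _ 2 2) exprn_ge0// sqr_ge0.
pose G w := m ^+ 3 * \sum_k cf k ^+ 4 * qterm k h i w ^+ 4.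
have Lk k : L1 (fun w => cf k ^+ 4 * qterm k h i w ^+ 4) by apply: L1Z; have [] := HK k h i h0.
have LS : L1 (fun w => \sum_k cf k ^+ 4 * qterm k h i w ^+ 4) by exact: L1_sum.
have LG : L1 G by exact: L1Z.
have qG w : qform h i w ^+ 4 <= G w.
  rewrite (le_trans (pow4_sum_le _ _))// ler_wpM2l ?exprn_ge0//.
  by apply: ler_sum => k _; rewrite exprMn.
have q0 w : 0 <= qform h i w ^+ 4 by rewrite (exprM _ 2 2) exprn_ge0// sqr_ge0.
have Lq : L1 (fun w => qform h i w ^+ 4).
  apply: (L1_dom _ LG) => [|w]; last by rewrite ger0_norm.
  by apply: measurable_funX; have [[]] := qform_moments i h0.
split=> //; apply: (le_trans (Ex_le Lq LG qG)).
rewrite ExZ// ler_wpM2l ?exprn_ge0// Ex_sum//; apply: ler_sum => k _.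
have [L E] := HK k h i h0; rewrite ExZ// ler_wpM2l//.
by rewrite (exprM _ 2 2) exprn_ge0// sqr_ge0.
Qed.

Lemma qform_indep (h : R) n k : 0 < h -> (k < n)%N ->
  indep2 P (fun w => \sum_(0 <= i < k) qform h i w) (qform h k).
Proof.
move=> h0 kn; pose tt i : R := i%:R * h.
have tt0 : 0 <= tt 0%N by rewrite /tt mul0r.
have ttS i : tt i <= tt i.+1 by rewrite ltW// gridS.
have mq (B : pred ('I_n * J)) i (ik : (i < n)%N) : (forall j, B (Ordinal ik, j)) ->
    measurable_fun [set: g_sigma_algebraType (@grid_block d T R J W n tt B)] (qform h i).
  move=> HB.
  have mNB z : measurable_fun [set: g_sigma_algebraType (@grid_block d T R J W n tt B)] (N z h i).
    apply: measurable_sum => j; apply: measurable_funM => //.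
    exact: (@inc_block _ _ _ _ _ n tt B (Ordinal ik) j).
  apply: measurable_sum => l; apply: measurable_funM => //.
  apply: measurable_funB => //; apply: measurable_funM => //; apply: measurable_funM; exact: mNB.
apply: (@grid_indep2 _ _ _ P _ _ hW n tt tt0 ttS (fun ij => ij.1 < k)%N (fun ij => ij.1 == k :> nat)).
- by move=> ij /ltn_eqF ->.
- rewrite (_ : (fun w => _) = (fun w => \sum_(i < k) qform h i w)); last first.
    by apply/funext => w; rewrite big_mkord.
  apply: measurable_sum => i; apply: (mq _ i (ltn_trans (ltn_ord i) kn)) => j /=.
  exact: ltn_ord.
- by apply: (mq _ k kn) => j /=.
Qed.

Lemma qform_clt (h : nat -> R) : (forall n, 0 < h n) -> forall u : R,
  Ex (fun w => cos (u * ((Num.sqrt n%:R)^-1 * \sum_(0 <= i < n) qform (h n) i w))) @[n --> \oo]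
     --> expR (- (u ^+ 2 * qvar / 2)) /\
  Ex (fun w => sin (u * ((Num.sqrt n%:R)^-1 * \sum_(0 <= i < n) qform (h n) i w))) @[n --> \oo]
     --> (0 : R).
Proof.
move=> h0; have [K K0 HK] := qform_pow4.
apply: (@clt _ _ _ _ (fun n => qform (h n)) qvar K) => n i ni.
- by have [[]] := qform_moments i (h0 n).
- by have [] := HK (h n) i (h0 n).
- by have [] := qform_moments i (h0 n).
- by have [] := qform_moments i (h0 n).
- by have [] := HK (h n) i (h0 n).
- exact: qform_indep ni.
Qed.

Lemma qform_sum2 (h : R) n : 0 < h ->
  L2 (fun w => \sum_(0 <= i < n) qform h i w) /\
  Ex (fun w => (\sum_(0 <= i < n) qform h i w) ^+ 2) = n%:R * qvar.
Proof.
move=> h0; have [|||L E] := @orthogonal_sum _ _ _ P n (fun _ _ => 1) (qform h) 1 qvar.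
- move=> i _; have [L E1 E2] := qform_moments i h0; split=> // w; by rewrite normr1.
- move=> i _ X Y mX mY; rewrite expr1n preimage_cst.
  by case: ifP => _; rewrite ?setTI ?set0I ?probability_setT ?measure0 ?mul1e ?mul0e.
- move=> i ni; have H := qform_indep h0 ni.
  by rewrite (_ : (fun w => _) = (fun w => \sum_(0 <= k < i) qform h k w))//; apply/funext => w; rewrite mulr1; apply: eq_bigr => k _; rewrite mul1r.
have F w : \sum_(0 <= i < n) 1 * qform h i w = \sum_(0 <= i < n) qform h i w.
  by apply: eq_bigr => i _; rewrite mul1r.
rewrite (_ : (fun w => \sum_(0 <= i < n) qform h i w) = (fun w => \sum_(0 <= i < n) 1 * qform h i w)); last exact/funext.
split=> //; rewrite (_ : (fun w => _) = (fun w => (\sum_(0 <= i < n) 1 * qform h i w) ^+ 2)); last first.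
  by apply/funext => w; rewrite F.
rewrite E mulrC; congr (_ * _).
under eq_bigr do rewrite expr1n Ex_cst.
by rewrite sumr_const_nat subn0.
Qed.
End quadratic.

(** * The realized covariance and its noise part *)

Section realized.
Context d (T : measurableType d) (R : realType) (P : probability T R).
Local Notation Ex := (expect P).
Local Notation L1 := (L1 P).
Local Notation L2 := (L2 P).
Context (J : finType) (W : J -> R -> T -> R) (hW : noise_family P W).
Context (p : nat) (A : 'I_p -> J -> R) (u : 'I_p -> R -> R -> T -> R).
Context (X : R -> T -> 'cV[R]_p).
Hypothesis u_small : forall x, small_resid P W (u x).
Hypothesis XE : forall x (s t : R) w, 0 <= s -> 0 <= t ->
  X t w x 0 - X s w x 0 = u x s t w + \sum_j A x j * inc W j s t w.
Local Notation N := (noise_part W A).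
Local Notation Sg := (noise_cov A).

(** What is left after the centred quadratic terms of the noise: the products with at least one
    drift remainder, divided by n h. *)
Definition realized_err (x y : 'I_p) (n : nat) (h : R) (w : T) : R :=
  realized_cov X n h w x y - Sg x y
  - n%:R^-1 * \sum_(0 <= i < n) (h^-1 * (N x h i w * N y h i w) - Sg x y).

Let U x (h : R) (i : nat) w := step (u x) h i w.

Let errE x y n (h : R) w : (0 < n)%N -> 0 < h ->
  realized_err x y n h w = (n%:R * h)^-1 * (\sum_(0 <= i < n) U x h i w * U y h i w
    + (\sum_j A y j * \sum_(0 <= i < n) U x h i w * step (inc W j) h i w
    + \sum_j A x j * \sum_(0 <= i < n) U y h i w * step (inc W j) h i w)).
Proof.
move=> n0 h0; have nN : n%:R != 0 :> R by rewrite pnatr_eq0 -lt0n.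
have hN : h != 0 by rewrite gt_eqF.
have swap z z' : \sum_j A z j * \sum_(0 <= i < n) U z' h i w * step (inc W j) h i w
    = \sum_(0 <= i < n) U z' h i w * N z h i w.
  under eq_bigr do rewrite mulr_sumr.
  rewrite exchange_big; apply: eq_bigr => i _; rewrite /noise_part mulr_sumr.
  by apply: eq_bigr => j _; ring.
rewrite !swap /realized_err sumrB sumr_const_nat subn0 -mulr_sumr.
rewrite /realized_cov !mxE summxE big_add1 /=.
have -> : \sum_(0 <= i < n) ((X (i.+1%:R * h) w - X (i%:R * h) w) *m (X (i.+1%:R * h) w - X (i%:R * h) w)^T) x y
   = \sum_(0 <= i < n) (U x h i w + N x h i w) * (U y h i w + N y h i w).
  apply: eq_bigr => i _; rewrite !mxE big_ord1 !mxE.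
  have i0 k : 0 <= k%:R * h by rewrite mulr_ge0// ltW.
  by rewrite !XE.
have -> : \sum_(0 <= i < n) (U x h i w + N x h i w) * (U y h i w + N y h i w)
  = \sum_(0 <= i < n) U x h i w * U y h i w + (\sum_(0 <= i < n) U x h i w * N y h i w
    + \sum_(0 <= i < n) U y h i w * N x h i w) + \sum_(0 <= i < n) N x h i w * N y h i w.
  by rewrite -!big_split; apply: eq_bigr => i _ /=; ring.
rewrite -[Sg x y *+ n]mulr_natr; field.
by rewrite hN nN.
Qed.

(** Divided by n h, the products of two remainders are of order h, and those of a remainder with the
    noise of order h + sqrt (h / n) by the second bound of [small_resid]. *)
Lemma realized_err_small : exists2 C, 0 <= C & forall x y n (h : R), (0 < n)%N -> 0 < h <= 1 ->
  L1 (realized_err x y n h) /\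
  Ex (fun w => `|realized_err x y n h w|) <= C * (h + Num.sqrt h / Num.sqrt n%:R).
Proof.
have /choice[c Hc] : forall x, exists C, 0 <= C /\ forall h, 0 < h <= 1 ->
  (forall i, L2 (step (u x) h i) /\ Ex (fun w => step (u x) h i w ^+ 2) <= C * h ^+ 2) /\
  (forall j n, L1 (fun w => \sum_(0 <= i < n) step (u x) h i w * step (inc W j) h i w) /\
     Ex (fun w => `|\sum_(0 <= i < n) step (u x) h i w * step (inc W j) h i w|)
     <= C * (Num.sqrt n%:R * h * (Num.sqrt n%:R * h + Num.sqrt h))).
  by move=> x; have [C C0 H] := u_small x; exists C.
pose C0 := \sum_x c x; pose a := \sum_x \sum_j `|A x j|.
have cC x : c x <= C0.
  by rewrite /C0 (bigD1 x)//= lerDl sumr_ge0// => y _; have [] := Hc y.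
have C00 : 0 <= C0 by apply: sumr_ge0 => y _; have [] := Hc y.
have a0 : 0 <= a by apply: sumr_ge0 => y _; apply: sumr_ge0.
have aA x : \sum_j `|A x j| <= a.
  by rewrite /a (bigD1 x)//= lerDl sumr_ge0// => y _; apply: sumr_ge0.
exists (2 * C0 + 2 * (a * C0)) => [|x y n h n0 h01]; first by rewrite !addr_ge0 ?mulr_ge0.
have /andP[h0 h1] := h01.
have [_ /(_ h h01) [HU HN]] := Hc x; have [_ /(_ h h01) [HU' HN']] := Hc y.
pose s : R := Num.sqrt n%:R; pose t := Num.sqrt h.
have s2 : s ^+ 2 = n%:R by rewrite sqr_sqrtr.
have t2 : t ^+ 2 = h by rewrite sqr_sqrtr// ltW.
have t0 : 0 < t by rewrite sqrtr_gt0.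
have s0 : 0 < s by rewrite sqrtr_gt0 ltr0n.
pose F1 w := \sum_(0 <= i < n) U x h i w * U y h i w.
pose F2 w := \sum_j A y j * \sum_(0 <= i < n) U x h i w * step (inc W j) h i w.
pose F3 w := \sum_j A x j * \sum_(0 <= i < n) U y h i w * step (inc W j) h i w.
have LU i : L1 (fun w => U x h i w * U y h i w).
  by apply: L2M; [have [] := HU i|have [] := HU' i].
have LF1 : L1 F1.
  rewrite /F1 (_ : (fun w => _) = (fun w => \sum_(i < n) U x h i w * U y h i w)).
    by apply: L1_sum => i _.
  by apply/funext => w; rewrite big_mkord.
have LF2 : L1 F2 by apply: L1_sum => j _; apply: L1Z; have [] := HN j n.
have LF3 : L1 F3 by apply: L1_sum => j _; apply: L1Z; have [] := HN' j n.
have EF1 : Ex (fun w => `|F1 w|) <= 2 * C0 * (n%:R * h ^+ 2).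
  apply: (@le_trans _ _ (Ex (fun w => \sum_(i < n) `|U x h i w * U y h i w|))).
    apply: Ex_le => [||w]; [exact: L1_norm|by apply: L1_sum => i _; exact: L1_norm|].
    by rewrite /F1 big_mkord ler_norm_sum.
  rewrite Ex_sum; last by move=> i _; exact: L1_norm.
  rewrite [leRHS]mulrCA [leRHS]mulr_natl -[X in _ *+ X]card_ord -sumr_const; apply: ler_sum => i _.
  have [L E] := HU i; have [L' E'] := HU' i.
  apply: (le_trans (Ex_AMGM ltr01 L L')); rewrite invr1 !mul1r.
  have h2 : 0 <= h ^+ 2 by exact: sqr_ge0.
  by have := ler_wpM2r h2 (cC x); have := ler_wpM2r h2 (cC y); lra.
have EF (z z' : 'I_p) : (forall j m, L1 (fun w => \sum_(0 <= i < m) U z h i w * step (inc W j) h i w) /\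
     Ex (fun w => `|\sum_(0 <= i < m) U z h i w * step (inc W j) h i w|)
     <= c z * (Num.sqrt m%:R * h * (Num.sqrt m%:R * h + Num.sqrt h))) ->
   Ex (fun w => `|\sum_j A z' j * \sum_(0 <= i < n) U z h i w * step (inc W j) h i w|)
   <= a * C0 * (s * h * (s * h + t)).
  move=> H; have LZ j : L1 (fun w => `|A z' j| * `|\sum_(0 <= i < n) U z h i w * step (inc W j) h i w|).
    by apply/L1Z/L1_norm; have [] := H j n.
  apply: (@le_trans _ _ (Ex (fun w => \sum_j `|A z' j| * `|\sum_(0 <= i < n) U z h i w * step (inc W j) h i w|))).
    apply: Ex_le => [||w].
    - by apply/L1_norm/L1_sum => j _; apply: L1Z; have [] := H j n.
    - by apply: L1_sum.
    - by rewrite (le_trans (ler_norm_sum _ _ _))//; apply: ler_sum => j _; rewrite normrM.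
  have st0 : 0 <= s * h * (s * h + t) by rewrite !mulr_ge0 ?addr_ge0 ?mulr_ge0 ?ltW.
  rewrite Ex_sum//; apply: (@le_trans _ _ (\sum_j `|A z' j| * (C0 * (s * h * (s * h + t))))).
    apply: ler_sum => j _; have [L E] := H j n.
    rewrite ExZ; last exact: L1_norm.
    by rewrite ler_wpM2l// (le_trans E)// ler_wpM2r.
  by rewrite -mulr_suml -[leRHS]mulrA; apply: ler_wpM2r; [exact: mulr_ge0|exact: aA].
have EF2 := EF x y HN; have EF3 := EF y x HN'.
have nh0 : 0 < (n%:R * h)^-1 by rewrite invr_gt0 mulr_gt0// ltr0n.
have eE : realized_err x y n h = (fun w => (n%:R * h)^-1 * (F1 w + (F2 w + F3 w))).
  by apply/funext => w; rewrite errE.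
have LF : L1 (fun w => F1 w + (F2 w + F3 w)) by apply: L1D => //; apply: L1D.
rewrite eE; split; first exact: L1Z.
rewrite (_ : (fun w => _) = (fun w => (n%:R * h)^-1 * `|F1 w + (F2 w + F3 w)|)); last first.
  by apply/funext => w; rewrite normrM gtr0_norm.
rewrite ExZ; last exact: L1_norm.
rewrite ler_pdivrMl ?mulr_gt0 ?ltr0n//.
apply: (@le_trans _ _ (Ex (fun w => `|F1 w| + (`|F2 w| + `|F3 w|)))).
  apply: Ex_le => [||w]; [exact: L1_norm|by apply: L1D; [|apply: L1D]; exact: L1_norm|].
  by rewrite (le_trans (ler_normD _ _))// lerD2l ler_normD.
rewrite ExD; [|exact: L1_norm|by apply: L1D; exact: L1_norm].
rewrite ExD; [|exact: L1_norm|exact: L1_norm].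
apply: (le_trans (lerD EF1 (lerD EF2 EF3))); rewrite -/s -/t -s2 -t2.
have -> : s ^+ 2 * t ^+ 2 * ((2 * C0 + 2 * (a * C0)) * (t ^+ 2 + t / s))
  = 2 * C0 * (s ^+ 2 * (t ^+ 2) ^+ 2) + (a * C0 * (s * t ^+ 2 * (s * t ^+ 2 + t)) +
     a * C0 * (s * t ^+ 2 * (s * t ^+ 2 + t))) + 2 * C0 * (s * t ^+ 3).
  by field; rewrite gt_eqF.
by rewrite lerDl !mulr_ge0 ?exprn_ge0 ?(ltW s0) ?(ltW t0).
Qed.
End realized.

(** * Vectorization and positive definite matrices *)

Section vectorization.
Context (R : realType) (p : nat).
Implicit Types A E S : 'M[R]_p.

Local Notation D := (dup_mx R p).
Local Notation pos := (tnth (vech_tuple p)).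

Lemma vech_pos_inj : injective pos.
Proof.
apply: tuple_uniqP; apply: allpairs_uniq_dep; first exact: enum_uniq.
- by move=> j _; rewrite filter_uniq ?enum_uniq.
- by move=> [? ?] [? ?] _ _ /= [-> ->].
Qed.

Lemma vech_pos_le k : ((pos k).2 <= (pos k).1)%N.
Proof.
have := mem_tnth k (vech_tuple p) => /allpairsPdep[j [i [_]]].
by rewrite mem_filter => /andP[? _] ->.
Qed.

Lemma vech_pos_swap k l : ((pos l == pos k) || (pos l == ((pos k).2, (pos k).1))) = (l == k).
Proof.
rewrite (inj_eq vech_pos_inj); have [//|lk /=] := eqVneq l k.
apply: contra_neqF lk => /eqP E; apply: vech_pos_inj; rewrite E.
have := vech_pos_le k; have := vech_pos_le l; rewrite E /=.
case: (pos k) => i j /= ij ji; have /val_inj -> : (i = j :> nat) by apply/eqP; rewrite eqn_leq ij.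
by [].
Qed.

Lemma sum_unindex (F : 'I_p * 'I_p -> R) :
  \sum_(k < p * p) F (mxtens_unindex k) = \sum_i \sum_j F (j, i).
Proof.
rewrite exchange_big pair_bigA /= (reindex (@mxtens_index p p)) /=.
  by apply: eq_bigr => -[i j] _; rewrite mxtens_indexK.
by exists (@mxtens_unindex p p) => k _; [exact: mxtens_indexK|exact: mxtens_unindexK].
Qed.

(** The symmetric matrix with half-vectorization [v], read off from [D *m v]. It lets identities
    about [D] be checked on symmetric matrices instead of index by index. *)
Definition unvech (v : 'cV[R]_(vech_dim p)) : 'M[R]_p :=
  \matrix_(i, j) (D *m v) (mxtens_index (j, i)) 0.

Lemma vec_unvech v : vec (unvech v) = D *m v.
Proof.
apply/colP => k; rewrite mxE; case: (mxtens_indexP k) => j i.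
by rewrite mxtens_indexK [LHS]mxE.
Qed.

Lemma unvech_sym v : (unvech v)^T = unvech v.
Proof.
apply/matrixP => i j; rewrite !mxE; apply: eq_bigr => k _.
by rewrite !mxE !mxtens_indexK /= orbC.
Qed.

Lemma unvechK v : vech (unvech v) = v.
Proof.
apply/colP => k; rewrite mxE /= mxE mxE (bigD1 k)//= big1 ?addr0 => [|l lk].
  by rewrite mxE mxtens_indexK /= -surjective_pairing eqxx mul1r.
rewrite mxE mxtens_indexK /= -surjective_pairing.
by rewrite vech_pos_swap (negbTE lk) mul0r.
Qed.

Lemma vec_inj : injective (@vec R p).
Proof.
move=> A B /colP AB; apply/matrixP => i j.
by have := AB (mxtens_index (j, i)); rewrite !mxE mxtens_indexK.
Qed.

Lemma vechK A : A^T = A -> unvech (vech A) = A.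
Proof. by move=> sA; apply: vec_inj; rewrite vec_unvech dup_mxE. Qed.

(** The Moore-Penrose inverse of [D] in closed form: symmetrize, then take [vech]. On the diagonal
    both deltas hold and the two weights 1 / 2 add up to 1. *)
Definition dup_pinv : 'M[R]_(vech_dim p, p * p) :=
  \matrix_(l, k) (let ji := mxtens_unindex k in
    2^-1 * ((pos l == (ji.2, ji.1))%:R + (pos l == (ji.1, ji.2))%:R)).

Let delta_sum (F : 'I_p -> 'I_p -> R) (a : 'I_p * 'I_p) :
  \sum_i \sum_j (a == (i, j))%:R * F i j = F a.1 a.2.
Proof.
rewrite pair_bigA (bigD1 a)//= -surjective_pairing eqxx mul1r big1 ?addr0// => b ba.
by rewrite -surjective_pairing eq_sym (negbTE ba) mul0r.
Qed.

Lemma dup_pinv_vec A : dup_pinv *m vec A = vech (2^-1 *: (A + A^T)).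
Proof.
apply/colP => l; rewrite !mxE; under eq_bigr do rewrite !mxE.
rewrite (sum_unindex (fun ji => 2^-1 * ((pos l == (ji.2, ji.1))%:R + (pos l == (ji.1, ji.2))%:R) * A ji.2 ji.1)) /=.
under eq_bigr do under eq_bigr do rewrite -mulrA mulrDl mulrDr.
under eq_bigr do rewrite big_split /=.
rewrite big_split /= [RHS]mxE [X in _ = _ * X]mxE [X in _ = _ * (_ + X)]mxE mulrDr; congr (_ + _).
  under eq_bigr do rewrite -mulr_sumr; rewrite -mulr_sumr; congr (_ * _).
  exact: (delta_sum (fun i j => A i j)).
rewrite exchange_big /=; under eq_bigr do rewrite -mulr_sumr; rewrite -mulr_sumr; congr (_ * _).
exact: (delta_sum (fun i j => A j i)).
Qed.

Lemma dup_pinv_sym A : A^T = A -> dup_pinv *m vec A = vech A.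
Proof.
move=> sA; rewrite dup_pinv_vec sA; congr vech; apply/matrixP => i j; rewrite !mxE.
by field.
Qed.

Lemma dup_pinvK : dup_pinv *m D = 1%:M.
Proof.
apply/matrixP => k l; have /colP/(_ k) : dup_pinv *m D *m delta_mx l 0 = delta_mx l (0 : 'I_1).
  by rewrite -mulmxA -vec_unvech dup_pinv_sym ?unvech_sym// unvechK.
by rewrite -colE !mxE eqxx andbT.
Qed.

Let vec_dot A B : ((vec A)^T *m vec B) 0 0 = \sum_i \sum_j A i j * B i j.
Proof.
rewrite mxE -(sum_unindex (fun ji => A ji.2 ji.1 * B ji.2 ji.1)).
by apply: eq_bigr => k _; rewrite !mxE.
Qed.

Lemma vec_tr A B : ((vec A)^T *m vec B) 0 0 = \tr (A^T *m B).
Proof.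
rewrite vec_dot exchange_big /mxtrace; apply: eq_bigr => j _; rewrite mxE.
by apply: eq_bigr => i _; rewrite mxE.
Qed.

Definition unvec (v : 'cV[R]_(p * p)) : 'M[R]_p := \matrix_(i, j) v (mxtens_index (j, i)) 0.

Lemma unvecK v : vec (unvec v) = v.
Proof.
apply/colP => k; rewrite mxE; case: (mxtens_indexP k) => j i.
by rewrite mxtens_indexK /= mxE.
Qed.

(** This product acts on [vec A] as the symmetrization of [A], which is self-adjoint for the trace
    inner product. *)
Lemma dup_pinv_proj_sym : (D *m dup_pinv)^T = D *m dup_pinv.
Proof.
have E A : D *m dup_pinv *m vec A = vec (2^-1 *: (A + A^T)).
  rewrite -mulmxA dup_pinv_vec -dup_mxE// linearZ/= linearD/= trmxK.
  by rewrite addrC.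
apply/matrixP => a b; rewrite mxE.
have M (B : 'M[R]_(p * p)) c e : B c e = ((delta_mx c 0 : 'cV_(p * p))^T *m (B *m delta_mx e (0 : 'I_1))) 0 0.
  by rewrite trmx_delta -colE -rowE !mxE.
rewrite (M _ b a) (M _ a b) -(unvecK (delta_mx a 0)) -(unvecK (delta_mx b 0)).
set U := unvec _; set V := unvec _; rewrite !E !vec_tr.
rewrite -[in RHS]mxtrace_tr trmx_mul trmxK !linearZ/= -!scalemxAl !linearZ/=.
congr (_ * _); rewrite mulmxDr linearD/= [(U + _)^T]linearD/= mulmxDl linearD/= trmxK.
by congr (_ + _); rewrite -trmx_mul mxtrace_tr mxtrace_mulC.
Qed.

Lemma mpinv_dup : mpinv D = dup_pinv.
Proof.
have H : is_mpinv D dup_pinv.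
  split; rewrite -?mulmxA ?dup_pinvK ?mulmx1 ?mulmxA ?dup_pinvK ?mul1mx ?trmx1//.
  exact: dup_pinv_proj_sym.
apply: (is_mpinv_uniq _ H); apply: (@xgetPex _ 0 [set X | is_mpinv D X]).
by exists dup_pinv.
Qed.

Lemma tens_vec S A : (S *t S) *m vec A = vec (S *m A *m S^T).
Proof.
apply/colP => k; rewrite [RHS]mxE mxE; case: (mxtens_indexP k) => j i.
rewrite mxtens_indexK /=.
under eq_bigr do rewrite !mxE !mxtens_indexK /=.
rewrite (sum_unindex (fun ji => S j ji.1 * S i ji.2 * A ji.2 ji.1)) /= exchange_big /= mxE.
apply: eq_bigr => b _; rewrite !mxE mulr_suml; apply: eq_bigr => a _; ring.
Qed.

(** The l-th column is 2 [dup_pinv] applied to [vec (S *m P *m S)], where [P] is the symmetrized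
    unit matrix at position l, because [vec P] is the l-th row of [dup_pinv] transposed. *)
Lemma asym_WE S k l : S^T = S ->
  asym_W S k l = S (pos k).1 (pos l).1 * S (pos k).2 (pos l).2
               + S (pos k).1 (pos l).2 * S (pos k).2 (pos l).1.
Proof.
move=> sS; have Sij i j : S i j = S j i by rewrite -{1}sS mxE.
pose P : 'M[R]_p := 2^-1 *: (delta_mx (pos l).1 (pos l).2 + delta_mx (pos l).2 (pos l).1).
have E : vec P = (dup_pinv)^T *m delta_mx l (0 : 'I_1).
  rewrite -colE; apply/colP => m; case: (mxtens_indexP m) => j' i'.
  rewrite [LHS]mxE [RHS]mxE [RHS]mxE [RHS]mxE !mxtens_indexK /P !mxE /=; case: (pos l) => i j /=.
  rewrite !xpair_eqE ![i' == _]eq_sym ![j' == _]eq_sym.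
  by rewrite [(j == i') && _]andbC.
have -> : asym_W S k l = (asym_W S *m delta_mx l (0 : 'I_1)) k 0 by rewrite -colE [RHS]mxE.
rewrite /asym_W mpinv_dup -scalemxAl -!mulmxA -E tens_vec sS mxE.
have sP : P^T = P by rewrite /P linearZ/= linearD/= !trmx_delta addrC.
rewrite dup_pinv_sym; last by rewrite !trmx_mul sS sP mulmxA.
rewrite mxE /P -scalemxAr -scalemxAl mxE mulrA divff ?mul1r ?pnatr_eq0//.
rewrite mulmxDr mulmxDl mxE.
have F a b i j : (S *m delta_mx a b *m S) i j = S i a * S b j.
  rewrite -(mul_delta_mx (0 : 'I_1)) !mulmxA -colE -mulmxA -rowE mxE big_ord1 !mxE //.
by rewrite !F; congr (_ + _); rewrite [S _ (pos k).2]Sij.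
Qed.

(** The candidate inverse is verified on the vectors [vech V] with [V] symmetric: [D *m dup_pinv]
    fixes the vectorizations of symmetric matrices, so that the two Kronecker products meet and
    cancel. *)
Lemma asym_W_inv S : S^T = S -> S \in unitmx ->
  asym_W S \in unitmx /\
  invmx (asym_W S) = 2^-1 *: (D^T *m (invmx S *t invmx S) *m D).
Proof.
move=> sS uS; have siS : (invmx S)^T = invmx S by rewrite trmx_inv sS.
set Z := _ *: _.
have WZ : asym_W S *m Z = 1%:M.
  apply/matrixP => k l.
  have /colP/(_ k) : asym_W S *m Z *m delta_mx l 0 = delta_mx l (0 : 'I_1).
    rewrite /asym_W /Z mpinv_dup -!scalemxAl -!scalemxAr -!scalemxAl scalerA divff ?pnatr_eq0// scale1r.
    rewrite -!mulmxA -vec_unvech; set V := unvech _.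
    have sV : V^T = V by exact: unvech_sym.
    rewrite tens_vec siS [_^T *m (_ *m _)]mulmxA -trmx_mul dup_pinv_proj_sym.
    have sV' : (invmx S *m V *m invmx S)^T = invmx S *m V *m invmx S.
      by rewrite !trmx_mul siS sV mulmxA.
    rewrite -(mulmxA D) dup_pinv_sym// -dup_mxE// tens_vec sS !mulmxA mulmxV// mul1mx.
    by rewrite mulmxKV// dup_pinv_sym// /V unvechK.
  by rewrite -colE !mxE eqxx andbT.
have [uW _] := mulmx1_unit WZ; split=> //.
by rewrite -[Z]mul1mx -(mulVmx uW) -mulmxA WZ mulmx1.
Qed.

(** For E = E' the right side is the second order term in [contrast_quadratic]: the contrast weighs
    deviations by the inverse of their limit covariance. *)
Lemma asym_W_inv_form S E E' : S^T = S -> S \in unitmx -> E^T = E -> E'^T = E' ->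
  ((vech E)^T *m invmx (asym_W S) *m vech E') 0 0
  = 2^-1 * \tr (invmx S *m E *m invmx S *m E').
Proof.
move=> sS uS sE sE'; have [_ ->] := asym_W_inv sS uS.
have siS : (invmx S)^T = invmx S by rewrite trmx_inv sS.
rewrite -scalemxAr -scalemxAl mxE; congr (_ * _).
rewrite -!mulmxA -dup_mxE// mulmxA -trmx_mul -dup_mxE// tens_vec siS vec_tr sE.
by rewrite !mulmxA [LHS]mxtrace_mulC !mulmxA.
Qed.

End vectorization.

(** * Positive definite matrices *)

Section positive_definite.
Context (R : realType).

Lemma sqr_form n (x : 'cV[R]_n) : (x^T *m x) 0 0 = \sum_i x i 0 ^+ 2.
Proof. by rewrite mxE; apply: eq_bigr => i _; rewrite mxE expr2. Qed.

Lemma mul_trmx_diag m n (F : 'M[R]_(m, n)) i : (F *m F^T) i i = \sum_j F i j ^+ 2.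
Proof. by rewrite mxE; apply: eq_bigr => j _; rewrite mxE expr2. Qed.

Lemma posdef_unit n (S : 'M[R]_n) : posdef S -> S \in unitmx.
Proof.
move=> [_ pS]; rewrite unitmxE unitfE; apply/negP => /det0P[v v0 vS].
have := pS v^T; rewrite trmxK vS mul0mx mxE ltxx => /(_ _)/notF; apply.
by apply: contra v0 => /eqP/(congr1 trmx); rewrite trmxK trmx0 => ->.
Qed.

(** Induction on the size through the Schur complement [C'] of the top left entry. *)
Lemma posdef_chol n (S : 'M[R]_n) : posdef S -> exists L : 'M[R]_n, S = L *m L^T.
Proof.
elim: n S => [S _|n IH]; first by exists 0; apply/matrixP => -[].
rewrite -[n.+1]/(1 + n)%N => S [sS pS].
pose a := S 0 0; pose b := dlsubmx S; pose C := drsubmx S.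
have e0 : (delta_mx 0 0 : 'cV[R]_(1 + n)) != 0.
  by apply/eqP => /colP/(_ 0)/eqP; rewrite !mxE !eqxx oner_eq0.
have a0 : 0 < a by have := pS _ e0; rewrite trmx_delta -rowE -colE !mxE.
have aN : a != 0 by rewrite gt_eqF.
have SE : S = block_mx a%:M b^T b C.
  rewrite -[LHS]submxK; congr block_mx.
    by apply/matrixP => i j; rewrite !ord1 !mxE eqxx mulr1n; congr (S _ _); exact: val_inj.
  by rewrite /b -[in RHS]sS trmx_dlsub trmxK.
have sC : C^T = C by rewrite /C -[in RHS]sS trmx_drsub.
pose C' := C - a^-1 *: (b *m b^T).
have pC' : posdef C'.
  split; first by rewrite /C' linearB/= linearZ/= trmx_mul trmxK sC.
  (* The first coordinate minimizes the form of [S] for given [y]; the minimum is the form of the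
     Schur complement. *)
  move=> y y0; pose x : 'cV[R]_(1 + n) := col_mx (- a^-1 *: (b^T *m y)) y.
  have x0 : x != 0.
    by apply: contra y0 => /eqP/(congr1 dsubmx); rewrite col_mxKd => ->; rewrite linear0.
  have := pS x x0; rewrite -mulmxA [in S *m x]SE mul_block_col mul_scalar_mx scalerA mulrN divff//.
  rewrite scaleN1r addNr /x tr_col_mx mul_row_col mulmx0 add0r.
  by rewrite -mulmxA /C' mulmxBl -scalemxAl -scalemxAr scaleNr mulmxA addrC.
have [L' EL'] := IH _ pC'.
pose s := Num.sqrt a; have s0 : s != 0 by rewrite sqrtr_eq0 -ltNge.
have ss : s * s = a by rewrite -expr2 sqr_sqrtr// ltW.
exists (block_mx s%:M 0 (s^-1 *: b) L').
rewrite tr_block_mx mulmx_block !tr_scalar_mx trmx0 !mul0mx !mulmx0 !addr0 SE; congr block_mx.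
- by rewrite -scalar_mxM ss.
- by rewrite mul_scalar_mx linearZ/= scalerA divff// scale1r.
- by rewrite mul_mx_scalar scalerA divff// scale1r.
- by rewrite -EL' /C' linearZ/= -scalemxAl -scalemxAr scalerA -invfM ss addrC subrK.
Qed.

Lemma posdef_inv n (S : 'M[R]_n) : posdef S -> posdef (invmx S).
Proof.
move=> pS; have uS := posdef_unit pS; have [sS posS] := pS.
have siS : (invmx S)^T = invmx S by rewrite trmx_inv sS.
split=> // x x0; have y0 : invmx S *m x != 0.
  by apply: contra x0 => /eqP/(congr1 (mulmx S)); rewrite mulKVmx// mulmx0 => ->.
by have := posS _ y0; rewrite trmx_mul siS -mulmxA mulKVmx.
Qed.

(** With S = L L^T and M = K K^T the trace is the squared Frobenius norm of L^T E K, and both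
    factors are invertible. *)
Lemma trace_form_gt0 n (S M E : 'M[R]_n) : posdef S -> posdef M -> E != 0 ->
  0 < \tr (S *m E *m M *m E^T).
Proof.
move=> pS pM E0; have [L EL] := posdef_chol pS; have [K EK] := posdef_chol pM.
have uL : L \in unitmx by have := posdef_unit pS; rewrite EL unitmx_mul => /andP[].
have uK : K \in unitmx by have := posdef_unit pM; rewrite EK unitmx_mul => /andP[].
pose F := L^T *m E *m K.
have F0 : F != 0.
  apply: contra E0 => /eqP F0.
  have -> : E = invmx L^T *m F *m invmx K by rewrite /F !mulmxA mulVmx ?unitmx_tr// mul1mx mulmxK.
  by rewrite F0 mulmx0 mul0mx.
have -> : \tr (S *m E *m M *m E^T) = \tr (F *m F^T).
  by rewrite EL EK -!mulmxA mxtrace_mulC /F !trmx_mul trmxK !mulmxA.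
have F2 i : 0 <= (F *m F^T) i i.
  by rewrite mul_trmx_diag sumr_ge0// => j _; rewrite sqr_ge0.
rewrite lt_def sumr_ge0// andbT; apply: contra F0.
rewrite /mxtrace psumr_eq0// => /allP H; apply/eqP/matrixP => i j; rewrite [RHS]mxE.
have := H i (mem_index_enum _); rewrite mul_trmx_diag psumr_eq0 => [|k _]; last exact: sqr_ge0.
by move=> /allP/(_ j (mem_index_enum _)); rewrite sqrf_eq0 => /eqP.
Qed.

Lemma asym_W_inv_posdef p (S : 'M[R]_p) : posdef S -> posdef (invmx (asym_W S)).
Proof.
move=> pS; have uS := posdef_unit pS; have [sS _] := pS.
have [uW EW] := asym_W_inv sS uS.
have siS : (invmx S)^T = invmx S by rewrite trmx_inv sS.
split=> [|v v0].
  by rewrite EW linearZ/= !trmx_mul trmxK trmx_tens siS mulmxA.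
rewrite -(unvechK v) asym_W_inv_form ?unvech_sym//.
rewrite mulr_gt0 ?invr_gt0//.
have := @trace_form_gt0 _ (invmx S) (invmx S) (unvech v) (posdef_inv pS) (posdef_inv pS).
rewrite unvech_sym; apply; apply: contra v0 => /eqP E.
by apply/eqP; rewrite -[LHS]unvechK E; apply/colP => k; rewrite mxE /= !mxE.
Qed.

Lemma posdef_congr m n (S : 'M[R]_m) (D : 'M[R]_(m, n)) : posdef S -> \rank D = n ->
  posdef (D^T *m S *m D).
Proof.
move=> [sS pS] rD; split=> [|x x0]; first by rewrite !trmx_mul trmxK sS mulmxA.
have Dx0 : D *m x != 0.
  apply: contra x0 => /eqP Dx.
  have fD : row_free D^T by rewrite /row_free mxrank_tr rD.
  apply/eqP/trmx_inj/(row_free_inj fD); rewrite trmx0 mul0mx -trmx_mul Dx trmx0 //.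
by have := pS _ Dx0; rewrite trmx_mul !mulmxA.
Qed.

Lemma posdefD n (S M : 'M[R]_n) : posdef S -> possemidef M -> posdef (S + M).
Proof.
move=> [sS pS] [sM pM]; split=> [|x x0]; first by rewrite linearD/= sS sM.
by rewrite mulmxDr mulmxDl mxE ltr_pwDl// pS.
Qed.

Lemma possemidef_congr m n (S : 'M[R]_m) (D : 'M[R]_(n, m)) : possemidef S ->
  possemidef (D *m S *m D^T).
Proof.
move=> [sS pS]; split=> [|x]; first by rewrite !trmx_mul trmxK sS mulmxA.
by have := pS (D^T *m x); rewrite trmx_mul trmxK !mulmxA.
Qed.

Lemma possemidefD n (S M : 'M[R]_n) : possemidef S -> possemidef M -> possemidef (S + M).
Proof.
move=> [sS pS] [sM pM]; split=> [|x]; first by rewrite linearD/= sS sM.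
by rewrite mulmxDr mulmxDl mxE addr_ge0.
Qed.

(** The covariance is a sum over the sources: the measurement errors give a definite block diagonal
    matrix, while [Sigma_xi] and [Sigma_zeta] enter by congruence as semidefinite terms. *)
Lemma sem_cov_posdef p1 p2 k1 k2 (m : sem R p1 p2 k1 k2) : sem_admissible m ->
  posdef (sem_cov m).
Proof.
move=> [_ _ _ [pxi pze] [pde pep]].
pose Pi := invmx (Psi m).
pose A : 'M[R]_(p1 + p2, k1) := col_mx (Lambda1 m) (Lambda2 m *m Pi *m Gamma m).
pose B : 'M[R]_(p1 + p2, k2) := col_mx 0 (Lambda2 m *m Pi).
have -> : sem_cov m = block_mx (Sigma_delta m) 0 0 (Sigma_eps m)
    + (A *m Sigma_xi m *m A^T + B *m Sigma_zeta m *m B^T).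
  have [sxi _] := pxi.
  rewrite /sem_cov /A /B !tr_col_mx !mul_col_mx !mul_mx_row -!block_mxEv !add_block_mx trmx0 !mul0mx !mulmx0.
  rewrite !add0r !addr0 -/Pi; congr block_mx.
  - by rewrite addrC.
  - by rewrite !trmx_mul !mulmxA.
  - by rewrite !trmx_mul !trmxK sxi !mulmxA.
  - by rewrite addrC; congr (_ + _); rewrite mulmxDr !mulmxDl !trmx_mul !mulmxA.
apply: posdefD; last by apply: possemidefD; exact: possemidef_congr.
have [sde qde] := pde; have [sep qep] := pep.
split=> [|x x0]; first by rewrite tr_block_mx !trmx0 sde sep.
rewrite -(vsubmxK x) tr_col_mx mul_row_block !mulmx0 addr0 add0r mul_row_col mxE.
have pe (n : nat) (S : 'M[R]_n) (y : 'cV[R]_n) : posdef S -> 0 <= (y^T *m S *m y) 0 0.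
  by move=> [_ pS]; have [->|/pS/ltW//] := eqVneq y 0; rewrite mulmx0 mxE.
have [u0|u0] := eqVneq (usubmx x) 0.
  have [d0|d0] := eqVneq (dsubmx x) 0; last by rewrite ltr_wpDl ?pe// qep.
  by move: x0; rewrite -(vsubmxK x) u0 d0 col_mx0 eqxx.
by rewrite ltr_pwDl ?pe// qde.
Qed.
End positive_definite.

(** * The Gaussian contrast *)

Section determinant_derivative.
Context (R : realType).

(** The determinant is the reversed characteristic polynomial of - A at s. Its leading coefficients
    are 1 and the trace of A, and every other term carries a factor s^2. *)
Lemma det_perturb n (A : 'M[R]_n) : exists2 C, 0 <= C & forall s : R, `|s| <= 1 ->
  `|\det (1%:M + s *: A) - 1 - s * \tr A| <= C * s ^+ 2.
Proof.
case: n A => [|n] A.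
  exists 0 => // s _; rewrite det_mx00 /mxtrace big_ord0 subrr mulr0 subrr normr0 mul0r //.
pose p := char_poly (- A).
exists (\sum_(k < n) `|p`_k|) => [|s s1]; first by rewrite sumr_ge0.
have [->|s0] := eqVneq s 0.
  by rewrite scale0r addr0 det1 subrr mul0r subrr normr0 expr0n mulr0.
have E : \det (1%:M + s *: A) = \sum_(k < n.+2) p`_k * s ^+ (n.+1 - k).
  have -> : 1%:M + s *: A = s *: (s^-1%:M + A) by rewrite scalerDr scale_scalar_mx divff.
  rewrite detZ; have -> : \det (s^-1%:M + A) = p.[s^-1].
    rewrite /p /char_poly -horner_evalE -det_map_mx; congr (\det _).
    apply/matrixP => i j; rewrite !mxE /= /horner_eval hornerD hornerN hornerMn hornerX hornerC.
    by rewrite opprK.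
  rewrite horner_coef size_char_poly mulr_sumr; apply: eq_bigr => k _.
  rewrite mulrCA exprVn; congr (_ * _).
  by rewrite -{1}(subnK (leq_ord k)) exprD mulfK// expf_neq0.
rewrite E !big_ord_recr /= subnn expr0 mulr1 subSnn expr1.
have -> : p`_n.+1 = 1.
  by have /monicP := char_poly_monic (- A); rewrite lead_coefE size_char_poly.
have -> : p`_n = \tr A by rewrite /p char_poly_trace// linearN/= opprK.
have -> : \sum_(i < n) p`_i * s ^+ (n.+1 - i) + \tr A * s + 1 - 1 - s * \tr A
   = \sum_(i < n) p`_i * s ^+ (n.+1 - i) by ring.
rewrite (le_trans (ler_norm_sum _ _ _))// mulr_suml; apply: ler_sum => k _.
rewrite normrM ler_wpM2l// normrX.
have -> : (n.+1 - k = (n.-1 - k) + 2)%N.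
  move: (ltn_ord k); move: (nat_of_ord k) => k'; case: (n) => [//|m] km.
  by rewrite /= addn2 !subSn// ltnW.
rewrite exprD [X in _ * X]real_normK ?num_real// ger_pMl ?exprn_even_gt0//.
by rewrite exprn_ile1.
Qed.

Lemma posdef_det_gt0 n (S : 'M[R]_n) : posdef S -> 0 < \det S.
Proof.
move=> pS; have [L EL] := posdef_chol pS.
have := posdef_unit pS; rewrite unitmxE unitfE => d0.
by rewrite lt_def d0 EL det_mulmx det_tr -expr2 sqr_ge0.
Qed.

(** Jacobi's formula; factoring out det M reduces it to the expansion at the identity in
    [det_perturb]. *)
Lemma is_derive_det n (S E : 'M[R]_n) (t : R) : S + t *: E \in unitmx ->
  is_derive t 1 (fun t => \det (S + t *: E))
    (\det (S + t *: E) * \tr (invmx (S + t *: E) *m E)).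
Proof.
move=> uM; set M := S + t *: E in uM *.
have [C C0 HC] := det_perturb (invmx M *m E).
set f := (fun t => _); set L := _ * _.
have ME s : \det (S + (s + t) *: E) = \det M * \det (1%:M + s *: (invmx M *m E)).
  rewrite -det_mulmx mulmxDr mulmx1 -scalemxAr mulKVmx// /M -addrA -scalerDl.
  by rewrite [t + s]addrC.
have lim : s^-1 *: ((f \o shift t) (s *: 1) - f t) @[s --> 0^'] --> L.
  apply/cvgrPdist_le => e e0.
  have D0 : 0 < e / (`|\det M| * C + 1) by rewrite divr_gt0// ltr_wpDl// mulr_ge0.
  near=> s.
  have s0 : s != 0 by near: s; exact: nbhs_dnbhs_neq.
  have s1 : `|s| <= 1.
    by near: s; apply: dnbhs0_le.
  have sD : `|s| <= e / (`|\det M| * C + 1) by near: s; apply: dnbhs0_le.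
  rewrite /f /= -[s%:A]/(s * 1) mulr1 -/M ME.
  have -> : L - s^-1 *: (\det M * \det (1%:M + s *: (invmx M *m E)) - \det M)
     = - (\det M * s^-1 * (\det (1%:M + s *: (invmx M *m E)) - 1 - s * \tr (invmx M *m E))).
    by rewrite /L -[s^-1 *: _]/(s^-1 * _); field.
  rewrite normrN !normrM; have H := HC s s1.
  apply: (@le_trans _ _ (`|\det M| * `|s^-1| * (C * s ^+ 2))).
    by rewrite ler_wpM2l// mulr_ge0.
  have -> : `|\det M| * `|s^-1| * (C * s ^+ 2) = `|s| * (`|\det M| * C).
    rewrite -[s ^+ 2]real_normK ?num_real// normfV; field.
    by rewrite normr_eq0.
  apply: (@le_trans _ _ (`|s| * (`|\det M| * C + 1))); first by rewrite ler_wpM2l// lerDl.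
  by rewrite -ler_pdivlMr// ltr_wpDl// mulr_ge0.
by apply: DeriveDef; [apply/cvg_ex; exists L|exact: cvg_lim lim].
Unshelve. all: by end_near.
Qed.

End determinant_derivative.

(** * Positivity and quadratic expansion of the contrast *)

Section contrast_expansion.
Context (R : realType).

Lemma invmx_sub n (S M : 'M[R]_n) : S \in unitmx -> M \in unitmx ->
  invmx S - invmx M = invmx S *m (M - S) *m invmx M.
Proof. by move=> uS uM; rewrite mulmxBr mulmxBl mulmxK// mulVmx// mul1mx. Qed.

Lemma posdef_segment n (S Q : 'M[R]_n) (t : R) : posdef S -> posdef Q -> 0 <= t <= 1 ->
  posdef (S + t *: (Q - S)).
Proof.
move=> [sS pS] [sQ pQ] /andP[t0 t1].
have E : S + t *: (Q - S) = (1 - t) *: S + t *: Q.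
  by apply/matrixP => i j; rewrite !mxE; ring.
rewrite E; split=> [|x x0]; first by rewrite linearD/= !linearZ/= sS sQ.
rewrite mulmxDr mulmxDl -!scalemxAr -!scalemxAl mxE [X in X + _]mxE [X in _ + X]mxE.
have a := pS x x0; have b := pQ x x0.
have [->|tN] := eqVneq t 0; first by rewrite subr0 mul1r mul0r addr0.
have t0' : 0 < t by rewrite lt_def tN.
by rewrite ltr_wpDl ?mulr_gt0// mulr_ge0 ?subr_ge0// ltW.
Qed.

(* Taylor expansion along the segment from [S] to [Q]; at [c = 0] it gives the
   sign of the contrast, at [c] the limit of the trace its second order term. *)
Lemma contrast_taylor n (S Q : 'M[R]_n) (c : R) : posdef S -> posdef Q ->
  exists2 t : R, 0 < t < 1 & contrastF Q S - c / 2
    = t * (\tr (invmx S *m (Q - S) *m invmx (S + t *: (Q - S)) *m (Q - S)) - c).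
Proof.
move=> pS pQ; pose E := Q - S; pose M (t : R) := S + t *: E.
(* [phi 1 - phi 0] is the left side. Since the inverses of S and M t differ by t times a product,
   the derivative of [phi] carries a factor t, and a single mean value step gives a term of second
   order in E. *)
pose phi (t : R) := t * \tr (invmx S *m E) - ln (\det (M t)) - c / 2 * t ^+ 2.
have pM (t : R) : 0 <= t <= 1 -> posdef (M t) by exact: posdef_segment.
pose dphi t := t * (\tr (invmx S *m E *m invmx (M t) *m E) - c).
have dphiP (t : R) : 0 <= t <= 1 -> is_derive t 1 phi (dphi t).
  move=> t01; have uM := posdef_unit (pM t t01); have d0 := posdef_det_gt0 (pM t t01).
  have D1 := is_derive_det uM.
  have D2 := @is_derive1_comp _ (@ln R) _ _ _ _ (is_derive1_ln d0) D1.
  have D3 : is_derive t 1 (fun t : R => t * \tr (invmx S *m E)) (\tr (invmx S *m E)).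
    by apply: is_derive_eq; rewrite scaler0 add0r -[_%:A]/(_ * 1) mulr1.
  have D4 : is_derive t 1 (fun t : R => c / 2 * t ^+ 2) (c * t).
    by apply: is_derive_eq; rewrite -[_ *: _]/(_ * _) -[_%:A]/(_ * 1); field.
  apply: (is_derive_eq (is_deriveB (is_deriveB D3 D2) D4)).
  rewrite mulKf ?gt_eqF// /dphi mulrBr; congr (_ - _); last by rewrite mulrC.
  rewrite -linearB -mulmxBl /= (invmx_sub (posdef_unit pS) uM).
  by rewrite /M [S + _ - S]addrC addKr -scalemxAr -!scalemxAl linearZ.
have [t t01 Et] : exists2 t, t \in `]0, 1[ & phi 1 - phi 0 = dphi t * (1 - 0).
  apply: MVT => // [t|]; first by rewrite in_itv/= => /andP[/ltW t0 /ltW t1]; apply: dphiP; rewrite t0.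
  apply: derivable_within_continuous => t; rewrite in_itv/= => t01.
  by have [] := dphiP t t01.
exists t; first by move: t01; rewrite in_itv.
rewrite -/E -/(M t) -/(dphi t); move: Et; rewrite subr0 mulr1 => <-.
rewrite /phi /M scale0r addr0 scale1r /E subrKC expr1n expr0n/= !mul0r !mul1r mulr1 mulr0.
rewrite /contrastF mulmxBr mulVmx ?posdef_unit// linearB/= mxtrace1.
by ring.
Qed.

Lemma contrastF_refl n (S : 'M[R]_n) : posdef S -> contrastF S S = 0.
Proof.
move=> pS; rewrite /contrastF subrr add0r mulVmx ?posdef_unit// mxtrace1.
by rewrite subrr.
Qed.

Lemma contrastF_gt0 n (S Q : 'M[R]_n) : posdef S -> posdef Q -> Q != S ->
  0 < contrastF Q S.
Proof.
move=> pS pQ QS; have [t /andP[t0 t1]] := contrast_taylor 0 pS pQ.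
rewrite mul0r !subr0 => ->; rewrite mulr_gt0//.
have sE : (Q - S)^T = Q - S by rewrite linearB/=; case: pS => -> _; case: pQ => -> _.
rewrite -[X in _ *m X]sE; apply: trace_form_gt0; [exact: posdef_inv|apply: posdef_inv|].
  by apply: posdef_segment => //; rewrite !ltW.
by rewrite subr_eq0.
Qed.

Lemma form_norm n (A : 'M[R]_n) (x y : 'cV[R]_n) :
  `|(x^T *m A *m y) 0 0| <= n%:R ^+ 2 * (`|A| * `|x| * `|y|).
Proof.
have xT : `|x^T| <= `|x| by apply: mx_norm_le => // i j; rewrite mxE mx_norm_coord.
apply: (le_trans (mx_norm_coord _ _ _)); apply: (le_trans (mx_norm_mul _ _)).
have H : `|x^T *m A| <= n%:R * `|x| * `|A|.
  by rewrite (le_trans (mx_norm_mul _ _))// ler_wpM2r// ler_wpM2l.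
have -> : n%:R ^+ 2 * (`|A| * `|x| * `|y|) = n%:R * (n%:R * `|x| * `|A|) * `|y| by ring.
by rewrite ler_wpM2r// ler_wpM2l.
Qed.

(** The Cholesky factor is invertible, so the norm of x is controlled by that of [L^T *m x]; this
    yields an explicit constant without minimizing over a sphere. *)
Lemma posdef_lower n (S : 'M[R]_n) : posdef S ->
  exists2 c, 0 < c & forall x : 'cV[R]_n, c * `|x| ^+ 2 <= (x^T *m S *m x) 0 0.
Proof.
move=> pS; have [L EL] := posdef_chol pS.
have uL : L^T \in unitmx by have := posdef_unit pS; rewrite EL unitmx_mul => /andP[].
pose a := n%:R * `|invmx L^T| + 1.
have a0 : 0 < a by rewrite ltr_wpDl// mulr_ge0.
exists (a ^- 2) => [|x]; first by rewrite invr_gt0 exprn_gt0.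
pose y := L^T *m x.
have yE : (x^T *m S *m x) 0 0 = \sum_i y i 0 ^+ 2.
  by rewrite -sqr_form /y trmx_mul trmxK EL !mulmxA.
have y2 : `|y| ^+ 2 <= \sum_i y i 0 ^+ 2.
  have S0 : 0 <= \sum_i y i 0 ^+ 2 by apply: sumr_ge0 => i _; exact: sqr_ge0.
  rewrite -[leRHS]sqr_sqrtr// ler_sqr ?nnegrE ?sqrtr_ge0//.
  apply: mx_norm_le => [|i j]; first exact: sqrtr_ge0.
  rewrite ord1 -ler_sqr ?nnegrE ?sqrtr_ge0// sqr_sqrtr// real_normK ?num_real//.
  by rewrite (bigD1 i)//= lerDl; apply: sumr_ge0 => k _; exact: sqr_ge0.
rewrite yE (le_trans _ y2)// ler_pdivrMl ?exprn_gt0// -exprMn.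
apply: lerXn2r; rewrite ?nnegrE ?mulr_ge0 ?(ltW a0)//.
have {1}-> : x = invmx L^T *m y by rewrite /y mulKmx.
apply: (le_trans (mx_norm_mul _ _)).
by rewrite ler_wpM2r// lerDl.
Qed.

Lemma posdef_near n (S : 'M[R]_n) : posdef S ->
  exists2 e, 0 < e & forall Q : 'M[R]_n, Q^T = Q -> `|Q - S| < e -> posdef Q.
Proof.
move=> pS; have [c c0 Hc] := posdef_lower pS.
have n0 : 0 < n%:R ^+ 2 + 1 :> R by rewrite ltr_wpDl// sqr_ge0.
exists (c / (n%:R ^+ 2 + 1)) => [|Q sQ QS]; first by rewrite divr_gt0.
split=> // x x0; have x2 : 0 < `|x| ^+ 2 by rewrite exprn_gt0// normr_gt0.
have -> : Q = S + (Q - S) by rewrite subrKC.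
rewrite mulmxDr mulmxDl mxE.
apply: (@lt_le_trans _ _ (c * `|x| ^+ 2 - n%:R ^+ 2 * (`|Q - S| * `|x| * `|x|))); last first.
  by apply: lerD => //; have := form_norm (Q - S) x x; rewrite ler_norml => /andP[].
rewrite -mulrA -expr2 mulrA -mulrBl mulr_gt0// subr_gt0.
move: QS; rewrite ltr_pdivlMr// => QS.
by apply: le_lt_trans QS; rewrite mulrC ler_wpM2l// lerDl.
Qed.

Lemma invmx_near n (S : 'M[R]_n) (e : R) : S \in unitmx -> 0 < e ->
  exists2 d, 0 < d & forall M : 'M[R]_n, M \in unitmx -> `|M - S| <= d ->
    `|invmx M - invmx S| <= e.
Proof.
move=> uS e0; pose a := `|invmx S|; pose k : R := n%:R ^+ 2.
have k0 : 0 <= k by exact: sqr_ge0.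
have na : 0 <= a by exact: normr_ge0.
have d1 : 0 < (2 * k * a + 1)^-1 by rewrite invr_gt0 ltr_wpDl// !mulr_ge0.
have d2 : 0 < e / (2 * k * a ^+ 2 + 1) by rewrite divr_gt0// ltr_wpDl// !mulr_ge0.
(* The first member keeps the norm of [invmx M] below 2 a, by absorbing half of it in the triangle
   inequality; the second then gives the accuracy [e]. *)
exists (Num.min (2 * k * a + 1)^-1 (e / (2 * k * a ^+ 2 + 1))) => [|M uM].
  by rewrite lt_min d1.
rewrite le_min; set d := `|M - S| => /andP[dd1 dd2].
have dd1' : d * (2 * k * a + 1) <= 1 by rewrite -ler_pdivlMr ?mul1r// ltr_wpDl// !mulr_ge0.
have dd2' : d * (2 * k * a ^+ 2 + 1) <= e by rewrite -ler_pdivlMr// ltr_wpDl// !mulr_ge0.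
have H : `|invmx M - invmx S| <= k * `|invmx M| * d * a.
  rewrite invmx_sub// -normrN -mulNmx -mulmxN opprB.
  apply: (le_trans (mx_norm_mul _ _)).
  have -> : k * `|invmx M| * d * a = n%:R * (n%:R * `|invmx M| * d) * a by rewrite /k; ring.
  by rewrite ler_wpM2r// ler_wpM2l// mx_norm_mul.
have m2 : `|invmx M| <= 2 * a.
  have : `|invmx M| <= a + `|invmx M - invmx S|.
    by rewrite -{1}(subrK (invmx S) (invmx M)) addrC ler_normD.
  have d0 : 0 <= d by exact: normr_ge0. have a0 := na.
  set m := `|invmx M| in H *; set b := `|_ - _| in H * => mb.
  have m0 : 0 <= m by exact: normr_ge0.
  have : m * (d * (2 * k * a)) <= m * 1 by rewrite ler_wpM2l//; move: dd1'; rewrite mulrDr mulr1; lra.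
  by move: H mb; rewrite /m /b; nra.
apply: (le_trans H); apply: le_trans dd2'.
have d0 : 0 <= d by exact: normr_ge0. have a0 := na.
apply: (@le_trans _ _ (k * (2 * a) * d * a)).
  by rewrite ler_wpM2r// ler_wpM2r// ler_wpM2l.
rewrite mulrDr mulr1 (_ : _ * d * a = d * (2 * k * a ^+ 2)); last by ring.
by rewrite lerDl.
Qed.

Lemma mxtrace_norm n (A : 'M[R]_n) : `|\tr A| <= n%:R * `|A|.
Proof.
rewrite mulr_natl -[X in _ *+ X]card_ord -sumr_const (le_trans (ler_norm_sum _ _ _))//.
by apply: ler_sum => i _; exact: mx_norm_coord.
Qed.

Lemma mxtrace_sub n (A B : 'M[R]_n) : \tr (A - B) = \tr A - \tr B.
Proof. by rewrite /mxtrace -sumrB; apply: eq_bigr => i _; rewrite !mxE. Qed.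

Lemma trace4_norm n (A B E : 'M[R]_n) :
  `|\tr (A *m E *m B *m E)| <= n%:R ^+ 4 * (`|A| * `|B| * `|E| ^+ 2).
Proof.
apply: (le_trans (mxtrace_norm _)).
rewrite exprS -mulrA ler_wpM2l//; apply: (le_trans (mx_norm_mul _ _)).
have -> : n%:R ^+ 3 * (`|A| * `|B| * `|E| ^+ 2) = n%:R * (n%:R * (n%:R * `|A| * `|E|) * `|B|) * `|E| by ring.
rewrite ler_wpM2r// ler_wpM2l//; apply: (le_trans (mx_norm_mul _ _)).
by rewrite ler_wpM2r// ler_wpM2l// mx_norm_mul.
Qed.

(** Uniform in both arguments and with the inverses frozen at [S0], so that contrasts at two
    parameter values are compared through one quadratic form. *)
Lemma contrast_quadratic n (S0 : 'M[R]_n) (e : R) : posdef S0 -> 0 < e ->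
  exists2 d, 0 < d & forall S Q : 'M[R]_n, posdef S -> posdef Q ->
    `|S - S0| <= d -> `|Q - S0| <= d ->
    `|contrastF Q S - \tr (invmx S0 *m (Q - S) *m invmx S0 *m (Q - S)) / 2|
    <= e * `|Q - S| ^+ 2.
Proof.
move=> pS0 e0; set K := invmx S0; pose m := n%:R ^+ 4 * (2 * `|K| + 1) + 1.
have m0 : 0 < m by rewrite ltr_wpDl// mulr_ge0// ?exprn_ge0// addr_ge0// mulr_ge0.
have em : 0 < Num.min 1 (e / m) by rewrite lt_min ltr01 divr_gt0.
have [d d0 Hd] := invmx_near (posdef_unit pS0) em.
exists d => // S Q pS pQ Sd Qd; set E := Q - S.
have [t /andP[t0 t1] ->] := contrast_taylor (\tr (K *m E *m K *m E)) pS pQ.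
rewrite -/E; have t01 : 0 <= t <= 1 by rewrite !ltW.
have pM := posdef_segment pS pQ t01; set M := S + t *: E in pM *.
have Md : `|M - S0| <= d.
  have -> : M - S0 = (1 - t) *: (S - S0) + t *: (Q - S0).
    by apply/matrixP => i j; rewrite !mxE; ring.
  apply: (le_trans (ler_normD _ _)); rewrite !normrZ !ger0_norm ?(ltW t0) ?subr_ge0 ?(ltW t1)//.
  have -> : d = (1 - t) * d + t * d by ring.
  by apply: lerD; apply: ler_wpM2l => //; rewrite ?subr_ge0 ltW.
have := Hd S (posdef_unit pS) Sd; have := Hd M (posdef_unit pM) Md.
rewrite !le_min -/K => /andP[A1 Ae] /andP[B1 Be].
set A := invmx S in B1 Be *; set B := invmx M in A1 Ae *.
have -> : \tr (A *m E *m B *m E) - \tr (K *m E *m K *m E)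
   = \tr ((A - K) *m E *m B *m E) + \tr (K *m E *m (B - K) *m E).
  rewrite mulmxBl mulmxBl mulmxBl [K *m E *m (B - K)]mulmxBr [(_ - _) *m E]mulmxBl.
  by rewrite !mxtrace_sub addrA subrK.
have nB : `|B| <= `|K| + 1.
  by rewrite -(subrK K B) addrC (le_trans (ler_normD _ _))// lerD2l.
rewrite normrM [`|t|]ger0_norm ?(ltW t0)//.
apply: (@le_trans _ _ (`|\tr ((A - K) *m E *m B *m E) + \tr (K *m E *m (B - K) *m E)|)).
  by rewrite ler_piMl// ltW.
apply: (le_trans (ler_normD _ _)).
apply: (le_trans (lerD (trace4_norm _ _ _) (trace4_norm _ _ _))).
set x := `|A - K| in B1 Be *; set y := `|B - K| in A1 Ae *.
have x0 : 0 <= x by exact: normr_ge0.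
have y0 : 0 <= y by exact: normr_ge0.
have n4 : 0 <= n%:R ^+ 4 :> R by rewrite exprn_ge0.
have E2 : 0 <= `|E| ^+ 2 by exact: sqr_ge0.
have em0 : 0 <= e / m by rewrite ltW// divr_gt0.
have -> : n%:R ^+ 4 * (x * `|B| * `|E| ^+ 2) + n%:R ^+ 4 * (`|K| * y * `|E| ^+ 2)
   = n%:R ^+ 4 * (x * `|B| + `|K| * y) * `|E| ^+ 2 by ring.
rewrite ler_wpM2r//.
apply: (@le_trans _ _ (n%:R ^+ 4 * (e / m * (`|K| + 1) + `|K| * (e / m)))).
  rewrite ler_wpM2l//; apply: lerD; last exact: ler_wpM2l.
  exact: ler_pM.
rewrite (_ : _ * _ = e * (n%:R ^+ 4 * (2 * `|K| + 1) / m)); last by field; rewrite gt_eqF.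
by rewrite ger_pMr// ler_pdivrMr// mul1r lerDl.
Qed.
End contrast_expansion.

(** * Minimum contrast estimation *)

Section minimum_contrast.
Context (R : realType) (p q : nat) (Theta : set 'cV[R]_q) (G : 'cV[R]_q -> 'M[R]_p).
Context (theta0 : 'cV[R]_q) (Delta : 'M[R]_(vech_dim p, q)).
Local Notation S0 := (G theta0).
Hypothesis Theta_compact : compact Theta.
Hypothesis Theta_int : exists2 r, 0 < r & forall y, `|y - theta0| < r -> Theta y.
Hypothesis G_posdef : forall y, Theta y -> posdef (G y).
Hypothesis G_cont : forall x, Theta x -> forall e, 0 < e ->
  \forall y \near x, Theta y -> `|G y - G x| <= e.
Hypothesis G_inj : forall x y, Theta x -> Theta y -> G x = G y -> x = y.
Hypothesis G_diff : forall e, 0 < e -> exists2 d, 0 < d & forall y, `|y - theta0| < d ->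
  `|vech (G y) - vech S0 - Delta *m (y - theta0)| <= e * `|y - theta0|.
Hypothesis Delta_rank : \rank Delta = q.

Let Theta0 : Theta theta0.
Proof. by have [r r0] := Theta_int; apply; rewrite subrr normr0. Qed.

Let pS0 : posdef S0. Proof. exact: G_posdef. Qed.

Definition minimizes (Q : 'M[R]_p) (x : 'cV[R]_q) :=
  Theta x /\ forall y, Theta y -> contrast Q (G x) <= contrast Q (G y).

(* Only the concavity of [ln \o det], in the form [0 <= contrastF S1 S], is
   used: the determinant itself need not be continuous. *)
Let separation (S1 : 'M[R]_p) : posdef S1 -> S1 != S0 ->
  exists2 e, 0 < e & forall S Q, posdef S -> posdef Q -> `|S - S1| <= e -> `|Q - S0| <= e ->
    contrastF Q S0 < contrastF Q S.
Proof.
move=> pS1 S10; have a0 := contrastF_gt0 pS1 pS0 _.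
have {a0} : 0 < contrastF S0 S1 by apply: a0; rewrite eq_sym.
set a := contrastF S0 S1 => a0.
pose b := `|invmx S1|; pose k := `|invmx S0|; pose s := `|S0|.
have [b0 k0 s0] : [/\ 0 <= b, 0 <= k & 0 <= s] by split; exact: normr_ge0.
(* One summand for each of the four traces [t1] to [t4] by which the difference of contrasts at (S,
   Q) may fall short of its value [a] at (S1, S0). *)
pose c := p%:R ^+ 2 * ((b + 1) + (s + 1) + b + k) + 1.
have c0 : 0 < c by rewrite ltr_wpDl// mulr_ge0 ?exprn_ge0// !addr_ge0.
pose e := Num.min 1 (a / c / 2).
have e0 : 0 < e by rewrite lt_min ltr01 !divr_gt0.
have e1 : e <= 1 by rewrite ge_min lexx.
have eac : e * c <= a / 2.
  by rewrite -ler_pdivlMr// mulrAC /e ge_min lexx orbT.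
have [d d0 Hd] := invmx_near (posdef_unit pS1) e0.
exists (Num.min e d) => [|S Q pS pQ]; first by rewrite lt_min e0.
rewrite le_min => /andP[Se Sd]; rewrite le_min => /andP[Qe _].
have SI := Hd S (posdef_unit pS) Sd.
have F0 : 0 <= contrastF S1 S.
  have [->|N] := eqVneq S1 S; first by rewrite contrastF_refl.
  by rewrite ltW// contrastF_gt0.
have tr2 (A B : 'M[R]_p) : `|\tr (A *m B)| <= p%:R ^+ 2 * (`|A| * `|B|).
  apply: (le_trans (mxtrace_norm _)); rewrite expr2 -mulrA ler_wpM2l// mulrA.
  exact: mx_norm_mul.
have nS : `|invmx S| <= b + 1.
  rewrite -(subrK (invmx S1) (invmx S)) addrC (le_trans (ler_normD _ _))// lerD2l.
  exact: le_trans e1.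
have nQ : `|Q| <= s + 1.
  rewrite -(subrK S0 Q) addrC (le_trans (ler_normD _ _))// lerD2l.
  exact: le_trans e1.
have t1 := tr2 (invmx S) (S - S1); have t2 := tr2 (invmx S - invmx S1) Q.
have t3 := tr2 (invmx S1) (Q - S0); have t4 := tr2 (invmx S0) (Q - S0).
have p2 : 0 <= p%:R ^+ 2 :> R by rewrite exprn_ge0.
have {}t1 : `|\tr (invmx S *m (S - S1))| <= p%:R ^+ 2 * ((b + 1) * e).
  by apply: (le_trans t1); rewrite ler_wpM2l// ler_pM.
have {}t2 : `|\tr ((invmx S - invmx S1) *m Q)| <= p%:R ^+ 2 * (e * (s + 1)).
  by apply: (le_trans t2); rewrite ler_wpM2l// ler_pM.
have {}t3 : `|\tr (invmx S1 *m (Q - S0))| <= p%:R ^+ 2 * (b * e).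
  by apply: (le_trans t3); rewrite ler_wpM2l// ler_pM.
have {}t4 : `|\tr (invmx S0 *m (Q - S0))| <= p%:R ^+ 2 * (k * e).
  by apply: (le_trans t4); rewrite ler_wpM2l// ler_pM.
move: F0 eac t1 t2 t3 t4; rewrite !mulmxBr !mulmxBl !mxtrace_sub !mulVmx ?posdef_unit// !mxtrace1.
rewrite /a /contrastF /c !ler_norml => F0 eac /andP[t1 _] /andP[t2 _] /andP[t3 _] /andP[_ t4].
move: a0; rewrite /a /contrastF => a0.
lra.
Qed.

(** Around each parameter at distance at least [e], the contrast at [theta0] is strictly smaller for
    all Q near [S0]. Compactness, in near-covering form, makes that neighbourhood of [S0]
    uniform. *)
Lemma minimizer_near (e : R) : 0 < e -> exists2 d, 0 < d & forall Q x, Q^T = Q ->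
  `|Q - S0| < d -> minimizes Q x -> `|x - theta0| < e.
Proof.
move=> e0; have [dp dp0 Hp] := posdef_near pS0.
pose K := Theta `&` [set x | e <= `|x - theta0|].
have cn : continuous (fun x : 'cV[R]_q => `|x - theta0|).
  move=> x; have cB : y - theta0 @[y --> x] --> x - theta0.
    apply: (@cvgB _ _ _ (nbhs x) (nbhs_filter x)); first exact: cvg_id.
    exact: (@cvg_cst _ _ _ (nbhs x) (nbhs_filter x)).
  exact: (@cvg_norm _ _ _ (nbhs x) (nbhs_filter x) _ _ cB).
have cK : compact K.
  apply: compact_closedI => //.
  have -> : [set x | e <= `|x - theta0|] = (fun x => `|x - theta0|) @^-1` [set r | e <= r] by [].
  apply: closed_comp; last exact: closed_ge.
  by move=> x _; exact: cn.
pose Pr (Q : 'M[R]_p) x := Theta x -> posdef Q -> contrastF Q S0 < contrastF Q (G x).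
have near x : K x -> \forall x' \near x & Q \near nbhs S0, Pr Q x'.
  move=> [Tx ex]; have Gx : G x != S0.
    apply/eqP => /(G_inj Tx Theta0) xE; move: ex => /=.
    by rewrite xE subrr normr0 leNgt e0.
  have [dl dl0 Hs] := separation (G_posdef Tx) Gx.
  exists ([set y | Theta y -> `|G y - G x| <= dl], [set Q | `|Q - S0| <= dl]).
    split=> /=; first exact: G_cont.
    by apply/nbhs_ballP; exists dl => // Q; rewrite -ball_normE /= distrC => /ltW.
  by move=> [y Q] /= [Hy HQ] Ty pQ; apply: Hs => //; [exact: G_posdef|exact: Hy].
move/compact_near_coveringP: cK => /(_ _ (nbhs S0) Pr (nbhs_filter S0) near).
case/nbhs_ballP.
move=> dl /= dl0 HB; exists (Num.min dl dp) => [|Q x sQ]; first by rewrite lt_min dl0.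
rewrite lt_min => /andP[Qd Qp] [Tx mx]; rewrite ltNge; apply/negP => ex.
(* This close to [S0], Q is positive definite and [contrast] takes its Gaussian branch. *)
have pQ := Hp Q sQ Qp.
have : contrastF Q S0 < contrastF Q (G x).
  by apply: (HB Q _ x) => //; rewrite -ball_normE /= distrC.
have := mx theta0 Theta0; rewrite /contrast posdef_unit// leNgt => /negP.
by [].
Qed.

Local Notation Wi := (invmx (asym_W S0)).

(** The weighted least squares solution of [Delta *m t = v] with weight [Wi], as a linear map of
    v. *)
Definition gauss_newton : 'M[R]_(q, vech_dim p) :=
  invmx (Delta^T *m Wi *m Delta) *m Delta^T *m Wi.

Let fm (a b : 'cV[R]_(vech_dim p)) : R := (a^T *m Wi *m b) 0 0.

Let pWi : posdef Wi. Proof. exact: asym_W_inv_posdef. Qed.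

Let fmC a b : fm a b = fm b a.
Proof.
have [sW _] := pWi; rewrite /fm.
have -> : (a^T *m Wi *m b) 0 0 = ((a^T *m Wi *m b)^T) 0 0 by rewrite [RHS]mxE.
by rewrite !trmx_mul trmxK sW mulmxA.
Qed.

Let fmBl a b c : fm (a - b) c = fm a c - fm b c.
Proof. by rewrite /fm linearB/= !mulmxBl !mxE. Qed.

Let fmBr a b c : fm a (b - c) = fm a b - fm a c.
Proof. by rewrite fmC fmBl !(fmC a). Qed.

Let fm_sq a b : fm (a - b) (a - b) = fm a a - 2 * fm a b + fm b b.
Proof. by rewrite fmBl !fmBr (fmC b a); ring. Qed.

Let fm_ge0 a : 0 <= fm a a.
Proof. by have [_ H] := pWi; have [->|/H/ltW//] := eqVneq a 0; rewrite /fm mulmx0 mxE. Qed.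

Let vechB (A B : 'M[R]_p) : vech (A - B) = vech A - vech B.
Proof. by apply/colP => k; rewrite mxE /= !mxE. Qed.

Let vech_norm (E : 'M[R]_p) : `|vech E| <= `|E|.
Proof. by apply: mx_norm_le => // i j; rewrite mxE mx_norm_coord. Qed.

Let norm_vech (E : 'M[R]_p) : E^T = E -> `|E| <= `|vech E|.
Proof.
move=> sE; apply: mx_norm_le => // i j.
rewrite -[E in X in X <= _](vechK sE) mxE mxE.
have -> : \sum_k dup_mx R p (mxtens_index (j, i)) k * vech E k 0 = E i j.
  by have := dup_mxE sE => /colP/(_ (mxtens_index (j, i))); rewrite !mxE mxtens_indexK.
wlog ij : i j / (j <= i)%N => [H|].
  have [/H//|/ltnW/H] := leqP j i.
  by have -> : E j i = E i j by rewrite -[in LHS]sE mxE.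
have : (i, j) \in vech_tuple p.
  apply/allpairsPdep; exists j, i; split => //; first exact: mem_enum.
  by rewrite mem_filter ij mem_enum.
by case/tnthP => k kE; have := mx_norm_coord (vech E) k 0; rewrite mxE /= -kE.
Qed.

(** One constant for the sizes of all vectors in [minimizer_expansion], in terms of the deviation
    [m] of the covariance and the distance [t] between the two points compared there. *)
Let bounds (c1 c3 m t : R) : 0 <= c1 -> 0 <= c3 -> 0 <= m -> 0 <= t ->
  let c := 1 + c1 + c3 * (1 + c1) + c3 in
  [/\ t + c1 * m <= c * (m + t), c1 * m <= c * (m + t), m + c3 * (c1 * m) <= c * (m + t) &
      m + c3 * (c1 * m) + c3 * t <= c * (m + t)].
Proof.
move=> c10 c30 m0 t0 c.
have -> : c * (m + t) = m + t + (c1 * m + c1 * t)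
    + (c3 * m + c3 * t + (c3 * (c1 * m) + c3 * (c1 * t))) + (c3 * m + c3 * t).
  by rewrite /c; ring.
have [p1 p2 p3 p4] : [/\ 0 <= c1 * m, 0 <= c1 * t, 0 <= c3 * m & 0 <= c3 * t] by rewrite !mulr_ge0.
have [p5 p6] : 0 <= c3 * (c1 * m) /\ 0 <= c3 * (c1 * t) by rewrite !mulr_ge0.
by split; lra.
Qed.

(* The value of the contrast at the minimizer is compared with its value at
   [theta0 + gauss_newton *m vech (Q - S0)]: differentiability of [G] at [theta0]
   alone suffices, no derivative of the contrast in [theta] is taken. *)
Lemma minimizer_expansion (e : R) : 0 < e -> exists2 d, 0 < d & forall Q x, Q^T = Q ->
  `|Q - S0| < d -> minimizes Q x ->
  `|x - theta0 - gauss_newton *m vech (Q - S0)| <= e * `|Q - S0|.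
Proof.
move=> e0; have [c0 c00 Hc0] := posdef_lower (posdef_congr pWi Delta_rank).
pose v : R := (vech_dim p)%:R; pose c1 := v * `|gauss_newton|; pose c3 := q%:R * `|Delta|.
have v0 : 0 <= v by [].
have [c10 c30] : 0 <= c1 /\ 0 <= c3 by rewrite !mulr_ge0.
pose c := 1 + c1 + c3 * (1 + c1) + c3.
have c31 : 0 <= c3 * (1 + c1) by rewrite mulr_ge0// addr_ge0.
have c_ge1 : 1 <= c by rewrite /c -!addrA lerDl !addr_ge0.
have c_gt0 : 0 < c := lt_le_trans ltr01 c_ge1.
pose c4 := v ^+ 2 * `|Wi|; have c40 : 0 <= c4 by rewrite mulr_ge0 ?exprn_ge0.
(* Five bilinear error terms (2 + 2 + 1 in the two squares), two contrast remainders of 4 c^2 each,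
   and 1 for positivity. *)
pose C := 5 * c4 * c ^+ 2 + 8 * c ^+ 2 + 1.
have C0 : 0 < C by rewrite ltr_wpDl// addr_ge0 ?mulr_ge0 ?exprn_ge0 ?(ltW c_gt0).
(* In c0 t^2 <= e1 C (2 m^2 + 2 t^2), the first quotient absorbs the t^2 on the right and the second
   turns the m^2 term into (e m)^2. *)
pose e1 := Num.min 1 (Num.min (c0 / (4 * C)) (c0 * e ^+ 2 / (4 * C))).
have e10 : 0 < e1 by rewrite !lt_min ltr01 !divr_gt0 ?mulr_gt0 ?exprn_gt0.
have e11 : e1 <= 1 by rewrite ge_min lexx.
have e1a : e1 * (4 * C) <= c0.
  by rewrite -ler_pdivlMr ?mulr_gt0// /e1 !ge_min lexx !orbT.
have e1b : e1 * (4 * C) <= c0 * e ^+ 2.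
  by rewrite -ler_pdivlMr ?mulr_gt0// /e1 !ge_min lexx !orbT.
have [dd dd0 Hd] := G_diff e10.
have [dq dq0 Hq] := contrast_quadratic pS0 e10.
have [dp dp0 Hp] := posdef_near pS0.
have [rr r0 Hr] := Theta_int.
(* Within t0 of [theta0], a point lies in [Theta], obeys the first order expansion of [G], and has
   its covariance within [dq] of [S0]. Both the minimizer and the comparison point must lie
   there. *)
pose t0 := Num.min dd (Num.min rr (dq / (c3 + 1))).
have t00 : 0 < t0 by rewrite !lt_min dd0 r0 divr_gt0// ltr_wpDl.
have [dm dm0 Hm] := minimizer_near t00.
exists (Num.min (Num.min dm dp) (Num.min dq (t0 / (c1 + 1)))) => [|Q x sQ].
  by rewrite !lt_min dm0 dp0 dq0 divr_gt0// ltr_wpDl.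
rewrite !lt_min => /andP[/andP[Qm Qp] /andP[Qq Qt]] mx.
have xt := Hm Q x sQ Qm mx; have [Tx mxx] := mx.
have pQ := Hp Q sQ Qp; have [sS0 _] := pS0.
pose m := `|vech (Q - S0)|; have mQ : m <= `|Q - S0| by exact: vech_norm.
have m0 : 0 <= m by exact: normr_ge0.
pose d := x - theta0; pose d' := gauss_newton *m vech (Q - S0).
pose x' := theta0 + d'; have x'E : x' - theta0 = d' by rewrite /x' addrC addKr.
have nd' : `|d'| <= c1 * m by exact: mx_norm_mul.
have x't : `|x' - theta0| < t0.
  rewrite x'E (le_lt_trans nd')//; apply: (@le_lt_trans _ _ ((c1 + 1) * `|Q - S0|)).
    by rewrite ler_pM// lerDl.
  by rewrite mulrC -ltr_pdivlMr// ltr_wpDl.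
have tdd y : `|y - theta0| < t0 -> [/\ Theta y,
    `|vech (G y) - vech S0 - Delta *m (y - theta0)| <= e1 * `|y - theta0| & `|G y - S0| <= dq].
  rewrite !lt_min => /andP[y1 /andP[y2 y3]]; have H := Hd y y1; have Ty := Hr y y2.
  split=> //; have [sG _] := G_posdef Ty.
  have sE : (G y - S0)^T = G y - S0 by rewrite linearB/= sG sS0.
  apply: (le_trans (norm_vech sE)).
  have -> : vech (G y - S0) = (vech (G y) - vech S0 - Delta *m (y - theta0)) + Delta *m (y - theta0).
    by rewrite subrK vechB.
  apply: (le_trans (ler_normD _ _)); apply: (@le_trans _ _ ((c3 + 1) * `|y - theta0|)).
    rewrite mulrDl addrC; apply: lerD; first exact: mx_norm_mul.
    by apply: (le_trans H); rewrite ler_wpM2r.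
  by rewrite mulrC -ler_pdivlMr ?ltr_wpDl// ltW.
have [_ Dx Gx] := tdd x xt; have [Tx' Dx' Gx'] := tdd x' x't.
pose rho := vech (G x) - vech S0 - Delta *m d.
pose rho' := vech (G x') - vech S0 - Delta *m d'.
rewrite x'E in Dx'; rewrite -/d -/rho in Dx; rewrite -/rho' in Dx'.
pose y := d - d'; pose g := vech (Q - S0) - Delta *m d'.
have Ex : vech (Q - G x) = g - Delta *m y - rho.
  rewrite /g /y mulmxBr /rho !vechB; apply/colP => k; rewrite !mxE; ring.
have Ex' : vech (Q - G x') = g - rho'.
  by rewrite /g /rho' !vechB; apply/colP => k; rewrite !mxE; ring.
(* The normal equations: the least squares residual is orthogonal to the range of [Delta] for the
   weight [Wi]. *)
have orth : fm g (Delta *m y) = 0.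
  rewrite fmC /fm trmx_mul /g mulmxBr.
  have uV := posdef_unit (posdef_congr pWi Delta_rank).
  have -> : y^T *m Delta^T *m Wi *m (Delta *m d') = y^T *m Delta^T *m Wi *m vech (Q - S0).
    rewrite (_ : _ *m _ = y^T *m (Delta^T *m Wi *m Delta *m (invmx (Delta^T *m Wi *m Delta)
      *m (Delta^T *m Wi *m vech (Q - S0))))); last by rewrite /d' /gauss_newton !mulmxA.
    by rewrite mulKVmx// !mulmxA.
  by rewrite subrr mxE.
have fmb a b : `|fm a b| <= c4 * (`|a| * `|b|).
  by rewrite (le_trans (form_norm _ _ _))// /c4 -!mulrA.
pose t := `|y|; have t_ge0 : 0 <= t by exact: normr_ge0.
pose z := m + t; have z0 : 0 <= z by rewrite addr_ge0.
(* In the comparison of the two contrasts the common square [fm g g] cancels, and orthogonality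
   leaves the form at [Delta *m y] against terms that all carry [e1]. *)
have key : fm (Delta *m y) (Delta *m y) <= e1 * C * z ^+ 2.
  have [pGx pGx'] := (G_posdef Tx, G_posdef Tx').
  have sE (a : 'cV[R]_q) : Theta a -> (Q - G a)^T = Q - G a.
    by move=> Ta; have [sG _] := G_posdef Ta; rewrite linearB/= sQ sG.
  have F a : Theta a -> `|G a - S0| <= dq ->
      `|contrastF Q (G a) - fm (vech (Q - G a)) (vech (Q - G a))| <= e1 * `|vech (Q - G a)| ^+ 2.
    move=> Ta Ga; have := Hq (G a) Q (G_posdef Ta) pQ Ga (ltW Qq).
    rewrite /fm asym_W_inv_form ?posdef_unit ?sE// mulrC => /le_trans; apply.
    rewrite ler_wpM2l ?(ltW e10)//; apply: lerXn2r; rewrite ?nnegrE//.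
    exact/norm_vech/sE.
  have mm : contrastF Q (G x) <= contrastF Q (G x').
    by have := mxx x' Tx'; rewrite /contrast posdef_unit.
  have := F x Tx Gx; have := F x' Tx' Gx'; rewrite Ex Ex'.
  set X := g - _ - rho; set X' := g - rho'; rewrite !ler_norml => /andP[_ F1] /andP[F2 _].
  have [k1 k2 k3 k4] := bounds c10 c30 m0 t_ge0.
  have nd : `|d| <= c * z.
    rewrite (_ : d = y + d'); last by rewrite /y subrK.
    rewrite (le_trans (ler_normD _ _))// -/t.
    apply: (@le_trans _ _ (t + c1 * m)); first by rewrite lerD2l.
    exact: k1.
  have nd'' : `|d'| <= c * z by exact: le_trans k2.
  have nr : `|rho| <= e1 * (c * z) by rewrite (le_trans Dx)// ler_wpM2l// ltW.
  have nr' : `|rho'| <= e1 * (c * z) by rewrite (le_trans Dx')// ler_wpM2l// ltW.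
  have nDd : `|Delta *m d'| <= c3 * (c1 * m).
    by rewrite (le_trans (mx_norm_mul _ _))// ler_wpM2l.
  have ng : `|g| <= c * z.
    rewrite (le_trans (ler_normB _ _))// (@le_trans _ _ (m + c3 * (c1 * m)))//.
      by rewrite lerD2l.
  have nDy : `|Delta *m y| <= c3 * t by exact: mx_norm_mul.
  have ngy : `|g - Delta *m y| <= c * z.
    rewrite (le_trans (ler_normB _ _))// (@le_trans _ _ (m + c3 * (c1 * m) + c3 * t))//.
      by apply: lerD => //; rewrite (le_trans (ler_normB _ _))// lerD2l.
  have cz0 : 0 <= c * z by rewrite mulr_ge0// ltW.
  have ecz : e1 * (c * z) <= c * z by rewrite ler_piMl.
  have nX : `|X| <= 2 * (c * z).
    by rewrite (le_trans (ler_normB _ _))// mulr_natl mulr2n; apply: lerD => //; exact: le_trans ecz.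
  have nX' : `|X'| <= 2 * (c * z).
    by rewrite (le_trans (ler_normB _ _))// mulr_natl mulr2n; apply: lerD => //; exact: le_trans ecz.
  have sq4 : 4 * (c * z) ^+ 2 = (2 * (c * z)) ^+ 2 by ring.
  have X2 : `|X| ^+ 2 <= 4 * (c * z) ^+ 2.
    by rewrite sq4; apply: lerXn2r => //; rewrite nnegrE// mulr_ge0.
  have X2' : `|X'| ^+ 2 <= 4 * (c * z) ^+ 2.
    by rewrite sq4; apply: lerXn2r => //; rewrite nnegrE// mulr_ge0.
  have FX : fm X X = fm g g + fm (Delta *m y) (Delta *m y) - 2 * fm (g - Delta *m y) rho + fm rho rho.
    by rewrite /X (fm_sq (g - Delta *m y)) (fm_sq g (Delta *m y)) orth mulr0 subr0.
  have FX' : fm X' X' = fm g g - 2 * fm g rho' + fm rho' rho' by exact: fm_sq.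
  have b1 : `|fm (g - Delta *m y) rho| <= c4 * (c * z * (e1 * (c * z))).
    by rewrite (le_trans (fmb _ _))// ler_wpM2l// ler_pM.
  have b2 : `|fm g rho'| <= c4 * (c * z * (e1 * (c * z))).
    by rewrite (le_trans (fmb _ _))// ler_wpM2l// ler_pM.
  have b3 : `|fm rho' rho'| <= c4 * (c * z * (e1 * (c * z))).
    by rewrite (le_trans (fmb _ _))// ler_wpM2l// ler_pM// (le_trans nr').
  have b4 := fm_ge0 rho.
  have e1X : e1 * `|X| ^+ 2 <= e1 * (4 * (c * z) ^+ 2) by rewrite ler_wpM2l// ltW.
  have e1X' : e1 * `|X'| ^+ 2 <= e1 * (4 * (c * z) ^+ 2) by rewrite ler_wpM2l// ltW.
  move: b1 b2 b3; rewrite !ler_norml => /andP[_ b1] /andP[b2 _] /andP[_ b3].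
  have -> : e1 * C * z ^+ 2 = 5 * (c4 * (c * z * (e1 * (c * z)))) + 2 * (e1 * (4 * (c * z) ^+ 2)) + e1 * z ^+ 2.
    by rewrite /C; ring.
  have ez : 0 <= e1 * z ^+ 2 by apply: mulr_ge0; [exact: ltW|exact: sqr_ge0].
  move: FX FX'; set u1 := fm X X in F2 *; set u2 := fm X' X' in F1 *; lra.
have low := Hc0 y; rewrite -/t in low.
have E : (y^T *m (Delta^T *m Wi *m Delta) *m y) 0 0 = fm (Delta *m y) (Delta *m y).
  by rewrite /fm trmx_mul !mulmxA.
have ct : c0 * t ^+ 2 <= e1 * C * z ^+ 2 by rewrite E in low; exact: le_trans key.
have z2 : z ^+ 2 <= 2 * m ^+ 2 + 2 * t ^+ 2.
  by have := sqr_ge0 (m - t); rewrite /z; nra.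
have t2 : c0 * t ^+ 2 <= c0 * (e * m) ^+ 2.
  have eC : 0 <= e1 * C by rewrite mulr_ge0// ltW.
  have h1 : e1 * C * z ^+ 2 <= e1 * C * (2 * m ^+ 2 + 2 * t ^+ 2) by rewrite ler_wpM2l.
  have h2 : e1 * (4 * C) * t ^+ 2 <= c0 * t ^+ 2 by rewrite ler_wpM2r ?sqr_ge0.
  have h3 : e1 * (4 * C) * m ^+ 2 <= c0 * e ^+ 2 * m ^+ 2 by rewrite ler_wpM2r ?sqr_ge0.
  by rewrite exprMn mulrA; lra.
rewrite -/d -/d' -/y -/t (@le_trans _ _ (e * m))//; last by rewrite ler_wpM2l// ltW.
by rewrite -ler_sqr ?nnegrE ?mulr_ge0 ?(ltW e0)// -(ler_pM2l c00).
Qed.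

End minimum_contrast.

(** * Differentiability of the covariance map *)

Section matrix_differentiability.
Context (R : realType) (q : nat).
Implicit Type x : 'cV[R]_q.

Definition diff_mx m n (F : 'cV[R]_q -> 'M[R]_(m, n)) x :=
  forall i j, differentiable (fun y => F y i j) x.

Lemma differentiable_bigsum (I : Type) (r : seq I) (f : I -> 'cV[R]_q -> R) x :
  (forall i, differentiable (f i) x) -> differentiable (fun y => \sum_(i <- r) f i y) x.
Proof.
move=> df; elim: r => [|i r IH].
  rewrite (_ : (fun y => _) = cst 0); last by apply/funext => y; rewrite big_nil.
  exact: differentiable_cst.
rewrite (_ : (fun y => _) = f i + (fun y => \sum_(i <- r) f i y)).
  exact: differentiableD.
by apply/funext => y; rewrite big_cons.
Qed.

Lemma differentiable_bigprod (I : Type) (r : seq I) (f : I -> 'cV[R]_q -> R) x :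
  (forall i, differentiable (f i) x) -> differentiable (fun y => \prod_(i <- r) f i y) x.
Proof.
move=> df; elim: r => [|i r IH].
  rewrite (_ : (fun y => _) = cst 1); last by apply/funext => y; rewrite big_nil.
  exact: differentiable_cst.
rewrite (_ : (fun y => _) = f i * (fun y => \prod_(i <- r) f i y)).
  exact: differentiableM.
by apply/funext => y; rewrite big_cons.
Qed.

Lemma diff_mxD m n (F G : 'cV[R]_q -> 'M[R]_(m, n)) x :
  diff_mx F x -> diff_mx G x -> diff_mx (fun y => F y + G y) x.
Proof.
move=> dF dG i j.
rewrite (_ : (fun y => _) = (fun y => F y i j) + (fun y => G y i j)).
  exact: differentiableD.
by apply/funext => y; rewrite mxE.
Qed.

Lemma diff_mx_mul m n p (F : 'cV[R]_q -> 'M[R]_(m, n)) (G : 'cV[R]_q -> 'M[R]_(n, p)) x :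
  diff_mx F x -> diff_mx G x -> diff_mx (fun y => F y *m G y) x.
Proof.
move=> dF dG i j.
rewrite (_ : (fun y => _) = (fun y => \sum_k F y i k * G y k j)).
  by apply: differentiable_bigsum => k; exact: differentiableM.
by apply/funext => y; rewrite mxE.
Qed.

Lemma diff_mx_tr m n (F : 'cV[R]_q -> 'M[R]_(m, n)) x :
  diff_mx F x -> diff_mx (fun y => (F y)^T) x.
Proof.
move=> dF i j; rewrite (_ : (fun y => _) = (fun y => F y j i)); first exact: dF.
by apply/funext => y; rewrite mxE.
Qed.

Lemma diff_mx_det n (F : 'cV[R]_q -> 'M[R]_n) x :
  diff_mx F x -> differentiable (fun y => \det (F y)) x.
Proof.
move=> dF; rewrite /determinant; apply: differentiable_bigsum => s.
set c := (X in X ^+ _); rewrite -[fun y => _]/(c ^+ perm.odd_perm s *: (fun y => \prod_i F y i (perm.fun_of_perm s i))).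
by apply: differentiableZ; apply: differentiable_bigprod => i; exact: dF.
Qed.

(* Unlike [invmx], differentiable without a case distinction. *)
Definition adj_inv n (A : 'M[R]_n) : 'M[R]_n := (\det A)^-1 *: \adj A.

Lemma adj_invE n (A : 'M[R]_n) : A \in unitmx -> adj_inv A = invmx A.
Proof. by rewrite /invmx => ->. Qed.

Lemma diff_mx_inv n (F : 'cV[R]_q -> 'M[R]_n) x :
  diff_mx F x -> F x \in unitmx -> diff_mx (fun y => adj_inv (F y)) x.
Proof.
move=> dF uF i j; have dN : \det (F x) != 0 by rewrite -unitfE -unitmxE.
rewrite (_ : (fun y => _) = (fun y => (\det (F y))^-1) * (fun y => (-1) ^+ (j + i) *
    \det (row' j (col' i (F y))))); last first.
  by apply/funext => y; rewrite /adj_inv !mxE.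
apply: differentiableM; first exact/differentiableV/dN/diff_mx_det.
rewrite (_ : (fun y => _) = (-1) ^+ (j + i) *: (fun y => \det (row' j (col' i (F y))))) //.
apply/differentiableZ/diff_mx_det => k l.
by rewrite (_ : (fun y => _) = (fun y => F y (lift j k) (lift i l)))//; apply/funext => y; rewrite !mxE.
Qed.

Lemma diff_mx_block m1 m2 n1 n2 (A : 'cV[R]_q -> 'M[R]_(m1, n1)) (B : 'cV[R]_q -> 'M[R]_(m1, n2))
    (C : 'cV[R]_q -> 'M[R]_(m2, n1)) (D : 'cV[R]_q -> 'M[R]_(m2, n2)) x :
  diff_mx A x -> diff_mx B x -> diff_mx C x -> diff_mx D x ->
  diff_mx (fun y => block_mx (A y) (B y) (C y) (D y)) x.
Proof.
move=> dA dB dC dD i j.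
have E (F : 'cV[R]_q -> R) : (fun y => block_mx (A y) (B y) (C y) (D y) i j) =1 F ->
    differentiable F x -> differentiable (fun y => block_mx (A y) (B y) (C y) (D y) i j) x.
  by move=> /funext ->.
case: (split_ordP i) => i' ei; case: (split_ordP j) => j' ej; rewrite ei ej in E *.
- by apply: (E (fun y => A y i' j')) => // y; rewrite block_mxEul.
- by apply: (E (fun y => B y i' j')) => // y; rewrite block_mxEur.
- by apply: (E (fun y => C y i' j')) => // y; rewrite block_mxEdl.
- by apply: (E (fun y => D y i' j')) => // y; rewrite block_mxEdr.
Qed.

Lemma diff_mx_eval m n (M : 'M[sem_entry R q]_(m, n)) x :
  diff_mx (fun y => map_mx (entry_eval y) M) x.
Proof.
move=> i j; rewrite (_ : (fun y => _) = (fun y => entry_eval y (M i j))); last first.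
  by apply/funext => y; rewrite mxE.
by case: (M i j) => [c|k] /=; [exact: differentiable_cst|exact: differentiable_coord].
Qed.

Lemma diff_mx_continuous m n (F : 'cV[R]_q -> 'M[R]_(m, n)) x : diff_mx F x ->
  forall e, 0 < e -> \forall y \near x, `|F y - F x| <= e.
Proof.
move=> dF e e0.
have H : \forall y \near x, forall i, forall j, `|F x i j - F y i j| <= e.
  apply: (@filter_forall _ _ _ (nbhs x) (nbhs_filter x)) => i.
  apply: (@filter_forall _ _ _ (nbhs x) (nbhs_filter x)) => j.
  have := differentiable_continuous (dF i j).
  by move/(@cvgrPdist_le _ _ _ (nbhs x) (nbhs_filter x)) => /(_ e e0).
apply: filterS H => y Hy; apply: mx_norm_le => [|i j]; first exact: ltW.
by rewrite !mxE distrC.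
Qed.

Lemma diff_mx_jacobian m (F : 'cV[R]_q -> 'cV[R]_m) x : diff_mx F x ->
  forall e, 0 < e -> exists2 d, 0 < d & forall y, `|y - x| < d ->
    `|F y - F x - jacobian_mx F x *m (y - x)| <= e * `|y - x|.
Proof.
move=> dF e e0.
have H : \forall h \near (0 : 'cV[R]_q), forall i,
    `|F (h + x) i 0 - F x i 0 - 'd (fun y => F y i 0) x h| <= e * `|h|.
  apply: (@filter_forall _ _ _ (nbhs (0 : 'cV[R]_q)) (nbhs_filter (0 : 'cV[R]_q))) => i.
  have := diff_locally (dF i 0); move/eqaddoP => /(_ e e0).
  apply: filterS => h; rewrite /= !fctE /= opprD addrA.
  by [].
move/nbhs_ballP: H => [d d0 H]; exists d => // y yx.
have := H (y - x); rewrite -ball_normE /= sub0r normrN subrK => /(_ yx) {}H.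
apply: mx_norm_le => [|i j]; first by rewrite mulr_ge0// ltW.
rewrite ord1 !mxE; have -> : \sum_j0 jacobian_mx F x i j0 * (y - x) j0 0 = 'd (fun y => F y i 0) x (y - x).
  rewrite [in RHS](matrix_sum_delta (y - x)) linear_sum /=; apply: eq_bigr => k _.
  rewrite big_ord1 linearZ /= !mxE mulrC; congr (_ * _).
  by rewrite deriveE.
exact: H.
Qed.

End matrix_differentiability.

(** * The covariance as a differentiable function of the parameter *)

Section covariance_map.
Context (R : realType) (q p1 p2 k1 k2 : nat) (M : sem (sem_entry R q) p1 p2 k1 k2).

Definition adj_sem_cov (m : sem R p1 p2 k1 k2) : 'M[R]_(p1 + p2) :=
  let L1 := Lambda1 m in let L2 := Lambda2 m in let G := Gamma m in
  let Pi := adj_inv (Psi m) in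
  let S11 := L1 *m Sigma_xi m *m L1^T + Sigma_delta m in
  let S12 := L1 *m Sigma_xi m *m G^T *m Pi^T *m L2^T in
  let S22 := L2 *m Pi *m (G *m Sigma_xi m *m G^T + Sigma_zeta m) *m Pi^T *m L2^T
             + Sigma_eps m in
  block_mx S11 S12 S12^T S22.

Lemma adj_sem_covE m : Psi m \in unitmx -> adj_sem_cov m = sem_cov m.
Proof. by move=> uP; rewrite /adj_sem_cov adj_invE. Qed.

Lemma diff_mx_sem_cov x : Psi (sem_eval M x) \in unitmx ->
  diff_mx (fun y => adj_sem_cov (sem_eval M y)) x.
Proof.
move=> uP; have dPi := diff_mx_inv (diff_mx_eval (Psi M) x) uP.
have d12 : diff_mx (fun y => Lambda1 (sem_eval M y) *m Sigma_xi (sem_eval M y) *m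
    (Gamma (sem_eval M y))^T *m (adj_inv (Psi (sem_eval M y)))^T *m (Lambda2 (sem_eval M y))^T) x.
  by repeat (apply: diff_mx_mul || apply: diff_mx_tr || apply: diff_mx_eval || exact: dPi).
apply: diff_mx_block => //; last 2 first.
- exact: diff_mx_tr.
- apply: diff_mxD; last exact: diff_mx_eval.
  repeat (apply: diff_mx_mul || apply: diff_mx_tr || apply: diff_mxD || apply: diff_mx_eval || exact: dPi).
apply: diff_mxD; last exact: diff_mx_eval.
by repeat (apply: diff_mx_mul || apply: diff_mx_tr || apply: diff_mx_eval).
Qed.
End covariance_map.

Section structural_model.
Context (R : realType) (q p1 p2 k1 k2 : nat) (M : sem (sem_entry R q) p1 p2 k1 k2).
Context (Theta : set 'cV[R]_q) (theta0 : 'cV[R]_q).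
Hypothesis M_admissible : forall theta, Theta theta -> sem_admissible (sem_eval M theta).
Hypothesis Theta_interior : interior Theta theta0.
Local Notation G := (fun theta => sem_cov (sem_eval M theta)).
Local Notation G' := (fun theta => adj_sem_cov (sem_eval M theta)).
Local Notation Delta := (jacobian_mx (fun theta => vech (G theta)) theta0).

Lemma interior_ball : exists2 r, 0 < r & forall y, `|y - theta0| < r -> Theta y.
Proof.
have /nbhs_ballP[r r0 H] := Theta_interior; exists r => // y yx; apply: H.
by rewrite -ball_normE /= distrC.
Qed.

Let covE y : Theta y -> G' y = G y.
Proof. by move=> /M_admissible[_ _ uP _ _]; exact: adj_sem_covE. Qed.

Let dG x : Theta x -> diff_mx G' x.
Proof. by move=> /M_admissible[_ _ uP _ _]; exact: diff_mx_sem_cov. Qed.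

Lemma model_posdef y : Theta y -> posdef (G y).
Proof. by move=> /M_admissible; exact: sem_cov_posdef. Qed.

Lemma model_continuous x : Theta x -> forall e, 0 < e ->
  \forall y \near x, Theta y -> `|G y - G x| <= e.
Proof.
move=> Tx e e0; have := diff_mx_continuous (dG Tx) e0.
apply: (@filterS _ (nbhs x) (nbhs_filter x)) => y /= H Ty.
by rewrite -!covE.
Qed.

Lemma model_differentiable e : 0 < e -> exists2 d, 0 < d & forall y, `|y - theta0| < d ->
  `|vech (G y) - vech (G theta0) - Delta *m (y - theta0)| <= e * `|y - theta0|.
Proof.
move=> e0; have [r r0 Tr] := interior_ball.
have T0 : Theta theta0 by apply: Tr; rewrite subrr normr0.
have dv : diff_mx (fun y => vech (G' y)) theta0.
  move=> k j; rewrite (_ : (fun y => _) = (fun y => G' y (tnth (vech_tuple _) k).1 (tnth (vech_tuple _) k).2)).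
    exact: dG.
  by apply/funext => y; rewrite mxE.
have [d d0 H] := diff_mx_jacobian dv e0.
exists (Num.min d r); first by rewrite lt_min d0.
move=> y; rewrite lt_min => /andP[yd yr].
have := H y yd; rewrite (covE (Tr _ yr)) (covE T0).
(* A derivative depends only on values near [theta0], an interior point, and on [Theta] the two
   covariance maps agree. *)
have -> // : jacobian_mx (fun y => vech (G' y)) theta0 = Delta.
apply: eq_mx => i j.
apply: (@near_eq_derive _ _ _ (fun y => vech (G' y) i 0) (fun y => vech (G y) i 0)).
apply: (@filterS _ (nbhs theta0) (nbhs_filter theta0) _ _ _ Theta_interior) => z Tz.
by rewrite (covE Tz).
Qed.
End structural_model.

(** * Asymptotics of the estimator *)

Section convergence_in_probability.
Context d (T : measurableType d) (R : realType) (P : probability T R).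
Local Notation Ex := (expect P).
Local Notation L1 := (L1 P).

Lemma measurable_tail (f : T -> R) (e : R) : measurable_fun [set: T] f ->
  measurable [set w | e < `|f w|].
Proof.
move=> mf; rewrite (_ : [set w | _] = (fun w => `|f w|) @^-1` `]e, +oo[%classic); last first.
  by apply/seteqP; split=> w /=; rewrite in_itv/= andbT.
have mnf : measurable_fun [set: T] (fun w => `|f w|) by exact: measurableT_comp.
by rewrite -[X in measurable X]setTI; apply: mnf.
Qed.

Lemma measurable_norm_tail q (Z : T -> 'cV[R]_q) (e : R) : random_vector Z ->
  measurable [set w | e < `|Z w|].
Proof.
move=> mZ; have := measurable_tail e (random_vector_norm mZ).
by congr (measurable _); apply/seteqP; split=> w /=; rewrite normr_id.
Qed.

Lemma prob_le_setU (A B C : set T) (s t : R) : measurable A -> measurable B -> measurable C ->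
  C `<=` A `|` B -> (P A <= s%:E)%E -> (P B <= t%:E)%E -> (P C <= (s + t)%:E)%E.
Proof.
move=> mA mB mC CAB Ps Pt; apply: (@le_trans _ _ (P (A `|` B))).
  by apply: le_measure; rewrite ?inE//; exact: measurableU.
by rewrite EFinD (le_trans (measureU2 P mA mB))// leeD.
Qed.

Lemma cvg_prob0 (A : nat -> set T) : (forall t : R, 0 < t -> \forall n \near \oo, (P (A n) <= t%:E)%E) ->
  P (A n) @[n --> \oo] --> 0%E.
Proof.
move=> H; have fP n (t : R) : (P (A n) <= t%:E)%E -> P (A n) \is a fin_num.
  by move=> Pt; rewrite ge0_fin_numE// (le_lt_trans Pt) ?ltry.
apply/fine_cvgP; split.
  by have := H 1 ltr01; apply: filterS => n; exact: fP.
apply/cvgrPdist_le => t /H; apply: filterS => n Ht /=.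
by rewrite sub0r normrN ger0_norm ?fine_ge0// -lee_fin fineK// (fP _ _ Ht).
Qed.

(** Slutsky's step, for the cosine and the sine, which are bounded by 1 and 1-Lipschitz. *)
Lemma lipschitz_Ex_sub (g : R -> R) (x y : T -> R) (e t : R) :
  measurable_fun [set: T] x -> measurable_fun [set: T] y -> measurable_fun [set: R] g ->
  (forall a, `|g a| <= 1) -> (forall a b, `|g a - g b| <= `|a - b|) -> 0 <= e ->
  (P [set w | (e < `|x w - y w|)%R] <= t%:E)%E ->
  `|Ex (fun w => g (x w)) - Ex (fun w => g (y w))| <= e + 2 * t.
Proof.
move=> mx my mg g1 gl e0 Pt.
have Lg z : measurable_fun [set: T] z -> L1 (fun w => g (z w)).
  by move=> mz; apply: (@L1_bnd _ _ _ _ _ 1) => //; exact: measurableT_comp.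
have mA : measurable [set w | e < `|x w - y w|] by apply: measurable_tail; exact: measurable_funB.
set A := [set w | _] in mA Pt.
have LA : L1 (\1_A : T -> R).
  apply: (@L1_bnd _ _ _ _ _ 1); first exact: measurable_indic.
  by move=> w; rewrite indicE; case: (_ \in _); rewrite ?normr1 ?normr0.
have EA : Ex (\1_A : T -> R) <= t.
  by rewrite -lee_fin -EFin_Ex// integral_indic// setIT.
rewrite -ExB ?(le_trans (Ex_norm (L1B (Lg _ mx) (Lg _ my))))//; try exact: Lg.
apply: (@le_trans _ _ (Ex (fun w => e + 2 * (\1_A w : R)))).
  apply: Ex_le; [exact/L1_norm/L1B/Lg/my/Lg|apply: L1D; [exact: L1_cst|exact: L1Z]|move=> w].
  rewrite indicE; have [wA|] := boolP (w \in A).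
    by rewrite (le_trans (ler_normB _ _))// mulr1 (le_trans (lerD (g1 _) (g1 _)))// lerDr.
  rewrite notin_setE /A /= => /negP; rewrite -leNgt => ZK.
  by rewrite mulr0 addr0 (le_trans (gl _ _)).
rewrite ExD ?ExZ ?Ex_cst//; [|exact: L1_cst|exact: L1Z].
by rewrite lerD2l ler_wpM2l.
Qed.

End convergence_in_probability.

(** * Consistency and asymptotic normality of a locally linear functional *)

Section asymptotics.
Context d (T : measurableType d) (R : realType) (P : probability T R).
Local Notation Ex := (expect P).
Local Notation L1 := (L1 P).
Local Notation L2 := (L2 P).
Context (J : finType) (W : J -> R -> T -> R) (hW : noise_family P W).
Context (p q : nat) (A : 'I_p -> J -> R) (u : 'I_p -> R -> R -> T -> R).
Context (X : R -> T -> 'cV[R]_p).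
Hypothesis u_small : forall x, small_resid P W (u x).
Hypothesis XE : forall x (s t : R) w, 0 <= s -> 0 <= t ->
  X t w x 0 - X s w x 0 = u x s t w + \sum_j A x j * inc W j s t w.
Context (S0 : 'M[R]_p).
Hypothesis S0E : forall x y, S0 x y = noise_cov A x y.
Context (h : nat -> R).
Hypothesis h_gt0 : forall n, 0 < h n.
Hypothesis h_cvg : h n @[n --> \oo] --> 0.
Context (theta : nat -> T -> 'cV[R]_q) (theta0 : 'cV[R]_q).
Hypothesis theta_meas : forall n, (0 < n)%N -> random_vector (theta n).
Local Notation Q n w := (realized_cov X n (h n) w).
(** The minimum contrast property enters this section only here and in [theta_expansion]. *)
Hypothesis theta_near : forall e, 0 < e -> exists2 d, 0 < d & forall n w, (0 < n)%N ->
  `|Q n w - S0| < d -> `|theta n w - theta0| < e.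

(** For n > 0, [S0] plus this matrix is the covariance that would be realized without drift. *)
Definition main_part n w : 'M[R]_p := \matrix_(x, y) (n%:R^-1 *
  \sum_(0 <= i < n) ((h n)^-1 * (noise_part W A x (h n) i w * noise_part W A y (h n) i w)
                     - noise_cov A x y)).

(** A sum over entries dominates the sup norm, and its expectation splits entry by entry. *)
Definition main_norm n w : R := \sum_x \sum_y `|main_part n w x y|.

Definition err_norm n w : R := \sum_x \sum_y `|realized_err W A X x y n (h n) w|.

Let main_norm_ge0 n w : 0 <= main_norm n w.
Proof. by do 2!apply: sumr_ge0 => ? _. Qed.

Let err_norm_ge0 n w : 0 <= err_norm n w.
Proof. by do 2!apply: sumr_ge0 => ? _. Qed.

Let entry_le (F : 'I_p -> 'I_p -> R) x y : (forall x y, 0 <= F x y) ->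
  F x y <= \sum_x \sum_y F x y.
Proof.
move=> F0; rewrite (bigD1 x)//= (bigD1 y)//= -addrA lerDl addr_ge0 ?sumr_ge0// => z _.
exact: sumr_ge0.
Qed.

Let main_part_le n w : `|main_part n w| <= main_norm n w.
Proof.
apply: mx_norm_le => // x y.
exact: (@entry_le (fun x y => `|main_part n w x y|)).
Qed.

Let cov_split n w x y : Q n w x y - S0 x y = main_part n w x y + realized_err W A X x y n (h n) w.
Proof. by rewrite S0E [main_part n w x y]mxE /realized_err [RHS]addrC subrK. Qed.

Let cov_sub_main n w : `|Q n w - S0 - main_part n w| <= err_norm n w.
Proof.
apply: mx_norm_le => // x y.
rewrite mxE [X in `|X + _|]mxE [X in `|_ + X + _|]mxE [X in `|_ + X|]mxE cov_split addrAC subrr add0r.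
exact: (@entry_le (fun x y => `|realized_err W A X x y n (h n) w|)).
Qed.

Let cov_le n w : `|Q n w - S0| <= main_norm n w + err_norm n w.
Proof.
rewrite -[Q n w - S0](subrK (main_part n w)) (le_trans (ler_normD _ _))// addrC lerD//.
Qed.

Lemma main_norm_bound : exists2 c, 0 <= c & forall n, (0 < n)%N ->
  L1 (main_norm n) /\ Ex (main_norm n) <= c / Num.sqrt n%:R.
Proof.
pose v x y := qvar A (fun _ : unit => (x, y)) (fun=> 1).
have v0 x y : 0 <= v x y.
  have [_] := qform_sum2 hW A (fun _ : unit => (x, y)) (fun=> 1) 1 (h_gt0 0).
  by rewrite /v mul1r => <-; apply: Ex_ge0 => w; exact: sqr_ge0.
exists (\sum_x \sum_y (v x y + 1)) => [|n n0].
  by do 2!apply: sumr_ge0 => ? _; rewrite addr_ge0.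
have s0 : 0 < Num.sqrt n%:R :> R by rewrite sqrtr_gt0 ltr0n.
have s2 : Num.sqrt n%:R ^+ 2 = n%:R :> R by rewrite sqr_sqrtr.
have H x y : L2 (fun w => main_part n w x y) /\
    Ex (fun w => `|main_part n w x y|) <= (v x y + 1) / Num.sqrt n%:R.
  have [L E] := qform_sum2 hW A (fun _ : unit => (x, y)) (fun=> 1) n (h_gt0 n).
  have mE : (fun w => main_part n w x y) = (fun w => n%:R^-1 *
      \sum_(0 <= i < n) qform W A (fun _ : unit => (x, y)) (fun=> 1) (h n) i w).
    apply/funext => w; rewrite mxE; congr (_ * _); apply: eq_bigr => i _.
    by rewrite /qform (bigD1 tt)//= big1 ?addr0 ?mul1r// => -[].
  have Lm : L2 (fun w => main_part n w x y) by rewrite mE; exact: L2Z.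
  (* The entry has second moment v / n; with weight sqrt n both terms are of order 1 / sqrt n. *)
  split => //; have := Ex_AMGM s0 Lm (L2_cst P 1).
  rewrite (_ : (fun w => `|_ * 1|) = (fun w => `|main_part n w x y|)); last first.
    by apply/funext => w; rewrite mulr1.
  move=> /le_trans; apply; rewrite Ex_cst expr1n mulr1 mulrDl mul1r lerD2r.
  rewrite (_ : (fun w => _ ^+ 2) = (fun w => n%:R^-1 ^+ 2 *
     (\sum_(0 <= i < n) qform W A (fun _ : unit => (x, y)) (fun=> 1) (h n) i w) ^+ 2)); last first.
    by apply/funext => w; rewrite -exprMn -[in RHS](congr1 (fun f => f w) mE).
  rewrite ExZ ?E; last by case: L.
  rewrite /v; move: (Num.sqrt _) (qvar _ _ _) s0 s2 => s V s0 <-.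
  by rewrite le_eqVlt; apply/orP; left; apply/eqP; field; rewrite gt_eqF.
have L : L1 (main_norm n).
  apply: L1_sum => x _; apply: L1_sum => y _; apply/L1_norm/L2_L1.
  by have [] := H x y.
split=> //; rewrite /main_norm Ex_sum => [|x _]; last first.
  by apply: L1_sum => y _; apply/L1_norm/L2_L1; have [] := H x y.
rewrite mulr_suml; apply: ler_sum => x _; rewrite Ex_sum => [|y _]; last first.
  by apply/L1_norm/L2_L1; have [] := H x y.
by rewrite mulr_suml; apply: ler_sum => y _; have [] := H x y.
Qed.

Lemma err_norm_bound : exists2 c, 0 <= c & forall n, (0 < n)%N -> h n <= 1 ->
  L1 (err_norm n) /\ Ex (err_norm n) <= c * (h n + Num.sqrt (h n) / Num.sqrt n%:R).
Proof.
have [C C0 H] := realized_err_small u_small XE.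
exists (\sum_(x < p) \sum_(y < p) C) => [|n n0 h1]; first by do 2!apply: sumr_ge0 => ? _.
have h01 : 0 < h n <= 1 by rewrite h_gt0.
have L x y : L1 (fun w => `|realized_err W A X x y n (h n) w|).
  by apply: L1_norm; have [] := H x y n _ n0 h01.
split; first by do 2!apply: L1_sum => ? _; exact: L.
rewrite /err_norm Ex_sum => [|x _]; last by apply: L1_sum.
rewrite mulr_suml; apply: ler_sum => x _; rewrite Ex_sum => [|y _]; last exact: L.
by rewrite mulr_suml; apply: ler_sum => y _; have [] := H x y n _ n0 h01.
Qed.

Let near_ok : \forall n \near \oo, (0 < n)%N /\ h n <= 1.
Proof.
have h1 : \forall n \near \oo, h n <= 1.
  move/cvgrPdist_le : h_cvg => /(_ 1 ltr01); apply: filterS => n.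
  by rewrite sub0r normrN; exact: (le_trans (ler_norm _)).
by near=> n; split; [near: n; exact: nbhs_infty_gt|near: n].
Unshelve. all: by end_near. Qed.

Let sqrth_cvg : Num.sqrt (h n) @[n --> \oo] --> 0.
Proof.
have := @sqrt_continuous R 0; rewrite /continuous_at sqrtr0 => H.
exact: (cvg_comp _ _ h_cvg H).
Qed.

Let cov_tail e t : 0 < e -> 0 < t ->
  \forall n \near \oo, L1 (main_norm n) /\ L1 (err_norm n) /\
    (P [set w | (e < `|main_norm n w + err_norm n w|)%R] <= t%:E)%E.
Proof.
move=> e0 t0; have [c c0 Hc] := main_norm_bound; have [C C0 HC] := err_norm_bound.
have cvg0 : c * (Num.sqrt n%:R)^-1 + C * (h n + Num.sqrt (h n) * (Num.sqrt n%:R)^-1)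
    @[n --> \oo] --> (0 : R).
  rewrite [X in _ --> X](_ : _ = c * 0 + C * (0 + 0 * 0)); last by ring.
  apply: cvgD; first by apply: cvgM; [exact: cvg_cst|exact: cvg_invsqrtn].
  apply: cvgM; first exact: cvg_cst.
  by apply: cvgD => //; apply: cvgM => //; exact: cvg_invsqrtn.
have et0 : 0 < e * t by rewrite mulr_gt0.
near=> n; have [n0 h1] : (0 < n)%N /\ h n <= 1 by near: n; exact: near_ok.
have [Lm Em] := Hc n n0; have [Le Ee] := HC n n0 h1; split=> //; split=> //.
apply: le_trans (markov1 (L1D Lm Le) e0) _; rewrite lee_fin ler_pdivrMl//.
rewrite (_ : (fun w => _) = (fun w => main_norm n w + err_norm n w)); last first.
  by apply/funext => w; rewrite ger0_norm// addr_ge0.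
rewrite ExD// (le_trans (lerD Em Ee))// (le_trans (ler_norm _))// -normrN -sub0r.
by near: n; move/cvgrPdist_le : cvg0; apply.
Unshelve. all: by end_near. Qed.

Lemma estimator_consistent : cvg_in_prob P \oo theta theta0.
Proof.
move=> e e0; apply: cvg_prob0 => t t0; have [dd d0 H] := theta_near e0.
have d20 : 0 < dd / 2 by rewrite divr_gt0.
near=> n; have [n0 h1] : (0 < n)%N /\ h n <= 1 by near: n; exact: near_ok.
have [Lm [Le HP]] : L1 (main_norm n) /\ L1 (err_norm n) /\
    (P [set w | (dd / 2 < `|main_norm n w + err_norm n w|)%R] <= t%:E)%E.
  by near: n; exact: cov_tail.
apply: le_trans HP; apply: le_measure; rewrite ?inE.
- apply: measurable_norm_tail => i.
  rewrite (_ : (fun w => _) = (fun w => theta n w i 0 - theta0 i 0)); last by apply/funext => w; rewrite !mxE.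
  by apply: measurable_funB => //; exact: theta_meas.
- by have := measurable_tail (dd / 2) (measurable_funD (L1_meas Lm) (L1_meas Le)).
move=> w /= ew; rewrite ltNge; apply/negP => le2.
suff : `|Q n w - S0| < dd by move/(H n w n0); rewrite ltNge (ltW ew).
rewrite (le_lt_trans (cov_le n w))// (le_lt_trans (ler_norm _))// (le_lt_trans le2)//.
by rewrite ltr_pdivrMr// ltr_pMr// ltr1n.
Unshelve. all: by end_near. Qed.

Context (K : 'M[R]_(q, vech_dim p)).
Hypothesis theta_expansion : forall e, 0 < e -> exists2 d, 0 < d & forall n w, (0 < n)%N ->
  `|Q n w - S0| < d ->
  `|theta n w - theta0 - K *m vech (Q n w - S0)| <= e * `|Q n w - S0|.
Hypothesis nh2_cvg : n%:R * h n ^+ 2 @[n --> \oo] --> 0.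

Local Notation sq n := (Num.sqrt n%:R : R).
Local Notation Z n w := (sq n *: (theta n w - theta0)).
Local Notation lin n w := (sq n *: (K *m vech (main_part n w))).

Let vech_sub (B C : 'M[R]_p) : vech (B - C) = vech B - vech C.
Proof. by apply/matrixP => i j; by do 3?rewrite !mxE /=. Qed.

Let vech_norm (B : 'M[R]_p) : `|vech B| <= `|B|.
Proof. by apply: mx_norm_le => // i j; rewrite !mxE; exact: mx_norm_coord. Qed.

Let kn : R := (vech_dim p)%:R * `|K|.

Let kn_ge0 : 0 <= kn. Proof. exact: mulr_ge0. Qed.

Let mul_vech_le (B : 'M[R]_p) : `|K *m vech B| <= kn * `|B|.
Proof. by rewrite (le_trans (mx_norm_mul _ _))// ler_wpM2l. Qed.

(** [main_norm], which after rescaling stays bounded in mean, meets only the small factor [e]; the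
    constant [kn] falls on [err_norm], which is negligible. *)
Let gap_le e n w : 0 <= e ->
  `|theta n w - theta0 - K *m vech (Q n w - S0)| <= e * `|Q n w - S0| ->
  `|Z n w - lin n w| <= e * (sq n * main_norm n w) + (e + kn) * (sq n * err_norm n w).
Proof.
move=> e0 H; rewrite -scalerBr normrZ (ger0_norm (sqrtr_ge0 _)).
have -> : theta n w - theta0 - K *m vech (main_part n w)
    = (theta n w - theta0 - K *m vech (Q n w - S0)) + K *m vech (Q n w - S0 - main_part n w).
  by rewrite (vech_sub (Q n w - S0)) mulmxBr addrA subrK.
rewrite (mulrCA e) (mulrCA (e + kn)) -mulrDr ler_wpM2l ?sqrtr_ge0//.
rewrite (le_trans (ler_normD _ _))// mulrDl addrA -mulrDr lerD//.
  by rewrite (le_trans H)// ler_wpM2l.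
by rewrite (le_trans (mul_vech_le _))// ler_wpM2l.
Qed.

(** This is where n h^2 -> 0 enters: the rescaled error is sqrt (n h^2) + sqrt h. *)
Let sqrt_err_cvg : sq n * (h n + Num.sqrt (h n) / sq n) @[n --> \oo] --> 0.
Proof.
have H1 : Num.sqrt (n%:R * h n ^+ 2) @[n --> \oo] --> 0.
  have := @sqrt_continuous R 0; rewrite /continuous_at sqrtr0 => H.
  exact: (cvg_comp _ _ nh2_cvg H).
apply: (@cvg_eq_near _ (fun n => Num.sqrt (n%:R * h n ^+ 2) + Num.sqrt (h n))).
  near=> n; have n0 : (0 < n)%N by near: n; exact: nbhs_infty_gt.
  rewrite sqrtrM// sqrtr_sqr gtr0_norm// mulrDr mulrCA divff ?mulr1//.
  by rewrite gt_eqF// sqrtr_gt0 ltr0n.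
by rewrite -[0 in X in _ --> X](addr0 0); exact: cvgD.
Unshelve. all: by end_near. Qed.

Let Z_rv n : (0 < n)%N -> random_vector (fun w => Z n w).
Proof.
move=> n0 i; rewrite (_ : (fun w => _) = (fun w => sq n * (theta n w i 0 - theta0 i 0))).
  by apply: measurable_funM => //; apply: measurable_funB => //; exact: theta_meas.
by apply/funext => w; rewrite !mxE.
Qed.

Let main_meas n x y : measurable_fun [set: T] (fun w => main_part n w x y).
Proof.
rewrite (_ : (fun w => _) = (fun w => n%:R^-1 *
      \sum_(0 <= i < n) qform W A (fun _ : unit => (x, y)) (fun=> 1) (h n) i w)).
  have [[mL _] _] := qform_sum2 hW A (fun _ : unit => (x, y)) (fun=> 1) n (h_gt0 n).
  exact: measurable_funM.
apply/funext => w; rewrite mxE; congr (_ * _); apply: eq_bigr => i _.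
by rewrite /qform (bigD1 tt)//= big1 ?addr0 ?mul1r// => -[].
Qed.

Let lin_rv n : random_vector (fun w => lin n w).
Proof.
move=> i; rewrite (_ : (fun w => _) = (fun w => sq n * \sum_k K i k *
    main_part n w (tnth (vech_tuple p) k).1 (tnth (vech_tuple p) k).2)); last first.
  by apply/funext => w; rewrite mxE [X in _ * X]mxE; congr (_ * _); apply: eq_bigr => k _; rewrite [X in _ * X]mxE.
apply: measurable_funM => //; apply: measurable_sum => k.
by apply: measurable_funM.
Qed.

Let gap_tail e t : 0 < e -> 0 < t ->
  \forall n \near \oo, (P [set w | (e < `|Z n w - lin n w|)%R] <= t%:E)%E.
Proof.
move=> e0 t0; have [c c0 Hc] := main_norm_bound; have [C C0 HC] := err_norm_bound.
(* Makes the main part contribute at most half of [e * (t / 2)] to the mean of [F] below; for large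
   n the error part contributes at most the other half. *)
pose b := e * (t / 2) / (2 * (c + 1)).
have b0 : 0 < b by rewrite divr_gt0 ?mulr_gt0 ?divr_gt0// ltr_wpDl.
have [dd d0 H] := theta_expansion b0.
have [d20 t20] : 0 < dd / 2 /\ 0 < t / 2 by rewrite !divr_gt0.
have cvg0 : (b + kn) * (C * (sq n * (h n + Num.sqrt (h n) / sq n))) @[n --> \oo] --> 0.
  rewrite -[0 in X in _ --> X](mulr0 (b + kn)) -[0 in X in _ --> X](mulr0 C).
  by apply: cvgM; [exact: cvg_cst|apply: cvgM => //; exact: cvg_cst].
have e2 : 0 < e * (t / 2) / 2 by rewrite divr_gt0 ?mulr_gt0 ?divr_gt0.
near=> n; have [n0 h1] : (0 < n)%N /\ h n <= 1 by near: n; exact: near_ok.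
have s0 : 0 < sq n by rewrite sqrtr_gt0 ltr0n.
have [_ [_ HP]] : L1 (main_norm n) /\ L1 (err_norm n) /\
    (P [set w | (dd / 2 < `|main_norm n w + err_norm n w|)%R] <= (t / 2)%:E)%E.
  by near: n; exact: cov_tail.
have [Lm Em] := Hc n n0; have [Le Ee] := HC n n0 h1.
pose F w := b * (sq n * main_norm n w) + (b + kn) * (sq n * err_norm n w).
have LF : L1 F by apply: L1D; apply: L1Z; exact: L1Z.
have F0 w : 0 <= F w.
  by rewrite addr_ge0// mulr_ge0// ?addr_ge0 ?(ltW b0)// mulr_ge0// sqrtr_ge0.
have EF : Ex F <= e * (t / 2).
  rewrite /F ExD ?ExZ//; try by do ?apply: L1Z.
  rewrite [leRHS](splitr (e * (t / 2))); apply: lerD.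
    have : sq n * Ex (main_norm n) <= c.
      by rewrite (le_trans (ler_wpM2l (ltW s0) Em))// mulrC divfK// gt_eqF.
    move/(ler_wpM2l (ltW b0))/le_trans; apply.
    rewrite /b invfM mulrA -[leLHS]mulrA ler_piMr ?(ltW e2)//.
    by rewrite ler_pdivrMl ?mulr1 ?ltr_wpDl// lerDl.
  apply: (@le_trans _ _ ((b + kn) * (C * (sq n * (h n + Num.sqrt (h n) / sq n))))).
    rewrite ler_wpM2l ?addr_ge0 ?(ltW b0)// mulrCA ler_wpM2l ?(ltW s0)//.
  rewrite (le_trans (ler_norm _))// -normrN -sub0r.
  by near: n; move/cvgrPdist_le : cvg0; apply.
have HF : (P [set w | (e < `|F w|)%R] <= (t / 2)%:E)%E.
  apply: le_trans (markov1 LF e0) _; rewrite lee_fin ler_pdivrMl//.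
  by rewrite (_ : (fun w => `|F w|) = F)//; apply/funext => w; rewrite ger0_norm.
rewrite [t]splitr.
apply: (prob_le_setU _ _ _ _ HP HF).
- by have := measurable_tail (dd / 2) (measurable_funD (L1_meas Lm) (L1_meas Le)).
- by apply: measurable_tail; exact: L1_meas LF.
- apply: measurable_norm_tail => i.
  rewrite (_ : (fun w => _) = (fun w => Z n w i 0 - lin n w i 0)).
    by apply: measurable_funB; [exact: Z_rv|exact: lin_rv].
  by apply/funext => w; rewrite mxE [X in _ + X]mxE.
move=> w /= ew; have [/ltW dw|dw] := ltP (dd / 2) `|main_norm n w + err_norm n w|; first by left.
right; rewrite (lt_le_trans ew)// (le_trans _ (ler_norm _))// gap_le ?(ltW b0)//.
apply: H => //.
rewrite (le_lt_trans (cov_le n w))// (le_lt_trans (ler_norm _))// (le_lt_trans dw)//.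
by rewrite ltr_pdivrMr// ltr_pMr// ltr1n.
Unshelve. all: by end_near. Qed.

Let Z_tight e : 0 < e -> exists2 B : R, 0 < B &
  \forall n \near \oo, (P [set w | (B < `|Z n w|)%R] <= e%:E)%E.
Proof.
move=> e0; have [c c0 Hc] := main_norm_bound; have e20 : 0 < e / 2 by rewrite divr_gt0.
(* Markov's level for the linear part, whose mean is at most [kn * c]; the gap to it exceeds 1 with
   small probability by [gap_tail]. *)
pose B := (kn * c + 1) / (e / 2).
have B0 : 0 < B by rewrite divr_gt0// ltr_wpDl// mulr_ge0.
exists (1 + B); first by rewrite addr_gt0.
near=> n; have n0 : (0 < n)%N by near: n; exact: nbhs_infty_gt.
have s0 : 0 < sq n by rewrite sqrtr_gt0 ltr0n.
have [Lm Em] := Hc n n0.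
have HG : (P [set w | (1 < `|Z n w - lin n w|)%R] <= (e / 2)%:E)%E.
  by near: n; exact: gap_tail.
pose F w := kn * (sq n * main_norm n w).
have LF : L1 F by apply: L1Z; exact: L1Z.
have F0 w : 0 <= F w by rewrite mulr_ge0// mulr_ge0// sqrtr_ge0.
have HF : (P [set w | (B < `|F w|)%R] <= (e / 2)%:E)%E.
  apply: le_trans (markov1 LF B0) _; rewrite lee_fin ler_pdivrMl//.
  rewrite (_ : (fun w => `|F w|) = F); last by apply/funext => w; rewrite ger0_norm.
  rewrite /B divfK ?gt_eqF// /F ExZ ?ExZ//; last exact: L1Z.
  apply: (@le_trans _ _ (kn * c)); last by rewrite lerDl.
  by rewrite ler_wpM2l// (le_trans (ler_wpM2l (ltW s0) Em))// mulrC divfK// gt_eqF.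
rewrite [e]splitr; apply: (prob_le_setU _ _ _ _ HG HF).
- apply: measurable_norm_tail => i.
  rewrite (_ : (fun w => _) = (fun w => Z n w i 0 - lin n w i 0)).
    by apply: measurable_funB; [exact: Z_rv|exact: lin_rv].
  by apply/funext => w; rewrite mxE [X in _ + X]mxE.
- by apply: measurable_tail; exact: L1_meas LF.
- exact/measurable_norm_tail/Z_rv.
move=> w /= Bw; have [g1|g1] := ltP 1 `|Z n w - lin n w|; first by left.
right; rewrite (lt_le_trans _ (ler_norm _))//.
have HZ : `|Z n w| <= 1 + F w.
  rewrite -[X in `|X|](subrK (lin n w)) (le_trans (ler_normD _ _))// lerD//.
  rewrite normrZ (ger0_norm (sqrtr_ge0 _)) /F mulrCA ler_wpM2l ?sqrtr_ge0//.
  by rewrite (le_trans (mul_vech_le _))// ler_wpM2l.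
by have := lt_le_trans Bw HZ; rewrite ltrD2l.
Unshelve. all: by end_near. Qed.

Let coef (a : 'cV[R]_q) k : R := (K^T *m a) k 0.

(** The Cramer-Wold reduction; the leading 1 matches [qform_clt] at [u = 1]. *)
Let dot_lin a n w : (0 < n)%N -> dot a (lin n w) = 1 * ((sq n)^-1 *
  \sum_(0 <= i < n) qform W A (tnth (vech_tuple p)) (coef a) (h n) i w).
Proof.
move=> n0; have s0 : 0 < sq n by rewrite sqrtr_gt0 ltr0n.
have s2 : sq n ^+ 2 = n%:R by rewrite sqr_sqrtr.
rewrite /qform exchange_big mul1r /dot -scalemxAr mxE mulmxA.
have -> : a^T *m K = (K^T *m a)^T by rewrite trmx_mul trmxK.
rewrite mxE !mulr_sumr; apply: eq_bigr => k _.
rewrite [X in _ * (X * _)]mxE -/(coef a k) [X in _ * (_ * X)]mxE [X in _ * (_ * X)]mxE -mulr_sumr.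
rewrite /qterm; move: (\sum_(0 <= i < n) _) => V.
have -> : n%:R^-1 = (sq n ^+ 2)^-1 by rewrite s2.
by field; rewrite gt_eqF.
Qed.

Let qvar_coef a : S0^T = S0 -> qvar A (tnth (vech_tuple p)) (coef a)
  = (a^T *m (K *m asym_W S0 *m K^T) *m a) 0 0.
Proof.
move=> S0T; have -> : a^T *m (K *m asym_W S0 *m K^T) *m a
    = (K^T *m a)^T *m asym_W S0 *m (K^T *m a) by rewrite trmx_mul trmxK !mulmxA.
rewrite /qvar exchange_big mxE; apply: eq_bigr => l _.
rewrite [X in X * _]mxE mulr_suml; apply: eq_bigr => k _.
rewrite [(K^T *m a)^T 0 k]mxE -/(coef a k) -/(coef a l) asym_WE// !S0E /qcov.
by rewrite mulrAC.
Qed.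

Lemma estimator_asymptotically_normal (j : J) (L : 'M[R]_q) :
  L *m L^T = K *m asym_W S0 *m K^T ->
  cvg_in_law P (fun n w => Z n w) (gauss_law hW j L).
Proof.
move=> LE f cf [C fC]; have S0T : S0^T = S0.
  by apply/matrixP => x y; rewrite mxE !S0E; apply: eq_bigr => k _; rewrite mulrC.
rewrite gauss_lawE//; last by exists C.
have cfg (g : R -> R) (l : R) a : measurable_fun [set: R] g -> (forall x, `|g x| <= 1) ->
   (forall x y, `|g x - g y| <= `|x - y|) ->
   Ex (fun w => g (1 * ((sq n)^-1 *
     \sum_(0 <= i < n) qform W A (tnth (vech_tuple p)) (coef a) (h n) i w))) @[n --> \oo] --> l ->
   Ex (fun w => g (dot a (Z n w))) @[n --> \oo] --> l.
  move=> mg g1 gl gcvg; apply/cvgrPdist_le => e e0.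
  (* Converts a gap in sup norm into a gap of linear forms; the added 1 keeps the divisor
     positive. *)
  pose s := \sum_i `|a i 0| + 1; have s0 : 0 < s by rewrite ltr_wpDl// sumr_ge0.
  have [e3 e8] : 0 < e / 2 /\ 0 < e / 8 by rewrite !divr_gt0.
  have es : 0 < e / 4 / s by rewrite !divr_gt0.
  near=> n; have n0 : (0 < n)%N by near: n; exact: nbhs_infty_gt.
  have H1 : `|l - Ex (fun w => g (dot a (lin n w)))| <= e / 2.
    under eq_fun do rewrite dot_lin//.
    by near: n; move/cvgrPdist_le : gcvg; apply.
  have H2 : (P [set w | (e / 4 / s < `|Z n w - lin n w|)%R] <= (e / 8)%:E)%E.
    by near: n; exact: gap_tail.
  have H3 : (P [set w | (e / 4 < `|dot a (Z n w) - dot a (lin n w)|)%R] <= (e / 8)%:E)%E.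
    apply: le_trans H2; apply: le_measure; rewrite ?inE.
    - by apply: measurable_tail; apply: measurable_funB; apply: dot_meas; [exact: Z_rv|exact: lin_rv].
    - apply: measurable_norm_tail => i.
      rewrite (_ : (fun w => _) = (fun w => Z n w i 0 - lin n w i 0)).
        by apply: measurable_funB; [exact: Z_rv|exact: lin_rv].
      by apply/funext => w; rewrite mxE [X in _ + X]mxE.
    move=> w ew; rewrite /= ltr_pdivrMr//; apply: lt_le_trans ew _.
    have -> : dot a (Z n w) - dot a (lin n w) = dot a (Z n w - lin n w).
      by rewrite /dot mulmxBr [RHS]mxE [X in _ = _ + X]mxE.
    rewrite dotE (le_trans (ler_norm_sum _ _ _))// mulrDr mulr_sumr ler_wpDr ?mulr1//.
    by apply: ler_sum => i _; rewrite normrM mulrC ler_wpM2r// mx_norm_coord.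
  have := lipschitz_Ex_sub (dot_meas a (Z_rv n0)) (dot_meas a (lin_rv n)) mg g1 gl _ H3.
  rewrite ltW ?divr_gt0// => /(_ isT) H4.
  rewrite (le_trans (ler_distD (Ex (fun w => g (dot a (lin n w)))) _ _))//.
  rewrite distrC in H4; rewrite (le_trans (lerD H1 H4))//.
  by rewrite le_eqVlt; apply/orP; left; apply/eqP; field.
have mcos : measurable_fun [set: R] (@cos R).
  by apply: continuous_measurable_fun => x; exact: continuous_cos.
have msin : measurable_fun [set: R] (@sin R).
  by apply: continuous_measurable_fun => x; exact: continuous_sin.
have sinl (x y : R) : `|sin x - sin y| <= `|x - y|.
  rewrite -!cosBpihalf (le_trans (norm_cosB_le _ _))//.
  by rewrite opprB addrA subrK.
have cfE a := qform_clt hW A (tnth (vech_tuple p)) (coef a) h_gt0 1.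
have ExC n : (0 < n)%N -> ('E_P[(fun w => f (Z n w))])%E = (Ex (fun w => f (Z n w)))%:E.
  move=> n0; rewrite unlock -EFin_Ex//; apply: (@L1_bnd _ _ _ _ _ C) => //.
  exact: (continuous_random_vector (Z_rv n0)).
have : Ex (fun w => f (Z n w)) @[n --> \oo] --> Ex (f \o gauss_vector W j L).
  apply: (@levy _ _ _ P q (fun n w => Z n w) (gauss_vector W j L)) => //.
  - exact: (gauss_vector_rv hW j L).
  - move=> a; have [-> _] := cf_gauss hW j L a; apply: cfg => //.
    + by move=> x; rewrite ler_norml cos_geN1 cos_le1.
    + exact: norm_cosB_le.
    by have [+ _] := cfE a; rewrite expr1n mul1r qvar_coef// -LE.
  - move=> a; have [_ ->] := cf_gauss hW j L a; apply: cfg => //.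
    + by move=> x; rewrite ler_norml sin_geN1 sin_le1.
    by have [_] := cfE a.
  - move=> e e0; pose V := \sum_i Ex (fun w => gauss_vector W j L w i 0 ^+ 2).
    have V0 : 0 <= V by apply: sumr_ge0 => i _; apply: Ex_ge0 => w; exact: sqr_ge0.
    (* As B >= 1, B^2 e >= B e >= q V, so Chebyshev's bound q V / B^2 is at most [e]. *)
    pose B := 1 + q%:R * V / e.
    have B1 : 1 <= B by rewrite lerDl divr_ge0 ?mulr_ge0// ltW.
    have B0 : 0 < B := lt_le_trans ltr01 B1.
    exists B => //; apply: le_trans (tail_bound (C := V) B0 (gauss_vector_L2 hW j L) _) _.
      move=> i; rewrite /V (bigD1 i)//= lerDl sumr_ge0// => k _.
      by apply: Ex_ge0 => w; exact: sqr_ge0.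
    rewrite lee_fin ler_pdivrMl ?exprn_gt0//.
    rewrite (@le_trans _ _ (B * e))//; last by rewrite ler_wpM2r ?(ltW e0)// expr2 ler_peMl// ltW.
    by rewrite /B mulrDl divfK ?gt_eqF// lerDr mul1r ltW.
  - by exists C.
move=> H; have H' : (Ex (fun w => f (Z n w)))%:E @[n --> \oo] --> (Ex (f \o gauss_vector W j L))%:E.
  by apply: cvg_EFin; [exact: nearW|exact: H].
apply: cvg_trans H'; apply: near_eq_cvg; near=> n; rewrite ExC//.
by near: n; exact: nbhs_infty_gt.
Unshelve. all: by end_near. Qed.

End asymptotics.

(** * The structural equation model *)

(** The sandwich formula collapses because the weight is the inverse of the covariance that it meets
    in the middle. *)
Lemma gauss_newton_cov (R : realType) (p q : nat) (G : 'cV[R]_q -> 'M[R]_p)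
    (theta0 : 'cV[R]_q) (Delta : 'M[R]_(vech_dim p, q)) :
  posdef (G theta0) -> \rank Delta = q ->
  let K := gauss_newton G theta0 Delta in
  K *m asym_W (G theta0) *m K^T = invmx (Delta^T *m invmx (asym_W (G theta0)) *m Delta).
Proof.
move=> pS rD K; have [uW _] := asym_W_inv pS.1 (posdef_unit pS).
have pWi := asym_W_inv_posdef pS; have pV := posdef_congr pWi rD.
set Wi := invmx (asym_W (G theta0)) in pWi pV *; set V := _ *m _ *m _ in pV *.
have -> : K^T = Wi *m Delta *m invmx V.
  by rewrite !trmx_mul trmxK pWi.1 trmx_inv pV.1 mulmxA.
have -> : K = invmx V *m Delta^T *m Wi by [].
rewrite mulmxKV// -!mulmxA (mulmxA Wi) (mulmxA Delta^T) (mulmxA Delta^T) -/V.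
by rewrite mulKmx// posdef_unit.
Qed.

(** * Reduced form of the structural equation model *)

Section noise_loadings.
Context (R : realType) (p1 p2 k1 k2 r1 r2 r3 r4 : nat).
Context (S1 : 'M[R]_(k1, r1)) (S2 : 'M[R]_(p1, r2))
        (S3 : 'M[R]_(p2, r3)) (S4 : 'M[R]_(k2, r4)).
Context (L10 : 'M[R]_(p1, k1)) (L20 : 'M[R]_(p2, k2)) (Gamma0 : 'M[R]_(k2, k1)) (Psi0 : 'M[R]_k2).

(** Solving the structural equation for [eta] makes the observed vector a linear image of the four
    latent processes; these four matrices are its coefficients. *)
Definition load_xi : 'M[R]_(p1 + p2, k1) := col_mx L10 (L20 *m invmx Psi0 *m Gamma0).
Definition load_delta : 'M[R]_(p1 + p2, p1) := col_mx 1%:M 0.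
Definition load_eps : 'M[R]_(p1 + p2, p2) := col_mx 0 1%:M.
Definition load_zeta : 'M[R]_(p1 + p2, k2) := col_mx 0 (L20 *m invmx Psi0).

Definition noise_load (x : 'I_(p1 + p2)) (j : stacked_index r1 r2 r3 r4) : R :=
  match j with
  | inl (inl i) => (load_xi *m S1) x i | inl (inr i) => (load_delta *m S2) x i
  | inr (inl i) => (load_eps *m S3) x i | inr (inr i) => (load_zeta *m S4) x i
  end.

Let gram m n (A : 'M[R]_(m, n)) x y : \sum_i A x i * A y i = (A *m A^T) x y.
Proof. by rewrite mxE; apply: eq_bigr => i _; rewrite mxE. Qed.

Lemma sem_cov_noise x y :
  sem_cov (Sem L10 L20 Gamma0 Psi0 (S1 *m S1^T) (S2 *m S2^T) (S3 *m S3^T) (S4 *m S4^T)) x y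
  = noise_cov noise_load x y.
Proof.
rewrite /noise_cov !big_sumType /= !gram.
have -> : (load_xi *m S1) *m (load_xi *m S1)^T = block_mx
    (L10 *m (S1 *m S1^T) *m L10^T) (L10 *m (S1 *m S1^T) *m Gamma0^T *m (invmx Psi0)^T *m L20^T)
    (L20 *m invmx Psi0 *m Gamma0 *m (S1 *m S1^T) *m L10^T)
    (L20 *m invmx Psi0 *m (Gamma0 *m (S1 *m S1^T) *m Gamma0^T) *m (invmx Psi0)^T *m L20^T).
  by rewrite mul_col_mx tr_col_mx mul_col_row !trmx_mul !mulmxA.
have -> : (load_delta *m S2) *m (load_delta *m S2)^T = block_mx (S2 *m S2^T) 0 0 0.
  by rewrite mul_col_mx tr_col_mx mul_col_row !mul1mx !mul0mx !trmx0 !mulmx0.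
have -> : (load_eps *m S3) *m (load_eps *m S3)^T = block_mx 0 0 0 (S3 *m S3^T).
  by rewrite mul_col_mx tr_col_mx mul_col_row !mul1mx !mul0mx !trmx0 !mulmx0.
have -> : (load_zeta *m S4) *m (load_zeta *m S4)^T = block_mx 0 0 0
    (L20 *m invmx Psi0 *m (S4 *m S4^T) *m (invmx Psi0)^T *m L20^T).
  by rewrite mul_col_mx tr_col_mx mul_col_row !mul0mx !trmx0 !mulmx0 !trmx_mul !mulmxA.
have addE m n (A B : 'M[R]_(m, n)) i j : A i j + B i j = (A + B) i j by rewrite mxE.
rewrite !addE !add_block_mx !addr0 /sem_cov /=.
congr (block_mx _ _ _ _ _ _).
  by rewrite !trmx_mul !trmxK !mulmxA.
by rewrite mulmxDr !mulmxDl -addrA [_ + S3 *m _]addrC.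
Qed.

End noise_loadings.

Section observed_process.
Context d (T : measurableType d) (R : realType) (P : probability T R).
Context (p1 p2 k1 k2 r1 r2 r3 r4 : nat).
Context (W1 : R -> T -> 'cV[R]_r1) (W2 : R -> T -> 'cV[R]_r2)
        (W3 : R -> T -> 'cV[R]_r3) (W4 : R -> T -> 'cV[R]_r4).
Context (S1 : 'M[R]_(k1, r1)) (S2 : 'M[R]_(p1, r2))
        (S3 : 'M[R]_(p2, r3)) (S4 : 'M[R]_(k2, r4)).
Context (L10 : 'M[R]_(p1, k1)) (L20 : 'M[R]_(p2, k2)) (Gamma0 : 'M[R]_(k2, k1)) (Psi0 : 'M[R]_k2).
Local Notation J := (stacked_index r1 r2 r3 r4).
Local Notation W := (stacked_noise W1 W2 W3 W4).

Local Notation load_xi := (load_xi L10 L20 Gamma0 Psi0).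
Local Notation load_delta := (load_delta R p1 p2).
Local Notation load_eps := (load_eps R p1 p2).
Local Notation load_zeta := (load_zeta p1 L20 Psi0).
Local Notation noise_load := (noise_load S1 S2 S3 S4 L10 L20 Gamma0 Psi0).

Context (xi : R -> T -> 'cV[R]_k1) (delta : R -> T -> 'cV[R]_p1)
        (eps : R -> T -> 'cV[R]_p2) (zeta : R -> T -> 'cV[R]_k2).

Definition obs_resid (x : 'I_(p1 + p2)) (s t : R) (w : T) : R :=
  \sum_l load_xi x l * resid W S1 (inl \o inl) xi l s t w +
  \sum_l load_delta x l * resid W S2 (inl \o inr) delta l s t w +
  (\sum_l load_eps x l * resid W S3 (inr \o inl) eps l s t w +
   \sum_l load_zeta x l * resid W S4 (inr \o inr) zeta l s t w).

Let load_resid k r (F : 'M[R]_(p1 + p2, k)) (S : 'M[R]_(k, r)) (iota : 'I_r -> J)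
    (Y : R -> T -> 'cV[R]_k) x s t w :
  \sum_l F x l * resid W S iota Y l s t w =
  (F *m Y t w) x 0 - (F *m Y s w) x 0 - \sum_i (F *m S) x i * inc W (iota i) s t w.
Proof.
rewrite !mxE -sumrB.
have -> : \sum_i (F *m S) x i * inc W (iota i) s t w
    = \sum_l F x l * \sum_i S l i * inc W (iota i) s t w.
  under [RHS]eq_bigr do rewrite mulr_sumr.
  rewrite [RHS]exchange_big; apply: eq_bigr => i _ /=.
  by rewrite mxE mulr_suml; apply: eq_bigr => l _; rewrite mulrA.
by rewrite -sumrB; apply: eq_bigr => l _; rewrite /resid !mulrBr.
Qed.

Context (eta : R -> T -> 'cV[R]_k2) (X : R -> T -> 'cV[R]_(p1 + p2)).
Hypothesis Psi0_unit : Psi0 \in unitmx.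
Hypothesis eta_eq : forall (t : R) w, 0 <= t -> Psi0 *m eta t w = Gamma0 *m xi t w + zeta t w.
Hypothesis X_eq : forall (t : R) w, 0 <= t ->
  X t w = col_mx (L10 *m xi t w + delta t w) (L20 *m eta t w + eps t w).

Lemma observed_increment x (s t : R) w : 0 <= s -> 0 <= t ->
  X t w x 0 - X s w x 0 = obs_resid x s t w + \sum_j noise_load x j * inc W j s t w.
Proof.
move=> s0 t0.
have XE r : 0 <= r -> X r w x 0 = (load_xi *m xi r w) x 0 + (load_delta *m delta r w) x 0
    + ((load_eps *m eps r w) x 0 + (load_zeta *m zeta r w) x 0).
  move=> r0; have addE (A B : 'cV[R]_(p1 + p2)) : A x 0 + B x 0 = (A + B) x 0 by rewrite mxE.
  rewrite !addE; congr (fun_of_matrix _ x 0).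
  rewrite X_eq//; have -> : eta r w = invmx Psi0 *m (Gamma0 *m xi r w + zeta r w).
    by rewrite -eta_eq// mulKmx.
  rewrite !mul_col_mx !add_col_mx !mul1mx !mul0mx ?addr0 ?add0r; congr col_mx.
  by rewrite mulmxA mulmxDr -!mulmxA -addrA [eps r w + _]addrC.
rewrite !XE// /obs_resid !load_resid !big_sumType /=; ring.
Qed.

Context (B1 : 'cV[R]_k1 -> 'cV[R]_k1) (B2 : 'cV[R]_p1 -> 'cV[R]_p1)
        (B3 : 'cV[R]_p2 -> 'cV[R]_p2) (B4 : 'cV[R]_k2 -> 'cV[R]_k2)
        (c1 : 'cV[R]_k1) (c2 : 'cV[R]_p1) (c3 : 'cV[R]_p2) (c4 : 'cV[R]_k2).
Hypothesis hW : noise_family P W.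
Hypotheses (hxi : sde_solution P B1 S1 c1 W1 xi) (hdelta : sde_solution P B2 S2 c2 W2 delta)
           (heps : sde_solution P B3 S3 c3 W3 eps) (hzeta : sde_solution P B4 S4 c4 W4 zeta).
Hypotheses (B1_lip : lipschitz B1) (B2_lip : lipschitz B2)
           (B3_lip : lipschitz B3) (B4_lip : lipschitz B4).
Hypotheses (xi_mom : bounded_moments P xi) (delta_mom : bounded_moments P delta)
           (eps_mom : bounded_moments P eps) (zeta_mom : bounded_moments P zeta).

Lemma obs_resid_small x : small_resid P W (obs_resid x).
Proof.
have colE r (V : R -> T -> 'cV[R]_r) (iota : 'I_r -> J) :
    (forall t w i, W (iota i) t w = V t w i 0) -> (fun t w => \col_i W (iota i) t w) = V.
  move=> VE; apply/funext => t; apply/funext => w; apply/colP => i.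
  by rewrite mxE VE.
do 2!apply: small_residD; apply: small_resid_sum => l; apply: small_residZ.
- by apply: (resid_small hW _ B1_lip xi_mom l); rewrite (@colE _ W1)//; exact: hxi.
- by apply: (resid_small hW _ B2_lip delta_mom l); rewrite (@colE _ W2)//; exact: hdelta.
- by apply: (resid_small hW _ B3_lip eps_mom l); rewrite (@colE _ W3)//; exact: heps.
- by apply: (resid_small hW _ B4_lip zeta_mom l); rewrite (@colE _ W4)//; exact: hzeta.
Qed.

End observed_process.

Lemma realized_cov_sym (T : Type) (R : realType) (p : nat) (X : R -> T -> 'cV[R]_p) n h w :
  (realized_cov X n h w)^T = realized_cov X n h w.
Proof.
rewrite /realized_cov linearZ /= raddf_sum /=; congr (_ *: _); apply: eq_bigr => i _.
by rewrite trmx_mul trmxK.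
Qed.

Unset Implicit Arguments.
Set Strict Implicit.
Set Printing Implicit Defensive.

Theorem theorem6
  (R : realType) (d : measure_display) (Omega : measurableType d)
  (P : probability Omega R)
  (* dimensions *)
  (p1 p2 k1 k2 r1 r2 r3 r4 q : nat)
  (hp1 : (1 <= p1)%N) (hp2 : (1 <= p2)%N)
  (hk1 : (1 <= k1)%N) (hk2 : (1 <= k2)%N)
  (hr1 : (1 <= r1)%N) (hr2 : (1 <= r2)%N)
  (hr3 : (1 <= r3)%N) (hr4 : (1 <= r4)%N)
  (hkp1 : (k1 <= p1)%N) (hkp2 : (k2 <= p2)%N)
  (* driving noises *)
  (W1 : R -> Omega -> 'cV[R]_r1) (W2 : R -> Omega -> 'cV[R]_r2)
  (W3 : R -> Omega -> 'cV[R]_r3) (W4 : R -> Omega -> 'cV[R]_r4)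
  (hW1 : wiener P W1) (hW2 : wiener P W2)
  (hW3 : wiener P W3) (hW4 : wiener P W4)
  (hW : mutually_independent P (fun i : 'I_4 =>
          nth set0 [:: sigma_vprocess W1; sigma_vprocess W2;
                       sigma_vprocess W3; sigma_vprocess W4] i))
  (* latent processes *)
  (B1 : 'cV[R]_k1 -> 'cV[R]_k1) (B2 : 'cV[R]_p1 -> 'cV[R]_p1)
  (B3 : 'cV[R]_p2 -> 'cV[R]_p2) (B4 : 'cV[R]_k2 -> 'cV[R]_k2)
  (S1 : 'M[R]_(k1, r1)) (S2 : 'M[R]_(p1, r2))
  (S3 : 'M[R]_(p2, r3)) (S4 : 'M[R]_(k2, r4))
  (c1 : 'cV[R]_k1) (c2 : 'cV[R]_p1) (c3 : 'cV[R]_p2) (c4 : 'cV[R]_k2)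
  (xi : R -> Omega -> 'cV[R]_k1) (delta : R -> Omega -> 'cV[R]_p1)
  (eps : R -> Omega -> 'cV[R]_p2) (zeta : R -> Omega -> 'cV[R]_k2)
  (hxi : sde_solution P B1 S1 c1 W1 xi)
  (hdelta : sde_solution P B2 S2 c2 W2 delta)
  (heps : sde_solution P B3 S3 c3 W3 eps)
  (hzeta : sde_solution P B4 S4 c4 W4 zeta)
  (* true matrices *)
  (L10 : 'M[R]_(p1, k1)) (L20 : 'M[R]_(p2, k2))
  (Gamma0 : 'M[R]_(k2, k1)) (Bmx0 : 'M[R]_k2)
  (hS2 : posdef (S2 *m S2^T)) (hS3 : posdef (S3 *m S3^T))
  (hL10 : \rank L10 = k1)
  (hBmx0 : forall i, Bmx0 i i = 0)
  (hPsi0 : 1%:M - Bmx0 \in unitmx)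
  (* observed process *)
  (eta : R -> Omega -> 'cV[R]_k2)
  (heta : forall (t : R) w, 0 <= t ->
     eta t w = Bmx0 *m eta t w + Gamma0 *m xi t w + zeta t w)
  (X : R -> Omega -> 'cV[R]_(p1 + p2))
  (hX : forall (t : R) w, 0 <= t ->
     X t w = col_mx (L10 *m xi t w + delta t w) (L20 *m eta t w + eps t w))
  (* parametric model *)
  (Theta : set 'cV[R]_q)
  (hTheta_convex : convex_set Theta) (hTheta_compact : compact Theta)
  (M : sem (sem_entry R q) p1 p2 k1 k2)
  (hM : forall theta, Theta theta -> sem_admissible (sem_eval M theta))
  (* sampling scheme and minimum contrast estimator *)
  (h : nat -> R) (hh : forall n, 0 < h n)
  (hat_theta : nat -> Omega -> 'cV[R]_q)
  (hhat_meas : forall n, (1 <= n)%N -> random_vector (hat_theta n))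
  (hhat_Theta : forall n w, (1 <= n)%N -> Theta (hat_theta n w))
  (hhat_min : forall n w, (1 <= n)%N ->
     let Fn theta :=
       contrast (realized_cov X n (h n) w) (sem_cov (sem_eval M theta)) in
     (Fn (hat_theta n w))%:E = ereal_inf [set (Fn theta)%:E | theta in Theta])
  (* assumptions on the latent processes *)
  (hB1_lip : lipschitz B1) (hB2_lip : lipschitz B2)
  (hB3_lip : lipschitz B3) (hB4_lip : lipschitz B4)
  (hB1_C4 : CN_polygrowth 4 B1) (hB2_C4 : CN_polygrowth 4 B2)
  (hB3_C4 : CN_polygrowth 4 B3) (hB4_C4 : CN_polygrowth 4 B4)
  (hxi_mom : bounded_moments P xi) (hdelta_mom : bounded_moments P delta)
  (heps_mom : bounded_moments P eps) (hzeta_mom : bounded_moments P zeta)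
  (hxi_erg : ergodic P xi) (hdelta_erg : ergodic P delta)
  (heps_erg : ergodic P eps) (hzeta_erg : ergodic P zeta)
  (* true parameter, identifiability and rank condition *)
  (theta0 : 'cV[R]_q) (htheta0 : interior Theta theta0)
  (hSigma0 :
     sem_cov (Sem L10 L20 Gamma0 (1%:M - Bmx0) (S1 *m S1^T) (S2 *m S2^T)
                (S3 *m S3^T) (S4 *m S4^T))
     = sem_cov (sem_eval M theta0))
  (hident : forall theta1 theta2, Theta theta1 -> Theta theta2 ->
     sem_cov (sem_eval M theta1) = sem_cov (sem_eval M theta2) ->
     theta1 = theta2)
  (hrank :
     \rank (jacobian_mx (fun theta => vech (sem_cov (sem_eval M theta))) theta0)
     = q)
  (* high-frequency asymptotics *)
  (hh0 : h n @[n --> \oo] --> 0)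
  (hnh : n%:R * h n @[n --> \oo] --> +oo) :
  let Delta :=
    jacobian_mx (fun theta => vech (sem_cov (sem_eval M theta))) theta0 in
  let W0 := asym_W (sem_cov (sem_eval M theta0)) in
  cvg_in_prob P \oo hat_theta theta0 /\
  (n%:R * h n ^+ 2 @[n --> \oo] --> 0 ->
   exists mu : probability (borel R q) R,
     is_mvnormal mu 0 (invmx (Delta^T *m invmx W0 *m Delta)) /\
     cvg_in_law P
       (fun n w => Num.sqrt n%:R *: (hat_theta n w - theta0)) mu).
Proof.
move=> Delta W0.
have hWf := stacked_noise_family hW1 hW2 hW3 hW4 hW.
pose G theta := sem_cov (sem_eval M theta).
have T0 : Theta theta0 by exact: interior_subset.
have pG := model_posdef hM; have cG := model_continuous hM; have dG := model_differentiable hM htheta0.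
have hr := interior_ball htheta0.
have eta_eq (t : R) w : 0 <= t -> (1%:M - Bmx0) *m eta t w = Gamma0 *m xi t w + zeta t w.
  move=> t0; rewrite mulmxBl mul1mx; apply/eqP; rewrite subr_eq; apply/eqP.
  by rewrite [RHS]addrC addrA; exact: heta.
have XE := observed_increment W1 W2 W3 W4 S1 S2 S3 S4 hPsi0 eta_eq hX.
have us := obs_resid_small L10 L20 Gamma0 (1%:M - Bmx0) hWf hxi hdelta heps hzeta
  hB1_lip hB2_lip hB3_lip hB4_lip hxi_mom hdelta_mom heps_mom hzeta_mom.
have S0E x y : G theta0 x y = noise_cov (noise_load S1 S2 S3 S4 L10 L20 Gamma0 (1%:M - Bmx0)) x y.
  by rewrite /G -hSigma0 sem_cov_noise.
have hmin n w : (0 < n)%N -> minimizes Theta G (realized_cov X n (h n) w) (hat_theta n w).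
  move=> n0; split; first exact: hhat_Theta.
  move=> y Ty; rewrite -lee_fin (hhat_min n w n0); apply: ereal_inf_lbound.
  by exists y.
split.
  apply: (estimator_consistent hWf us XE S0E hh hh0 hhat_meas) => e e0.
  have [dd d0 H] := minimizer_near hTheta_compact hr pG cG hident e0.
  by exists dd => // n w n0 Qd; apply: H Qd (hmin n w n0); exact: realized_cov_sym.
move=> nh2.
have pV := posdef_inv (posdef_congr (asym_W_inv_posdef (pG _ T0)) hrank).
have [L LE] := posdef_chol pV.
(* A coordinate of the first noise, available since r1 >= 1; its first q unit increments carry the
   Gaussian limit vector. *)
pose j : stacked_index r1 r2 r3 r4 := inl (inl (Ordinal hr1)).
exists (gauss_law hWf j L); split; first by rewrite [X in is_mvnormal _ _ X]LE; exact: gauss_law_mvnormal.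
apply: (estimator_asymptotically_normal (K := gauss_newton G theta0 Delta) us XE S0E hh hh0 hhat_meas _ nh2).
  move=> e e0.
  have [dd d0 H] := minimizer_expansion hTheta_compact hr pG cG hident dG hrank e0.
  by exists dd => // n w n0 Qd; apply: H Qd (hmin n w n0); exact: realized_cov_sym.
by rewrite gauss_newton_cov// ?LE//; exact: pG.
Qed.
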